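(* Let $G$ be a discrete group, let $(A,G,\alpha)$ be a C*-dynamical system with $A\subseteq \mathcal{B}(H)$ a non-degenerate C*-algebra, and let $F$ be a Herz-Schur $(A,G,\alpha)$-multiplier. Assume that the reduced crossed product $A\rtimes_{\alpha,r}G$ possesses the strong operator approximation property (SOAP). The following are equivalent: (i) the map $S_F : A\rtimes_{\alpha,r}G\to A\rtimes_{\alpha,r}G$ is completely compact; (ii) there exist a net $(F_i)_{i\in\mathbb{I}}$ of Herz-Schur $(A,G,\alpha)$-multipliers and, for each $i\in\mathbb{I}$, a finite dimensional subspace $\mathcal{U}_i\subseteq A$, such that each $F_i$ is finitely supported, $\operatorname{ran}F_i(s)\subseteq\mathcal{U}_i$ for each $i\in\mathbb{I}$ and each $s\in G$, and $\|F_i-F\|_{\rm m}\to_{i\in\mathbb{I}}0$; (iii) there exist a net $(\varphi_i)_{i\in\mathbb{I}}$ of band finite Schur $A$-multipliers and, for each $i\in\mathbb{I}$, a finite dimensional subspace $\mathcal{U}_i\subseteq A$, such that $\operatorname{ran}(\alpha_s\circ\varphi_i(s,e))\subseteq\mathcal{U}_i$ for all $i\in\mathbb{I}$ and all $s\in G$ (in particular, $\varphi_i(s,e)$ maps $A$ into $A$), and $\|S_{\mathcal{N}(F)}-S_{\varphi_i}\|_{\rm cb}\to_{i\in\mathbb{I}}0$.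
   Context: Throughout, $G$ is a discrete group with identity $e$, $A\subseteq\mathcal{B}(H)$ is a non-degenerate C*-algebra, $\alpha:G\to\mathrm{Aut}(A)$ is a homomorphism. On $\mathcal{H}=\ell^2(G)\otimes H=\ell^2(G,H)$ put $(\lambda_t\xi)(s)=\xi(t^{-1}s)$ and $(\pi(a)\xi)(s)=\alpha_{s^{-1}}(a)(\xi(s))$. For $f\in\ell^1(G,A)$ let $\tilde\pi(f)=\sum_{s\in G}\pi(f(s))\lambda_s$; the reduced crossed product $A\rtimes_{\alpha,r}G$ is the norm closure of $\tilde\pi(\ell^1(G,A))$ in $\mathcal{B}(\mathcal{H})$. $\mathrm{CB}(\mathcal{X},\mathcal{Z})$ is the space of completely bounded maps between operator spaces, $\mathrm{CB}(\mathcal X)=\mathrm{CB}(\mathcal X,\mathcal X)$, with norm $\|\cdot\|_{\rm cb}$; $\otimes_{\min}$ is the minimal (spatial) tensor product. A bounded map $F:G\to\mathrm{CB}(A)$ is a Herz-Schur $(A,G,\alpha)$-multiplier if the map $S_F:\tilde\pi(f)\mapsto\tilde\pi(F\cdot f)$, where $(F\cdot f)(t)=F(t)(f(t))$, $f\in\ell^1(G,A)$, is completely bounded; $S_F$ also denotes its (unique) completely bounded extension to $A\rtimes_{\alpha,r}G$, so $S_F(\pi(a)\lambda_t)=\pi(F(t)(a))\lambda_t$, and $\|F\|_{\rm m}=\|S_F\|_{\rm cb}$. Operators on $\mathcal{H}=\oplus_{s\in G}H$ are identified with $G\times G$ matrices $(x_{p,q})$ with entries in $\mathcal{B}(H)$,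 where $\langle x_{p,q}\xi,\eta\rangle=\langle x(\delta_q\otimes\xi),\delta_p\otimes\eta\rangle$. A bounded function $\varphi:G\times G\to\mathrm{CB}(A,\mathcal{B}(H))$ is a Schur $A$-multiplier if $S_\varphi:(x_{p,q})_{p,q}\mapsto(\varphi(q,p)(x_{p,q}))_{p,q}$ is a completely bounded map from $\mathcal{B}(\ell^2(G))\otimes_{\min}A$ into $\mathcal{B}(\mathcal{H})$. The function $\varphi$ is band finite if there is a finite set $E\subseteq G$ with $\varphi(s,t)=0$ whenever $ts^{-1}\notin E$. For bounded $F:G\to\mathrm{CB}(A)$, $\mathcal{N}(F)(s,t)(a)=\alpha_{t^{-1}}(F(ts^{-1})(\alpha_t(a)))$; if $F$ is a Herz-Schur $(A,G,\alpha)$-multiplier then $\mathcal{N}(F)$ is a Schur $A$-multiplier. A completely bounded map $\Psi:\mathcal{X}\to\mathcal{Z}$ between operator spaces is completely compact if for every $\epsilon>0$ there is a finite dimensional subspace $\mathcal{Y}\subseteq\mathcal{Z}$ such that $\mathrm{dist}(\Psi^{(m)}(x),M_m(\mathcal{Y}))<\epsilon$ for all $m\in\mathbb{N}$ and all $x\in M_m(\mathcal{X})$ with $\|x\|\le1$. An operator space $\mathcal{X}$ has the SOAP if there is a net $(\Phi_i)$ of completely bounded finite rank maps on $\mathcal{X}$ such that $\|(\mathrm{id}\otimes\Phi_i)(x)-x\|\to0$ for every Hilbert space $K$ and every $x\in\mathcal{B}(K)\otimes_{\min}\mathcal{X}$. *)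

(* Defs.v *)
From HB Require Import structures.
From mathcomp Require Import all_boot all_order all_algebra.
From mathcomp Require Import complex finmap.
From mathcomp Require Import mathcomp_extra boolp classical_sets functions cardinality fsbigop reals.
From mathcomp Require Import constructive_ereal ereal topology normedtype sequences esum.
From mathcomp Require Import lra ring.
Set SsrOldRewriteGoalsOrder.
Set Implicit Arguments. Unset Strict Implicit. Unset Printing Implicit Defensive.
Import Order.TTheory GRing.Theory Num.Theory numFieldNormedType.Exports.
Local Open Scope classical_set_scope.
Local Open Scope complex_scope.
Local Open Scope ring_scope.

Section Sums.
Variables (R : realType) (I : choiceType).
Implicit Types a b : I -> R.

Definition asum a : \bar R := \esum_(i in [set: I]) (a i)%:E.

Lemma asum_ge0 a : (forall i, 0 <= a i) -> (0 <= asum a)%E.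
Proof. by move=> a0; apply: esum_ge0 => i _; rewrite lee_fin. Qed.

Lemma le_asum a b : (forall i, a i <= b i) -> (asum a <= asum b)%E.
Proof. by move=> ab; apply: le_esum => i _; rewrite lee_fin. Qed.

Lemma asumD a b : (forall i, 0 <= a i) -> (forall i, 0 <= b i) ->
  asum (fun i => a i + b i) = (asum a + asum b)%E.
Proof.
move=> a0 b0; rewrite /asum -esumD; [|by move=> i _; rewrite lee_fin..].
by apply: eq_esum => i _; rewrite EFinD.
Qed.

Lemma asumZ c a : 0 <= c -> (forall i, 0 <= a i) ->
  asum (fun i => c * a i) = (c%:E * asum a)%E.
Proof.
move=> c0 a0; rewrite /asum /esum -ereal_supZl//; last first.
  by apply/set0P; eexists; exists set0 => //; split.
congr ereal_sup; apply/seteqP; split => [_ [X [finX XI] <-]|_ [_ [X [finX XI] <-] <-]] /=.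
  exists (\sum_(i \in X) (a i)%:E)%E; first by exists X.
  by rewrite !fsumEFin//= -EFinM mulr_fsumr.
exists X => //.
by rewrite !fsumEFin//= -EFinM mulr_fsumr.
Qed.

Lemma asum_fin a : (forall i, 0 <= a i) -> (asum a < +oo)%E ->
  (fine (asum a))%:E = asum a.
Proof. by move=> a0 foo; rewrite fineK// ge0_fin_numE ?asum_ge0. Qed.

(** The unordered sum of an absolutely summable real family. *)
Definition usum a : R :=
  fine (asum (fun i => Num.max (a i) 0)) -
  fine (asum (fun i => Num.max (- a i) 0)).

Lemma usum_nneg a : (forall i, 0 <= a i) -> usum a = fine (asum a).
Proof.
move=> a0; rewrite /usum [X in _ - fine X](_ : _ = 0%E) /= ?subr0; last first.
  by apply: esum1 => i _; rewrite max_r// oppr_le0.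
by congr (fine (asum _)); apply/funext => i; rewrite max_l.
Qed.

Lemma usumB a p q : (forall i, 0 <= p i) -> (forall i, 0 <= q i) ->
  (asum p < +oo)%E -> (asum q < +oo)%E ->
  (forall i, a i = p i - q i) -> usum a = fine (asum p) - fine (asum q).
Proof.
move=> p0 q0 pf qf apq.
pose u i := Num.max (a i) 0; pose v i := Num.max (- a i) 0.
have u0 i : 0 <= u i by rewrite le_max lexx orbT.
have v0 i : 0 <= v i by rewrite le_max lexx orbT.
have uf : (asum u < +oo)%E.
  by apply: le_lt_trans pf; apply: le_asum => i; rewrite /u apq ge_max p0 gerBl q0.
have vf : (asum v < +oo)%E.
  by apply: le_lt_trans qf; apply: le_asum => i; rewrite /v apq ge_max q0 opprB gerBl p0.
have uv i : u i + q i = p i + v i.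
  rewrite /u /v; have := apq i; case/orP: (le_total 0 (a i)) => a0 e.
    by rewrite max_l// max_r ?oppr_le0//; lra.
  by rewrite max_r// max_l ?oppr_ge0//; lra.
have : asum (fun i => u i + q i) = asum (fun i => p i + v i).
  by congr asum; apply/funext.
rewrite !asumD// -(asum_fin u0 uf) -(asum_fin q0 qf) -(asum_fin p0 pf).
rewrite -(asum_fin v0 vf) -!EFinD => -[]; rewrite /usum -/u -/v => e; lra.
Qed.

Definition abs_summable a := (asum (fun i => `|a i|)%R < +oo)%E.

Let pos a i := Num.max (a i) 0.
Let pos0 a i : 0 <= pos a i. Proof. by rewrite le_max lexx orbT. Qed.
Let neg0 a i : 0 <= Num.max (- a i) 0. Proof. by rewrite le_max lexx orbT. Qed.
Let posf a : abs_summable a -> (asum (pos a) < +oo)%E.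
Proof. by apply: le_lt_trans; apply: le_asum => i; rewrite ge_max normr_ge0 ler_norm. Qed.
Let negf a : abs_summable a -> (asum (fun i => Num.max (- a i) 0)%R < +oo)%E.
Proof.
by apply: le_lt_trans; apply: le_asum => i; rewrite ge_max normr_ge0 -normrN ler_norm.
Qed.
Let posneg a i : a i = pos a i - Num.max (- a i) 0.
Proof.
rewrite /pos; case/orP: (le_total 0 (a i)) => a0.
  by rewrite max_l// max_r ?oppr_le0//; lra.
by rewrite max_r// max_l ?oppr_ge0//; lra.
Qed.

Lemma usumD a b : abs_summable a -> abs_summable b ->
  usum (fun i => a i + b i) = usum a + usum b.
Proof.
move=> af bf.
have D (f g : I -> R) : (forall i, 0 <= f i) -> (forall i, 0 <= g i) ->
    (asum f < +oo)%E -> (asum g < +oo)%E ->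
    (asum (fun i => f i + g i)%R < +oo)%E /\
    fine (asum (fun i => f i + g i)%R) = fine (asum f) + fine (asum g).
  move=> f0 g0 ff gf; rewrite asumD// -(asum_fin f0 ff) -(asum_fin g0 gf) -EFinD.
  by rewrite ltry.
have [pf pe] := D _ _ (pos0 a) (pos0 b) (posf af) (posf bf).
have [nf ne] := D _ _ (neg0 a) (neg0 b) (negf af) (negf bf).
rewrite (@usumB _ _ _ _ _ pf nf); last 3 first.
- by move=> i; rewrite addr_ge0 ?pos0.
- by move=> i; rewrite addr_ge0 ?neg0.
- by move=> i; have := posneg a i; have := posneg b i; rewrite -/(pos a i); lra.
by rewrite pe ne /usum -/(pos a) -/(pos b); lra.
Qed.

Lemma usumN a : usum (fun i => - a i) = - usum a.
Proof.
by rewrite /usum opprB; congr (_ - fine (asum _)); apply/funext => i; rewrite opprK.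
Qed.

Lemma usumZ c a : abs_summable a -> usum (fun i => c * a i) = c * usum a.
Proof.
move=> af.
wlog c0 : c / 0 <= c => [hw|].
  have [|/ltW c0] := leP 0 c; first exact: hw.
  have := hw (- c); rewrite oppr_ge0 => /(_ c0).
  rewrite (_ : (fun i => _) = (fun i => - (c * a i))); last by apply/funext => i; ring.
  by rewrite usumN; lra.
rewrite (@usumB _ (fun i => c * pos a i) (fun i => c * Num.max (- a i) 0)).
- rewrite !asumZ// -(asum_fin (pos0 a) (posf af)) -(asum_fin (neg0 a) (negf af)).
  by rewrite /usum -mulrBr.
- by move=> i; rewrite mulr_ge0 ?pos0.
- by move=> i; rewrite mulr_ge0 ?neg0.
- by rewrite asumZ// -(asum_fin (pos0 a) (posf af)) -EFinM ltry.
- by rewrite asumZ// -(asum_fin (neg0 a) (negf af)) -EFinM ltry.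
- by move=> i; rewrite {1}posneg mulrBr.
Qed.

Lemma le_asum_seq a M : (forall i, 0 <= a i) ->
  (forall s : seq I, uniq s -> \sum_(i <- s) a i <= M) -> (asum a <= M%:E)%E.
Proof.
move=> a0 sM; apply: ge_ereal_sup => _ [X [finX _] <-].
by rewrite fsumEFin// lee_fin fsbig_finite//= sM.
Qed.

Lemma asum_ge_seq a (s : seq I) : (forall i, 0 <= a i) -> uniq s ->
  ((\sum_(i <- s) a i)%:E <= asum a)%E.
Proof.
move=> a0 us; apply: esum_ge; exists [set` s] => //.
by rewrite fsumEFin// lee_fin -fsbig_seq.
Qed.

End Sums.

Section RealNorm.
Variables (R : realType) (V : normedModType R[i]).
Implicit Types v w : V.

(** Norms over [R[i]] take values in [R[i]]; [nrm] is the same norm in [R]. *)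
Definition nrm v : R := complex.Re `|v|.

Lemma nrmE v : (nrm v)%:C = `|v|.
Proof. by rewrite RRe_real// ger0_real. Qed.

Lemma nrm_ge0 v : 0 <= nrm v.
Proof. by rewrite -ler0c nrmE. Qed.

Lemma nrm0 : nrm 0 = 0.
Proof. by rewrite /nrm normr0. Qed.

Lemma nrm_eq0 v : nrm v = 0 -> v = 0.
Proof. by move=> v0; apply/normr0_eq0; rewrite -nrmE v0. Qed.

Lemma nrmN v : nrm (- v) = nrm v.
Proof. by rewrite /nrm normrN. Qed.

Lemma nrmD v w : nrm (v + w) <= nrm v + nrm w.
Proof. by rewrite -lecR rmorphD/= !nrmE ler_normD. Qed.

Lemma nrmB v w : nrm (v - w) <= nrm v + nrm w.
Proof. by rewrite -(nrmN w) nrmD. Qed.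

Lemma nrmZ (c : R[i]) v : nrm (c *: v) = complex.Re `|c| * nrm v.
Proof. by apply: (@complexI R); rewrite rmorphM/= !nrmE normrZ. Qed.

Lemma nrm_lt v e : (`|v| < e%:C) = (nrm v < e).
Proof. by rewrite -nrmE ltcR. Qed.

End RealNorm.

Section L2.
Variables (R : realType) (I : choiceType) (V : normedModType R[i]).
Implicit Types f g : I -> V.

Definition sqsum f : \bar R := asum (fun i => nrm (f i) ^+ 2).

Definition square_summable : {pred I -> V} :=
  fun f => `[< (sqsum f < +oo)%E >].

Lemma sqsum_ge0 f : (0 <= sqsum f)%E.
Proof. by apply: asum_ge0 => i; rewrite sqr_ge0. Qed.

Lemma sqsumZ c f : sqsum (fun i => c *: f i) = ((complex.Re `|c| ^+ 2)%:E * sqsum f)%E.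
Proof.
rewrite /sqsum -asumZ ?sqr_ge0//; last by move=> i; rewrite sqr_ge0.
by congr asum; apply/funext => i; rewrite nrmZ exprMn.
Qed.

Lemma square_summable_submod : submod_closed square_summable.
Proof.
split => [|c f g /asboolP fs /asboolP gs]; apply/asboolP.
  rewrite /sqsum /asum esum1 ?ltry// => i _ /=.
  by rewrite nrm0 expr0n.
pose p i := nrm (c *: f i) ^+ 2.
pose q i := nrm (g i) ^+ 2.
have p0 i : 0 <= p i by rewrite sqr_ge0.
have q0 i : 0 <= q i by rewrite sqr_ge0.
have pf : (asum p < +oo)%E.
  have -> : asum p = sqsum (fun i => c *: f i) by [].
  by rewrite sqsumZ lte_mul_pinfty// lee_fin sqr_ge0.
apply: (@le_lt_trans _ _ (asum (fun i => 2 * (p i + q i)))).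
  apply: le_asum => i; rewrite /p /q /=.
  apply: (@le_trans _ _ ((nrm (c *: f i) + nrm (g i)) ^+ 2)).
    by rewrite lerXn2r ?nnegrE ?addr_ge0 ?nrm_ge0 ?nrmD.
  have : 0 <= (nrm (c *: f i) - nrm (g i)) ^+ 2 by rewrite sqr_ge0.
  by rewrite sqrrB sqrrD; lra.
rewrite asumZ ?asumD//; last by move=> i; rewrite addr_ge0.
rewrite lte_mul_pinfty ?lee_fin ?adde_ge0 ?asum_ge0//.
by rewrite lte_add_pinfty.
Qed.

HB.instance Definition _ := GRing.isSubmodClosed.Build R[i] (I -> V)
  square_summable square_summable_submod.

Record l2 := L2 { l2val :> I -> V; l2P : l2val \in square_summable }.
HB.instance Definition _ := [isSub for l2val].
HB.instance Definition _ := [Choice of l2 by <:].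
HB.instance Definition _ := [SubChoice_isSubLmodule of l2 by <:].

Lemma l2_fin (x : l2) : (sqsum x < +oo)%E.
Proof. by case: x => f /= /asboolP. Qed.

Definition l2norm (x : l2) : R := Num.sqrt (fine (sqsum x)).

Lemma l2normE (x : l2) : sqsum x = (l2norm x ^+ 2)%:E.
Proof.
rewrite sqr_sqrtr ?fine_ge0 ?sqsum_ge0// fineK// ge0_fin_numE ?sqsum_ge0//.
exact: l2_fin.
Qed.

Lemma l2norm_ge0 (x : l2) : 0 <= l2norm x. Proof. exact: sqrtr_ge0. Qed.

Lemma l2norm_le (x : l2) M : 0 <= M -> (sqsum x <= (M ^+ 2)%:E)%E -> l2norm x <= M.
Proof. by move=> M0; rewrite l2normE lee_fin ler_sqr ?nnegrE ?l2norm_ge0. Qed.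

Lemma l2_coord (x : l2) i : nrm (x i) <= l2norm x.
Proof.
rewrite -ler_sqr ?nnegrE ?l2norm_ge0 ?nrm_ge0// -lee_fin -l2normE.
have := @asum_ge_seq R I (fun i => nrm (x i) ^+ 2) [:: i].
by rewrite big_seq1; apply => // j; rewrite sqr_ge0.
Qed.

Lemma l2norm_eq0 (x : l2) : l2norm x = 0 -> x = 0.
Proof.
move=> x0; apply/val_inj/funext => i; apply: nrm_eq0; apply/eqP.
by rewrite eq_le nrm_ge0 andbT -x0 l2_coord.
Qed.

Lemma l2normZ (c : R[i]) (x : l2) : l2norm (c *: x) = complex.Re `|c| * l2norm x.
Proof.
have c0 : 0 <= complex.Re `|c| by rewrite -ler0c RRe_real ?ger0_real.
apply/eqP; rewrite -(eqrXn2 (_ : 0 < 2)%N) ?mulr_ge0 ?l2norm_ge0//.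
have := sqsumZ c x; rewrite -[X in X = _]/(sqsum (c *: x)) !l2normE -EFinM exprMn.
by move=> /eqP; rewrite eqe.
Qed.

Lemma l2normD (x y : l2) : l2norm (x + y) <= l2norm x + l2norm y.
Proof.
have [/l2norm_eq0 ->|xn0] := eqVneq (l2norm x) 0.
  by rewrite add0r lerDr l2norm_ge0.
have [/l2norm_eq0 ->|yn0] := eqVneq (l2norm y) 0.
  by rewrite addr0 lerDl l2norm_ge0.
set a := l2norm x in xn0 *; set b := l2norm y in yn0 *.
have a0 : 0 < a by rewrite lt_def xn0 l2norm_ge0.
have b0 : 0 < b by rewrite lt_def yn0 l2norm_ge0.
apply: l2norm_le; first by rewrite addr_ge0 ?ltW.
pose p i := a^-1 * nrm (x i) ^+ 2; pose q i := b^-1 * nrm (y i) ^+ 2.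
have p0 i : 0 <= p i by rewrite mulr_ge0 ?sqr_ge0 ?invr_ge0 ?ltW.
have q0 i : 0 <= q i by rewrite mulr_ge0 ?sqr_ge0 ?invr_ge0 ?ltW.
apply: (@le_trans _ _ (asum (fun i => (a + b) * (p i + q i)))).
  apply: le_asum => i.
  apply: (@le_trans _ _ ((nrm (x i) + nrm (y i)) ^+ 2)).
    by rewrite lerXn2r ?nnegrE ?addr_ge0 ?nrm_ge0 ?nrmD.
  rewrite -subr_ge0 /p /q.
  rewrite (_ : _ - _ = (a * b)^-1 * (b * nrm (x i) - a * nrm (y i)) ^+ 2).
    by rewrite mulr_ge0 ?sqr_ge0// invr_ge0 mulr_ge0 ?ltW.
  by field; rewrite xn0 yn0.
rewrite asumZ ?asumD//; [|by rewrite addr_ge0 ?ltW|by move=> i; rewrite addr_ge0].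
rewrite !asumZ ?invr_ge0 ?(ltW a0) ?(ltW b0)//; try by move=> i; rewrite sqr_ge0.
rewrite -/(sqsum x) -/(sqsum y) !l2normE -/a -/b -!EFinM lee_fin.
by rewrite !expr2 !mulKf// expr2.
Qed.

Let norm (x : l2) : R[i] := (l2norm x)%:C.
Let normD x y : norm (x + y) <= norm x + norm y.
Proof. by rewrite -rmorphD lecR l2normD. Qed.
Let normZ (c : R[i]) x : norm (c *: x) = `|c| * norm x.
Proof. by rewrite /norm l2normZ rmorphM -(nrmE (c : R[i]^o)). Qed.
Let norm_eq0 x : norm x = 0 -> x = 0.
Proof. by move=> /complexI /l2norm_eq0. Qed.

HB.instance Definition _ := Lmodule_isNormed.Build R[i] l2 normD normZ norm_eq0.

Lemma l2_nrm (x : l2) : nrm x = l2norm x. Proof. by []. Qed.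

End L2.

Section L2Complete.
Variables (R : realType) (I : choiceType) (V : completeNormedModType R[i]).
Local Notation l2 := (l2 I V).

Lemma gt0_complex (e : R[i]) : 0 < e -> {d : R | 0 < d & e = d%:C}.
Proof.
move=> e0; have er : e \is Num.real by rewrite gtr0_real.
by exists (complex.Re e); [rewrite -ltcR RRe_real|rewrite RRe_real].
Qed.


Lemma nrm_ballE (W : normedModType R[i]) (x : W) (e : R) :
  ball x e%:C = [set y | nrm (x - y) < e].
Proof. by rewrite -ball_normE; apply/seteqP; split => y /=; rewrite nrm_lt. Qed.

Lemma nrm_cauchyP (W : normedModType R[i]) (F : set_system W) :
  ProperFilter F -> cauchy F <->
  forall e : R, 0 < e -> exists x, F [set y | nrm (x - y) < e].
Proof.
move=> FF; rewrite cauchyP; split => [Fc e e0|Fc _ /gt0_complex[e e0 ->]].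
  have := Fc e%:C; rewrite ltcR => /(_ e0)[x].
  by rewrite nrm_ballE; exists x.
by have [x Fx] := Fc e e0; exists x; rewrite nrm_ballE.
Qed.

Lemma nrm_cvgP (W : normedModType R[i]) (F : set_system W) (l : W) :
  Filter F -> F --> l <->
  forall e : R, 0 < e -> F [set y | nrm (l - y) < e].
Proof.
move=> FF; split=> [/cvg_ballP Fl e e0|Fl].
  by rewrite -nrm_ballE; apply: Fl; rewrite ltcR.
by apply/cvg_ballP => _ /gt0_complex[e e0 ->]; rewrite near_simpl nrm_ballE; exact: Fl.
Qed.

Lemma l2_complete (F : set_system l2) : ProperFilter F -> cauchy F -> cvg F.
Proof.
move=> FF /(nrm_cauchyP FF) Fc.
have Fi i : cvg ((fun x : l2 => x i) @ F).
  apply: cauchy_cvg; apply/nrm_cauchyP => e e0.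
  have [x Fx] := Fc e e0; exists (x i) => /=.
  apply: filterS Fx => y /=; apply: le_lt_trans.
  exact: (l2_coord (x - y) i).
pose g i : V := lim ((fun x : l2 => x i) @ F).
have gi i e : 0 < e -> F [set y : l2 | nrm (g i - y i) < e].
  by move=> e0; have /nrm_cvgP/(_ e e0) := Fi i.
have gJ (e : R) (s : seq I) : 0 < e ->
    F [set y : l2 | forall i, i \in s -> nrm (g i - y i) < e].
  move=> e0; elim: s => [|j s IH]; first by apply: filterS filterT.
  apply: filterS2 (gi j e e0) IH => y /= hj hs i.
  by rewrite inE => /orP[/eqP ->//|]; exact: hs.
have main (d : R) (x y : l2) : 0 < d -> F [set y : l2 | nrm (x - y) < d] ->
    nrm (x - y) < d -> (sqsum (fun i => (g i - y i)%R) <= ((4 * d) ^+ 2)%:E)%E.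
  move=> d0 Fx xy; apply: le_asum_seq => [i|s us]; first by rewrite sqr_ge0.
  pose e := d / (size s).+1%:R.
  have e0 : 0 < e by rewrite divr_gt0.
  have [z [/= xz zs]] := filter_ex (filterI Fx (gJ e s e0)).
  apply: (@le_trans _ _ (\sum_(i <- s) (2 * e ^+ 2 + 2 * nrm ((z - y : l2) i) ^+ 2))).
    rewrite !big_seq; apply: ler_sum => i /zs /ltW gz.
    have gy : nrm (g i - y i) <= e + nrm (z i - y i).
      have -> : g i - y i = (g i - z i) + (z i - y i) by rewrite addrA subrK.
      by apply: le_trans (nrmD _ _) _; rewrite lerD2r.
    apply: (@le_trans _ _ ((e + nrm (z i - y i)) ^+ 2)).
      by rewrite lerXn2r ?nnegrE ?addr_ge0 ?nrm_ge0 ?(ltW e0).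
    rewrite -[(z - y : l2) i]/(z i - y i).
    have : 0 <= (e - nrm (z i - y i)) ^+ 2 by rewrite sqr_ge0.
    by rewrite sqrrB sqrrD; lra.
  rewrite big_split/= -[X in X + _ <= _]mulr_sumr -[X in _ + X <= _]mulr_sumr.
  have zy : \sum_(i <- s) nrm ((z - y : l2) i) ^+ 2 <= (2 * d) ^+ 2.
    rewrite -lee_fin; apply: (@le_trans _ _ (sqsum (z - y : l2))).
      by apply: (@asum_ge_seq _ _ (fun i => nrm ((z - y : l2) i) ^+ 2)) => // i; rewrite sqr_ge0.
    rewrite l2normE lee_fin lerXn2r ?nnegrE ?l2norm_ge0 ?mulr_ge0 ?(ltW d0)//.
    have -> : z - y = (x - y) - (x - z) by rewrite opprB [RHS]addrC addrA subrK.
    rewrite -l2_nrm; apply: le_trans (nrmB _ _) _.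
    by have := ltW xy; have := ltW xz; lra.
  have es : \sum_(i <- s) e ^+ 2 <= d ^+ 2.
    rewrite big_const_seq count_predT iter_addr_0.
    have n1 : (1 : R) <= (size s).+1%:R by rewrite ler1n.
    have n0 : (0 : R) < (size s).+1%:R by rewrite ltr0n.
    have de : d = e * (size s).+1%:R by rewrite /e divfK// gt_eqF.
    rewrite -mulr_natr de [leRHS]exprMn ler_wpM2l ?sqr_ge0//.
    apply: (@le_trans _ _ (size s).+1%:R); first by rewrite ler_nat.
    by rewrite expr2 ler_peMr// ltW.
  have -> : (4 * d) ^+ 2 = 16 * d ^+ 2 by ring.
  have e2 : (2 * d) ^+ 2 = 4 * d ^+ 2 by ring.
  have : 0 <= d ^+ 2 by rewrite sqr_ge0.
  move: zy es; rewrite e2.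
  by move: (\sum_(i <- s) _) (\sum_(i <- s) _) (d ^+ 2) => S T D; lra.
have gl2 : g \in @square_summable R I V.
  have [x Fx] := Fc 1 ltr01.
  have [y /= xy] := filter_ex Fx.
  have gy : (fun i => g i - y i) \in @square_summable R I V.
    by apply/asboolP; apply: le_lt_trans (main 1 x y ltr01 Fx xy) _; rewrite ltry.
  have -> : g = (fun i => g i - y i) + y :> (I -> V).
    by apply/funext => i /=; rewrite -[RHS]/(g i - y i + y i) subrK.
  by rewrite rpredD// l2P.
apply/cvg_ex; exists (L2 gl2); apply/nrm_cvgP => e e0.
have d0 : 0 < e / 8 by rewrite divr_gt0.
have [x Fx] := Fc _ d0.
apply: filterS (Fx) => y /= xy.
rewrite l2_nrm; apply: (@le_lt_trans _ _ (4 * (e / 8))); last by lra.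
apply: l2norm_le; first by rewrite mulr_ge0// ltW.
exact: main Fx xy.
Qed.

HB.instance Definition _ := Uniform_isComplete.Build l2 l2_complete.

End L2Complete.

HB.mixin Record NormedModule_hasInner (R : realType) V & NormedModule R[i] V := {
  inner : V -> V -> R[i];
  inner_scalar : forall y, scalar (inner^~ y);
  innerC : forall x y, inner x y = (inner y x)^*;
  innerxx : forall x, inner x x = `|x| ^+ 2 }.

#[short(type="hilbertType")]
HB.structure Definition Hilbert (R : realType) :=
  {V of CompleteNormedModule R[i] V & NormedModule_hasInner R V}.

Section InnerTheory.
Variables (R : realType) (V : hilbertType R).
Implicit Types x y z : V.

Lemma innerZ (a : R[i]) x y : inner (a *: x) y = a * inner x y.
Proof.
have := inner_scalar y a x 0; have := inner_scalar y 1 0 0.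
by rewrite /= scale1r !addr0 mul1r -[X in X = _]addr0 => /addrI <-; rewrite addr0.
Qed.

Lemma innerD x y z : inner (x + y) z = inner x z + inner y z.
Proof. by have := inner_scalar z 1 x y; rewrite /= scale1r mul1r. Qed.

Lemma innerNx x y : inner (- x) y = - inner x y.
Proof. by rewrite -scaleN1r innerZ mulN1r. Qed.

Lemma innerxx_nrm x : inner x x = (nrm x ^+ 2)%:C.
Proof. by rewrite innerxx -nrmE rmorphXn. Qed.

Lemma Re_inner_le x y : `|complex.Re (inner x y)| <= nrm x ^+ 2 + nrm y ^+ 2.
Proof.
have key (z : V) : 0 <= nrm z ^+ 2 + nrm y ^+ 2 + 2 * complex.Re (inner z y).
  have : 0 <= nrm (z + y) ^+ 2 by rewrite sqr_ge0.
  have : (nrm (z + y) ^+ 2)%:C = inner (z + y) (z + y) by rewrite innerxx_nrm.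
  rewrite innerD (innerC z (z + y)) (innerC y (z + y)) !innerD !innerxx_nrm (innerC y z).
  case: (inner z y) => a b [-> _] /=; lra.
have := key x; have := key (- x); rewrite innerNx nrmN /= raddfN => h1 h2.
have := sqr_ge0 (nrm x); have := sqr_ge0 (nrm y) => p q.
by rewrite ler_norml; apply/andP; split; lra.
Qed.

Lemma Im_inner_le x y : `|complex.Im (inner x y)| <= nrm x ^+ 2 + nrm y ^+ 2.
Proof.
have := Re_inner_le (- 'i *: x) y.
have -> : nrm (- 'i *: x) = nrm x.
  by rewrite nrmZ normrN normc_def /= expr0n expr1n add0r sqrtr1 mul1r.
by rewrite innerZ; case: (inner x y) => a b /=; rewrite !(mul0r, oppr0, mulN1r, sub0r, opprK).
Qed.

End InnerTheory.

Section L2Hilbert.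
Variables (R : realType) (I : choiceType) (V : hilbertType R).
Local Notation l2 := (l2 I V).
Implicit Types x y : l2.

(** The sum over [i] of [inner (x i) (y i)]. *)
Definition l2inner x y : R[i] :=
  usum (fun i => complex.Re (inner (x i) (y i))) +i*
  usum (fun i => complex.Im (inner (x i) (y i))).

Let summable_inner (h : R[i] -> R) x y :
    (forall v w : V, `|h (inner v w)| <= nrm v ^+ 2 + nrm w ^+ 2) ->
  abs_summable (fun i => h (inner (x i) (y i))).
Proof.
move=> hle; apply: (@le_lt_trans _ _ (asum (fun i => nrm (x i) ^+ 2 + nrm (y i) ^+ 2))).
  exact: le_asum.
by rewrite asumD ?lte_add_pinfty ?l2_fin// => i; rewrite sqr_ge0.
Qed.

Let sRe x y : abs_summable (fun i => complex.Re (inner (x i) (y i))).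
Proof. by apply: summable_inner => v w; exact: Re_inner_le. Qed.

Let sIm x y : abs_summable (fun i => complex.Im (inner (x i) (y i))).
Proof. by apply: summable_inner => v w; exact: Im_inner_le. Qed.

Let abs_summableZ c (a : I -> R) : abs_summable a -> abs_summable (fun i => c * a i).
Proof.
move=> af; rewrite /abs_summable (_ : (fun i => _) = (fun i => `|c| * `|a i|)).
  by rewrite asumZ// lte_mul_pinfty ?asum_ge0.
by apply/funext => i; rewrite normrM.
Qed.

Let abs_summableD (a b : I -> R) : abs_summable a -> abs_summable b ->
  abs_summable (fun i => a i + b i).
Proof.
move=> af bf; apply: (@le_lt_trans _ _ (asum (fun i => `|a i| + `|b i|))).
  by apply: le_asum => i; exact: ler_normD.
by rewrite asumD// lte_add_pinfty.
Qed.

Let l2inner_scalar y : scalar (l2inner^~ y).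
Proof.
case=> [c d] x x'; rewrite /l2inner.
have e i : inner ((((c +i* d)%C : R[i]) *: x + x' : l2) i) (y i) =
    (c +i* d)%C * inner (x i) (y i) + inner (x' i) (y i).
  by rewrite -innerZ -innerD.
set f := fun i => complex.Re (inner (x i) (y i)).
set g := fun i => complex.Im (inner (x i) (y i)).
set f' := fun i => complex.Re (inner (x' i) (y i)).
set g' := fun i => complex.Im (inner (x' i) (y i)).
rewrite (_ : (fun i => complex.Re _) = (fun i => (c * f i + (- d) * g i) + f' i)); last first.
  apply/funext => i; rewrite e /f /g /f'.
  by case: (inner (x i) (y i)) => ? ?; case: (inner (x' i) (y i)) => ? ? /=; ring.
rewrite (_ : (fun i => complex.Im _) = (fun i => (c * g i + d * f i) + g' i)); last first.
  apply/funext => i; rewrite e /f /g /g'.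
  by case: (inner (x i) (y i)) => ? ?; case: (inner (x' i) (y i)) => ? ? /=; ring.
have [sf sg sf' sg'] : [/\ abs_summable f, abs_summable g, abs_summable f' & abs_summable g'].
  by split; [exact: sRe|exact: sIm|exact: sRe|exact: sIm].
have lin (a b : R) (p q r : I -> R) : abs_summable p -> abs_summable q ->
    abs_summable r -> usum (fun i => (a * p i + b * q i) + r i) =
    (a * usum p + b * usum q) + usum r.
  move=> ps qs rs.
  rewrite (@usumD _ _ (fun i => a * p i + b * q i) r)//; last first.
    by apply: abs_summableD; exact: abs_summableZ.
  rewrite (@usumD _ _ (fun i => a * p i) (fun i => b * q i)); last 2 first.
    exact: abs_summableZ.
    exact: abs_summableZ.
  by rewrite usumZ// usumZ.
rewrite !lin//.
by apply/eqP; rewrite eq_complex /=; apply/andP; split; apply/eqP; ring.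
Qed.

Let l2innerC x y : l2inner x y = (l2inner y x)^*.
Proof.
rewrite -[RHS]/(conjc _) /l2inner /= -usumN.
congr (Complex _ _); congr usum; apply/funext => i; rewrite (innerC (x i)).
  by case: (inner _ _).
by case: (inner _ _).
Qed.

Let l2innerxx x : l2inner x x = `|x| ^+ 2.
Proof.
rewrite /l2inner -nrmE l2_nrm -rmorphXn /=.
have -> : (fun i => complex.Im (inner (x i) (x i))) = (fun=> 0).
  by apply/funext => i; rewrite innerxx_nrm.
have -> : (fun i => complex.Re (inner (x i) (x i))) = (fun i => nrm (x i) ^+ 2).
  by apply/funext => i; rewrite innerxx_nrm.
rewrite !usum_nneg// => [|i]; last by rewrite sqr_ge0.
rewrite -/(sqsum x) l2normE /= [asum _](_ : _ = 0%E)//.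
by apply: esum1.
Qed.

HB.instance Definition _ :=
  NormedModule_hasInner.Build R l2 l2inner_scalar l2innerC l2innerxx.

End L2Hilbert.

Section ComplexHilbert.
Variable R : realType.

(** The one-dimensional Hilbert space, on a copy of [R[i]] that can carry a
    completeness instance. *)
Definition scal : Type := R[i]^o.
HB.instance Definition _ := NormedModule.copy scal R[i]^o.

Lemma scal_complete (F : set_system scal) : ProperFilter F -> cauchy F -> cvg F.
Proof.
move=> FF /(nrm_cauchyP FF) Fc.
have sub (h : R[i] -> R) : (forall z w, h (z - w) = h z - h w) ->
    (forall z : scal, `|h z| <= nrm z) -> cvg (h @ F).
  move=> hB hn; apply: R_complete; apply/cauchyP => e e0.
  have [x Fx] := Fc e e0; exists (h x).
  have : F (h @^-1` ball (h x) e); last by [].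
  apply: filterS Fx => y /=; rewrite -ball_normE /= -hB; apply: le_lt_trans; exact: hn.
have nE (z : scal) : nrm z = Num.sqrt (complex.Re z ^+ 2 + complex.Im z ^+ 2).
  by rewrite /nrm normc_def.
have nRe (z : scal) : `|complex.Re z| <= nrm z.
  by rewrite nE -sqrtr_sqr ler_wsqrtr// lerDl sqr_ge0.
have nIm (z : scal) : `|complex.Im z| <= nrm z.
  by rewrite nE -sqrtr_sqr ler_wsqrtr// lerDr sqr_ge0.
have reB (z w : R[i]) : complex.Re (z - w) = complex.Re z - complex.Re w.
  by case: z w => [? ?] [].
have imB (z w : R[i]) : complex.Im (z - w) = complex.Im z - complex.Im w.
  by case: z w => [? ?] [].
have cRe := sub (@complex.Re R) reB nRe.
have cIm := sub (@complex.Im R) imB nIm.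
set a := lim (@complex.Re R @ F) in cRe; set b := lim (@complex.Im R @ F) in cIm.
apply/cvg_ex; exists (a +i* b : scal); apply/nrm_cvgP => e e0.
have e2 : 0 < e / 2 by rewrite divr_gt0.
have /cvgrPdist_lt /(_ _ e2) Fa : @complex.Re R @ F --> a by [].
have /cvgrPdist_lt /(_ _ e2) Fb : @complex.Im R @ F --> b by [].
apply: filterS2 Fa Fb => z /= za zb.
apply: (@le_lt_trans _ _ (`|a - complex.Re z| + `|b - complex.Im z|)); last by lra.
rewrite nE -ler_sqr ?nnegrE ?sqrtr_ge0 ?addr_ge0// sqr_sqrtr ?addr_ge0 ?sqr_ge0//.
case: z za zb => c d /= _ _.
rewrite [leRHS]sqrrD !real_normK ?num_real// lerD2r lerDl.
by rewrite mulrn_wge0 ?mulr_ge0.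
Qed.

HB.instance Definition _ := Uniform_isComplete.Build scal scal_complete.

Definition scal_inner (z w : scal) : R[i] := (z : R[i]) * w^*.

Let inner_scalar w : scalar (scal_inner^~ w).
Proof. by move=> a z z'; rewrite /scal_inner /= mulrDl mulrA. Qed.
Let innerC z w : scal_inner z w = (scal_inner w z)^*.
Proof. by rewrite /scal_inner rmorphM/= conjCK mulrC. Qed.
Let innerxx z : scal_inner z z = `|z| ^+ 2.
Proof. by rewrite normCK. Qed.

HB.instance Definition _ :=
  NormedModule_hasInner.Build R scal inner_scalar innerC innerxx.
End ComplexHilbert.

Section ToL2.
Variables (R : realType) (I : choiceType) (V : normedModType R[i]).

(** The element of l^2(I, V) given by [f], and 0 if [f] is not square summable. *)
Definition to_l2 (f : I -> V) : l2 I V := insubd 0 f.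

Lemma to_l2E f : f \in @square_summable R I V -> to_l2 f = f :> (I -> V).
Proof. by move=> fs; rewrite /to_l2 -[LHS]/(val (insubd _ _)) val_insubd fs. Qed.

End ToL2.

Definition directed (D : Type) (le : D -> D -> Prop) : Prop :=
  [/\ inhabited D, forall i, le i i,
      forall i j k, le i j -> le j k -> le i k
    & forall i j, exists k, le i k /\ le j k].

Definition net_to0 (R : realType) (D : Type) (le : D -> D -> Prop)
    (u : D -> \bar R) : Prop :=
  forall e : R, 0 < e -> exists i0, forall i, le i0 i -> (u i < e%:E)%E.

(** Operators on a Hilbert space [H] are plain functions [H -> H], which carry
    the pointwise vector space structure; [bop H] is B(H).  A (concrete)
    operator space is a subset of [bop H], and maps between operator spaces are
    functions of which only the restriction to the given domain matters. *)
Section Operators.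
Variables (R : realType) (H : hilbertType R).
Implicit Types (x y : H -> H) (X Y : set (H -> H)).

Definition opnorm x : \bar R :=
  ereal_sup [set (nrm (x v))%:E | v in [set v | nrm v <= 1]].

Definition bop : set (H -> H) := [set x | linear x /\ (opnorm x < +oo)%E].

Definition opclosure X : set (H -> H) :=
  [set y | bop y /\
    forall e : R, 0 < e -> exists2 x, X x & (opnorm (y - x)%R < e%:E)%E].

(** The norm of M_m(B(H)) = B(H^m). *)
Definition mxnorm m (x : 'M[H -> H]_m) : \bar R :=
  ereal_sup
    [set (Num.sqrt (\sum_i nrm (\sum_j x i j (v j)) ^+ 2))%:E
      | v in [set v : 'I_m -> H | \sum_j nrm (v j) ^+ 2 <= 1]].

Definition mxset X m : set 'M[H -> H]_m := [set x | forall i j, X (x i j)].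

Definition findim Y : Prop :=
  exists n (e : 'I_n -> H -> H),
    Y = [set \sum_i c i *: e i | c in [set: 'I_n -> R[i]]].

Definition adjoint x y : Prop := forall u v, inner (x u) v = inner u (y v).

Definition cstar_algebra (A : set (H -> H)) : Prop :=
  [/\ A `<=` bop,
      A 0 /\ forall (c : R[i]) a b, A a -> A b -> A (c *: a + b),
      forall a b, A a -> A b -> A (a \o b),
      forall a, A a -> exists2 b, A b & adjoint a b
    & opclosure A `<=` A].

Definition nondegenerate_alg (A : set (H -> H)) : Prop :=
  forall (v : H) (e : R), 0 < e ->
    exists n (a : 'I_n -> H -> H) (w : 'I_n -> H),
      (forall k, A (a k)) /\ nrm (v - \sum_k a k (w k)) < e.

End Operators.
Arguments bop {R} H.

Section CompletelyBounded.
Variables (R : realType) (H L : hilbertType R).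
Implicit Types (X : set (H -> H)) (Z : set (L -> L)).
Implicit Types Psi : (H -> H) -> (L -> L).

Definition linear_on X Psi : Prop :=
  forall (c : R[i]) x y, X x -> X y -> Psi (c *: x + y) = c *: Psi x + Psi y.

Definition cbnorm X Psi : \bar R :=
  ereal_sup [set r | exists m (x : 'M[H -> H]_m),
    [/\ mxset X x, (mxnorm x <= 1)%E & r = mxnorm (map_mx Psi x)]].

Definition CB X Z Psi : Prop :=
  [/\ forall x, X x -> Z (Psi x), linear_on X Psi & (cbnorm X Psi < +oo)%E].

Definition finite_rank X Psi : Prop :=
  exists2 Y : set (L -> L), findim Y & forall x, X x -> Y (Psi x).

Definition completely_compact X Z Psi : Prop :=
  CB X Z Psi /\
  forall e : R, 0 < e -> exists Y : set (L -> L),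
    [/\ findim Y, Y `<=` Z
      & forall m (x : 'M[H -> H]_m), mxset X x -> (mxnorm x <= 1)%E ->
        (ereal_inf [set mxnorm (map_mx Psi x - y)%R | y in @mxset R L Y m]
          < e%:E)%E].

End CompletelyBounded.

(** [hilbert_tensor t]: the pair of [T] and [t] is a Hilbert space tensor
    product of [K] and [L], with [t k l] in the role of k ⊗ l. *)
Section MinimalTensor.
Variables (R : realType) (K L T : hilbertType R) (t : K -> L -> T).

Definition hilbert_tensor : Prop :=
  [/\ forall l, linear (t^~ l), forall k, linear (t k),
      forall k l k' l', inner (t k l) (t k' l') = inner k k' * inner l l'
    & forall (v : T) (e : R), 0 < e ->
        exists n (k : 'I_n -> K) (l : 'I_n -> L),
          nrm (v - \sum_j t (k j) (l j)) < e].

(** b ⊗ x, the bounded operator sending each k ⊗ l to b k ⊗ x l. *)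
Definition tensop (b : K -> K) (x : L -> L) : T -> T :=
  xget 0 [set y | bop T y /\ forall k l, y (t k l) = t (b k) (x l)].

(** B(K) ⊗_min X. *)
Definition mintensor (X : set (L -> L)) : set (T -> T) :=
  opclosure [set y | exists n (b : 'I_n -> K -> K) (x : 'I_n -> L -> L),
    (forall j, bop K (b j) /\ X (x j)) /\ y = \sum_j tensop (b j) (x j)].

(** id ⊗ Phi, the bounded extension of b ⊗ x |-> b ⊗ Phi x to B(K) ⊗_min X. *)
Definition id_tensor (X : set (L -> L)) (Phi : (L -> L) -> (L -> L)) :
    (T -> T) -> (T -> T) :=
  xget 0 [set Th |
    [/\ forall x, mintensor X x -> mintensor X (Th x),
        linear_on (mintensor X) Th,
        exists c : R, forall x, mintensor X x ->
          (opnorm (Th x) <= c%:E * opnorm x)%E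
      & forall b x, bop K b -> X x -> Th (tensop b x) = tensop b (Phi x)]].

End MinimalTensor.

Definition SOAP (R : realType) (L : hilbertType R) (X : set (L -> L)) : Prop :=
  exists (D : Type) (le : D -> D -> Prop) (Phi : D -> (L -> L) -> (L -> L)),
    [/\ directed le,
        forall i, CB X X (Phi i) /\ finite_rank X (Phi i)
      & forall (K T : hilbertType R) (t : K -> L -> T), hilbert_tensor t ->
          forall x, mintensor t X x ->
            net_to0 le (fun i => opnorm (id_tensor t X (Phi i) x - x)%R)].

Section CrossedProduct.
Variables (R : realType) (G : groupType) (H : hilbertType R).
Variables (A : set (H -> H)) (alpha : G -> (H -> H) -> (H -> H)).
Local Notation HH := (l2 G H).

Definition star_automorphism (f : (H -> H) -> (H -> H)) : Prop :=
  [/\ set_bij A A f, linear_on A f,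
      forall a b, A a -> A b -> f (a \o b) = f a \o f b
    & forall a b, A a -> A b -> adjoint a b -> adjoint (f a) (f b)].

Definition dyn_action : Prop :=
  (forall t, star_automorphism (alpha t)) /\
  forall s t a, A a -> alpha (s * t)%g a = alpha s (alpha t a).

Definition lambda_ (t : G) : HH -> HH :=
  fun xi => to_l2 (fun s => xi (t^-1 * s)%g).

Lemma lambda_E t xi : lambda_ t xi = (fun s => xi (t^-1 * s)%g) :> (G -> H).
Proof.
apply: to_l2E; apply/asboolP.
rewrite (_ : sqsum _ = sqsum xi) ?l2_fin// /sqsum /asum.
rewrite -(@reindex_esum R G G setT setT (fun s => (t^-1 * s)%g)
  (fun s => (nrm (xi s) ^+ 2)%:E))//.
split=> // [s s' _ _ /mulgI//|s _]; exists (t * s)%g => //.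
by rewrite mulgA mulVg mul1g.
Qed.

(** Automorphisms of a C*-algebra are isometric, so for [a] in [A] the function
    given to [to_l2] is square summable. *)
Definition pi_ (a : H -> H) : HH -> HH :=
  fun xi => to_l2 (fun s => alpha s^-1%g a (xi s)).

(** [T] is the sum of the family [u], unconditionally convergent in norm. *)
Definition is_opsum (u : G -> HH -> HH) (T : HH -> HH) : Prop :=
  bop HH T /\
  forall e : R, 0 < e -> exists E0 : {fset G}, forall E : {fset G},
    (E0 `<=` E)%fset -> (opnorm (T - \sum_(s <- E) u s)%R < e%:E)%E.

Definition pi_tilde (f : G -> H -> H) : HH -> HH :=
  xget 0 (is_opsum (fun s => pi_ (f s) \o lambda_ s)).

Definition l1_space : set (G -> H -> H) :=
  [set f | (forall s, A (f s)) /\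
           (\esum_(s in [set: G]) opnorm (f s) < +oo)%E].

Definition crossed : set (HH -> HH) := opclosure (pi_tilde @` l1_space).

Definition bounded_CB (F : G -> (H -> H) -> (H -> H)) : Prop :=
  (forall t, CB A A (F t)) /\ exists c : R, forall t, (cbnorm A (F t) <= c%:E)%E.

Definition multf (F : G -> (H -> H) -> (H -> H)) (f : G -> H -> H) :
    G -> H -> H :=
  fun t => F t (f t).

Definition herz_schur (F : G -> (H -> H) -> (H -> H)) : Prop :=
  bounded_CB F /\
  exists S, CB (pi_tilde @` l1_space) (pi_tilde @` l1_space) S /\
    forall f, l1_space f -> S (pi_tilde f) = pi_tilde (multf F f).

(** The completely bounded extension to the reduced crossed product; its values
    off [crossed] are irrelevant. *)
Definition S_ (F : G -> (H -> H) -> (H -> H)) : (HH -> HH) -> (HH -> HH) :=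
  xget 0 [set S | CB crossed crossed S /\
    forall f, l1_space f -> S (pi_tilde f) = pi_tilde (multf F f)].

Definition mnorm (F : G -> (H -> H) -> (H -> H)) : \bar R :=
  cbnorm crossed (S_ F).

Definition finitely_supported (F : G -> (H -> H) -> (H -> H)) : Prop :=
  exists E : {fset G}, forall s, s \notin E -> forall a, A a -> F s a = 0.

(** The identification of l^2(G) ⊗ H with l^2(G, H). *)
Definition l2tensor (k : l2 G (scal R)) (v : H) : HH :=
  to_l2 (fun s => (k s : R[i]) *: v).

Lemma l2tensorE k v : l2tensor k v = (fun s => (k s : R[i]) *: v) :> (G -> H).
Proof.
apply: to_l2E; apply/asboolP.
rewrite (_ : sqsum _ = asum (fun s => nrm v ^+ 2 * nrm (k s) ^+ 2)).
  by rewrite asumZ ?sqr_ge0// ?lte_mul_pinfty ?l2_fin ?lee_fin ?sqr_ge0// => s;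
    rewrite sqr_ge0.
by congr asum; apply/funext => s; rewrite nrmZ exprMn mulrC.
Qed.

Definition l2basis (q : G) : l2 G (scal R) :=
  to_l2 (V := scal R) (fun s => (s == q)%:R : R[i]).

Lemma l2basisE q : l2basis q = (fun s => (s == q)%:R) :> (G -> scal R).
Proof.
apply: to_l2E; apply/asboolP.
apply: (@le_lt_trans _ _ 1%:E); last by rewrite ltry.
apply: le_asum_seq => [s|r ur]; first by rewrite sqr_ge0.
rewrite (eq_bigr (fun s => (s == q)%:R)); last first.
  by move=> s _; case: eqP => _; rewrite /nrm ?normr0 ?normr1 /= ?expr0n ?expr1n.
rewrite -natr_sum lern1 (_ : bigop _ _ _ = count_mem q r); last first.
  by rewrite -sum1_count [RHS]big_mkcond; apply: eq_bigr => s _; rewrite /=; case: eqP.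
by rewrite count_uniq_mem// leq_b1.
Qed.

(** Since the inner product of [z] and [l2tensor (l2basis p) w] is that of [z p]
    and [w], this is the (p, q) entry of the matrix of [x]. *)
Definition entry (x : HH -> HH) (p q : G) : H -> H :=
  fun v => x (l2tensor (l2basis q) v) p.

Definition schur_domain : set (HH -> HH) := mintensor l2tensor A.

Definition schur_map (phi : G -> G -> (H -> H) -> (H -> H))
    (S : (HH -> HH) -> (HH -> HH)) : Prop :=
  CB schur_domain (bop HH) S /\
  forall x p q, schur_domain x -> entry (S x) p q = phi q p (entry x p q).

Definition schur_multiplier (phi : G -> G -> (H -> H) -> (H -> H)) : Prop :=
  [/\ forall s t, CB A (bop H) (phi s t),
      exists c : R, forall s t, (cbnorm A (phi s t) <= c%:E)%E
    & exists S, schur_map phi S].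

Definition S_schur (phi : G -> G -> (H -> H) -> (H -> H)) :
    (HH -> HH) -> (HH -> HH) :=
  xget 0 (schur_map phi).

Definition band_finite (phi : G -> G -> (H -> H) -> (H -> H)) : Prop :=
  exists E : {fset G}, forall s t, (t * s^-1)%g \notin E ->
    forall a, A a -> phi s t a = 0.

Definition N_ (F : G -> (H -> H) -> (H -> H)) : G -> G -> (H -> H) -> (H -> H) :=
  fun s t a => alpha t^-1%g (F (t * s^-1)%g (alpha t a)).

End CrossedProduct.
Arguments schur_domain {R} G {H} A.

(* Main.v *)
Require Import Defs.
From HB Require Import structures.
From mathcomp Require Import all_boot all_order all_algebra.
From mathcomp Require Import complex finmap.
From mathcomp Require Import boolp classical_sets functions fsbigop reals.
From mathcomp Require Import constructive_ereal ereal topology normedtype sequences esum.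
From mathcomp Require Import lra ring.
Set SsrOldRewriteGoalsOrder.
Set Implicit Arguments. Unset Strict Implicit. Unset Printing Implicit Defensive.
Import Order.TTheory GRing.Theory Num.Theory numFieldNormedType.Exports.
Local Open Scope classical_set_scope.
Local Open Scope complex_scope.
Local Open Scope ring_scope.

(** (i) => (ii): the images under S_F of all matrices of norm at most 1 fit into one block
    diagonal element of B(K) ⊗_min X, so a single map Φ of the SOAP net makes Φ ∘ S_F cb-close
    to S_F.  Its range is finite dimensional and can be moved into the finitely supported sums;
    compressing to the Fourier coefficients, t ↦ (a ↦ E_t(Ψ(π(a)λ_t))), gives the multiplier,
    and this compression is cb-contractive by transference: the entries of a matrix
    (π(α_{p_i} a_ij) λ_{p_i p_j⁻¹}) transform under S_F by the Schur multiplier N(F).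
    (ii) => (iii) is transference alone, with φ_i = N(F_i).
    (iii) => (i): if φ is supported on the band E_0 and close to N(F), then S_F is small on
    elements whose Fourier coefficients vanish on E_0.  The point is that each matrix x of norm
    at most 1 over X has, up to a small error on E_0, the same coefficients on E_0 as a matrix c
    of bounded norm supported in a finite set that depends on E_0 and on the error only.  To find
    c, let T be the selfadjoint dilation of x, scaled to norm 1/2, and h its truncation to a window of
    degrees; h may be unbounded but h (1 + h^{2D})⁻¹ is not, and on a vector z of degree 1 it
    differs from T z by about h^{2D+1} z, which is of size 2^{-2D} up to truncation errors
    that become small when averaged over many windows.  Then S_F(x) is close to S_F(c), and a
    second φ, now close to N(F) relative to the support of c, moves S_F(c) into a fixed finite
    dimensional space. *)

(** * Operators and matrices of operators, with real norm bounds *)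

(** The obstacle in (iii) => (i) is a circularity. A φ close to N(F) fixes a band E, and its finite
    dimensional information concerns the single column φ(s, e). Rebuilding S_F(x) from that column,
    coefficient by coefficient over E, costs a factor of the size of E, which depends on the very
    closeness that should beat it. Nor is cutting x down to finitely many coefficients bounded, in
    general, independently of their number. Hence the two choices of φ: the first only fixes E_0,
    and the second can be made after the size of the support of c is known. The map x ↦ c is not
    linear and need not be, because complete compactness asks only for the distance to one finite
    dimensional space. Uniformity over matrix sizes is obtained by making c one fixed noncommutative
    polynomial in the homogeneous parts of T, for all T at once. *)

Section Linear.
Variables (R : realType) (V W : normedModType R[i]).
Implicit Types (x y : V -> W).

Lemma linearD x u v : linear x -> x (u + v) = x u + x v.
Proof. by move=> lx; have := lx 1 u v; rewrite !scale1r. Qed.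

Lemma linear0' x : linear x -> x 0 = 0.
Proof. by move=> lx; have := linearD 0 0 lx; rewrite addr0 => /eqP; rewrite addrC -subr_eq subrr eq_sym => /eqP. Qed.

Lemma linearZ' x c u : linear x -> x (c *: u) = c *: x u.
Proof. by move=> lx; have := lx c u 0; rewrite !addr0 linear0' ?addr0. Qed.

Lemma linearN' x u : linear x -> x (- u) = - x u.
Proof. by move=> lx; rewrite -scaleN1r linearZ' // scaleN1r. Qed.

Lemma linearB' x u v : linear x -> x (u - v) = x u - x v.
Proof. by move=> lx; rewrite linearD // linearN'. Qed.

Lemma linear_sum' x (I : Type) (r : seq I) (P : pred I) (F : I -> V) : linear x ->
  x (\sum_(i <- r | P i) F i) = \sum_(i <- r | P i) x (F i).
Proof.
move=> lx; elim/big_rec2: _ => [|i a b _ <-]; first exact: linear0'.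
exact: linearD.
Qed.

Lemma sumfE (I : Type) (r : seq I) (P : pred I) (F : I -> V -> W) v :
  (\sum_(i <- r | P i) F i) v = \sum_(i <- r | P i) F i v.
Proof. by elim/big_rec2: _ => // i a b _ <-. Qed.

Lemma linear_add x y : linear x -> linear y -> linear (x + y).
Proof.
move=> lx ly c u v; rewrite -[LHS]/(x (c *: u + v) + y (c *: u + v)) lx ly.
by rewrite -[(x + y) u]/(x u + y u) -[(x + y) v]/(x v + y v) scalerDr addrACA.
Qed.

Lemma linear_scale c x : linear x -> linear (c *: x).
Proof.
move=> lx a u v; rewrite -[LHS]/(c *: x (a *: u + v)) lx.
by rewrite -[(c *: x) u]/(c *: x u) -[(c *: x) v]/(c *: x v) scalerDr !scalerA mulrC.
Qed.

Lemma linear_opp x : linear x -> linear (- x).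
Proof. by rewrite -scaleN1r; exact: linear_scale. Qed.

Lemma linear_sub x y : linear x -> linear y -> linear (x - y).
Proof. by move=> lx ly; apply: linear_add => //; exact: linear_opp. Qed.

Lemma linear_zero : linear (0 : V -> W).
Proof. by move=> c u v; rewrite -[LHS]/(0 : W) -[(0 : V -> W) u]/(0 : W) scaler0 add0r. Qed.

Lemma linear_fsum (I : Type) (r : seq I) (P : pred I) (F : I -> V -> W) :
  (forall i, P i -> linear (F i)) -> linear (\sum_(i <- r | P i) F i).
Proof.
move=> lF; elim/big_rec: _ => [|i a Pi la]; first exact: linear_zero.
by apply: linear_add => //; exact: lF.
Qed.

(** A bound with a real constant and no normalisation of [v]: it passes through sums, products and
    limits without extended reals, and agrees with [opnorm] for linear maps and nonnegative
    constants. *)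
Definition ople x (M : R) := forall v, nrm (x v) <= M * nrm v.

Lemma ople_mon x M N : M <= N -> ople x M -> ople x N.
Proof. by move=> MN xM v; rewrite (le_trans (xM v)) ?ler_wpM2r ?nrm_ge0. Qed.

Lemma ople_add x y M N : ople x M -> ople y N -> ople (x + y) (M + N).
Proof. by move=> xM yN v; rewrite (le_trans (nrmD _ _)) // mulrDl lerD. Qed.

Lemma ople_scale c x M : ople x M -> ople (c *: x) (complex.Re `|c| * M).
Proof.
move=> xM v; rewrite -[(c *: x) v]/(c *: x v) nrmZ -mulrA ler_wpM2l ?xM //.
by rewrite -ler0c RRe_real ?ger0_real.
Qed.

Lemma ople_opp x M : ople x M -> ople (- x) M.
Proof. by move=> xM v; rewrite -[(- x) v]/(- x v) nrmN. Qed.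

Lemma ople_sub x y M N : ople x M -> ople y N -> ople (x - y) (M + N).
Proof. by move=> xM yN; apply: ople_add => //; exact: ople_opp. Qed.

Lemma ople_zero : ople 0 0.
Proof. by move=> v; rewrite mul0r nrm0. Qed.

Lemma ople_fsum (I : Type) (r : seq I) (P : pred I) (F : I -> V -> W) (M : I -> R) :
  (forall i, P i -> ople (F i) (M i)) ->
  ople (\sum_(i <- r | P i) F i) (\sum_(i <- r | P i) M i).
Proof.
move=> lF; elim/big_rec2: _ => [|i a b Pi la]; first exact: ople_zero.
by apply: ople_add => //; exact: lF.
Qed.

Lemma ople_eps x M : (forall e : R, 0 < e -> ople x (M + e)) -> ople x M.
Proof.
move=> xM v; apply/ler_addgt0Pr => e e0.
have d0 : 0 < nrm v + 1 by rewrite ltr_wpDl ?nrm_ge0.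
apply: (le_trans (xM (e / (nrm v + 1)) (divr_gt0 e0 d0) v)).
rewrite mulrDl lerD2l mulrAC ler_pdivrMr // ler_wpM2l ?(ltW e0) //; lra.
Qed.

End Linear.

Lemma Re_norm_real (R : realType) (r : R) : 0 <= r -> complex.Re `|r%:C| = r.
Proof. by move=> r0; rewrite ger0_norm // ler0c. Qed.

Lemma linear_comp (R : realType) (U V W : normedModType R[i]) (x : V -> W) (y : U -> V) :
  linear x -> linear y -> linear (x \o y).
Proof. by move=> lx ly c u v; rewrite /= ly lx. Qed.

Lemma ople_comp (R : realType) (U V W : normedModType R[i]) (x : V -> W) (y : U -> V) M N :
  0 <= M -> ople x M -> ople y N -> ople (x \o y) (M * N).
Proof.
by move=> M0 xM yN v; rewrite (le_trans (xM _)) // -mulrA ler_wpM2l.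
Qed.

Section FiniteL2.
Variables (R : realType) (I : finType) (V : normedModType R[i]).

Lemma asum_finType (a : I -> R) : (forall i, 0 <= a i) -> asum a = (\sum_i a i)%:E.
Proof.
move=> a0; apply/eqP; rewrite eq_le; apply/andP; split.
  apply: le_asum_seq => // s us.
  rewrite big_uniq //= [leRHS](bigID (mem s)) /= lerDl sumr_ge0 //.
by apply: asum_ge_seq => //; rewrite index_enum_uniq.
Qed.

Lemma finite_l2P (f : I -> V) : f \in @square_summable R I V.
Proof. by apply/asboolP; rewrite /sqsum asum_finType ?ltry // => i; rewrite sqr_ge0. Qed.

Lemma to_l2_fin (f : I -> V) i : to_l2 f i = f i.
Proof. by rewrite to_l2E // finite_l2P. Qed.

Lemma l2norm_fin (x : l2 I V) : nrm x ^+ 2 = \sum_i nrm (x i) ^+ 2.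
Proof.
by apply: EFin_inj; rewrite -l2normE /sqsum asum_finType // => i; rewrite sqr_ge0.
Qed.

End FiniteL2.

Section L2Basics.
Variables (R : realType) (I : choiceType) (V : normedModType R[i]).
Implicit Types x y : l2 I V.

Lemma l2_ext x y : (forall i, x i = y i) -> x = y.
Proof. by move=> xy; apply/val_inj/funext. Qed.

Lemma l2DE x y i : l2val (x + y) i = x i + y i. Proof. by []. Qed.
Lemma l2NE x i : l2val (- x) i = - x i. Proof. by []. Qed.
Lemma l2BE x y i : l2val (x - y) i = x i - y i. Proof. by []. Qed.
Lemma l2ZE c x i : l2val (c *: x) i = c *: x i. Proof. by []. Qed.
Lemma l2_0E i : l2val (0 : l2 I V) i = 0. Proof. by []. Qed.

Lemma l2sumE (J : Type) (r : seq J) (P : pred J) (F : J -> l2 I V) i :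
  l2val (\sum_(j <- r | P j) F j) i = \sum_(j <- r | P j) F j i.
Proof. by elim/big_rec2: _ => // j a b _ <-. Qed.

Lemma l2_nrm_le x M : 0 <= M ->
  (forall s : seq I, uniq s -> \sum_(i <- s) nrm (x i) ^+ 2 <= M ^+ 2) -> nrm x <= M.
Proof.
move=> M0 xM; rewrite l2_nrm l2norm_le //; apply: le_asum_seq => // i.
by rewrite sqr_ge0.
Qed.

Lemma l2_bessel x (s : seq I) : uniq s -> \sum_(i <- s) nrm (x i) ^+ 2 <= nrm x ^+ 2.
Proof.
move=> us; rewrite -lee_fin l2_nrm -l2normE.
by apply: (@asum_ge_seq _ _ (fun i => nrm (x i) ^+ 2)) => // i; rewrite sqr_ge0.
Qed.

Lemma to_l2_bounded (f : I -> V) (M : R) :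
  (forall s : seq I, uniq s -> \sum_(i <- s) nrm (f i) ^+ 2 <= M ^+ 2) ->
  f \in @square_summable R I V.
Proof.
move=> fM; apply/asboolP; rewrite (@le_lt_trans _ _ (M ^+ 2)%:E) ?ltry //.
by apply: le_asum_seq => // i; rewrite sqr_ge0.
Qed.

End L2Basics.
Arguments l2DE R I {V}.
Arguments l2NE R I {V}.
Arguments l2BE R I {V}.
Arguments l2ZE R I {V}.
Arguments l2_0E R I {V}.
Arguments l2sumE R I {V}.

Section Matrices.
Variables (R : realType) (V W : normedModType R[i]).

(** Arbitrary finite index types allow blocks such as [bool * I] or [I * 'I_n] without renumbering,
    and a matrix of operators becomes an honest operator between Hilbert spaces, to which adjoints
    and operator bounds apply. *)
Definition mxop (I J : finType) (x : I -> J -> V -> W) : l2 J V -> l2 I W :=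
  fun v => to_l2 (fun i => \sum_j x i j (v j)).

Lemma mxopE (I J : finType) (x : I -> J -> V -> W) v i : mxop x v i = \sum_j x i j (v j).
Proof. exact: to_l2_fin. Qed.

Definition mxle (I J : finType) (x : I -> J -> V -> W) (M : R) := ople (mxop x) M.

Lemma mxop_linear (I J : finType) (x : I -> J -> V -> W) :
  (forall i j, linear (x i j)) -> linear (mxop x).
Proof.
move=> lx c u v; apply: l2_ext => i.
rewrite -[RHS]/(c *: mxop x u i + mxop x v i) !mxopE scaler_sumr -big_split /=.
by apply: eq_bigr => j _; exact: (lx i j c (u j) (v j)).
Qed.

Lemma mxleP (I J : finType) (x : I -> J -> V -> W) M : 0 <= M ->
  mxle x M <-> forall v : J -> V,
  \sum_i nrm (\sum_j x i j (v j)) ^+ 2 <= M ^+ 2 * \sum_j nrm (v j) ^+ 2.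
Proof.
move=> M0; split => [xM v|xM v].
  have := xM (to_l2 v); rewrite -ler_sqr ?nnegrE ?nrm_ge0 ?mulr_ge0 ?nrm_ge0 //.
  rewrite exprMn !l2norm_fin; congr (_ <= _ * _); apply: eq_bigr => i _.
    by rewrite mxopE; congr (nrm _ ^+ 2); apply: eq_bigr => j _; rewrite to_l2_fin.
  by rewrite to_l2_fin.
rewrite -ler_sqr ?nnegrE ?nrm_ge0 ?mulr_ge0 ?nrm_ge0 // exprMn !l2norm_fin.
by under eq_bigr do rewrite mxopE; exact: xM.
Qed.

Lemma mxle_mon (I J : finType) (x : I -> J -> V -> W) M N : M <= N -> mxle x M -> mxle x N.
Proof. exact: ople_mon. Qed.

Lemma eq_mxle (I J : finType) (x y : I -> J -> V -> W) M :
  (forall i j v, x i j v = y i j v) -> mxle x M -> mxle y M.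
Proof.
move=> xy; suff -> : x = y by [].
by apply/funext => i; apply/funext => j; apply/funext.
Qed.

Lemma mxle_add (I J : finType) (x y : I -> J -> V -> W) M N :
  mxle x M -> mxle y N -> mxle (fun i j v => x i j v + y i j v) (M + N).
Proof.
move=> xM yN v; have -> : mxop (fun i j v => x i j v + y i j v) v = (mxop x + mxop y) v.
  apply: l2_ext => i; rewrite -[(mxop x + mxop y) v]/(mxop x v + mxop y v) (l2DE R I) !mxopE.
  by rewrite big_split.
exact: ople_add.
Qed.

Lemma mxle_scale (I J : finType) (c : R[i]) (x : I -> J -> V -> W) M :
  mxle x M -> mxle (fun i j v => c *: x i j v) (complex.Re `|c| * M).
Proof.
move=> xM v; have -> : mxop (fun i j v => c *: x i j v) v = (c *: mxop x) v.
  apply: l2_ext => i; rewrite -[(c *: mxop x) v]/(c *: mxop x v) (l2ZE R I) !mxopE.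
  by rewrite scaler_sumr.
exact: ople_scale.
Qed.

Lemma mxle_sub (I J : finType) (x y : I -> J -> V -> W) M N :
  mxle x M -> mxle y N -> mxle (fun i j v => x i j v - y i j v) (M + N).
Proof.
move=> xM yN; apply: (eq_mxle (x := fun i j v => x i j v + (- 1) *: y i j v)).
  by move=> i j v; rewrite scaleN1r.
by apply: mxle_add => //; have := mxle_scale (-1) yN; rewrite normrN normr1 mul1r.
Qed.

Lemma mxle_zero (I J : finType) : mxle (fun (i : I) (j : J) => (0 : V -> W)) 0.
Proof.
move=> v; rewrite (_ : mxop _ v = 0) ?nrm0 ?mul0r //.
by apply: l2_ext => i; rewrite mxopE big1.
Qed.

Lemma mxle_sum (K : Type) (r : seq K) (I J : finType) (x : K -> I -> J -> V -> W) (M : K -> R) :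
  (forall k, mxle (x k) (M k)) ->
  mxle (fun i j => \sum_(k <- r) x k i j) (\sum_(k <- r) M k).
Proof.
move=> xM; elim: r => [|k r IH].
  by rewrite big_nil; apply: eq_mxle (@mxle_zero I J) => i j v; rewrite big_nil.
rewrite big_cons; apply: eq_mxle (mxle_add (xM k) IH) => i j v.
by rewrite big_cons.
Qed.

Lemma mxle_entry (I J : finType) (x : I -> J -> V -> W) M i j :
  0 <= M -> (forall i j, linear (x i j)) -> mxle x M -> ople (x i j) M.
Proof.
move=> M0 lx /(mxleP _ M0) xM v.
have := xM (fun j' => if j' == j then v else 0).
rewrite [X in _ <= _ * X](bigD1 j) //= eqxx [X in _ <= _ * (_ + X)]big1 ?addr0; last first.
  by move=> k /negPf ->; rewrite nrm0 expr0n.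
move=> H; rewrite -ler_sqr ?nnegrE ?mulr_ge0 ?nrm_ge0 // exprMn; apply: le_trans H.
rewrite (bigD1 i) //= (bigD1 j) //= eqxx [\sum_(k | k != j) _]big1 ?addr0; last first.
  by move=> k /negPf ->; rewrite linear0'.
by rewrite lerDl sumr_ge0 // => k _; rewrite sqr_ge0.
Qed.

(** Deliberately crude: the bound grows with the size of the matrix. It serves to see that a matrix
    is bounded at all, or where entries can be approximated after the size is known. *)
Lemma mxle_entries (I J : finType) (x : I -> J -> V -> W) (M : R) : 0 <= M ->
  (forall i j, ople (x i j) M) -> mxle x (\sum_(i : I) \sum_(j : J) M).
Proof.
move=> M0 xM.
have h i0 j0 : mxle (fun i j => if (i == i0) && (j == j0) then x i0 j0 else 0) M.
  apply/mxleP => // v; rewrite (bigD1 i0) //= [X in _ + X]big1 ?addr0; last first.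
    by move=> i /negPf ->; rewrite big1 ?nrm0 ?expr0n // => j _.
  rewrite (bigD1 j0) //= !eqxx /= big1 ?addr0; last by move=> j /negPf ->.
  apply: (@le_trans _ _ (M ^+ 2 * nrm (v j0) ^+ 2)).
    by rewrite -exprMn lerXn2r ?nnegrE ?nrm_ge0 ?mulr_ge0 ?nrm_ge0 ?xM.
  rewrite ler_wpM2l ?sqr_ge0 // (bigD1 j0) //= lerDl sumr_ge0 // => k _.
  by rewrite sqr_ge0.
have := mxle_sum (index_enum I) (fun i0 => mxle_sum (index_enum J) (h i0)).
apply: eq_mxle => i j v; rewrite !sumfE (bigD1 i) //= [X in _ + X]big1 ?addr0; last first.
  by move=> k /negPf ki; rewrite sumfE big1 // => l _; rewrite eq_sym ki.
rewrite sumfE (bigD1 j) //= !eqxx /= big1 ?addr0 // => l /negPf lj.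
by rewrite eq_sym lj.
Qed.

(** A submatrix is a compression: [v] is extended by zero off the range of [g], and the rows outside
    the range of [f] are dropped. *)
Lemma mxle_reindex (I I' J J' : finType) (f : I' -> I) (g : J' -> J) (x : I -> J -> V -> W) M :
  0 <= M -> injective f -> injective g -> (forall i j, linear (x i j)) ->
  mxle x M -> mxle (fun i j => x (f i) (g j)) M.
Proof.
move=> M0 fi gi lx /(mxleP _ M0) xM; apply/mxleP => // v.
pose w j := \sum_(j' | g j' == j) v j'.
have wg j' : w (g j') = v j'.
  rewrite /w (bigD1 j') //= big1 ?addr0 // => k /andP[/eqP/gi ->].
  by rewrite eqxx.
have wS : \sum_j nrm (w j) ^+ 2 = \sum_j' nrm (v j') ^+ 2.
  rewrite (bigID (fun j => j \in codom g)) /= [X in _ + X]big1 ?addr0; last first.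
    move=> j; rewrite /w => jn; rewrite big1 ?nrm0 ?expr0n // => k /eqP gk.
    by rewrite -gk codom_f in jn.
  under [RHS]eq_bigr do rewrite -wg.
  by rewrite -big_uniq /= ?map_inj_uniq -?enumT ?enum_uniq //= big_map big_enum.
have sx i : \sum_j x i j (w j) = \sum_j' x i (g j') (v j').
  rewrite (eq_bigr (fun j => \sum_(j' | g j' == j) x i j (v j'))); last first.
    by move=> j _; rewrite linear_sum'.
  rewrite (exchange_big_dep predT) //=; apply: eq_bigr => j' _.
  by rewrite (big_pred1 (g j')) // => j; rewrite eq_sym.
have := xM w; rewrite wS; apply: le_trans.
under [leLHS]eq_bigr do rewrite -sx.
rewrite [leRHS](bigID (mem (codom f))) /= -[X in _ <= X + _]big_uniq; last first.
  by rewrite /= map_inj_uniq -?enumT ?enum_uniq.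
rewrite /= big_map big_enum /= lerDl sumr_ge0 // => i _.
by rewrite sqr_ge0.
Qed.

End Matrices.

(** * Extended-real norms versus real bounds *)

Section NormBounds.
Variables (R : realType) (H : hilbertType R).
Implicit Types (x y : H -> H).

Lemma opnormP x (M : R) : linear x -> 0 <= M -> (opnorm x <= M%:E)%E <-> ople x M.
Proof.
move=> lx M0; split => [xM v|xM].
  have b u : nrm u <= 1 -> nrm (x u) <= M.
    move=> u1; rewrite -lee_fin; apply: le_trans xM; apply: ereal_sup_ubound.
    by exists u.
  have [v0|v0] := eqVneq (nrm v) 0.
    by rewrite (nrm_eq0 v0) linear0' // !nrm0 mulr0.
  have vp : 0 < nrm v by rewrite lt_def v0 nrm_ge0.
  have := b ((nrm v)^-1%:C *: v).
  rewrite linearZ' // !nrmZ Re_norm_real ?invr_ge0 ?nrm_ge0 // mulVf // => /(_ (lexx _)).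
  by rewrite mulrC ler_pdivrMr.
apply: ge_ereal_sup => _ [v /= v1 <-]; rewrite lee_fin (le_trans (xM v)) //.
by rewrite -[leRHS]mulr1 ler_wpM2l.
Qed.

Lemma opnorm_ge0 x : linear x -> (0 <= opnorm x)%E.
Proof.
by move=> lx; apply: ereal_sup_ubound; exists 0; rewrite /= ?nrm0 ?ler01 // linear0' // nrm0.
Qed.

Lemma opnorm_lt_ople x (e : R) : linear x -> (opnorm x < e%:E)%E -> ople x e.
Proof.
move=> lx xe; have e0 : 0 <= e by rewrite -lee_fin (le_trans (opnorm_ge0 lx)) ?ltW.
by apply/opnormP => //; exact: ltW.
Qed.

Lemma ople_opnorm_lt x (M e : R) : linear x -> 0 <= M -> M < e -> ople x M -> (opnorm x < e%:E)%E.
Proof.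
by move=> lx M0 Me xM; apply: (@le_lt_trans _ _ M%:E); [exact/opnormP|rewrite lte_fin].
Qed.

Lemma bopP x : bop H x <-> linear x /\ exists2 M : R, 0 <= M & ople x M.
Proof.
split=> [[lx xoo]|[lx [M M0 xM]]]; split=> //.
  exists (fine (opnorm x)); first by rewrite fine_ge0 ?opnorm_ge0.
  apply/opnormP => //; first by rewrite fine_ge0 ?opnorm_ge0.
  by rewrite fineK // ge0_fin_numE ?opnorm_ge0.
by apply: (@le_lt_trans _ _ M%:E); [exact/opnormP|rewrite ltry].
Qed.

Lemma bop_lin x : bop H x -> linear x. Proof. by case. Qed.

Lemma bop_scaleD (c : R[i]) x y : bop H x -> bop H y -> bop H (c *: x + y).
Proof.
move=> /bopP[lx [M M0 xM]] /bopP[ly [N N0 yN]]; apply/bopP; split.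
  by apply: linear_add => //; exact: linear_scale.
exists (complex.Re `|c| * M + N); last by apply: ople_add => //; exact: ople_scale.
by rewrite addr_ge0 // mulr_ge0 // -ler0c RRe_real ?ger0_real.
Qed.

Lemma bop0 : bop H 0.
Proof. by apply/bopP; split; [exact: linear_zero|exists 0 => //; exact: ople_zero]. Qed.

Lemma bop_comp x y : bop H x -> bop H y -> bop H (x \o y).
Proof.
move=> /bopP[lx [M M0 xM]] /bopP[ly [N N0 yN]]; apply/bopP; split.
  exact: linear_comp.
by exists (M * N); [rewrite mulr_ge0|exact: ople_comp].
Qed.

Lemma mxnormP m (x : 'M[H -> H]_m) (M : R) : (forall i j, linear (x i j)) -> 0 <= M ->
  (mxnorm x <= M%:E)%E <-> mxle (fun i j => x i j) M.
Proof.
move=> lx M0; split => [xM|/(mxleP _ M0) xM].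
  apply/mxleP => // v; set s := (X in _ <= _ * X).
  have b (u : 'I_m -> H) : \sum_j nrm (u j) ^+ 2 <= 1 ->
      \sum_i nrm (\sum_j x i j (u j)) ^+ 2 <= M ^+ 2.
    move=> u1; rewrite -ler_sqrt ?sqr_ge0 //; rewrite sqrtr_sqr ger0_norm // -lee_fin.
    by apply: le_trans xM; apply: ereal_sup_ubound; exists u.
  have s0 : 0 <= s by apply: sumr_ge0 => j _; rewrite sqr_ge0.
  have [sz|sn] := eqVneq s 0.
    have v0 j : v j = 0.
      apply: nrm_eq0; apply/eqP; rewrite -sqrf_eq0; apply/eqP.
      apply: (@psumr_eq0P R 'I_m predT (fun j => nrm (v j) ^+ 2)) => //.
      by move=> k _; rewrite sqr_ge0.
    rewrite sz mulr0 big1 // => i _; rewrite big1 ?nrm0 ?expr0n // => j _.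
    by rewrite v0 linear0'.
  have sp : 0 < s by rewrite lt_def sn.
  pose r := (Num.sqrt s)^-1.
  have r0 : 0 <= r by rewrite invr_ge0 sqrtr_ge0.
  have r2 : r ^+ 2 = s^-1 by rewrite exprVn sqr_sqrtr.
  have := b (fun j => r%:C *: v j).
  under eq_bigr do rewrite nrmZ Re_norm_real // exprMn.
  rewrite -mulr_sumr r2 -/s mulVf // => /(_ (lexx _)).
  under eq_bigr => i _.
    under eq_bigr do rewrite linearZ' //.
    rewrite -scaler_sumr nrmZ Re_norm_real // exprMn r2; over.
  by rewrite -mulr_sumr mulrC ler_pdivrMr.
apply: ge_ereal_sup => _ [v /= v1 <-]; rewrite lee_fin.
rewrite -[M in leRHS]ger0_norm // -sqrtr_sqr ler_sqrt ?sqr_ge0 // (le_trans (xM v)) //.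
by rewrite -[leRHS]mulr1 ler_wpM2l ?sqr_ge0.
Qed.

Lemma mxnorm_ge0 m (x : 'M[H -> H]_m) : (forall i j, linear (x i j)) -> (0 <= mxnorm x)%E.
Proof.
move=> lx; apply: ereal_sup_ubound; exists (fun=> 0) => /=.
  by rewrite big1 ?ler01 // => i _; rewrite nrm0 expr0n.
rewrite big1 ?sqrtr0 // => i _; rewrite big1 ?nrm0 ?expr0n // => j _.
by rewrite linear0'.
Qed.

End NormBounds.

Lemma complex_normE (R : realType) (c : R[i]) : (complex.Re `|c|)%:C = `|c|.
Proof. by rewrite RRe_real // ger0_real. Qed.

(** * Linear and completely bounded maps on subspaces of operators *)

Definition lsub (R : realType) (V : lmodType R[i]) (X : set V) : Prop :=
  X 0 /\ forall (c : R[i]) a b, X a -> X b -> X (c *: a + b).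

Section Lsub.
Variables (R : realType) (V : lmodType R[i]) (X : set V).
Hypothesis sX : lsub X.

Lemma lsubZ (c : R[i]) a : X a -> X (c *: a).
Proof. by case: sX => X0 XD Xa; have := XD c a 0 Xa X0; rewrite addr0. Qed.

Lemma lsubD a b : X a -> X b -> X (a + b).
Proof. by case: sX => X0 XD Xa Xb; have := XD 1 a b Xa Xb; rewrite scale1r. Qed.

Lemma lsubB a b : X a -> X b -> X (a - b).
Proof. by move=> Xa Xb; apply: lsubD => //; rewrite -scaleN1r; exact: lsubZ. Qed.

Lemma lsub_sum (I : Type) (r : seq I) (P : pred I) (F : I -> V) :
  (forall i, P i -> X (F i)) -> X (\sum_(i <- r | P i) F i).
Proof.
move=> XF; elim/big_rec: _ => [|i a Pi]; first by case: sX.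
by apply: lsubD; exact: XF.
Qed.

End Lsub.

Section LinearOn.
Variables (R : realType) (H L : hilbertType R) (X : set (H -> H)).
Variable Psi : (H -> H) -> (L -> L).
Hypotheses (sX : lsub X) (lPsi : linear_on X Psi).

Lemma linear_on0 : Psi 0 = 0.
Proof.
have [X0 _] := sX; have := lPsi (-1) X0 X0.
by rewrite !scaleN1r !addNr.
Qed.

Lemma linear_onZ c x : X x -> Psi (c *: x) = c *: Psi x.
Proof.
by have [X0 _] := sX => Xx; have := lPsi c Xx X0; rewrite linear_on0 !addr0.
Qed.

Lemma linear_onD x y : X x -> X y -> Psi (x + y) = Psi x + Psi y.
Proof. by move=> Xx Xy; have := lPsi 1 Xx Xy; rewrite !scale1r. Qed.

Lemma linear_onB x y : X x -> X y -> Psi (x - y) = Psi x - Psi y.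
Proof.
move=> Xx Xy; rewrite -!(scaleN1r y) linear_onD ?linear_onZ ?scaleN1r //.
by rewrite -scaleN1r; exact: lsubZ.
Qed.

Lemma linear_on_sum (I : Type) (r : seq I) (P : pred I) (F : I -> H -> H) :
  (forall i, P i -> X (F i)) ->
  Psi (\sum_(i <- r | P i) F i) = \sum_(i <- r | P i) Psi (F i).
Proof.
move=> XF; suff [] : X (\sum_(i <- r | P i) F i) /\
    Psi (\sum_(i <- r | P i) F i) = \sum_(i <- r | P i) Psi (F i) by [].
elim/big_rec2: _ => [|i a b Pi [Xb <-]].
  by split; [case: sX|rewrite linear_on0].
by split; [apply: lsubD => //; exact: XF|rewrite linear_onD //; exact: XF].
Qed.

End LinearOn.

Lemma big_unit (V : nmodType) (F : unit -> V) : \sum_i F i = F tt.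
Proof. by rewrite (big_pred1 tt) //; case. Qed.

Section CompleteBounds.
Variables (R : realType) (H L : hilbertType R).
Implicit Types (X : set (H -> H)) (Psi : (H -> H) -> (L -> L)).

(** The bound is homogeneous in [N], and [I] is any finite type. With [0 < N], [cbnormP] can
    normalise by dividing by [N]; a matrix of norm zero is handled by arbitrarily small [N]. *)
Definition cble X Psi (M : R) : Prop :=
  forall (I : finType) (x : I -> I -> H -> H) (N : R),
    (forall i j, X (x i j)) -> 0 < N -> mxle x N ->
    mxle (fun i j => Psi (x i j)) (M * N).

Lemma cbnormP X Psi (M : R) : lsub X -> X `<=` bop H -> linear_on X Psi ->
  (forall x, X x -> linear (Psi x)) ->
  0 <= M -> (cbnorm X Psi <= M%:E)%E <-> cble X Psi M.
Proof.
move=> sX Xb lPsi lin M0; split=> [cM I x N Xx N0 xN|cM].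
  pose y : 'M[H -> H]_#|I| :=
    \matrix_(i, j) ((N^-1)%:C *: x (enum_val i) (enum_val j)).
  have lx i j : linear (x i j) by apply: bop_lin; exact: Xb.
  have Xy : mxset X y by move=> i j; rewrite mxE; exact: lsubZ.
  have y1 : (mxnorm y <= 1)%E.
    rewrite (_ : 1%E = (1 : R)%:E) //; apply/mxnormP => //.
      by move=> i j; rewrite mxE; exact: linear_scale.
    have := mxle_scale (N^-1)%:C (mxle_reindex (ltW N0) (@enum_val_inj _ (mem I))
      (@enum_val_inj _ (mem I)) lx xN).
    have -> : complex.Re `|(N^-1)%:C| * N = 1.
      by rewrite Re_norm_real ?invr_ge0 ?(ltW N0) // mulVf // gt_eqF.
    by apply: eq_mxle => i j v; rewrite mxE.
  have : (mxnorm (map_mx Psi y) <= M%:E)%E.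
    by apply: le_trans cM; apply: ereal_sup_ubound; exists #|I|, y.
  move=> /mxnormP => /(_ _ M0) h.
  have {}h : mxle (fun i j => map_mx Psi y i j) M.
    by apply: h => i j; rewrite !mxE (linear_onZ sX lPsi) //; apply: linear_scale; exact: lin.
  have := mxle_scale N%:C (mxle_reindex M0 (@enum_rank_inj I) (@enum_rank_inj I) _ h).
  rewrite Re_norm_real ?(ltW N0) // mulrC => /(_ _) h'.
  apply: eq_mxle (h' _) => i j.
    move=> v; rewrite !mxE !enum_rankK (linear_onZ sX lPsi) //.
    rewrite -[X in _ *: X = _]/(_ *: Psi (x i j) v) scalerA -rmorphM mulfV ?gt_eqF //.
    by rewrite scale1r.
  by rewrite !mxE (linear_onZ sX lPsi) //; apply: linear_scale; exact: lin.
apply: ge_ereal_sup => _ [m [x [Xx x1 ->]]].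
apply/mxnormP => //; first by move=> i j; rewrite mxE; exact: lin.
have := cM _ (fun i j => x i j) 1 (fun i j => Xx i j) ltr01.
rewrite mulr1 => h; apply: eq_mxle (h _).
  by move=> i j v; rewrite mxE.
by apply/mxnormP => // i j; apply: bop_lin; exact: Xb.
Qed.

Lemma cbnorm_ge0 X Psi : X 0 -> linear (Psi 0) -> (0 <= cbnorm X Psi)%E.
Proof.
move=> X0 lP; have l i j : linear (map_mx Psi (0 : 'M[H -> H]_0) i j) by case: i.
apply: (@le_trans _ _ (mxnorm (map_mx Psi (0 : 'M[H -> H]_0)))).
  exact: mxnorm_ge0.
apply: ereal_sup_ubound; exists 0, 0; split => //; first by case.
rewrite (_ : 1%E = (1 : R)%:E) //; apply/mxnormP => //; first by case.
by apply/mxleP => // v; rewrite !big_ord0 mulr0.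
Qed.

Lemma cbnorm_lt_cble X Psi (e : R) : lsub X -> X `<=` bop H -> linear_on X Psi ->
  (forall x, X x -> linear (Psi x)) -> (cbnorm X Psi < e%:E)%E -> cble X Psi e.
Proof.
move=> sX Xb lP lin ce; apply/cbnormP => //; last exact: ltW.
rewrite -lee_fin; apply: (le_trans _ (ltW ce)); apply: cbnorm_ge0; first by case: sX.
by apply: lin; case: sX.
Qed.

Lemma CB_cble X Z Psi : lsub X -> X `<=` bop H -> Z `<=` bop L ->
  CB X Z Psi <-> [/\ forall x, X x -> Z (Psi x), linear_on X Psi &
    exists2 M : R, 0 <= M & cble X Psi M].
Proof.
move=> sX Xb Zb; split => [[PZ lP Poo]|[PZ lP [M M0 cM]]]; split => //; last first.
  apply: (@le_lt_trans _ _ M%:E); last by rewrite ltry.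
  by apply/cbnormP => // x Xx; apply: bop_lin; exact/Zb/PZ.
have lin x : X x -> linear (Psi x) by move=> Xx; apply: bop_lin; exact/Zb/PZ.
have X0 : X 0 by case: sX.
have c0 : (0 <= cbnorm X Psi)%E by apply: cbnorm_ge0 => //; exact: lin.
exists (fine (cbnorm X Psi)); first by rewrite fine_ge0.
apply/cbnormP => //; first by rewrite fine_ge0.
by rewrite fineK // ge0_fin_numE.
Qed.

Lemma cble_ople X Psi (M N : R) x : X `<=` bop H -> (forall x, X x -> linear (Psi x)) ->
  0 <= M -> 0 < N -> cble X Psi M -> X x -> ople x N -> ople (Psi x) (M * N).
Proof.
move=> Xb lin M0 N0 cM Xx xN.
have := cM unit (fun _ _ => x) N (fun _ _ => Xx) N0.
have h : mxle (fun _ _ : unit => x) N.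
  apply/mxleP; first exact: ltW.
  move=> v; rewrite !big_unit.
  by rewrite -exprMn lerXn2r ?nnegrE ?nrm_ge0 ?mulr_ge0 ?nrm_ge0 ?(ltW N0).
move=> /(_ h) /(@mxle_entry _ _ _ _ _ _ _ tt tt); apply.
  by rewrite mulr_ge0 // ltW.
by move=> _ _; exact: lin.
Qed.

End CompleteBounds.

(** * Hilbert space geometry and completeness *)

Section Hilbert.
Variables (R : realType) (V : hilbertType R).
Implicit Types u v w : V.

Lemma innerDr u v w : inner u (v + w) = inner u v + inner u w.
Proof. by rewrite innerC innerD rmorphD (innerC u v) (innerC u w). Qed.

Lemma innerZr (c : R[i]) u v : inner u (c *: v) = c^* * inner u v.
Proof. by rewrite innerC innerZ rmorphM (innerC u v). Qed.

Lemma innerNr u v : inner u (- v) = - inner u v.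
Proof. by rewrite -scaleN1r innerZr rmorphN1 mulN1r. Qed.

Lemma innerBr u v w : inner u (v - w) = inner u v - inner u w.
Proof. by rewrite innerDr innerNr. Qed.

Lemma innerB u v w : inner (u - v) w = inner u w - inner v w.
Proof. by rewrite innerD innerNx. Qed.

Lemma inner0 v : inner 0 v = 0.
Proof. by rewrite -(scale0r v) innerZ mul0r. Qed.

Lemma inner0r v : inner v 0 = 0.
Proof. by rewrite innerC inner0 rmorph0. Qed.

Lemma inner_suml (I : Type) (r : seq I) (P : pred I) (F : I -> V) v :
  inner (\sum_(i <- r | P i) F i) v = \sum_(i <- r | P i) inner (F i) v.
Proof.
by elim/big_rec2: _ => [|i a b _ <-]; [exact: inner0|rewrite innerD].
Qed.

Lemma inner_sumr (I : Type) (r : seq I) (P : pred I) (F : I -> V) v :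
  inner v (\sum_(i <- r | P i) F i) = \sum_(i <- r | P i) inner v (F i).
Proof.
by elim/big_rec2: _ => [|i a b _ <-]; [exact: inner0r|rewrite innerDr].
Qed.

Definition rin u v : R := complex.Re (inner u v).

Lemma rin_xx u : rin u u = nrm u ^+ 2.
Proof. by rewrite /rin innerxx_nrm. Qed.

Lemma rinC u v : rin u v = rin v u.
Proof. by rewrite /rin innerC; case: (inner v u). Qed.

Lemma rinD u v w : rin (u + v) w = rin u w + rin v w.
Proof. by rewrite /rin innerD raddfD. Qed.

Lemma rinN u v : rin (- u) v = - rin u v.
Proof. by rewrite /rin innerNx raddfN. Qed.

Lemma rinZ (c : R) u v : rin (c%:C *: u) v = c * rin u v.
Proof. by rewrite /rin innerZ; case: (inner u v) => a b /=; rewrite mul0r subr0. Qed.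

Lemma nrm_sqrD u v : nrm (u + v) ^+ 2 = nrm u ^+ 2 + 2 * rin u v + nrm v ^+ 2.
Proof.
by rewrite -!rin_xx rinD (rinC u (u + v)) (rinC v (u + v)) !rinD (rinC v u); ring.
Qed.

Lemma nrm_sqrB u v : nrm (u - v) ^+ 2 = nrm u ^+ 2 - 2 * rin u v + nrm v ^+ 2.
Proof. by rewrite nrm_sqrD nrmN (rinC u) rinN rinC; ring. Qed.

Lemma rin_le u v : rin u v <= nrm u * nrm v.
Proof.
have [v0|v0] := eqVneq (nrm v) 0.
  by rewrite (nrm_eq0 v0) nrm0 mulr0 /rin inner0r.
have vp : 0 < nrm v by rewrite lt_def v0 nrm_ge0.
have [u0|u0] := eqVneq (nrm u) 0.
  by rewrite (nrm_eq0 u0) nrm0 mul0r /rin inner0.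
have up : 0 < nrm u by rewrite lt_def u0 nrm_ge0.
(* Expanding the square of ‖v‖u - ‖u‖v leaves 2‖u‖‖v‖ (‖u‖‖v‖ - Re⟨u, v⟩). *)
have : 0 <= nrm ((nrm v)%:C *: u - (nrm u)%:C *: v) ^+ 2 by rewrite sqr_ge0.
rewrite nrm_sqrB rinZ (rinC u) rinZ (rinC v) !nrmZ !Re_norm_real ?nrm_ge0 //.
have -> : (nrm v * nrm u) ^+ 2 - 2 * (nrm v * (nrm u * rin u v)) + (nrm u * nrm v) ^+ 2
  = (2 * (nrm v * nrm u)) * (nrm u * nrm v - rin u v) by ring.
by rewrite pmulr_rge0 ?mulr_gt0 // subr_ge0.
Qed.

Lemma cauchy_schwarz u v : complex.Re `|inner u v| <= nrm u * nrm v.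
Proof.
set c := inner u v.
have nc0 : 0 <= complex.Re `|c| by rewrite -ler0c RRe_real ?ger0_real.
have [->|n0] := eqVneq (complex.Re `|c|) 0; first by rewrite mulr_ge0 ?nrm_ge0.
have ncp : 0 < complex.Re `|c| by rewrite lt_def n0.
(* Rotating [u] by the conjugate of [c] makes the inner product real, equal to |c|². *)
have := rin_le (c^* *: u) v; rewrite nrmZ norm_conjC -mulrA.
have -> : rin (c^* *: u) v = complex.Re `|c| * complex.Re `|c|.
  rewrite /rin innerZ -/c mulrC -normCK -complex_normE -rmorphXn /= expr2.
  by [].
by rewrite ler_pM2l.
Qed.

Lemma adjointC (x y : V -> V) : adjoint x y -> adjoint y x.
Proof. by move=> xy u v; rewrite innerC -xy (innerC u). Qed.

Lemma adjoint_ople (x y : V -> V) M : 0 <= M -> adjoint x y -> ople x M -> ople y M.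
Proof.
move=> M0 xy xM v; have [->|n0] := eqVneq (nrm (y v)) 0.
  by rewrite mulr_ge0 ?nrm_ge0.
have yp : 0 < nrm (y v) by rewrite lt_def n0 nrm_ge0.
rewrite -(ler_pM2l yp) -expr2 -rin_xx /rin -xy.
apply: le_trans (rin_le _ _) _.
by rewrite [leRHS]mulrCA [leRHS]mulrA ler_wpM2r ?nrm_ge0 ?xM.
Qed.

Lemma cauchy_lim (u : nat -> V) (e : nat -> R) :
  (forall n m, (n <= m)%N -> nrm (u m - u n) <= e n) ->
  (forall d : R, 0 < d -> exists n, e n < d) ->
  exists l : V, forall n, nrm (l - u n) <= e n.
Proof.
move=> ue e0.
have : cvg (u @ \oo).
  apply: cauchy_cvg; apply/nrm_cauchyP => d d0.
  have [n en] := e0 d d0; exists (u n); exists n => // m /= nm.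
  by rewrite -nrmN opprB (le_lt_trans (ue _ _ nm)).
move=> /cvg_ex[l ul]; exists l => n; apply/ler_addgt0Pr => d d0.
have /nrm_cvgP/(_ _ d0)[N _ NP] := ul.
pose m := maxn n N.
have -> : l - u n = (l - u m) + (u m - u n) by rewrite addrA subrK.
apply: le_trans (nrmD _ _) _; rewrite addrC lerD ?ue ?leq_maxl // ltW //.
by apply: NP; rewrite /= leq_maxr.
Qed.

End Hilbert.

Lemma sub_split (V : zmodType) (a b c p q : V) :
  a - (b + c) = (a - (p + q)) - ((b - p) + (c - q)).
Proof. by rewrite addrACA -opprD opprB addrA subrK. Qed.

Section Completeness.
Variables (R : realType) (V W : hilbertType R).

Lemma ople_complete (y : nat -> V -> W) (e : nat -> R) :
  (forall n, linear (y n)) ->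
  (forall n m, (n <= m)%N -> ople (y m - y n) (e n)) ->
  (forall d : R, 0 < d -> exists n, e n < d) ->
  exists2 z : V -> W, linear z & forall n, ople (z - y n) (e n).
Proof.
move=> ly ye e0.
have lim v : exists l : W, forall n, nrm (l - y n v) <= e n * nrm v.
  apply: cauchy_lim => [n m nm|d d0]; first exact: ye.
  have v1 : 0 < nrm v + 1 by rewrite ltr_wpDl ?nrm_ge0.
  have [n en] := e0 (d / (nrm v + 1)) (divr_gt0 d0 v1); exists n.
  move: en; rewrite ltr_pdivlMr //; have := nrm_ge0 v.
  have [en0|en0 v0] := leP (e n) 0; last by apply: le_lt_trans; rewrite ler_wpM2l ?ltW //; lra.
  by move=> v0 _; apply: le_lt_trans d0; rewrite mulr_le0_ge0.
pose z v := projT1 (cid (lim v)).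
have zP v n : nrm (z v - y n v) <= e n * nrm v by rewrite /z; case: cid.
exists z => [c u v|n v]; last exact: zP.
apply/eqP; rewrite -subr_eq0; apply/eqP/nrm_eq0/eqP; rewrite eq_le nrm_ge0 andbT.
apply/ler_addgt0Pr => d d0; rewrite add0r.
pose K := nrm (c *: u + v) + (complex.Re `|c| * nrm u + nrm v) + 1.
have c0 : 0 <= complex.Re `|c| by rewrite -ler0c complex_normE.
have K0 : 0 < K by rewrite ltr_wpDl ?addr_ge0 ?mulr_ge0 ?nrm_ge0.
have [n en] := e0 (d / K) (divr_gt0 d0 K0).
have -> : z (c *: u + v) - (c *: z u + z v) =
    (z (c *: u + v) - y n (c *: u + v)) - (c *: (z u - y n u) + (z v - y n v)).
  by rewrite ly scalerBr -sub_split.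
apply: (le_trans (nrmB _ _)); apply: (le_trans (lerD (zP _ _) (nrmD _ _))).
rewrite nrmZ; apply: (@le_trans _ _ (e n * (K - 1))).
  rewrite /K addrK mulrDr lerD2l mulrDr lerD ?zP //.
  by rewrite mulrCA ler_wpM2l.
have [en0|en0] := leP (e n) 0.
  by apply: le_trans (ltW d0); rewrite mulr_le0_ge0 // /K addrK ?addr_ge0 ?mulr_ge0 ?nrm_ge0.
move: en; rewrite ltr_pdivlMr // => /ltW; apply: le_trans.
by rewrite ler_wpM2l ?ltW //; lra.
Qed.

(** The value at [v] is characterised by the estimate ‖l - y0 d‖ <= M‖v - d‖ for all [d] in [D];
    linearity, the bound and the agreement on [D] all follow from it without going back to a
    sequence. *)
Lemma extend_dense (D : set V) (y0 : V -> W) (M : R) : 0 <= M ->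
  lsub D -> (forall (v : V) (e : R), 0 < e -> exists2 d, D d & nrm (v - d) <= e) ->
  (forall (c : R[i]) a b, D a -> D b -> y0 (c *: a + b) = c *: y0 a + y0 b) ->
  (forall d, D d -> nrm (y0 d) <= M * nrm d) ->
  exists y : V -> W, [/\ linear y, ople y M & forall d, D d -> y d = y0 d].
Proof.
move=> M0 sD dD ly yM.
have yB a b : D a -> D b -> y0 (a - b) = y0 a - y0 b.
  by move=> Da Db; rewrite addrC -scaleN1r ly // scaleN1r addrC.
have lim v : exists l : W, forall d, D d -> nrm (l - y0 d) <= M * nrm (v - d).
  pose a n : R := n.+1%:R^-1.
  have a0 n : 0 < a n by rewrite invr_gt0 ltr0n.
  have am n m : (n <= m)%N -> a m <= a n.
    by move=> nm; rewrite lef_pV2 ?posrE ?ltr0n // ler_nat.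
  have acv (d : R) : 0 < d -> exists n, a n < d.
    move=> d0; have d0' : 0 < d^-1 by rewrite invr_gt0.
    exists (Num.bound d^-1); rewrite /a -[d in _ < d]invrK ltf_pV2 ?posrE ?ltr0n //.
    have := archi_boundP (ltW d0'); move/lt_trans; apply.
    by rewrite ltr_nat.
  pose u n := projT1 (cid2 (dD v (a n) (a0 n))).
  have Du n : D (u n) by rewrite /u; case: cid2.
  have ud n : nrm (v - u n) <= a n by rewrite /u; case: cid2.
  have [||l lP] := @cauchy_lim R W (fun n => y0 (u n)) (fun n => M * (2 * a n)).
  - move=> n m nm; rewrite -yB //; apply: le_trans (yM _ _) _; first exact: lsubB.
    rewrite ler_wpM2l //; have -> : u m - u n = (v - u n) - (v - u m).
      by rewrite opprB [RHS]addrC addrA subrK.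
    by apply: le_trans (nrmB _ _) _; have := ud n; have := ud m; have := am _ _ nm; lra.
  - move=> d d0; have M1 : 0 < 2 * (M + 1) by lra.
    have [n an] := acv (d / (2 * (M + 1))) (divr_gt0 d0 M1); exists n.
    move: an; rewrite ltr_pdivlMr //; have := a0 n; move: (a n) => b; nra.
  exists l => d Dd; apply/ler_addgt0Pr => e e0.
  have M1 : 0 < 3 * (M + 1) by lra.
  have [n an] := acv (e / (3 * (M + 1))) (divr_gt0 e0 M1).
  have -> : l - y0 d = (l - y0 (u n)) + (y0 (u n) - y0 d) by rewrite addrA subrK.
  apply: le_trans (nrmD _ _) _; rewrite -yB //.
  have h1 := lP n; have h2 : nrm (y0 (u n - d)) <= M * nrm (u n - d).
    by apply: yM; exact: lsubB.
  have h3 : nrm (u n - d) <= a n + nrm (v - d).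
    have -> : u n - d = (v - d) - (v - u n) by rewrite opprB [RHS]addrC addrA subrK.
    by apply: le_trans (nrmB _ _) _; have := ud n; lra.
  have h4 : M * nrm (u n - d) <= M * (a n + nrm (v - d)) by rewrite ler_wpM2l.
  move: an; rewrite ltr_pdivlMr //; have := a0 n.
  move: (a n) (nrm (v - d)) (nrm (l - _)) (nrm (y0 _)) (nrm (u n - d)) h1 h2 h4 => b p q r s h1 h2 h4 b0 h5.
  have : b * (3 * (M + 1)) = M * (2 * b) + (M * b + 3 * b) by ring.
  have : M * (b + p) = M * b + M * p by ring.
  lra.
pose y v := projT1 (cid (lim v)).
have yP v d : D d -> nrm (y v - y0 d) <= M * nrm (v - d).
  by rewrite /y; case: cid => l lP; exact: lP.
have yD d : D d -> y d = y0 d.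
  move=> Dd; apply/eqP; rewrite -subr_eq0; apply/eqP/nrm_eq0/eqP.
  by rewrite eq_le nrm_ge0 andbT; have := yP d d Dd; rewrite subrr nrm0 mulr0.
exists y; split=> // [c u v|v].
  apply/eqP; rewrite -subr_eq0; apply/eqP/nrm_eq0/eqP; rewrite eq_le nrm_ge0 andbT.
  apply/ler_addgt0Pr => e e0; rewrite add0r.
  have c0 : 0 <= complex.Re `|c| by rewrite -ler0c complex_normE.
  pose K := 2 * (M + 1) * (complex.Re `|c| + 1).
  have K0 : 0 < K by rewrite !mulr_gt0 //; lra.
  have [a Da ua] := dD u _ (divr_gt0 e0 K0).
  have [b Db vb] := dD v _ (divr_gt0 e0 K0).
  have -> : y (c *: u + v) - (c *: y u + y v) =
      (y (c *: u + v) - y0 (c *: a + b)) - (c *: (y u - y0 a) + (y v - y0 b)).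
    by rewrite ly // scalerBr -sub_split.
  apply: (le_trans (nrmB _ _)); apply: (le_trans (lerD (yP _ _ _) (nrmD _ _))).
    by case: sD => _; apply.
  rewrite nrmZ.
  have h1 : nrm (c *: u + v - (c *: a + b)) <= complex.Re `|c| * nrm (u - a) + nrm (v - b).
    rewrite -nrmZ; apply: le_trans (nrmD _ _); rewrite le_eqVlt; apply/orP; left; apply/eqP.
    by congr nrm; rewrite scalerBr opprD addrACA.
  have h2 := yP u a Da; have h3 := yP v b Db.
  move: h1 h2 h3 ua vb; set C := complex.Re _; set f := e / K.
  have fK : f * K = e by rewrite /f divfK // gt_eqF.
  move: (nrm (u - a)) (nrm (v - b)) (nrm (y u - _)) (nrm (y v - _)) (nrm (_ - _)) => p q r s t h1 h2 h3 h4 h5.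
  have h6 : M * t <= M * (C * f + f).
    by rewrite ler_wpM2l // (le_trans h1) // lerD // ler_wpM2l.
  have h7 : C * r <= C * (M * f) by rewrite ler_wpM2l // (le_trans h2) // ler_wpM2l.
  have h8 : s <= M * f by rewrite (le_trans h3) // ler_wpM2l.
  have f0 : 0 <= f by rewrite ltW // divr_gt0.
  have : 0 <= f * (C + 1) by rewrite mulr_ge0 // addr_ge0.
  have : f * K = M * (C * f + f) + (C * (M * f) + M * f) + 2 * (f * (C + 1)) by rewrite /K -/C; ring.
  by rewrite fK; lra.
apply/ler_addgt0Pr => e e0.
have K0 : 0 < 2 * (M + 1) by lra.
have [d Dd vd] := dD v _ (divr_gt0 e0 K0).
have -> : y v = (y v - y0 d) + y0 d by rewrite subrK.
apply: le_trans (nrmD _ _) _.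
have h1 := yP v d Dd; have h2 := yM d Dd.
have h3 : nrm d <= nrm v + nrm (v - d).
  by apply: le_trans (nrmB v (v - d)); rewrite opprB [X in _ <= nrm X]addrC subrK.
move: vd; rewrite ler_pdivlMr //.
have h4 : M * nrm d <= M * (nrm v + nrm (v - d)) by rewrite ler_wpM2l.
have := nrm_ge0 (v - d).
move: (nrm (v - d)) (nrm v) (nrm d) (nrm (y v - _)) (nrm (y0 _)) h1 h2 h4 => p q r s t h1 h2 h4 p0 h5.
have : M * (q + p) = M * q + M * p by ring.
have : p * (2 * (M + 1)) = 2 * (M * p) + 2 * p by ring.
lra.
Qed.

End Completeness.

(** * Matrix entries of operators on l^2(J, V) *)

Section SeqSums.
Variables (J : choiceType) (T : nmodType).

Lemma big_uniq_sub (s s' : seq J) (F : J -> T) : uniq s -> uniq s' ->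
  {subset s <= s'} -> (forall j, j \in s' -> j \notin s -> F j = 0) ->
  \sum_(j <- s') F j = \sum_(j <- s) F j.
Proof.
move=> us us' ss F0.
rewrite (bigID (mem s)) /= [X in _ + X]big_seq_cond [X in _ + X]big1 ?addr0; last first.
  by move=> j /andP[js' js]; apply: F0.
rewrite -big_filter; apply: perm_big; apply: uniq_perm => //; first exact: filter_uniq.
by move=> j; rewrite mem_filter /=; case: (boolP (j \in s)) => // /ss ->.
Qed.

End SeqSums.

Section Delta.
Variables (R : realType) (J : choiceType) (V : normedModType R[i]).
Implicit Types (v : V) (xi : l2 J V).

Definition dl (q : J) v : l2 J V := to_l2 (fun j => if j == q then v else 0).

Lemma dlE q v j : dl q v j = if j == q then v else 0.
Proof.
rewrite to_l2E //; apply: (@to_l2_bounded _ _ _ _ (nrm v)) => s us.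
rewrite (@big_uniq_sub _ _ [seq j <- s | j == q]) ?filter_uniq //.
- have : (size [seq j <- s | j == q] <= 1)%N.
    by rewrite size_filter count_uniq_mem // leq_b1.
  case: [seq _ <- _ | _] => [|k [|//]] _; first by rewrite big_nil sqr_ge0.
  by rewrite big_seq1; case: eqP => _ //; rewrite nrm0 expr0n sqr_ge0.
- by move=> k; rewrite mem_filter => /andP[].
- by move=> k ks; rewrite mem_filter ks andbT => /negPf ->; rewrite nrm0 expr0n.
Qed.

Lemma dl_linear q : linear (dl q).
Proof.
move=> c u v; apply: l2_ext => j; rewrite dlE.
rewrite -[RHS]/(c *: dl q u j + dl q v j) !dlE; case: eqP => // _.
by rewrite scaler0 addr0.
Qed.

Definition cut (s : seq J) xi : l2 J V := \sum_(q <- s) dl q (xi q).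

Lemma cutE s xi j : uniq s -> cut s xi j = if j \in s then xi j else 0.
Proof.
move=> us; rewrite /cut (l2sumE R J); case: ifPn => js.
  rewrite (bigD1_seq j) //= dlE eqxx big1 ?addr0 // => k kj.
  by rewrite dlE eq_sym (negPf kj).
rewrite big_seq big1 // => k ks; rewrite dlE; case: eqP => // jk.
by rewrite -jk (negPf js) in ks.
Qed.

Lemma nrm_sqr_le (x : l2 J V) M : 0 <= M ->
  (forall s : seq J, uniq s -> \sum_(i <- s) nrm (x i) ^+ 2 <= M) -> nrm x ^+ 2 <= M.
Proof.
move=> M0 xM; rewrite -[leRHS]sqr_sqrtr // lerXn2r ?nnegrE ?nrm_ge0 ?sqrtr_ge0 //.
by apply: l2_nrm_le; rewrite ?sqrtr_ge0 // => s us; rewrite sqr_sqrtr // xM.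
Qed.

Lemma nrm_cut s xi : uniq s -> nrm (cut s xi) ^+ 2 = \sum_(q <- s) nrm (xi q) ^+ 2.
Proof.
move=> us; apply/eqP; rewrite eq_le; apply/andP; split; last first.
  apply: le_trans (l2_bessel _ us); rewrite !big_seq; apply: ler_sum => q qs.
  by rewrite cutE // qs.
apply: nrm_sqr_le => [|r ur]; first by apply: sumr_ge0 => q _; rewrite sqr_ge0.
rewrite (@big_uniq_sub _ _ [seq j <- r | j \in s]) ?filter_uniq //; last 2 first.
- by move=> k; rewrite mem_filter => /andP[].
- by move=> k kr; rewrite mem_filter kr andbT cutE // => /negPf ->; rewrite nrm0 expr0n.
rewrite [leRHS](bigID (mem r)) /= -[X in _ <= X + _]big_filter.
rewrite (perm_big [seq j <- s | j \in r]) /=; last first.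
  by apply: uniq_perm; rewrite ?filter_uniq // => k; rewrite !mem_filter andbC.
apply: (@le_trans _ _ (\sum_(q <- [seq j <- s | j \in r]) nrm (xi q) ^+ 2)).
  rewrite !big_seq; apply: ler_sum => q; rewrite mem_filter => /andP[_ qs].
  by rewrite cutE // qs.
by rewrite lerDl sumr_ge0 // => q _; rewrite sqr_ge0.
Qed.

Lemma nrm_dl q v : nrm (dl q v) = nrm v.
Proof.
apply/eqP; rewrite -(@eqrXn2 _ 2) ?nrm_ge0 //.
have -> : dl q v = cut [:: q] (dl q v).
  by apply: l2_ext => j; rewrite cutE // inE dlE; case: eqP.
by rewrite nrm_cut // big_seq1 dlE eqxx.
Qed.

Lemma nrm_sub_cut s xi : uniq s ->
  nrm (xi - cut s xi) ^+ 2 = nrm xi ^+ 2 - \sum_(q <- s) nrm (xi q) ^+ 2.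
Proof.
move=> us.
have d' j : xi j - cut s xi j = if j \in s then 0 else xi j.
  by rewrite cutE //; case: ifP => _; rewrite ?subrr ?subr0.
have {d'} : forall j, l2val (xi - cut s xi) j = if j \in s then 0 else xi j by exact: d'.
move: (xi - cut s xi) => w d.
apply/eqP; rewrite eq_le; apply/andP; split.
  apply: nrm_sqr_le => [|r ur]; first by rewrite subr_ge0 l2_bessel.
  rewrite (@big_uniq_sub _ _ [seq j <- r | j \notin s]) ?filter_uniq //; last 2 first.
  - by move=> k; rewrite mem_filter => /andP[].
  - by move=> k kr; rewrite mem_filter kr andbT negbK d => ->; rewrite nrm0 expr0n.
  have := @l2_bessel _ _ _ xi (s ++ [seq j <- r | j \notin s]).
  rewrite cat_uniq us filter_uniq // andbT.
  have -> /= : ~~ has (mem s) [seq j <- r | j \notin s].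
    by apply/hasPn => k; rewrite mem_filter => /andP[ks _]; exact: ks.
  move=> /(_ isT); rewrite big_cat /= lerBrDl; apply: le_trans; rewrite lerD2l.
  rewrite !big_seq; apply: ler_sum => q; rewrite mem_filter => /andP[qs _].
  by rewrite d (negPf qs).
rewrite lerBlDr; apply: nrm_sqr_le => [|r ur].
  by rewrite addr_ge0 ?sqr_ge0 // sumr_ge0 // => q _; rewrite sqr_ge0.
rewrite (bigID (mem s)) /= addrC lerD //.
  apply: le_trans (l2_bessel _ (filter_uniq (fun j => j \notin s) ur)).
  rewrite big_filter big_seq_cond [leRHS]big_seq_cond; apply: ler_sum => q /andP[_ /negPf qs].
  by rewrite d qs.
rewrite [leRHS](bigID (mem r)) /= -[leLHS]big_filter.
rewrite (perm_big [seq j <- s | j \in r]) /=; last first.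
  by apply: uniq_perm; rewrite ?filter_uniq // => k; rewrite !mem_filter andbC.
by rewrite big_filter lerDl sumr_ge0 // => q _; rewrite sqr_ge0.
Qed.

(** If no finite set worked, every finite partial sum would stay below ‖ξ‖² - e², although ‖ξ‖² is
    the supremum of these sums. *)
Lemma cut_dense xi (e : R) : 0 < e -> exists s, uniq s /\
  forall s', uniq s' -> {subset s <= s'} -> nrm (xi - cut s' xi) <= e.
Proof.
move=> e0; apply: contrapT => h.
have bad s : uniq s -> \sum_(q <- s) nrm (xi q) ^+ 2 <= nrm xi ^+ 2 - e ^+ 2.
  move=> us; rewrite leNgt; apply/negP => lt; apply: h; exists s; split=> // s' us' ss.
  rewrite -ler_sqr ?nnegrE ?nrm_ge0 ?(ltW e0) // nrm_sub_cut //.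
  have : \sum_(q <- s) nrm (xi q) ^+ 2 <= \sum_(q <- s') nrm (xi q) ^+ 2.
    rewrite [leRHS](bigID (mem s)) /= -[X in _ <= X + _]big_filter.
    rewrite (perm_big [seq j <- s' | j \in s]) /= ?lerDl ?sumr_ge0 //.
    - by move=> q _; rewrite sqr_ge0.
    apply: uniq_perm; rewrite ?filter_uniq // => k.
    by rewrite mem_filter; case: (boolP (k \in s)) => // /ss ->.
  by move: lt; lra.
have e2 : 0 < e ^+ 2 by rewrite exprn_gt0.
have := bad [::] isT; rewrite big_nil => b0.
by have := nrm_sqr_le b0 bad; lra.
Qed.

End Delta.

Section Entries.
Variables (R : realType) (J : choiceType) (V : hilbertType R).
Implicit Types (x y : l2 J V -> l2 J V) (p q : J).

Definition ent x p q : V -> V := fun v => x (dl q v) p.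

Lemma ent_linear x p q : linear x -> linear (ent x p q).
Proof.
move=> lx c u v; rewrite /ent dl_linear.
by have -> : x (c *: dl q u + dl q v) = c *: x (dl q u) + x (dl q v) by exact: lx.
Qed.

Lemma ent_ople x p q M : 0 <= M -> ople x M -> ople (ent x p q) M.
Proof.
move=> M0 xM v; rewrite (le_trans (@l2_coord _ _ _ _ p)) //.
by have := xM (dl q v); rewrite nrm_dl.
Qed.

Lemma bop_ent x p q : bop (l2 J V) x -> bop V (ent x p q).
Proof.
move=> /bopP[lx [M M0 xM]]; apply/bopP; split; first exact: ent_linear.
by exists M => //; exact: ent_ople.
Qed.

Lemma cut_ent x s xi p : linear x -> x (cut s xi) p = \sum_(q <- s) ent x p q (xi q).
Proof. by move=> lx; rewrite /cut linear_sum' // (l2sumE R J). Qed.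

Lemma ent_ext x y : bop (l2 J V) x -> bop (l2 J V) y ->
  (forall p q v, ent x p q v = ent y p q v) -> x = y.
Proof.
move=> /bopP[lx [M M0 xM]] /bopP[ly [N N0 yN]] xy; apply/funext => xi.
apply/eqP; rewrite -subr_eq0; apply/eqP/nrm_eq0/eqP; rewrite eq_le nrm_ge0 andbT.
apply/ler_addgt0Pr => e e0; rewrite add0r.
have K0 : 0 < M + N + 1 by lra.
have [s [us sP]] := cut_dense xi (divr_gt0 e0 K0).
have -> : x xi - y xi = x (xi - cut s xi) - y (xi - cut s xi).
  have c : x (cut s xi) = y (cut s xi).
    by apply: l2_ext => p; rewrite !cut_ent //; apply: eq_bigr => q _; rewrite xy.
  by rewrite (linearB' xi (cut s xi) lx) (linearB' xi (cut s xi) ly) c opprB [RHS]addrA subrK.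
apply: le_trans (nrmB _ _) _.
have := sP s us (fun j js => js); rewrite ler_pdivlMr //.
have := xM (xi - cut s xi); have := yN (xi - cut s xi); have := nrm_ge0 (xi - cut s xi).
move: (nrm (x _)) (nrm (y _)) (nrm _) => a b c c0 h1 h2.
have -> : c * (M + N + 1) = M * c + N * c + c by ring.
lra.
Qed.

End Entries.

Lemma asum_sum (R : realType) (J : choiceType) (I : Type) (r : seq I) (a : I -> J -> R) :
  (forall i p, 0 <= a i p) ->
  asum (fun p => \sum_(i <- r) a i p) = (\sum_(i <- r) asum (a i))%E.
Proof.
move=> a0; elim: r => [|i r IH].
  rewrite big_nil /asum esum1 // => p _; by rewrite big_nil.
rewrite big_cons -IH -asumD //; last by move=> p; apply: sumr_ge0.
by congr asum; apply/funext => p; rewrite big_cons.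
Qed.

Section Sections.
Variables (R : realType) (V : hilbertType R) (I : finType) (J : choiceType).

(** Finite sections of an I by I matrix whose entries are themselves J by J matrices of operators on
    [V]. The bound makes sense before any operator with these entries is known to exist. *)
Definition secle (x : I -> I -> J -> J -> V -> V) (M : R) : Prop :=
  forall s : seq J, uniq s -> forall xi : I -> J -> V,
    \sum_i \sum_(p <- s) nrm (\sum_j \sum_(q <- s) x i j p q (xi j q)) ^+ 2
      <= M ^+ 2 * \sum_j \sum_(q <- s) nrm (xi j q) ^+ 2.

Lemma secle_mxle_fin (x : I -> I -> J -> J -> V -> V) (M : R) : 0 <= M ->
  (forall (n : nat) (p : 'I_n -> J), injective p ->
    mxle (fun a b : I * 'I_n => x a.1 b.1 (p a.2) (p b.2)) M) -> secle x M.
Proof.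
move=> M0 xM s us xi.
have ip : injective (tnth (in_tuple s)) by apply/tuple_uniqP.
have /(mxleP _ M0)/(_ (fun b => xi b.1 (tnth (in_tuple s) b.2))) := xM _ _ ip.
rewrite -(pair_bigA _ (fun i k => nrm (xi i (tnth (in_tuple s) k)) ^+ 2)) /=.
under [X in _ -> _ <= _ * X]eq_bigr do rewrite big_tnth.
apply: le_trans; rewrite le_eqVlt; apply/orP; left; apply/eqP.
rewrite -(pair_bigA _ (fun i k => nrm (\sum_(j : I * 'I_(size s))
  x i j.1 (tnth (in_tuple s) k) (tnth (in_tuple s) j.2) (xi j.1 (tnth (in_tuple s) j.2))) ^+ 2)) /=.
apply: eq_bigr => i _; rewrite big_tnth; apply: eq_bigr => k _.
congr (nrm _ ^+ 2).
rewrite -(pair_bigA _ (fun j l => x i j (tnth (in_tuple s) k) (tnth (in_tuple s) l)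
  (xi j (tnth (in_tuple s) l)))) /=.
by apply: eq_bigr => j _; rewrite big_tnth.
Qed.

Lemma sum_nrm_le (w : I -> l2 J V) (M : R) : 0 <= M ->
  (forall s : seq J, uniq s -> \sum_i \sum_(p <- s) nrm (w i p) ^+ 2 <= M) ->
  \sum_i nrm (w i) ^+ 2 <= M.
Proof.
move=> M0 wM; rewrite -lee_fin -sumEFin.
have -> : (\sum_i (nrm (w i) ^+ 2)%:E)%E = asum (fun p => \sum_i nrm (w i p) ^+ 2).
  rewrite (eq_bigr (fun i => asum (fun p => nrm (w i p) ^+ 2))); last first.
    by move=> i _; rewrite l2_nrm -l2normE.
  by rewrite asum_sum // => i p; rewrite sqr_ge0.
apply: le_asum_seq => [p|s us]; first by apply: sumr_ge0 => i _; rewrite sqr_ge0.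
by rewrite exchange_big /=; exact: wM.
Qed.

(** A bound on sections is a bound on vectors of finite support, which are dense; the a priori bound
    [K], however bad, carries it over to all vectors. *)
Lemma mxle_secle (x : I -> I -> l2 J V -> l2 J V) (M : R) : 0 <= M ->
  (forall i j, bop (l2 J V) (x i j)) ->
  secle (fun i j => ent (x i j)) M -> mxle x M.
Proof.
move=> M0 bx xM.
have lx i j : linear (x i j) by exact: bop_lin.
have [K K0 xK] : exists2 K : R, 0 <= K & mxle x K.
  have h i j : exists2 N : R, 0 <= N & ople (x i j) N by have /bopP[] := bx i j.
  pose N i j := projT1 (cid2 (h i j)).
  have N0 i j : 0 <= N i j by rewrite /N; case: cid2.
  have xN i j : ople (x i j) (N i j) by rewrite /N; case: cid2.
  pose N' := \sum_i \sum_j N i j.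
  have NN i j : N i j <= N'.
    rewrite /N' (bigD1 i) //= (bigD1 j) //= -addrA lerDl addr_ge0 // sumr_ge0 //.
    by move=> k _; apply: sumr_ge0.
  have N'0 : 0 <= N' by rewrite sumr_ge0 // => i _; rewrite sumr_ge0.
  exists (\sum_(i : I) \sum_(j : I) N').
    by rewrite sumr_ge0 // => i _; rewrite sumr_ge0.
  by apply: mxle_entries => // i j; apply: ople_mon (xN i j).
have fin s (v : l2 I (l2 J V)) : uniq s ->
    nrm (mxop x (to_l2 (fun i => cut s (v i)))) <= M * nrm v.
  move=> us; rewrite -ler_sqr ?nnegrE ?nrm_ge0 ?mulr_ge0 ?nrm_ge0 // exprMn !l2norm_fin.
  apply: sum_nrm_le.
    by rewrite mulr_ge0 ?sqr_ge0 // sumr_ge0 // => i _; rewrite sqr_ge0.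
  move=> r ur; pose t := undup (s ++ r).
  have ut : uniq t by exact: undup_uniq.
  have st : {subset s <= t} by move=> k ks; rewrite mem_undup mem_cat ks.
  have rt : {subset r <= t} by move=> k ks; rewrite mem_undup mem_cat ks orbT.
  have := xM t ut (fun j q => if q \in s then v j q else 0).
  have e1 : \sum_j \sum_(q <- t) nrm (if q \in s then v j q else 0) ^+ 2
      <= \sum_j nrm (v j) ^+ 2.
    apply: ler_sum => j _; rewrite (big_uniq_sub us) //.
      by apply: le_trans (l2_bessel (v j) us); rewrite !big_seq; apply: ler_sum => q ->.
    by move=> q _ /negPf ->; rewrite nrm0 expr0n.
  move=> h; have {}h := le_trans h (ler_wpM2l (sqr_ge0 M) e1); apply: le_trans h.
  apply: ler_sum => i _.
  rewrite [leRHS](bigID (mem r)) /= -[X in _ <= X + _]big_filter.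
  rewrite [X in _ <= X + _](perm_big r) /=; last first.
    apply: uniq_perm; rewrite ?filter_uniq // => k.
    by rewrite mem_filter; case: (boolP (k \in r)) => // /rt ->.
  apply: (@le_trans _ _ (\sum_(p <- r) nrm (\sum_j \sum_(q <- t)
      ent (x i j) p q (if q \in s then v j q else 0)) ^+ 2)); last first.
    by rewrite lerDl sumr_ge0 // => k _; rewrite sqr_ge0.
  rewrite le_eqVlt; apply/orP; left; apply/eqP; apply: eq_bigr => p _.
  congr (nrm _ ^+ 2); rewrite mxopE (l2sumE R J); apply: eq_bigr => j _.
  rewrite to_l2_fin cut_ent // (big_uniq_sub us ut st); last first.
    by move=> q _ /negPf ->; rewrite linear0' //; exact: ent_linear.
  by rewrite !big_seq; apply: eq_bigr => q ->.
move=> v; apply/ler_addgt0Pr => e e0.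
have [s us sP] : exists2 s, uniq s & nrm (v - to_l2 (fun i => cut s (v i))) <= e / (K + 1).
  pose d := e / (K + 1) / (#|I|%:R + 1).
  have d0 : 0 < d by rewrite !divr_gt0 ?ltr_wpDl.
  have h i := cut_dense (v i) d0.
  pose f i := projT1 (cid (h i)).
  have fP i : uniq (f i) /\ forall s', uniq s' -> {subset f i <= s'} ->
    nrm (v i - cut s' (v i)) <= d by rewrite /f; case: cid.
  pose s := undup (flatten [seq f i | i <- enum I]).
  have us : uniq s by exact: undup_uniq.
  exists s => //.
  have sub i : nrm (v i - cut s (v i)) <= d.
    have [_] := fP i; apply=> // k ki; rewrite mem_undup; apply/flattenP.
    by exists (f i) => //; apply: map_f; rewrite mem_enum.
  rewrite -ler_sqr ?nnegrE ?nrm_ge0 ?divr_ge0 ?(ltW e0) ?addr_ge0 // l2norm_fin.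
  apply: (@le_trans _ _ (\sum_(i : I) d ^+ 2)).
    apply: ler_sum => i _; rewrite (l2BE R I) to_l2_fin lerXn2r ?nnegrE ?nrm_ge0 ?(ltW d0) //.
  have -> : e / (K + 1) = d * (#|I|%:R + 1) by rewrite /d divfK // gt_eqF // ltr_wpDl.
  rewrite sumr_const -[leLHS]mulr_natr [leRHS]exprMn; apply: ler_wpM2l; first exact: sqr_ge0.
  have : (0 : R) <= #|I|%:R by [].
  by move: (#|I|%:R : R) => n n0; nra.
have lX : linear (mxop x) by exact: mxop_linear.
move: (fin s v us) sP; move: (to_l2 _) => c hc sP.
have -> : mxop x v = mxop x (v - c) + mxop x c by rewrite -(linearD _ _ lX) subrK.
apply: le_trans (nrmD _ _) _; rewrite addrC lerD //.
apply: le_trans (xK _) _; move: sP; rewrite ler_pdivlMr; last by lra.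
by have := nrm_ge0 (v - c); move: (nrm _) => a a0; nra.
Qed.

(** When k ↦ (g k, p k) is injective, the embeddings v ↦ δ_{g k} ⊗ δ_{p k} ⊗ v have orthogonal
    ranges, so the matrix is a compression of [x] by an isometry. *)
Lemma mxle_compress (K : finType) (x : I -> I -> l2 J V -> l2 J V) (M : R)
    (g : K -> I) (p : K -> J) :
  0 <= M -> (forall i j, linear (x i j)) -> mxle x M ->
  (forall k l, g k = g l -> p k = p l -> k = l) ->
  mxle (fun k l => ent (x (g k) (g l)) (p k) (p l)) M.
Proof.
move=> M0 lx xM gp; apply/mxleP => // v.
pose xi j : l2 J V := \sum_(l | g l == j) dl (p l) (v l).
pose pp i := [seq p k | k <- enum K & g k == i].
have upp i : uniq (pp i).
  rewrite map_inj_in_uniq ?filter_uniq -?enumT ?enum_uniq // => k l.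
  rewrite !mem_filter => /andP[/eqP gk _] /andP[/eqP gl _]; apply: gp.
  by rewrite gk.
have split (f : K -> R) : \sum_k f k = \sum_i \sum_(k | g k == i) f k.
  by rewrite (exchange_big_dep predT) //=; apply: eq_bigr => k _; rewrite (big_pred1 (g k)) // => i; rewrite eq_sym.
have /(mxleP _ M0)/(_ xi) h := xM.
have xin j : nrm (xi j) ^+ 2 <= \sum_(l | g l == j) nrm (v l) ^+ 2.
  have xij : xi j = cut (pp j) (xi j).
    apply: l2_ext => k; rewrite cutE //; case: ifPn => // kp.
    rewrite /xi (l2sumE R J) big1 // => l gl; rewrite dlE; case: eqP => // kl.
    by rewrite kl map_f // mem_filter gl mem_enum in kp.
  rewrite xij nrm_cut // big_map big_filter big_enum_cond /=.
  rewrite le_eqVlt; apply/orP; left; apply/eqP; apply: eq_bigr => l gl.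
  congr (nrm _ ^+ 2); rewrite /xi (l2sumE R J) (bigD1 l) //= dlE eqxx big1 ?addr0 //.
  move=> k /andP[/eqP gk kl]; rewrite dlE; case: eqP => // pk.
  by rewrite (gp l k) ?eqxx // ?(eqP gl) ?gk in kl.
rewrite [leRHS](_ : _ = M ^+ 2 * \sum_j \sum_(l | g l == j) nrm (v l) ^+ 2); last by rewrite split.
apply: (@le_trans _ _ (M ^+ 2 * \sum_j nrm (xi j) ^+ 2)); last first.
  by rewrite ler_wpM2l ?sqr_ge0 // ler_sum.
apply: le_trans h; rewrite split; apply: ler_sum => i _.
apply: le_trans (l2_bessel _ (upp i)); rewrite big_map big_filter big_enum_cond /=.
rewrite le_eqVlt; apply/orP; left; apply/eqP; apply: eq_bigr => k /eqP gk.
congr (nrm _ ^+ 2); rewrite (l2sumE R J).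
rewrite (eq_bigr (fun j => \sum_(l | g l == j) ent (x i j) (p k) (p l) (v l))); last first.
  by move=> j _; rewrite /xi linear_sum' // (l2sumE R J).
rewrite (exchange_big_dep predT) //=; apply: eq_bigr => l _.
by rewrite (big_pred1 (g l)) ?gk // => j; rewrite eq_sym.
Qed.

End Sections.

Section MatrixOperator.
Variables (R : realType) (J : choiceType) (V : hilbertType R).

(** The source of operators given by their matrix: sums of ℓ¹ families, values of Schur multipliers,
    tensor products b ⊗ x and block diagonals. The matrix formula is used on finitely supported
    vectors, where it does not depend on the support chosen by [sup], and is then extended by
    density. *)
Lemma matrix_op (x : J -> J -> V -> V) (M : R) : 0 <= M ->
  (forall p q, linear (x p q)) -> secle (fun _ _ : unit => x) M ->
  exists y : l2 J V -> l2 J V,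
    [/\ linear y, ople y M & forall p q v, ent y p q v = x p q v].
Proof.
move=> M0 lx xM.
have {}xM s : uniq s -> forall xi : J -> V,
    \sum_(p <- s) nrm (\sum_(q <- s) x p q (xi q)) ^+ 2 <= M ^+ 2 * \sum_(q <- s) nrm (xi q) ^+ 2.
  by move=> us xi; have := xM s us (fun _ => xi); rewrite !big_unit; under eq_bigr do rewrite big_unit.
pose D : set (l2 J V) := [set xi | exists2 s, uniq s & xi = cut s xi].
have D0 (xi : l2 J V) s j : uniq s -> xi = cut s xi -> j \notin s -> xi j = 0.
  by move=> us -> js; rewrite cutE // (negPf js).
have Din (xi : l2 J V) s : uniq s -> (forall j, j \notin s -> xi j = 0) -> xi = cut s xi.
  by move=> us h; apply: l2_ext => j; rewrite cutE //; case: ifPn => // /h.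
pose sup (xi : l2 J V) := xget [::] [set s | uniq s /\ xi = cut s xi].
have supP (xi : l2 J V) : D xi -> uniq (sup xi) /\ xi = cut (sup xi) xi.
  move=> [s us xs]; rewrite /sup; case: xgetP => [y _ []//|/(_ s)[]]; split=> //.
pose f (xi : l2 J V) p := \sum_(q <- sup xi) x p q (xi q).
have fE (xi : l2 J V) s p : D xi -> uniq s -> xi = cut s xi -> f xi p = \sum_(q <- s) x p q (xi q).
  move=> Dxi us xs; have [uu xu] := supP xi Dxi.
  pose t := undup (s ++ sup xi).
  have z r : uniq r -> xi = cut r xi -> forall j, j \in t -> j \notin r -> x p j (xi j) = 0.
    by move=> ur xr j _ jr; rewrite (D0 _ _ _ ur xr jr) linear0'.
  have ut : uniq t by exact: undup_uniq.
  rewrite /f -(big_uniq_sub uu ut _ (z _ uu xu)); last first.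
    by move=> k ks; rewrite mem_undup mem_cat ks orbT.
  by rewrite (big_uniq_sub us ut _ (z _ us xs)) // => k ks; rewrite mem_undup mem_cat ks.
have fb (xi : l2 J V) r : D xi -> uniq r -> \sum_(p <- r) nrm (f xi p) ^+ 2 <= (M * nrm xi) ^+ 2.
  move=> Dxi ur; have [uu xu] := supP xi Dxi.
  pose t := undup (sup xi ++ r).
  have ut : uniq t by exact: undup_uniq.
  have xt : xi = cut t xi.
    apply: Din => // j; rewrite mem_undup mem_cat negb_or => /andP[ju _].
    exact: D0 uu xu ju.
  have rt : {subset r <= t} by move=> k ks; rewrite mem_undup mem_cat ks orbT.
  rewrite exprMn {2}xt nrm_cut //; apply: le_trans (xM t ut xi).
  rewrite [leRHS](bigID (mem r)) /= -[X in _ <= X + _]big_filter.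
  rewrite [X in _ <= X + _](perm_big r) /=; last first.
    apply: uniq_perm; rewrite ?filter_uniq // => k.
    by rewrite mem_filter; case: (boolP (k \in r)) => // /rt ->.
  rewrite ler_wpDr ?sumr_ge0 // => [k _|]; first by rewrite sqr_ge0.
  rewrite le_eqVlt; apply/orP; left; apply/eqP; apply: eq_bigr => p _.
  by rewrite (fE xi t).
pose y0 (xi : l2 J V) : l2 J V := to_l2 (f xi).
have y0E (xi : l2 J V) p : D xi -> y0 xi p = f xi p.
  by move=> Dxi; rewrite /y0 to_l2E //; apply: to_l2_bounded => s us; exact: fb.
have sD : lsub D.
  split; first by exists [::] => //; apply: Din.
  move=> c a b [s us as_] [t ut bt]; exists (undup (s ++ t)); first exact: undup_uniq.
  apply: Din; first exact: undup_uniq.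
  move=> j; rewrite mem_undup mem_cat negb_or => /andP[js jt].
  by rewrite -[LHS]/(c *: a j + b j) (D0 _ _ _ us as_ js) (D0 _ _ _ ut bt jt) scaler0 addr0.
have [] := @extend_dense R (l2 J V) (l2 J V) D y0 M M0 sD.
- move=> v e e0; have [s [us sP]] := cut_dense v e0; exists (cut s v); last by apply: sP.
  by exists s => //; apply: Din => // j js; rewrite cutE // (negPf js).
- move=> c a b Da Db; apply: l2_ext => p.
  have Dab : D (c *: a + b) by case: sD => _; apply.
  rewrite -[RHS]/(c *: y0 a p + y0 b p) !y0E //.
  have [us as_] := supP _ Da; have [ut bt] := supP _ Db.
  pose t := undup (sup a ++ sup b).
  have utt : uniq t by exact: undup_uniq.
  have at_ : a = cut t a.
    apply: Din => // j; rewrite mem_undup mem_cat negb_or => /andP[ju _].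
    exact: D0 us as_ ju.
  have bt_ : b = cut t b.
    apply: Din => // j; rewrite mem_undup mem_cat negb_or => /andP[_ ju].
    exact: D0 ut bt ju.
  have abt : c *: a + b = cut t (c *: a + b).
    apply: Din => // j jt.
    by rewrite -[LHS]/(c *: a j + b j) (D0 _ _ _ utt at_ jt) (D0 _ _ _ utt bt_ jt) scaler0 addr0.
  rewrite (fE _ t p Dab) // (fE _ t p Da) // (fE _ t p Db) //.
  rewrite scaler_sumr -big_split /=; apply: eq_bigr => q _.
  exact: (lx p q c (a q) (b q)).
- move=> d Dd; apply: l2_nrm_le; first by rewrite mulr_ge0 ?nrm_ge0.
  by move=> s us; under eq_bigr do rewrite y0E //; exact: fb.
move=> y [ly yM yy]; exists y; split=> // p q v.
have dq : dl q v = cut [:: q] (dl q v).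
  by apply: Din => // j; rewrite inE dlE => /negPf ->.
have Dq : D (dl q v) by exists [:: q].
by rewrite /ent yy // y0E // (fE _ [:: q] p) // big_seq1 dlE eqxx.
Qed.

End MatrixOperator.

(** * Complete contractivity of *-automorphisms *)

Section DenseDelta.
Variables (R : realType) (J : choiceType) (V : hilbertType R).

Lemma dl_dense0 (W : normedModType R[i]) (f : l2 J V -> W) (M : R) : 0 <= M ->
  linear f -> ople f M -> (forall q v, f (dl q v) = 0) -> forall xi, f xi = 0.
Proof.
move=> M0 lf fM f0 xi; apply/nrm_eq0/eqP; rewrite eq_le nrm_ge0 andbT.
apply/ler_addgt0Pr => e e0; rewrite add0r.
have K0 : 0 < M + 1 by lra.
have [s [us sP]] := cut_dense xi (divr_gt0 e0 K0).
have c : f (cut s xi) = 0.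
  by rewrite /cut linear_sum' // big1.
have -> : f xi = f (xi - cut s xi) by rewrite (linearB' xi (cut s xi) lf) c subr0.
have := sP s us (fun j js => js); rewrite ler_pdivlMr //.
have := fM (xi - cut s xi); have := nrm_ge0 (xi - cut s xi).
by move: (nrm (f _)) (nrm _) => a b b0 h1; nra.
Qed.

(** Read off from norms: splitting off the coordinate [q] by Pythagoras and polarising avoids the
    infinite sum behind the inner product. *)
Lemma rin_dl q v (y : l2 J V) : rin (dl q v) y = rin v (y q).
Proof.
have h (w : l2 J V) : nrm w ^+ 2 = nrm (w - cut [:: q] w) ^+ 2 + nrm (w q) ^+ 2.
  by rewrite nrm_sub_cut // big_seq1 subrK.
have e : (dl q v + y) - cut [:: q] (dl q v + y) = y - cut [:: q] y.
  apply: l2_ext => j; rewrite -[LHS]/(dl q v j + y j - cut [:: q] (dl q v + y) j).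
  rewrite -[RHS]/(y j - cut [:: q] y j) !cutE // inE dlE; case: eqP => [->|_].
    by rewrite -[(dl q v + y : l2 J V) q]/(dl q v q + y q) dlE eqxx !subrr.
  by rewrite !subr0 add0r.
have := nrm_sqrD (dl q v) y; rewrite h e nrm_dl.
have -> : (dl q v + y : l2 J V) q = v + y q.
  by rewrite -[LHS]/(dl q v q + y q) dlE eqxx.
have := h y; have := nrm_sqrD v (y q).
move: (nrm (v + _) ^+ 2) (nrm (y - _) ^+ 2) (nrm y ^+ 2) (nrm (y q) ^+ 2) (nrm v ^+ 2).
by move=> a b c d f h1 h2 h3; lra.
Qed.

Lemma inner_dl q v (y : l2 J V) : inner (dl q v) y = inner v (y q).
Proof.
have imE (W : hilbertType R) (a b : W) : complex.Im (inner a b) = rin (- 'i *: a) b.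
  by rewrite /rin innerZ; case: (inner a b) => c d /=; rewrite !(mul0r, oppr0, mulN1r, sub0r, opprK).
apply/eqP; rewrite eq_complex; apply/andP; split; apply/eqP; first exact: rin_dl.
rewrite imE [RHS]imE -(rin_dl q (- 'i *: v) y); congr (rin _ y).
by rewrite (linearZ' _ _ (dl_linear q)).
Qed.

Lemma inner_dlr q v (y : l2 J V) : inner y (dl q v) = inner (y q) v.
Proof. by rewrite innerC inner_dl [RHS]innerC. Qed.

(** Two passes of [dl_dense0], one per variable: the defect ⟨y u, v⟩ - ⟨u, z v⟩ is continuous and
    linear in [u], and its conjugate in [v], so delta vectors suffice. *)
Lemma adjoint_ent (y z : l2 J V -> l2 J V) : bop _ y -> bop _ z ->
  (forall p q, adjoint (ent y p q) (ent z q p)) -> adjoint y z.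
Proof.
move=> /bopP[ly [M M0 yM]] /bopP[lz [N N0 zN]] yz u v.
have bnd (a b c d : l2 J V) (K L : R) : nrm a <= K * nrm c -> nrm b <= L * nrm d ->
    nrm (inner a d - inner c b : scal R) <= (K * nrm d + L * nrm d) * nrm c.
  move=> h1 h2; apply: le_trans (nrmB _ _) _.
  rewrite mulrDl; apply: lerD.
    apply: le_trans (cauchy_schwarz _ _) _.
    by rewrite mulrAC ler_wpM2r ?nrm_ge0.
  apply: le_trans (cauchy_schwarz _ _) _.
  by rewrite mulrC ler_wpM2r ?nrm_ge0.
have bndC (a b c d : l2 J V) (K L : R) : nrm a <= K * nrm c -> nrm b <= L * nrm d ->
    nrm (inner d a - inner b c : scal R) <= (K * nrm d + L * nrm d) * nrm c.
  move=> h1 h2; apply: le_trans (nrmB _ _) _.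
  rewrite mulrDl; apply: lerD.
    apply: le_trans (cauchy_schwarz _ _) _.
    by rewrite mulrC mulrAC ler_wpM2r ?nrm_ge0.
  apply: le_trans (cauchy_schwarz _ _) _.
  by rewrite ler_wpM2r ?nrm_ge0.
pose f u' : scal R := inner (y u') v - inner u' (z v).
suff h : f u = 0 by apply/eqP; rewrite -subr_eq0; apply/eqP.
apply: (@dl_dense0 (scal R) f (M * nrm v + N * nrm v)).
- by rewrite addr_ge0 // mulr_ge0 ?nrm_ge0.
- move=> c a b; rewrite /f ly !innerD !innerZ -[RHS]/(c * (_ - _) + (_ - _) : R[i]).
  by ring.
- by move=> u'; apply: bnd; [exact: yM|exact: zN].
move=> q a.
pose g v' : scal R := inner v' (y (dl q a)) - inner (z v') (dl q a).
suff h : g v = 0.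
  rewrite /f (innerC (y (dl q a)) v) (innerC (dl q a) (z v)) -rmorphB.
  by have {}h : inner v (y (dl q a)) - inner (z v) (dl q a) = 0 by []; rewrite h rmorph0.
apply: (@dl_dense0 (scal R) g (M * nrm (dl q a) + N * nrm (dl q a))).
- by rewrite addr_ge0 // mulr_ge0 ?nrm_ge0.
- move=> c a' b; rewrite /g lz !innerD !innerZ -[RHS]/(c * (_ - _) + (_ - _) : R[i]).
  by ring.
- move=> v'.
  have -> : (M * nrm (dl q a) + N * nrm (dl q a)) * nrm v' =
            (M * nrm v' + N * nrm v') * nrm (dl q a) by ring.
  by apply: bndC; [exact: yM|exact: zN].
move=> p b; rewrite /g inner_dl inner_dlr (innerC b) -[y (dl q a) p]/(ent y p q a) yz.
by rewrite -(innerC (ent z q p b) a) subrr.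
Qed.

End DenseDelta.

Lemma inner_fin (R : realType) (I : finType) (V : hilbertType R) (x y : l2 I V) :
  inner x y = \sum_i inner (x i) (y i).
Proof.
have -> : x = \sum_i dl i (x i).
  apply: l2_ext => j; rewrite (l2sumE R I) (bigD1 j) //= dlE eqxx big1 ?addr0 //.
  by move=> i ij; rewrite dlE eq_sym (negPf ij).
rewrite inner_suml; apply: eq_bigr => i _; rewrite inner_dl; congr inner.
rewrite (l2sumE R I) (bigD1 i) //= dlE eqxx big1 ?addr0 // => k ki.
by rewrite dlE eq_sym (negPf ki).
Qed.

Lemma l2_fin_sum (R : realType) (I : finType) (V : normedModType R[i]) (x : l2 I V) :
  x = \sum_i dl i (x i).
Proof.
apply: l2_ext => j; rewrite (l2sumE R I) (bigD1 j) //= dlE eqxx big1 ?addr0 //.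
by move=> i ij; rewrite dlE eq_sym (negPf ij).
Qed.

Section Geometric.
Variable R : realType.

Lemma geometric_small (r K d : R) : 0 <= r -> r < 1 -> 0 < d -> exists n, K * r ^+ n < d.
Proof.
move=> r0 r1 d0.
have K0 : 0 < `|K| + 1 by have := normr_ge0 K; lra.
have := @cvg_expr R r; rewrite ger0_norm // => /(_ r1) /cvgrPdist_lt /(_ _ (divr_gt0 d0 K0)).
move=> [n _ /(_ n (leqnn n))] /=; rewrite sub0r normrN ger0_norm ?exprn_ge0 //.
rewrite ltr_pdivlMr // => h; exists n; apply: le_lt_trans h.
by rewrite mulrC ler_wpM2l ?exprn_ge0 // (le_trans (ler_norm K)) // lerDl.
Qed.

End Geometric.

Section StarContractive.
Variables (R : realType) (K L : hilbertType R) (B : set (K -> K)).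
Variable f : (K -> K) -> (L -> L).
Hypotheses (cB : cstar_algebra B) (lf : linear_on B f).
Hypothesis fM : forall a b, B a -> B b -> f (a \o b) = f a \o f b.
Hypothesis fA : forall a b, B a -> B b -> adjoint a b -> adjoint (f a) (f b).

Let Bb : B `<=` bop K. Proof. by case: cB. Qed.
Let sB : lsub B. Proof. by case: cB. Qed.

Let half : R[i] := (2^-1 : R)%:C.

(* For ‖c‖ < 1 the fixed point s of s ↦ (c + s²)/2 gives 1 - c = (1 - s)². *)
Lemma star_sqrt (c : K -> K) (beta : R) : B c -> adjoint c c ->
  0 <= beta -> beta < 1 -> ople c beta ->
  exists s, [/\ B s, adjoint s s & s + s = c + (s \o s)].
Proof.
move=> Bc cc b0 b1 cb.
(* The smaller root of r = (beta + r²)/2. Every iterate stays in the ball of radius r, where [step]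
   is r-Lipschitz with r < 1, so the iteration converges geometrically. *)
pose r : R := 1 - Num.sqrt (1 - beta).
have rE : (beta + r ^+ 2) / 2 = r.
  have : Num.sqrt (1 - beta) ^+ 2 = 1 - beta by rewrite sqr_sqrtr //; lra.
  by rewrite /r sqrrB expr1n; move: (Num.sqrt _) => t; rewrite expr2; lra.
have r0 : 0 <= r.
  rewrite subr_ge0 -[leRHS]sqrtr1 ler_sqrt //; lra.
have r1 : r < 1 by rewrite ltrBlDr ltrDl sqrtr_gt0; lra.
pose step (t : K -> K) : K -> K := half *: (c + (t \o t)).
pose s n := iter n step 0.
have Bs n : B (s n).
  elim: n => [|n IH]; first by case: sB.
  apply: (lsubZ sB); apply: (lsubD sB) => //; by case: cB => _ _ h _ _; apply: h.
have ls n : linear (s n) by apply/bop_lin/Bb.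
have hn : complex.Re `|half| = 2^-1 by rewrite Re_norm_real // invr_ge0.
have sr n : ople (s n) r.
  elim: n => [|n IH]; first by apply: ople_mon r0 _; exact: ople_zero.
  rewrite -rE mulrC expr2 -hn; apply: ople_scale; apply: ople_add => //.
  exact: ople_comp.
have ssa n : adjoint (s n) (s n).
  elim: n => [|n IH] u v; first by rewrite /= inner0 inner0r.
  rewrite -[s n.+1 u]/(half *: (c u + s n (s n u))) -[s n.+1 v]/(half *: (c v + s n (s n v))).
  rewrite innerZ innerZr innerD innerDr cc !IH; congr (_ * _).
  by rewrite /half -[RHS]/(conjc _) /= oppr0.
have step_lip t t' (d : R) : 0 <= d -> linear t -> linear t' -> ople t r -> ople t' r ->
    ople (t - t') d -> ople (step t - step t') (r * d).
  move=> d0 lt lt' tr tr' ttd v.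
  have -> : (step t - step t') v = half *: (t ((t - t') v) + (t - t') (t' v)).
    rewrite -[LHS]/(half *: (c v + t (t v)) - half *: (c v + t' (t' v))) -scalerBr.
    congr (_ *: _); rewrite -[(t - t') v]/(t v - t' v) -[(t - t') (t' v)]/(t (t' v) - t' (t' v)).
    by rewrite (linearB' (t v) (t' v) lt) addrA subrK opprD addrACA subrr add0r.
  rewrite nrmZ hn; have h1 := tr ((t - t') v); have h2 := ttd (t' v).
  have h3 := ttd v; have h4 := tr' v.
  apply: (@le_trans _ _ (2^-1 * (nrm (t ((t - t') v)) + nrm ((t - t') (t' v))))).
    by rewrite ler_wpM2l ?invr_ge0 // nrmD.
  have h5 : r * nrm ((t - t') v) <= r * (d * nrm v) by rewrite ler_wpM2l.
  have h6 : d * nrm (t' v) <= d * (r * nrm v) by rewrite ler_wpM2l.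
  apply: (@le_trans _ _ (2^-1 * (r * (d * nrm v) + d * (r * nrm v)))).
    by rewrite ler_wpM2l ?invr_ge0 // lerD ?(le_trans h1) ?(le_trans h2).
  by rewrite le_eqVlt; apply/orP; left; apply/eqP; field.
have sd n : ople (s n.+1 - s n) (r * r ^+ n).
  elim: n => [|n IH]; first by rewrite expr0 mulr1 subr0.
  rewrite exprS; apply: step_lip (ls _) (ls _) (sr _) (sr _) IH.
  by rewrite mulr_ge0 ?exprn_ge0.
pose C := r / (1 - r).
have C0 : 0 <= C by rewrite divr_ge0 //; lra.
have sC n m : (n <= m)%N -> ople (s m - s n) (C * r ^+ n).
  move=> /subnK <-; move: (m - n)%N => l; elim: l n => [|k IH] n.
    rewrite add0n subrr; apply: (@ople_mon _ _ _ 0 0); last exact: ople_zero.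
    by rewrite mulr_ge0 ?exprn_ge0.
  rewrite addSnnS; have -> : s (k + n.+1)%N - s n = (s (k + n.+1)%N - s n.+1) + (s n.+1 - s n).
    by rewrite addrA subrK.
  have -> : C * r ^+ n = C * r ^+ n.+1 + r * r ^+ n.
    rewrite exprS /C; move: (r ^+ n) => t.
    have nz : 1 - r != 0 by apply: lt0r_neq0; lra.
    by field.
  by apply: ople_add.
have [t lt ts] := ople_complete ls sC (fun d d0 => geometric_small C r0 r1 d0).
have tr : ople t r.
  apply: ople_eps => e e0; have [n en] := geometric_small C r0 r1 e0.
  have -> : t = s n + (t - s n) by rewrite addrC subrK.
  by apply: ople_add => //; apply: ople_mon (ts n); exact: ltW.
have Bt : B t.
  case: cB => _ _ _ _; apply; split; first by apply/bopP; split => //; exists r.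
  move=> e e0; have [n en] := geometric_small C r0 r1 e0; exists (s n) => //.
  apply: (ople_opnorm_lt _ _ en (ts n)); last by rewrite mulr_ge0 ?exprn_ge0.
  exact: linear_sub.
exists t; split => //.
- move=> u v; apply/eqP; rewrite -subr_eq0; apply/eqP.
  apply: (@nrm_eq0 _ (scal R)); apply/eqP; rewrite eq_le nrm_ge0 andbT.
  apply/ler_addgt0Pr => e e0; rewrite add0r.
  have [n en] := geometric_small (C * (2 * (nrm u * nrm v))) r0 r1 e0.
  have -> : inner (t u) v - inner u (t v) = inner ((t - s n) u) v - inner u ((t - s n) v).
    rewrite -[(t - s n) u]/(t u - s n u) -[(t - s n) v]/(t v - s n v) innerB innerBr ssa.
    by ring.
  apply: le_trans (nrmB (inner ((t - s n) u) v : scal R) (inner u ((t - s n) v))) _.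
  apply: le_trans (lerD (cauchy_schwarz _ _) (cauchy_schwarz _ _)) _.
  have h1 : nrm ((t - s n) u) * nrm v <= C * r ^+ n * nrm u * nrm v.
    by rewrite ler_wpM2r ?nrm_ge0 // ts.
  have h2 : nrm u * nrm ((t - s n) v) <= nrm u * (C * r ^+ n * nrm v).
    by rewrite ler_wpM2l ?nrm_ge0 // ts.
  apply: le_trans (lerD h1 h2) _; apply: le_trans (ltW en).
  by rewrite le_eqVlt; apply/orP; left; apply/eqP; ring.
- suff z : ople (t - step t) 0.
    have e v : t v = step t v.
      apply/eqP; rewrite -subr_eq0; apply/eqP/nrm_eq0/eqP; rewrite eq_le nrm_ge0 andbT.
      by have := z v; rewrite mul0r.
    apply/funext => v; rewrite -[(t + t) v]/(t v + t v) {1}e {1}e.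
    rewrite -[step t v]/(half *: (c v + t (t v))) -scalerDl.
    have -> : half + half = 1 by rewrite -rmorphD /= -[RHS](rmorph1 (real_complex R)); congr (_%:C); lra.
    by rewrite scale1r.
  apply: ople_eps => e e0; rewrite add0r.
  have [n en] := geometric_small (C + C) r0 r1 e0.
  apply: (ople_mon (ltW en)); rewrite mulrDl.
  have -> : t - step t = (t - s n.+1) + (s n.+1 - step t) by rewrite addrA subrK.
  apply: ople_add.
    apply: ople_mon (ts n.+1); rewrite ler_wpM2l // exprS ler_piMl ?exprn_ge0 //; exact: ltW.
  have -> : s n.+1 - step t = - (step t - step (s n)) by rewrite opprB.
  apply: ople_opp; apply: (@ople_mon _ _ _ _ (r * (C * r ^+ n))).
    by apply: ler_piMl; [rewrite mulr_ge0 ?exprn_ge0|exact: ltW].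
  by apply: step_lip lt (ls _) tr (sr _) (ts n); rewrite mulr_ge0 ?exprn_ge0.
Qed.

(** For a = b/N of norm less than 1 and a selfadjoint s in [B] with 1 - a^* a = (1 - s)²,
    multiplicativity gives ‖v‖² - ‖f(a)v‖² = ‖v - f(s)v‖² >= 0. Only the relation a^* a = 2s - s²,
    which lives inside [B], is transported by [f]; this avoids units and spectra. *)
Lemma star_contractive b (M : R) : B b -> 0 <= M -> ople b M -> ople (f b) M.
Proof.
move=> Bb' M0 bM; apply: ople_eps => e e0.
have N0 : 0 < M + e by lra.
pose N := M + e; pose i : R[i] := (N^-1)%:C.
pose a : K -> K := i *: b.
have Ba : B a by exact: (lsubZ sB).
have [a' Ba' aa'] : exists2 a', B a' & adjoint a a' by case: cB => _ _ _ h _; exact: h.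
have M1 : M / N < 1 by rewrite ltr_pdivrMr // mul1r /N; lra.
have M2 : 0 <= M / N by rewrite divr_ge0 // ltW.
have aM : ople a (M / N).
  have := ople_scale i bM; rewrite Re_norm_real ?invr_ge0 ?(ltW N0) //.
  by rewrite mulrC.
have a'M : ople a' (M / N) by exact: adjoint_ople aM.
have Bc : B (a' \o a) by case: cB => _ _ h _ _; exact: h.
have [s [Bs ss sE]] : exists s, [/\ B s, adjoint s s & s + s = (a' \o a) + (s \o s)].
  apply: (@star_sqrt _ (M / N * (M / N))) => //.
  - by move=> u v; rewrite /= (adjointC aa') aa'.
  - by rewrite mulr_ge0.
  - by rewrite -[ltRHS]mulr1 ltr_pM.
  - exact: ople_comp.
have fa : ople (f a) 1.
  move=> v; rewrite mul1r -ler_sqr ?nnegrE ?nrm_ge0 // -rin_xx.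
  rewrite /rin (fA Ba Ba' aa') -[f a' (f a v)]/((f a' \o f a) v) -fM //.
  have Bss : B (s \o s) by case: cB => _ _ h _ _; exact: h.
  have -> : f (a' \o a) = f s + f s - (f s \o f s).
    have := congr1 f sE; rewrite (linear_onD lf Bs Bs) (linear_onD lf Bc Bss) (fM Bs Bs) => ->.
    by rewrite addrK.
  rewrite -[(f s + f s - _) v]/(f s v + f s v - f s (f s v)) innerBr innerDr.
  have -> : inner v (f s (f s v)) = inner (f s v) (f s v) by rewrite -(fA Bs Bs ss).
  have := sqr_ge0 (nrm (v - f s v)); rewrite nrm_sqrB -(rin_xx (f s v)) /rin !raddfB !raddfD /=.
  by move: (complex.Re _) (complex.Re _) => p q; lra.
have -> : f b = N%:C *: f a.
  rewrite -(linear_onZ sB lf) //; congr f.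
  by rewrite scalerA -rmorphM mulfV ?gt_eqF // scale1r.
by have := ople_scale N%:C fa; rewrite mulr1 Re_norm_real ?(ltW N0).
Qed.

End StarContractive.

Section MatrixAlgebra.
Variables (R : realType) (I : finType) (H : hilbertType R) (A : set (H -> H)).
Hypothesis cA : cstar_algebra A.

Definition mxalg : set (l2 I H -> l2 I H) :=
  [set y | bop _ y /\ forall i j, A (ent y i j)].

Lemma ent_mxop (x : I -> I -> H -> H) i j v : (forall i j, linear (x i j)) ->
  ent (mxop x) i j v = x i j v.
Proof.
move=> lx; rewrite /ent mxopE (bigD1 j) //= dlE eqxx big1 ?addr0 // => k kj.
by rewrite dlE (negPf kj) linear0'.
Qed.

Lemma mxop_ent (y : l2 I H -> l2 I H) : linear y -> mxop (ent y) = y.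
Proof.
move=> ly; apply/funext => v; apply: l2_ext => i.
by rewrite mxopE [in RHS](l2_fin_sum v) linear_sum' // (l2sumE R I).
Qed.

Lemma mxop_bop (x : I -> I -> H -> H) : (forall i j, bop H (x i j)) -> bop _ (mxop x).
Proof.
move=> bx; have lx i j : linear (x i j) by exact: bop_lin.
apply/bopP; split; first exact: mxop_linear.
have h i j : exists2 N : R, 0 <= N & ople (x i j) N by have /bopP[] := bx i j.
pose N i j := projT1 (cid2 (h i j)).
have N0 i j : 0 <= N i j by rewrite /N; case: cid2.
have xN i j : ople (x i j) (N i j) by rewrite /N; case: cid2.
have NN i j : N i j <= \sum_i \sum_j N i j.
  rewrite (bigD1 i) //= (bigD1 j) //= -addrA lerDl addr_ge0 // sumr_ge0 //.
  by move=> k _; apply: sumr_ge0.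
have N'0 : 0 <= \sum_i \sum_j N i j by rewrite sumr_ge0 // => i _; rewrite sumr_ge0.
exists (\sum_(i : I) \sum_(j : I) (\sum_i \sum_j N i j)).
  by rewrite sumr_ge0 // => i _; rewrite sumr_ge0.
by apply: mxle_entries => // i j; apply: ople_mon (xN i j).
Qed.

Lemma mxop_adjoint (x y : I -> I -> H -> H) :
  (forall i j, adjoint (x i j) (y j i)) -> adjoint (mxop x) (mxop y).
Proof.
move=> xy u v; rewrite !inner_fin.
under eq_bigr do rewrite mxopE inner_suml.
rewrite exchange_big /=; apply: eq_bigr => j _.
by rewrite mxopE inner_sumr; apply: eq_bigr => i _; rewrite xy.
Qed.

Lemma ent_comp (y z : l2 I H -> l2 I H) i j : linear y ->
  ent (y \o z) i j = \sum_k (ent y i k \o ent z k j).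
Proof.
move=> ly; apply/funext => v; rewrite sumfE /ent /= {1}(l2_fin_sum (z (dl j v))).
by rewrite linear_sum' // (l2sumE R I).
Qed.

(** Turns matrix estimates into operator estimates: applied to this algebra, contractivity of
    *-homomorphisms becomes complete contractivity. *)
Lemma mxalg_cstar : cstar_algebra mxalg.
Proof.
have [Ab sA Ac Aa Acl] := cA.
split.
- by move=> y [].
- split; first by split; [exact: bop0|move=> i j; case: sA].
  move=> c a b [ba Aa'] [bb Ab']; split; first exact: bop_scaleD.
  by move=> i j; case: sA => _ /(_ c _ _ (Aa' i j) (Ab' i j)).
- move=> a b [ba Aa'] [bb Ab']; split; first exact: bop_comp.
  move=> i j; rewrite ent_comp; last exact: bop_lin.
  by apply: (lsub_sum sA) => k _; exact: Ac.
- move=> a [ba Aa'].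
  pose b i j := projT1 (cid2 (Aa _ (Aa' i j))).
  have bA i j : A (b i j) by rewrite /b; case: cid2.
  have ab i j : adjoint (ent a i j) (b i j) by rewrite /b; case: cid2.
  have lb i j : linear (b i j) by apply/bop_lin/Ab.
  exists (mxop (fun i j => b j i)).
    split; first by apply: mxop_bop => i j; exact: Ab.
    move=> i j; rewrite (_ : ent _ i j = b j i) //; apply/funext => v.
    by rewrite ent_mxop.
  by rewrite -[a]mxop_ent; [exact: mxop_adjoint|exact: bop_lin].
move=> y [by_ yc]; split=> // i j; apply: Acl; split; first exact: bop_ent.
move=> e e0; have e2 : 0 < e / 2 by lra.
have [x [bx Ax] yx] := yc _ e2; exists (ent x i j) => //.
have l : linear (y - x) by apply: linear_sub; exact: bop_lin.
have h : ople (ent (y - x) i j) (e / 2) := ent_ople i j (ltW e2) (opnorm_lt_ople l yx).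
have e2e : e / 2 < e by rewrite ltr_pdivrMr // ltr_pMr // ltr1n.
exact: (ople_opnorm_lt (ent_linear i j l) (ltW e2) e2e h).
Qed.

Lemma star_mxle (f : (H -> H) -> (H -> H)) (x : I -> I -> H -> H) (M : R) :
  star_automorphism A f -> 0 <= M -> (forall i j, A (x i j)) -> mxle x M ->
  mxle (fun i j => f (x i j)) M.
Proof.
move=> [[fA _ _] lf fM fadj] M0 Ax xM.
have [Ab sA Ac _ _] := cA.
have fl a : A a -> linear (f a) by move=> /fA; move/Ab; exact: bop_lin.
have lx i j : linear (x i j) by exact/bop_lin/Ab.
pose g y : l2 I H -> l2 I H := mxop (fun i j => f (ent y i j)).
have Bx : mxalg (mxop x).
  split; first by apply: mxop_bop => i j; exact: Ab.
  move=> i j; rewrite (_ : ent _ i j = x i j) //; apply/funext => v.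
  exact: ent_mxop.
have h : ople (g (mxop x)) M.
  apply: (@star_contractive R _ _ mxalg g) => //.
  - exact: mxalg_cstar.
  - move=> c a b [ba Aa] [bb Ab']; apply/funext => v; apply: l2_ext => i.
    rewrite -[RHS]/(c *: g a v i + g b v i) !mxopE scaler_sumr -big_split.
    apply: eq_bigr => j _.
    by rewrite -[ent (c *: a + b) i j]/(c *: ent a i j + ent b i j) lf.
  - move=> a b [ba Aa] [bb Ab']; apply/funext => v; apply: l2_ext => i.
    rewrite /= !mxopE.
    under [RHS]eq_bigr => k _.
      rewrite mxopE linear_sum'; last exact: fl.
      over.
    rewrite exchange_big /=; apply: eq_bigr => j _.
    rewrite ent_comp; last exact: bop_lin.
    rewrite (linear_on_sum sA lf); last by move=> k _; exact: Ac.
    by rewrite sumfE; apply: eq_bigr => k _; rewrite fM.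
  - move=> a b [ba Aa] [bb Ab'] ab; apply: mxop_adjoint => i j; apply: fadj => // u v.
    by rewrite /ent -inner_dlr ab inner_dl.
suff e : mxop (fun i j => f (x i j)) = g (mxop x) by rewrite /mxle e.
congr mxop; apply/funext => i; apply/funext => j.
by congr f; apply/funext => v; rewrite ent_mxop.
Qed.

Lemma star_ople (f : (H -> H) -> (H -> H)) (a : H -> H) (M : R) :
  star_automorphism A f -> 0 <= M -> A a -> ople a M -> ople (f a) M.
Proof.
move=> [[fA _ _] lf fM fadj] M0 Aa aM.
exact: (@star_contractive R _ _ A f).
Qed.

End MatrixAlgebra.

(** * The reduced crossed product *)

Section BopSums.
Variables (R : realType) (H : hilbertType R).
Implicit Types x y : H -> H.

Lemma bop_add x y : bop H x -> bop H y -> bop H (x + y).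
Proof. by move=> bx by_; have := bop_scaleD 1 bx by_; rewrite scale1r. Qed.

Lemma bop_sub x y : bop H x -> bop H y -> bop H (x - y).
Proof. by move=> bx by_; have := bop_scaleD (-1) by_ bx; rewrite scaleN1r addrC. Qed.

End BopSums.

Section MoreSections.
Variables (R : realType) (J : choiceType) (V : hilbertType R).

Lemma ople_halves (W U : normedModType R[i]) (x : W -> U) (e : R) :
  ople x (e / 2 + e / 2) -> ople x e.
Proof. by apply: ople_mon; lra. Qed.

Lemma ople_inj (W : hilbertType R) (x y : V -> W) : ople (x - y) 0 -> x = y.
Proof.
move=> xy; apply/funext => v; apply/eqP; rewrite -subr_eq0; apply/eqP/nrm_eq0/eqP.
by rewrite eq_le nrm_ge0 andbT; have := xy v; rewrite mul0r.
Qed.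

Lemma mxle_sec (I : finType) (x : I -> I -> l2 J V -> l2 J V) (M : R) : 0 <= M ->
  (forall i j, linear (x i j)) -> mxle x M -> secle (fun i j => ent (x i j)) M.
Proof.
move=> M0 lx /(mxleP _ M0) xM s us xi.
pose z j : l2 J V := \sum_(q <- s) dl q (xi j q).
have zE j q : q \in s -> z j q = xi j q.
  move=> qs; rewrite /z (l2sumE R J) (bigD1_seq q) //= dlE eqxx big1 ?addr0 // => k kq.
  by rewrite dlE eq_sym (negPf kq).
have zn j : nrm (z j) ^+ 2 = \sum_(q <- s) nrm (xi j q) ^+ 2.
  have -> : z j = cut s (z j).
    apply: l2_ext => k; rewrite cutE //; case: ifPn => // ks.
    rewrite /z (l2sumE R J) big_seq big1 // => q qs; rewrite dlE; case: eqP => // kq.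
    by rewrite kq qs in ks.
  by rewrite nrm_cut // !big_seq; apply: eq_bigr => q qs; rewrite zE.
have := xM z; under [X in _ <= _ * X -> _]eq_bigr do rewrite zn.
apply: le_trans; apply: ler_sum => i _; apply: le_trans (l2_bessel _ us).
rewrite le_eqVlt; apply/orP; left; apply/eqP; apply: eq_bigr => p _.
congr (nrm _ ^+ 2); rewrite (l2sumE R J); apply: eq_bigr => j _.
by rewrite /z linear_sum' // (l2sumE R J).
Qed.

(** A section sees finitely many entries only, so the matrix that bounds it may change with [s]; for
    an ℓ¹ family it is that of a finite partial sum. *)
Lemma secle_local (I : finType) (x : I -> I -> J -> J -> V -> V) (M : R) :
  (forall s, uniq s -> exists2 y, secle y M &
    forall i j p q v, p \in s -> q \in s -> x i j p q v = y i j p q v) -> secle x M.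
Proof.
move=> h s us xi; have [y yM xy] := h s us; have := yM s us xi.
apply: le_trans; rewrite le_eqVlt; apply/orP; left; apply/eqP.
apply: eq_bigr => i _; rewrite !big_seq; apply: eq_bigr => p ps.
congr (nrm _ ^+ 2); apply: eq_bigr => j _; rewrite !big_seq; apply: eq_bigr => q qs.
exact: xy.
Qed.

Lemma ople_mxle1 (W : hilbertType R) (x : W -> W) (M : R) : 0 <= M ->
  ople x M <-> mxle (fun _ _ : unit => x) M.
Proof.
move=> M0; split => [xM|/(mxleP _ M0) xM v].
  apply/mxleP => // v; rewrite !big_unit -exprMn lerXn2r ?nnegrE ?mulr_ge0 ?nrm_ge0 //.
have := xM (fun=> v); rewrite !big_unit -exprMn ler_sqr ?nnegrE ?mulr_ge0 ?nrm_ge0 //.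
Qed.

Lemma ople_secle (y : l2 J V -> l2 J V) (M : R) : 0 <= M -> bop _ y ->
  secle (fun _ _ : unit => ent y) M -> ople y M.
Proof.
move=> M0 by_ yM; apply/(ople_mxle1 _ M0).
exact: (mxle_secle M0 (fun _ _ => by_) yM).
Qed.

End MoreSections.

Section Crossed.
Variables (R : realType) (G : groupType) (H : hilbertType R).
Variables (A : set (H -> H)) (alpha : G -> (H -> H) -> (H -> H)).
Hypotheses (cA : cstar_algebra A) (dyn : dyn_action A alpha).
Local Notation HH := (l2 G H).
Local Notation lambda := (@lambda_ R G H).
Local Notation pi := (pi_ alpha).

Lemma A_bop a : A a -> bop H a. Proof. by case: cA => h _ _ _ _; exact: h. Qed.
Lemma A_lsub : lsub A. Proof. by case: cA. Qed.
Lemma A_lin a : A a -> linear a. Proof. by move=> /A_bop/bop_lin. Qed.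
Lemma A_comp a b : A a -> A b -> A (a \o b). Proof. by case: cA => _ _ h _ _; exact: h. Qed.
Lemma A_zero : A 0. Proof. by case: A_lsub. Qed.

Lemma A_closed y : linear y -> (forall e : R, 0 < e -> exists2 x, A x & ople (y - x) e) -> A y.
Proof.
move=> ly yA; case: cA => _ _ _ _; apply; split.
  have [x Ax yx] := yA 1 ltr01; have [lx [M M0 xM]] := (bopP x).1 (A_bop Ax).
  apply/bopP; split => //; exists (M + 1); first by rewrite addr_ge0.
  by have := ople_add xM yx; rewrite addrC subrK.
move=> e e0; have [x Ax yx] := yA (e / 2) (divr_gt0 e0 (ltr0Sn _ _)); exists x => //.
apply: (ople_opnorm_lt _ _ _ yx); [|by lra|by lra].
by apply: linear_sub => //; exact: A_lin.
Qed.

Lemma al_star t : star_automorphism A (alpha t). Proof. by case: dyn. Qed.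
Lemma al_A t a : A a -> A (alpha t a). Proof. by case: (al_star t) => -[h _ _] _ _ _; exact: h. Qed.
Lemma al_lin t : linear_on A (alpha t). Proof. by case: (al_star t). Qed.
Lemma al_linear t a : A a -> linear (alpha t a). Proof. by move=> /(al_A t)/A_lin. Qed.
Lemma alM s t a : A a -> alpha (s * t)%g a = alpha s (alpha t a).
Proof. by case: dyn => _; exact. Qed.

Lemma al1 a : A a -> alpha 1%g a = a.
Proof.
move=> Aa; case: (al_star 1%g) => -[_ inj _] _ _ _; apply: inj; rewrite ?inE //.
  exact: al_A.
by rewrite -alM // mulg1.
Qed.

Lemma alKV t a : A a -> alpha t (alpha t^-1%g a) = a.
Proof. by move=> Aa; rewrite -alM // mulgV al1. Qed.

Lemma al0 t : alpha t 0 = 0. Proof. exact: (linear_on0 A_lsub (al_lin t)). Qed.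

Lemma al_ople t a (M : R) : 0 <= M -> A a -> ople a M -> ople (alpha t a) M.
Proof. by move=> M0 Aa; exact: (star_ople cA (al_star t)). Qed.

Lemma al_mxle t (I : finType) (x : I -> I -> H -> H) (M : R) : 0 <= M ->
  (forall i j, A (x i j)) -> mxle x M -> mxle (fun i j => alpha t (x i j)) M.
Proof. by move=> M0 Ax; exact: (star_mxle cA (al_star t)). Qed.

Lemma pi_E a xi s : A a -> pi a xi s = alpha s^-1%g a (xi s).
Proof.
move=> Aa; have [la [M M0 aM]] := (bopP a).1 (A_bop Aa).
rewrite /pi_ to_l2E //; apply: (@to_l2_bounded _ _ _ _ (M * nrm xi)) => r ur.
rewrite exprMn; apply: (@le_trans _ _ (M ^+ 2 * \sum_(i <- r) nrm (xi i) ^+ 2)).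
  rewrite mulr_sumr; apply: ler_sum => i _; rewrite -exprMn.
  by rewrite lerXn2r ?nnegrE ?nrm_ge0 ?mulr_ge0 ?nrm_ge0 // al_ople.
by rewrite ler_wpM2l ?sqr_ge0 // l2_bessel.
Qed.

Lemma lambdaE t xi s : lambda t xi s = xi (t^-1 * s)%g.
Proof. by rewrite lambda_E. Qed.

Lemma lambda_le t xi : nrm (lambda t xi) <= nrm xi.
Proof.
apply: l2_nrm_le; rewrite ?nrm_ge0 // => s us.
under eq_bigr do rewrite lambdaE.
have := @l2_bessel _ _ _ xi [seq (t^-1 * x)%g | x <- s].
by rewrite big_map; apply; rewrite map_inj_uniq // => x y /mulgI.
Qed.

Lemma lambda_linear t : linear (lambda t).
Proof.
move=> c u v; apply: l2_ext => s; rewrite lambdaE.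
by rewrite -[RHS]/(c *: lambda t u s + lambda t v s) !lambdaE.
Qed.

Lemma pi_linear a : A a -> linear (pi a).
Proof.
move=> Aa c u v; apply: l2_ext => s; rewrite pi_E //.
rewrite -[RHS]/(c *: pi a u s + pi a v s) !pi_E //.
exact: (al_linear s^-1%g Aa c (u s) (v s)).
Qed.

(** π(a) is diagonal with blocks α_{s⁻¹}(a), so complete contractivity of the automorphisms is used
    block by block. *)
Lemma pi_mxle (I : finType) (x : I -> I -> H -> H) (M : R) : 0 <= M ->
  (forall i j, A (x i j)) -> mxle x M -> mxle (fun i j => pi (x i j)) M.
Proof.
move=> M0 Ax xM; apply/mxleP => // v; apply: sum_nrm_le.
  by rewrite mulr_ge0 ?sqr_ge0 // sumr_ge0 // => i _; rewrite sqr_ge0.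
move=> s us; rewrite exchange_big /=.
apply: (@le_trans _ _ (\sum_(p <- s) M ^+ 2 * \sum_j nrm (v j p) ^+ 2)).
  apply: ler_sum => p _; have /(mxleP _ M0)/(_ (fun j => v j p)) := al_mxle p^-1%g M0 Ax xM.
  apply: le_trans; rewrite le_eqVlt; apply/orP; left; apply/eqP; apply: eq_bigr => i _.
  by congr (nrm _ ^+ 2); rewrite (l2sumE R G); apply: eq_bigr => j _; rewrite pi_E.
rewrite -mulr_sumr ler_wpM2l ?sqr_ge0 // exchange_big /=.
by apply: ler_sum => j _; exact: l2_bessel.
Qed.

Definition gen (t : G) (a : H -> H) : HH -> HH := pi a \o lambda t.

Lemma genE t a xi s : A a -> gen t a xi s = alpha s^-1%g a (xi (t^-1 * s)%g).
Proof. by move=> Aa; rewrite /gen /= pi_E // lambdaE. Qed.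

Lemma gen_linear t a : A a -> linear (gen t a).
Proof. by move=> Aa; apply: linear_comp; [exact: pi_linear|exact: lambda_linear]. Qed.

(* The matrix (π(α_{p_i} a_ij) λ_{p_i p_j⁻¹}) is diag(λ_{p_i}) (π(a_ij)) diag(λ_{p_j})⁻¹. *)
Lemma gen_mxle (I : finType) (p : I -> G) (x : I -> I -> H -> H) (M : R) : 0 <= M ->
  (forall i j, A (x i j)) -> mxle x M ->
  mxle (fun i j => gen (p i * (p j)^-1)%g (alpha (p i) (x i j))) M.
Proof.
move=> M0 Ax xM; apply/mxleP => // v.
have /(mxleP _ M0)/(_ (fun j => lambda (p j)^-1%g (v j))) h := pi_mxle M0 Ax xM.
have {}h := le_trans h (ler_wpM2l (sqr_ge0 M) (ler_sum _ _)).
apply: le_trans (h _ _); last first.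
  by move=> j _; rewrite lerXn2r ?nnegrE ?nrm_ge0 ?lambda_le.
apply: ler_sum => i _.
set a := \sum_j _; set b := \sum_j _.
suff -> : a = lambda (p i) b.
  have := lambda_le (p i) b; have := nrm_ge0 (lambda (p i) b); have := nrm_ge0 b.
  by move: (nrm b) (nrm _) => u w u0 w0 wu; rewrite lerXn2r ?nnegrE.
apply: l2_ext => s; rewrite lambdaE /a /b.
rewrite (l2sumE R G) [RHS](l2sumE R G); apply: eq_bigr => j _.
rewrite genE; last exact: al_A.
rewrite pi_E // lambdaE invgM !invgK.
by rewrite mulgA -(alM s^-1%g) // invgM invgK.
Qed.

Lemma gen_ople t a (M : R) : 0 <= M -> A a -> ople a M -> ople (gen t a) M.
Proof.
move=> M0 Aa aM v; apply: (@le_trans _ _ (M * nrm (lambda t v))); last first.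
  by rewrite ler_wpM2l // lambda_le.
have h := pi_mxle M0 (fun _ _ => Aa) ((ople_mxle1 a M0).1 aM).
exact: ((ople_mxle1 (pi a) M0).2 h (lambda t v)).
Qed.

Lemma gen_bop t a : A a -> bop HH (gen t a).
Proof.
move=> Aa; have [la [M M0 aM]] := (bopP a).1 (A_bop Aa).
by apply/bopP; split; [exact: gen_linear|exists M => //; exact: gen_ople].
Qed.

Lemma ent_gen t a p q v : A a ->
  ent (gen t a) p q v = if t == (p * q^-1)%g then alpha p^-1%g a v else 0.
Proof.
move=> Aa; rewrite /ent genE // dlE.
have -> : (t^-1 * p == q)%g = (t == p * q^-1)%g.
  by apply/eqP/eqP => [<-|->]; rewrite invgM invgK ?mulgA ?mulgV ?mul1g // -mulgA mulVg mulg1.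
by case: eqP => // _; rewrite linear0' //; exact: al_linear.
Qed.

Lemma genZD t c a b : A a -> A b -> gen t (c *: a + b) = c *: gen t a + gen t b.
Proof.
move=> Aa Ab; apply/funext => xi; apply: l2_ext => s.
rewrite -[RHS]/(c *: gen t a xi s + gen t b xi s) !genE //.
  by rewrite al_lin.
by case: A_lsub => _; apply.
Qed.

Definition pps (E : seq G) (f : G -> H -> H) : HH -> HH := \sum_(t <- E) gen t (f t).

Lemma pps_bop E f : (forall t, A (f t)) -> bop HH (pps E f).
Proof.
move=> Af; rewrite /pps; elim/big_rec: _ => [|t y _ by_]; first exact: bop0.
exact: (bop_add (gen_bop t (Af t)) by_).
Qed.

Lemma ent_pps E f p q v : (forall t, A (f t)) -> uniq E ->
  ent (pps E f) p q v = if (p * q^-1)%g \in E then alpha p^-1%g (f (p * q^-1)%g) v else 0.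
Proof.
move=> Af uE; rewrite /ent /pps sumfE (l2sumE R G).
under eq_bigr do rewrite -[l2val _ p]/(ent (gen _ _) p q v) ent_gen //.
case: ifPn => pE.
  by rewrite (bigD1_seq _ pE) //= eqxx big1 ?addr0 // => t /negPf ->.
rewrite big_seq big1 // => t tE; case: eqP => // te; by rewrite -te tE in pE.
Qed.

Lemma pps_ople E f (n : G -> R) : (forall t, A (f t)) -> (forall t, 0 <= n t) ->
  (forall t, ople (f t) (n t)) -> ople (pps E f) (\sum_(t <- E) n t).
Proof. by move=> Af n0 fn; apply: ople_fsum => t _; exact: gen_ople. Qed.

(** The Fourier coefficient of degree [t]. The (p, q) entry of Σ π(a_t)λ_t is α_{p⁻¹}(a_{pq⁻¹}), so
    the row p = 1 shows the coefficients untwisted. The definition makes sense for every operator on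
    ℓ²(G, H). *)
Definition fc (y : HH -> HH) (t : G) : H -> H := ent y 1%g t^-1%g.

Lemma fc_pps E f t : (forall t, A (f t)) -> uniq E ->
  fc (pps E f) t = if t \in E then f t else 0.
Proof.
move=> Af uE; apply/funext => v; rewrite /fc ent_pps // invgK mul1g invg1 al1 //.
by case: ifP.
Qed.

Section L1.
Variable f : G -> H -> H.
Hypothesis f1 : l1_space A f.

Lemma l1_norms : exists n : G -> R, exists2 N : R, 0 <= N &
  [/\ forall t, 0 <= n t, forall t, ople (f t) (n t),
    forall s, uniq s -> \sum_(t <- s) n t <= N &
    forall e : R, 0 < e -> exists2 s0, uniq s0 &
      forall s, uniq s -> (forall t, t \in s -> t \notin s0) -> \sum_(t <- s) n t <= e].
Proof.
have [Af foo] := f1.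
have lf t : linear (f t) by exact: A_lin.
pose n t := fine (opnorm (f t)).
have nE t : (n t)%:E = opnorm (f t).
  rewrite /n fineK // ge0_fin_numE ?opnorm_ge0 //.
  by have [_] := A_bop (Af t).
have n0 t : 0 <= n t by rewrite fine_ge0 ?opnorm_ge0.
have aoo : (asum n < +oo)%E.
  by rewrite /asum (eq_esum (b := fun t => opnorm (f t))).
exists n, (fine (asum n)); first by rewrite fine_ge0 ?asum_ge0.
have sN s : uniq s -> \sum_(t <- s) n t <= fine (asum n).
  by move=> us; rewrite -lee_fin asum_fin // asum_ge_seq.
split=> // [t|e e0]; first by apply/opnormP; rewrite ?nE.
apply: contrapT => h.
suff : (asum n <= (fine (asum n) - e)%:E)%E.
  by rewrite -{1}asum_fin // lee_fin; lra.
apply: le_asum_seq => // s us; rewrite leNgt; apply/negP => lt; apply: h.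
exists s => // r ur rs.
have := sN (s ++ r); rewrite cat_uniq us ur andbT big_cat /=.
have -> : ~~ has (mem s) r by apply/hasPn => k /rs.
by move=> /(_ isT); lra.
Qed.

(** The sum is built from its matrix: each finite section coincides with that of a finite sum
    [pps D f], whose norm is at most the ℓ¹ norm. The same comparison, with the degrees in [E]
    removed, bounds the tail. *)
Lemma l1_opsum : exists T : HH -> HH, is_opsum (fun s => pi (f s) \o lambda s) T.
Proof.
have [Af _] := f1.
have [n [N N0 [n0 fn nN tail]]] := l1_norms.
pose x p q := alpha p^-1%g (f (p * q^-1)%g).
have lx p q : linear (x p q) by exact: al_linear.
have loc (E : seq G) s (M : R) : uniq s -> uniq E -> 0 <= M ->
    (forall r, uniq r -> (forall t, t \in r -> t \notin E) -> \sum_(t <- r) n t <= M) ->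
  exists2 y : unit -> unit -> G -> G -> H -> H, secle y M &
    forall i j p q v, p \in s -> q \in s ->
      (if (p * q^-1)%g \in E then 0 else x p q v) = y i j p q v.
  move=> us uE M0 h.
  pose D := [seq t <- undup [seq (p * q^-1)%g | p <- s, q <- s] | t \notin E].
  have uD : uniq D by rewrite filter_uniq // undup_uniq.
  exists (fun _ _ => ent (pps D f)).
    apply: (@mxle_sec R G H unit (fun _ _ => pps D f)) => //.
      by move=> _ _; apply/bop_lin/pps_bop.
    apply: (ople_mxle1 (pps D f) M0).1; apply: (ople_mon _ (pps_ople D Af n0 fn)).
    by apply: h => // t; rewrite mem_filter => /andP[].
  move=> _ _ p q v ps qs; rewrite ent_pps // mem_filter mem_undup.
  have -> : (p * q^-1)%g \in [seq (p * q^-1)%g | p <- s, q <- s].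
    by apply/allpairsP; exists (p, q).
  by rewrite andbT; case: ifP.
have [|T [lT TN TE]] := @matrix_op R G H x N N0 lx.
  apply: secle_local => s us.
  have [y yM yE] := loc [::] s N us isT N0 (fun r ur _ => nN r ur).
  by exists y => // i j p q v ps qs; rewrite -(yE i j).
exists T; split; first by apply/bopP; split => //; exists N.
move=> e e0; have e2 : 0 < e / 2 by lra.
have [s0 us0 s0P] := tail _ e2.
exists [fset t in s0]%fset => E /fsubsetP sE.
have bT : bop HH T by apply/bopP; split => //; exists N.
have bS : bop HH (T - pps E f).
  exact: (bop_sub bT (pps_bop _ Af)).
apply: (ople_opnorm_lt (M := e / 2)); [exact: bop_lin|lra|lra|].
apply: ople_secle => //; first by lra.
apply: secle_local => s us.
have [|y yM yE] := loc E s (e / 2) us (fset_uniq E) (ltW e2).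
  move=> r ur rE; apply: s0P => // t tr; apply: contra (rE t tr) => ts0.
  by apply: sE; rewrite in_fset.
exists y => // i j p q v ps qs; rewrite -(yE i j p q v ps qs).
rewrite -[LHS]/(ent T p q v - ent (pps E f) p q v) TE ent_pps ?fset_uniq //.
by case: ifP => _; rewrite ?subrr ?subr0.
Qed.

Lemma pi_tilde_opsum : is_opsum (fun s => pi (f s) \o lambda s) (pi_tilde alpha f).
Proof. by have [T TS] := l1_opsum; exact: (xgetPex 0 (ex_intro _ T TS)). Qed.

Lemma pi_tilde_bop : bop HH (pi_tilde alpha f).
Proof. by case: pi_tilde_opsum. Qed.

Lemma ent_pi_tilde p q v : ent (pi_tilde alpha f) p q v = alpha p^-1%g (f (p * q^-1)%g) v.
Proof.
have [Af _] := f1; have [bT TE] := pi_tilde_opsum.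
suff -> : ent (pi_tilde alpha f) p q = alpha p^-1%g (f (p * q^-1)%g) by [].
apply: ople_inj; apply: ople_eps => e e0; rewrite add0r.
have [E0 E0P] := TE _ e0.
pose E := (E0 `|` [fset (p * q^-1)%g])%fset.
have := E0P E (fsubsetUl _ _).
have bS : bop HH (pi_tilde alpha f - pps E f).
  exact: (bop_sub bT (pps_bop _ Af)).
move=> /(opnorm_lt_ople (bop_lin bS))/(ent_ople p q (ltW e0)) h.
suff -> : ent (pi_tilde alpha f) p q - alpha p^-1%g (f (p * q^-1)%g) =
  ent (pi_tilde alpha f - pps E f) p q by [].
apply/funext => w; rewrite -[RHS]/(ent (pi_tilde alpha f) p q w - ent (pps E f) p q w).
by rewrite ent_pps ?fset_uniq // in_fsetU in_fset1 eqxx orbT.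
Qed.

End L1.

Definition ffin (E : seq G) (f : G -> H -> H) (t : G) : H -> H := if t \in E then f t else 0.

Lemma ffin_l1 E f : (forall t, A (f t)) -> l1_space A (ffin E f).
Proof.
move=> Af; have Aff t : A (ffin E f t) by rewrite /ffin; case: ifP => // _; exact: A_zero.
split=> //.
have fin t : exists2 M : R, 0 <= M & ople (f t) M by have /bopP[] := A_bop (Af t).
pose n t := projT1 (cid2 (fin t)).
have n0 t : 0 <= n t by rewrite /n; case: cid2.
have fn t : ople (f t) (n t) by rewrite /n; case: cid2.
apply: (@le_lt_trans _ _ (asum (fun t => if t \in E then n t else 0))).
  apply: le_esum => t _; apply/opnormP; first exact: A_lin.
    by case: ifP.
  by rewrite /ffin; case: ifP => // _; exact: ople_zero.
apply: (@le_lt_trans _ _ (\sum_(t <- undup E) n t)%:E); last by rewrite ltry.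
apply: le_asum_seq => [t|s us]; first by case: ifP.
rewrite -big_mkcond /= -big_filter.
apply: (@le_trans _ _ (\sum_(t <- [seq t <- undup E | t \in s]) n t)).
  rewrite le_eqVlt; apply/orP; left; apply/eqP; apply: perm_big.
  apply: uniq_perm; rewrite ?filter_uniq ?undup_uniq // => t.
  by rewrite !mem_filter mem_undup andbC.
by rewrite big_filter [leRHS](bigID (mem s)) /= lerDl sumr_ge0.
Qed.

Lemma pi_tilde_ffin E f : (forall t, A (f t)) -> uniq E -> pi_tilde alpha (ffin E f) = pps E f.
Proof.
move=> Af uE; have l1 := ffin_l1 E Af.
apply: ent_ext => [||p q v]; [exact: pi_tilde_bop|exact: pps_bop|].
rewrite ent_pi_tilde // ent_pps // /ffin; case: ifP => // _.
by rewrite al0.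
Qed.

Local Notation X := (crossed A alpha).

(** Tails of ℓ¹ families are small, so the finite sums [pps] are already dense; density arguments in
    the crossed product start from them. *)
Lemma crossedP y : X y <-> bop HH y /\ forall e : R, 0 < e ->
  exists E f, [/\ uniq E, forall t, A (f t) & ople (y - pps E f) e].
Proof.
split=> [[by_ yc]|[by_ yc]]; split=> // e e0.
  have e2 : 0 < e / 2 by lra.
  have [_ [f f1 <-] yf] := yc _ e2; have [Af _] := f1.
  have [bT TE] := pi_tilde_opsum f1.
  have [E0 /(_ E0 (fsubset_refl _)) E0P] := TE _ e2.
  exists E0, f; split => //; first exact: fset_uniq.
  have -> : y - pps E0 f = (y - pi_tilde alpha f) + (pi_tilde alpha f - pps E0 f).
    by rewrite addrA subrK.
  apply: ople_halves.
  have lp : linear (pps E0 f) by apply/bop_lin/pps_bop.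
  apply: ople_add; apply: opnorm_lt_ople => //; apply: linear_sub => //; exact: bop_lin.
have e2 : 0 < e / 2 by lra.
have [E [f [uE Af yE]]] := yc _ e2; exists (pps E f).
  by exists (ffin E f); [exact: ffin_l1|exact: pi_tilde_ffin].
apply: (ople_opnorm_lt _ _ _ yE); [|lra|lra].
by apply: linear_sub; apply: bop_lin => //; exact: pps_bop.
Qed.

Lemma crossed_bop : X `<=` bop HH. Proof. by move=> y []. Qed.
Lemma crossed_lin y : X y -> linear y. Proof. by move=> /crossed_bop/bop_lin. Qed.

Lemma crossed_pps E f : uniq E -> (forall t, A (f t)) -> X (pps E f).
Proof.
move=> uE Af; apply/crossedP; split; first exact: pps_bop.
move=> e e0; exists E, f; split=> //; rewrite subrr; apply: ople_mon (ltW e0) _.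
exact: ople_zero.
Qed.

Lemma pps1 t f : pps [:: t] f = gen t (f t).
Proof. by rewrite /pps big_seq1. Qed.

Lemma crossed_gen t a : A a -> X (gen t a).
Proof.
by move=> Aa; rewrite -(pps1 t (fun=> a)); exact: crossed_pps.
Qed.

Lemma ppsZD E E' f f' c : uniq E -> uniq E' -> (forall t, A (f t)) -> (forall t, A (f' t)) ->
  c *: pps E f + pps E' f' = pps (undup (E ++ E')) (fun t => c *: ffin E f t + ffin E' f' t).
Proof.
move=> uE uE' Af Af'.
have Aff : forall t, A (ffin E f t) by move=> t; rewrite /ffin; case: ifP => // _; exact: A_zero.
have Aff' : forall t, A (ffin E' f' t) by move=> t; rewrite /ffin; case: ifP => // _; exact: A_zero.
have AA t : A (c *: ffin E f t + ffin E' f' t) by case: A_lsub => _; apply.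
apply: ent_ext => [||p q v].
- by apply: bop_scaleD; exact: pps_bop.
- exact: pps_bop.
rewrite -[LHS]/(c *: ent (pps E f) p q v + ent (pps E' f') p q v) !ent_pps ?undup_uniq //.
rewrite mem_undup mem_cat al_lin // /ffin.
rewrite -[(c *: _ + _) v]/(c *: _ v + _ v).
case: (_ \in E); case: (_ \in E') => //=; rewrite ?al0 ?scaler0 ?add0r ?addr0 //.
Qed.

Lemma crossed_lsub : lsub X.
Proof.
split.
  by have := @crossed_pps [::] (fun=> 0) isT (fun=> A_zero); rewrite /pps big_nil.
move=> c a b /crossedP[ba ha] /crossedP[bb hb]; apply/crossedP; split.
  exact: bop_scaleD.
move=> e e0; have c0 : 0 <= complex.Re `|c| by rewrite -ler0c complex_normE.
pose d := e / (complex.Re `|c| + 1); have d0 : 0 < d by rewrite divr_gt0 //; lra.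
have [E [f [uE Af aE]]] := ha _ d0; have [E' [f' [uE' Af' bE]]] := hb _ d0.
exists (undup (E ++ E')), (fun t => c *: ffin E f t + ffin E' f' t).
have Aff : forall t, A (ffin E f t) by move=> t; rewrite /ffin; case: ifP => // _; exact: A_zero.
have Aff' : forall t, A (ffin E' f' t) by move=> t; rewrite /ffin; case: ifP => // _; exact: A_zero.
split; first exact: undup_uniq.
  by move=> t; case: A_lsub => _; apply.
rewrite -ppsZD // opprD addrACA -scalerBr.
have -> : e = complex.Re `|c| * d + d by rewrite /d; field; rewrite gt_eqF //; lra.
by apply: ople_add => //; exact: ople_scale.
Qed.

Lemma crossed_closed y : linear y ->
  (forall e : R, 0 < e -> exists2 x, X x & ople (y - x) e) -> X y.
Proof.
move=> ly yX; apply/crossedP; split.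
  have [x Xx yx] := yX 1 ltr01; have [lx [M M0 xM]] := (bopP x).1 (crossed_bop Xx).
  apply/bopP; split => //; exists (M + 1); first by rewrite addr_ge0.
  by have := ople_add xM yx; rewrite addrC subrK.
move=> e e0; have e2 : 0 < e / 2 by lra.
have [x /crossedP[bx xc] yx] := yX _ e2; have [E [f [uE Af xE]]] := xc _ e2.
exists E, f; split=> //; have -> : y - pps E f = (y - x) + (x - pps E f) by rewrite addrA subrK.
by apply: ople_halves; exact: ople_add.
Qed.

Lemma crossed_fc y t : X y -> A (fc y t).
Proof.
move=> /crossedP[by_ yc]; apply: A_closed; first by apply: ent_linear; exact: bop_lin.
move=> e e0; have [E [f [uE Af yE]]] := yc _ e0; exists (ffin E f t).
  by rewrite /ffin; case: ifP => // _; exact: A_zero.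
rewrite /ffin -fc_pps //.
exact: (@ent_ople _ _ _ (y - pps E f) 1%g t^-1%g e (ltW e0) yE).
Qed.

(** Holds for finite sums and survives norm limits. It makes an element of the crossed product
    determined by its coefficients, as [crossed_ext] records. *)
Lemma crossed_ent y p q : X y -> ent y p q = alpha p^-1%g (fc y (p * q^-1)%g).
Proof.
move=> Xy; have := Xy => /crossedP[by_ yc]; apply: ople_inj; apply: ople_eps => e e0.
have e2 : 0 < e / 2 by lra.
have [E [f [uE Af yE]]] := yc _ e2; rewrite add0r.
have Aff t : A (ffin E f t) by rewrite /ffin; case: ifP => // _; exact: A_zero.
have -> : ent y p q - alpha p^-1%g (fc y (p * q^-1)%g) =
    ent (y - pps E f) p q - alpha p^-1%g (fc y (p * q^-1)%g - ffin E f (p * q^-1)%g).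
  rewrite (linear_onB A_lsub (al_lin _) (crossed_fc _ Xy) (Aff _)).
  apply/funext => v.
  rewrite -[RHS]/(ent y p q v - ent (pps E f) p q v - (alpha _ _ v - alpha _ _ v)).
  rewrite ent_pps // /ffin; case: ifP => _; rewrite ?al0 ?subr0.
    by rewrite opprB addrA subrK.
  by [].
apply: ople_halves.
apply: ople_sub; first by apply: ent_ople; rewrite ?ltW.
apply: al_ople; first exact: ltW.
  by apply: (lsubB A_lsub) => //; exact: crossed_fc.
rewrite /ffin -fc_pps //.
exact: (@ent_ople _ _ _ (y - pps E f) 1%g _ (e / 2) (ltW e2) yE).
Qed.

Lemma crossed_ext y z : X y -> X z -> (forall t, fc y t = fc z t) -> y = z.
Proof.
move=> Xy Xz yz; apply: ent_ext => [||p q v]; [exact: crossed_bop..|].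
by rewrite !crossed_ent // yz.
Qed.

Lemma pi_tilde_crossed f : l1_space A f -> X (pi_tilde alpha f).
Proof.
move=> f1; split; first exact: pi_tilde_bop.
move=> e e0; exists (pi_tilde alpha f); first by exists f.
rewrite subrr; apply: (@ople_opnorm_lt _ _ _ 0) => //; first exact: linear_zero.
exact: ople_zero.
Qed.

Lemma fc_pi_tilde f t : l1_space A f -> fc (pi_tilde alpha f) t = f t.
Proof.
move=> f1; apply/funext => v; rewrite /fc ent_pi_tilde // invg1 al1; last by case: f1.
by rewrite invgK mul1g.
Qed.

End Crossed.

(** * Schur multipliers and transference *)

Lemma cbnorm_le (R : realType) (H L : hilbertType R) (X : set (H -> H))
    (Psi : (H -> H) -> (L -> L)) (M : R) : X `<=` bop H ->
  (forall x, X x -> linear (Psi x)) -> 0 <= M -> cble X Psi M -> (cbnorm X Psi <= M%:E)%E.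
Proof.
move=> Xb lin M0 cM; apply: ge_ereal_sup => _ [m [x [Xx x1 ->]]].
apply/mxnormP => //; first by move=> i j; rewrite mxE; exact: lin.
have := cM _ (fun i j => x i j) 1 (fun i j => Xx i j) ltr01.
rewrite mulr1 => h; apply: eq_mxle (h _).
  by move=> i j v; rewrite mxE.
by apply/mxnormP => // i j; apply: bop_lin; exact: Xb.
Qed.

Lemma frac_le (R : realType) (c e : R) : 0 <= c -> 0 <= e -> c * (e / (c + 1)) <= e.
Proof. by move=> c0 e0; rewrite mulrCA ler_piMr // ler_pdivrMr; lra. Qed.

Section EntrywiseMaps.
Variables (R : realType) (J : choiceType) (H : hilbertType R) (A : set (H -> H)).
Hypothesis sA : lsub A.
Implicit Types (phi : J -> J -> (H -> H) -> (H -> H)).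

(** The points [p] may repeat, and repetition encodes amplification by matrices. This one condition
    on finite matrices over [A] therefore controls the cb-norms of both S_φ and, for φ = N(F), S_F,
    and lets the two be compared. The arguments of [phi] are swapped because S_φ applies φ(q, p) to
    the entry x_{p,q}. *)
Definition schur_bd phi (M : R) : Prop :=
  forall (I : finType) (p : I -> J) (a : I -> I -> H -> H) (N : R),
    (forall i j, A (a i j)) -> 0 < N -> mxle a N ->
    mxle (fun i j => phi (p j) (p i) (a i j)) (M * N).

Definition matA (x : l2 J H -> l2 J H) : Prop := bop (l2 J H) x /\ forall p q, A (ent x p q).

(** Defined on all operators with entries in [A], a domain that contains both the crossed product
    and B(ℓ²(G)) ⊗_min A. *)
Definition smap phi (x : l2 J H -> l2 J H) : l2 J H -> l2 J H :=
  xget 0 [set y | bop (l2 J H) y /\ forall p q, ent y p q = phi q p (ent x p q)].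

Section Smap.
Variables (phi : J -> J -> (H -> H) -> (H -> H)) (M : R).
Hypotheses (M0 : 0 <= M) (bphi : schur_bd phi M).
Hypothesis lphi : forall q p, linear_on A (phi q p).
Hypothesis linphi : forall q p a, A a -> linear (phi q p a).

Let secphi (I : finType) (x : I -> I -> l2 J H -> l2 J H) (N : R) : 0 < N ->
  (forall i j, matA (x i j)) -> mxle x N ->
  secle (fun i j p q => phi q p (ent (x i j) p q)) (M * N).
Proof.
move=> N0 Ax xN; apply: secle_mxle_fin; first by rewrite mulr_ge0 // ltW.
move=> n p ip.
have h := @mxle_compress R H I J (I * 'I_n)%type x N fst (fun a => p a.2) (ltW N0).
apply: (bphi (fun a => p a.2) (a := fun a b => ent (x a.1 b.1) (p a.2) (p b.2))) => //.
  by move=> a b; case: (Ax a.1 b.1).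
apply: h => //; first by move=> i j; case: (Ax i j) => /bop_lin.
by move=> [a1 a2] [b1 b2] /= -> /ip ->.
Qed.

Lemma smapP x : matA x -> bop (l2 J H) (smap phi x) /\
  forall p q, ent (smap phi x) p q = phi q p (ent x p q).
Proof.
move=> Ax; have [bx Aent] := Ax; have [lx [N N0 xN]] := (bopP x).1 bx.
have N1 : 0 < N + 1 by lra.
have xN1 : ople x (N + 1) by apply: (ople_mon _ xN); lra.
have MN : 0 <= M * (N + 1) by rewrite mulr_ge0 // ltW.
have := secphi N1 (fun _ _ => Ax) ((ople_mxle1 x (ltW N1)).1 xN1).
move=> /(matrix_op MN)[|y [ly yM yE]]; first by move=> p q; apply: linphi.
have : exists y, bop (l2 J H) y /\ forall p q, ent y p q = phi q p (ent x p q).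
  exists y; split; first by apply/bopP; split=> //; exists (M * (N + 1)).
  by move=> p q; apply/funext => v; exact: yE.
by move=> /(xgetPex 0).
Qed.

Lemma smap_mxle (I : finType) (x : I -> I -> l2 J H -> l2 J H) (N : R) : 0 < N ->
  (forall i j, matA (x i j)) -> mxle x N ->
  mxle (fun i j => smap phi (x i j)) (M * N).
Proof.
move=> N0 Ax xN; apply: mxle_secle; first by rewrite mulr_ge0 // ltW.
  by move=> i j; case: (smapP (Ax i j)).
have := secphi N0 Ax xN; congr (secle _ _).
apply/funext => i; apply/funext => j; apply/funext => p; apply/funext => q.
by have [_ ->] := smapP (Ax i j).
Qed.

Lemma smapZD c x y : matA x -> matA y -> smap phi (c *: x + y) = c *: smap phi x + smap phi y.
Proof.
move=> Ax Ay; have [bx Aex] := Ax; have [by_ Aey] := Ay.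
have Axy : matA (c *: x + y).
  split; first exact: bop_scaleD.
  move=> p q; rewrite -[ent _ p q]/(c *: ent x p q + ent y p q).
  by case: sA => _; apply.
have [b1 e1] := smapP Axy; have [b2 e2] := smapP Ax; have [b3 e3] := smapP Ay.
apply: (ent_ext b1 (bop_scaleD c b2 b3)) => p q v.
rewrite e1 -[RHS]/(c *: ent (smap phi x) p q v + ent (smap phi y) p q v) e2 e3.
by rewrite -[ent (c *: x + y) p q]/(c *: ent x p q + ent y p q) lphi.
Qed.

End Smap.

End EntrywiseMaps.

Section Schur.
Variables (R : realType) (G : groupType) (H : hilbertType R).
Variables (A : set (H -> H)) (alpha : G -> (H -> H) -> (H -> H)).
Hypotheses (cA : cstar_algebra A) (dyn : dyn_action A alpha).
Local Notation HH := (l2 G H).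
Local Notation X := (crossed A alpha).
Local Notation gen := (gen alpha).
Implicit Types (phi : G -> G -> (H -> H) -> (H -> H)) (F : G -> (H -> H) -> (H -> H)).

Lemma crossed_matA x : X x -> matA A x.
Proof.
move=> Xx; split; first exact: crossed_bop Xx.
by move=> p q; rewrite (crossed_ent cA dyn _ _ Xx); apply/(al_A dyn)/(crossed_fc cA dyn).
Qed.

Lemma N_E F q p a : A a ->
  N_ alpha F q p a = alpha p^-1%g (F (p * q^-1)%g (alpha p a)).
Proof. by []. Qed.

(** Apply Psi to the matrix of [gen_mxle] and compress to the entries at (p_i, p_j): this yields
    N(F). Only the coefficient of degree t of Psi(π(a)λ_t) matters, so Psi need not come from a
    multiplier. [X0] is left free because the map of a Herz-Schur multiplier is at first given on
    the image of ℓ¹ only. *)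
Lemma transference (X0 : set (HH -> HH)) (Psi : (HH -> HH) -> (HH -> HH)) F (M : R) :
  0 <= M -> cble X0 Psi M -> (forall t a, A a -> X0 (gen t a)) ->
  (forall t a, A a -> X (Psi (gen t a)) /\ fc (Psi (gen t a)) t = F t a) ->
  schur_bd A (N_ alpha F) M.
Proof.
move=> M0 cM Xg PF I p a N Aa N0 aN.
have MN : 0 <= M * N by rewrite mulr_ge0 // ltW.
have h1 := gen_mxle cA dyn p (ltW N0) Aa aN.
have AA i j : A (alpha (p i) (a i j)) by exact: (al_A dyn).
have h2 := cM _ _ N (fun i j => Xg _ _ (AA i j)) N0 h1.
have h3 := @mxle_compress R H I G I _ (M * N) id p MN _ h2.
have h4 : mxle (fun k l => ent (Psi (gen (p k * (p l)^-1)%g (alpha (p k) (a k l)))) (p k) (p l)) (M * N).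
  apply: h3 => // i j; apply: (crossed_lin (A := A) (alpha := alpha)).
  by have [] := PF (p i * (p j)^-1)%g _ (AA i j).
apply: eq_mxle h4 => i j v.
have [XP fP] := PF (p i * (p j)^-1)%g _ (AA i j).
by rewrite (crossed_ent cA dyn _ _ XP) fP.
Qed.

Section NF.
Variable F : G -> (H -> H) -> (H -> H).
Hypothesis bF : bounded_CB A F.

Lemma F_A t a : A a -> A (F t a).
Proof. by move=> Aa; case: bF => /(_ t)[h _ _] _; exact: h. Qed.

Lemma F_lin t : linear_on A (F t).
Proof. by case: bF => /(_ t)[_ h _] _. Qed.

Lemma F_bound : exists2 c : R, 0 <= c & forall t, cble A (F t) c.
Proof.
case: bF => CBF [c cP].
have c0 : 0 <= c.
  rewrite -lee_fin; apply: le_trans (cP 1%g); apply: cbnorm_ge0; first exact: (A_zero cA).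
  by apply: (A_lin cA); apply: F_A; exact: (A_zero cA).
exists c => // t; apply/cbnormP => //.
- exact: (A_lsub cA).
- by move=> a; exact: (A_bop cA).
- exact: F_lin.
- by move=> a Aa; apply: (A_lin cA); exact: F_A.
Qed.

Lemma N_A q p a : A a -> A (N_ alpha F q p a).
Proof. by move=> Aa; apply: (al_A dyn); apply: F_A; exact: (al_A dyn). Qed.

Lemma N_lin q p : linear_on A (N_ alpha F q p).
Proof.
move=> c a b Aa Ab; rewrite /N_ (al_lin dyn) // F_lin ?(al_lin dyn) //.
- by apply: F_A; exact: (al_A dyn).
- by apply: F_A; exact: (al_A dyn).
- exact: (al_A dyn).
- exact: (al_A dyn).
Qed.

Lemma N_linear q p a : A a -> linear (N_ alpha F q p a).
Proof. by move=> Aa; apply: (A_lin cA); exact: N_A. Qed.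

Lemma F_ople t a (c N : R) : 0 <= c -> 0 <= N -> (forall t, cble A (F t) c) -> A a ->
  ople a N -> ople (F t a) (c * N).
Proof.
move=> c0 N0 cP Aa aN; apply: ople_eps => e e0.
have d0 : 0 < e / (c + 1) by rewrite divr_gt0 //; lra.
have nd : 0 < N + e / (c + 1) by lra.
have h := @cble_ople R H H A (F t) c _ a _ _ c0 nd (cP t) Aa.
apply: (ople_mon _ (h _ _ _)).
- by rewrite mulrDr lerD2l; exact: frac_le (ltW e0).
- by move=> b; exact: (A_bop cA).
- by move=> b Ab; apply: (A_lin cA); exact: F_A.
- by apply: (ople_mon _ aN); lra.
Qed.

Lemma multf_l1 f : l1_space A f -> l1_space A (multf F f).
Proof.
move=> f1; have [Af _] := f1.
have [n [N N0 [n0 fn nN _]]] := l1_norms cA f1.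
have [c c0 cP] := F_bound.
split; first by move=> t; exact: F_A.
apply: (@le_lt_trans _ _ (c * N)%:E); last by rewrite ltry.
apply: (@le_trans _ _ (asum (fun t => c * n t))).
  apply: le_esum => t _; apply/opnormP; rewrite ?mulr_ge0 //.
    by apply: (A_lin cA); exact: F_A.
  exact: F_ople.
apply: le_asum_seq => [t|s us]; first by rewrite mulr_ge0.
by rewrite -mulr_sumr ler_wpM2l // nN.
Qed.

Definition pl1 : set (HH -> HH) := pi_tilde alpha @` l1_space A.

Lemma pl1_crossed : pl1 `<=` X.
Proof. by move=> _ [f f1 <-]; exact: (pi_tilde_crossed cA dyn). Qed.

Lemma pl1_gen t a : A a -> pl1 (gen t a).
Proof.
move=> Aa; exists (ffin [:: t] (fun=> a)); first exact: (ffin_l1 cA).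
by rewrite (pi_tilde_ffin cA dyn) // pps1.
Qed.

Lemma fc_gen t a s : A a -> fc (gen t a) s = if s == t then a else 0.
Proof.
by move=> Aa; rewrite -(pps1 alpha t (fun=> a)) (fc_pps cA dyn) // inE.
Qed.

Lemma smap_crossed (M : R) x : 0 <= M -> schur_bd A (N_ alpha F) M -> X x ->
  forall t, fc (smap (N_ alpha F) x) t = F t (fc x t).
Proof.
move=> M0 bN Xx t.
have [_ e] := smapP M0 bN N_linear (crossed_matA Xx).
rewrite /fc e N_E; last by exact: (crossed_fc cA dyn t Xx).
have AF : A (F t (fc x t)) by apply: F_A; exact: (crossed_fc cA dyn t Xx).
by rewrite invg1 mul1g invgK (al1 dyn (crossed_fc cA dyn t Xx)) (al1 dyn AF).
Qed.

Lemma smap_pi_tilde (M : R) f : 0 <= M -> schur_bd A (N_ alpha F) M -> l1_space A f ->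
  smap (N_ alpha F) (pi_tilde alpha f) = pi_tilde alpha (multf F f).
Proof.
move=> M0 bN f1; have Xf := pi_tilde_crossed cA dyn f1.
have [b e] := smapP M0 bN N_linear (crossed_matA Xf).
have [Af _] := f1.
apply: (ent_ext b (pi_tilde_bop cA dyn (multf_l1 f1))) => p q v.
rewrite e (ent_pi_tilde cA dyn (multf_l1 f1)) (_ : ent _ p q = alpha p^-1%g (f (p * q^-1)%g)).
  by rewrite /N_ (alKV dyn).
by apply/funext => w; rewrite (ent_pi_tilde cA dyn).
Qed.

Lemma smap_X (M : R) x : 0 <= M -> schur_bd A (N_ alpha F) M -> X x ->
  X (smap (N_ alpha F) x).
Proof.
move=> M0 bN Xx.
have [b e] := smapP M0 bN N_linear (crossed_matA Xx).
apply: (crossed_closed cA dyn); first exact: bop_lin.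
move=> d d0; have M1 : 0 < d / (M + 1) by rewrite divr_gt0 //; lra.
have [bx xc] := (crossedP cA dyn x).1 Xx.
have [E [f [uE Af xE]]] := xc _ M1.
have f1 := ffin_l1 cA E Af.
exists (smap (N_ alpha F) (pps alpha E f)).
  rewrite -(pi_tilde_ffin cA dyn Af uE) (smap_pi_tilde M0 bN f1).
  by apply: (pi_tilde_crossed cA dyn); exact: multf_l1.
have Xp := crossed_pps cA dyn uE Af.
have Xd := lsubB (crossed_lsub cA dyn) Xx Xp.
have -> : smap (N_ alpha F) x - smap (N_ alpha F) (pps alpha E f) =
    smap (N_ alpha F) (x - pps alpha E f).
  rewrite addrC -scaleN1r -(smapZD (A_lsub cA) M0 bN N_lin N_linear) ?scaleN1r 1?addrC //; exact: crossed_matA.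
have := smap_mxle M0 bN N_linear M1 (fun _ _ => crossed_matA Xd)
  ((ople_mxle1 _ (ltW M1)).1 xE).
move=> /(ople_mxle1 (smap (N_ alpha F) (x - pps alpha E f)) _).2 h.
apply: (ople_mon _ (h _)); last by rewrite mulr_ge0 // ltW.
exact: frac_le (ltW d0).
Qed.

Lemma smap_CB (M : R) : 0 <= M -> schur_bd A (N_ alpha F) M ->
  [/\ forall x, X x -> X (smap (N_ alpha F) x), linear_on X (smap (N_ alpha F))
    & cble X (smap (N_ alpha F)) M].
Proof.
move=> M0 bN; split.
- by move=> x; exact: smap_X bN.
- by move=> c x y Xx Xy; apply: (smapZD (A_lsub cA) M0 bN N_lin N_linear); exact: crossed_matA.
- move=> I x N Xx N0 xN; apply: (smap_mxle M0 bN N_linear) => //.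
  by move=> i j; exact: crossed_matA.
Qed.

Lemma S_P (M : R) : 0 <= M -> schur_bd A (N_ alpha F) M ->
  CB X X (S_ A alpha F) /\
  forall f, l1_space A f -> S_ A alpha F (pi_tilde alpha f) = pi_tilde alpha (multf F f).
Proof.
move=> M0 bN; have [h1 h2 h3] := smap_CB M0 bN.
suff : exists S, CB X X S /\
    forall f, l1_space A f -> S (pi_tilde alpha f) = pi_tilde alpha (multf F f).
  by move=> /(xgetPex 0).
exists (smap (N_ alpha F)).
split; last by move=> f f1; exact: smap_pi_tilde bN f1.
apply/CB_cble.
- exact: (crossed_lsub cA dyn).
- exact: crossed_bop.
- exact: crossed_bop.
by split=> //; exists M.
Qed.

(** Both sides are bounded and agree on finite sums. From here on the map chosen by [S_] can be
    computed entrywise. *)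
Lemma S_smap (M : R) x : 0 <= M -> schur_bd A (N_ alpha F) M -> X x ->
  S_ A alpha F x = smap (N_ alpha F) x.
Proof.
move=> M0 bN Xx; have [CBS SE] := S_P M0 bN.
have sX := crossed_lsub cA dyn.
have [SX lS [K K0 cS]] := (CB_cble (S_ A alpha F) sX (@crossed_bop R G H A alpha) (@crossed_bop R G H A alpha)).1 CBS.
have [h1 h2 h3] := smap_CB M0 bN.
apply: ople_inj; apply: ople_eps => e e0; rewrite add0r.
have d0 : 0 < e / (K + M + 1) by rewrite divr_gt0 //; lra.
have [bx xc] := (crossedP cA dyn x).1 Xx.
have [E [f [uE Af xE]]] := xc _ d0.
have f1 := ffin_l1 cA E Af.
have Xp := crossed_pps cA dyn uE Af.
have Xd := lsubB sX Xx Xp.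
have lin1 y : X y -> linear (S_ A alpha F y) by move=> /SX; exact: crossed_lin.
have lin2 y : X y -> linear (smap (N_ alpha F) y) by move=> /h1; exact: crossed_lin.
have g1 := cble_ople (@crossed_bop R G H A alpha) lin1 K0 d0 cS Xd xE.
have g2 := cble_ople (@crossed_bop R G H A alpha) lin2 M0 d0 h3 Xd xE.
have -> : S_ A alpha F x - smap (N_ alpha F) x =
    S_ A alpha F (x - pps alpha E f) - smap (N_ alpha F) (x - pps alpha E f).
  rewrite (linear_onB sX lS Xx Xp) (linear_onB sX h2 Xx Xp).
  rewrite -(pi_tilde_ffin cA dyn Af uE) SE // (smap_pi_tilde M0 bN f1).
  by rewrite opprB [RHS]addrA subrK.
apply: (ople_mon _ (ople_sub g1 g2)).
by rewrite -mulrDl; apply: frac_le (ltW e0); rewrite ?addr_ge0.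
Qed.

(** Transference tests S_F on elements π(a)λ_t of a single degree, which already lie in the image of
    ℓ¹; the resulting bound then extends the map to the crossed product through [smap]. *)
Lemma herz_schur_bd : herz_schur A alpha F -> exists2 M : R, 0 <= M & schur_bd A (N_ alpha F) M.
Proof.
move=> [_ [S [CBS SE]]].
have sP : lsub pl1.
  split.
    exists (ffin [::] (fun=> 0)); first by apply: (ffin_l1 cA) => t; exact: (A_zero cA).
    by rewrite (pi_tilde_ffin cA dyn) /pps ?big_nil // => t; exact: (A_zero cA).
  move=> c _ _ [f f1 <-] [g g1 <-]; have [Af _] := f1; have [Ag _] := g1.
  have fg1 : l1_space A (fun t => c *: f t + g t).
    split; first by move=> t; case: (A_lsub cA) => _; apply.
    have [n [N N0 [n0 fn nN _]]] := l1_norms cA f1.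
    have [n' [N' N0' [n0' fn' nN' _]]] := l1_norms cA g1.
    have c0 : 0 <= complex.Re `|c| by rewrite -ler0c complex_normE.
    apply: (@le_lt_trans _ _ (complex.Re `|c| * N + N')%:E); last by rewrite ltry.
    apply: (@le_trans _ _ (asum (fun t => complex.Re `|c| * n t + n' t))).
      apply: le_esum => t _; apply/opnormP.
      - by apply: linear_add; [apply: linear_scale|]; exact: (A_lin cA).
      - by rewrite addr_ge0 // mulr_ge0.
      - by apply: ople_add => //; exact: ople_scale.
    apply: le_asum_seq => [t|s us]; first by rewrite addr_ge0 // mulr_ge0.
    by rewrite big_split /= -mulr_sumr lerD ?nN' // ler_wpM2l // nN.
  exists (fun t => c *: f t + g t) => //.
  apply: ent_ext => [||p q v].
  - exact: (pi_tilde_bop cA dyn fg1).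
  - by apply: bop_scaleD; exact: (pi_tilde_bop cA dyn).
  rewrite (ent_pi_tilde cA dyn fg1) (al_lin dyn) //.
  rewrite -[RHS]/(c *: ent (pi_tilde alpha f) p q v + ent (pi_tilde alpha g) p q v).
  exact: (f_equal2 (fun a b => c *: a + b) (esym (ent_pi_tilde cA dyn f1 p q v))
    (esym (ent_pi_tilde cA dyn g1 p q v))).
have pb : pl1 `<=` bop HH by move=> x /pl1_crossed; exact: crossed_bop.
have [SX lS [M M0 cM]] := (CB_cble S sP pb pb).1 CBS.
exists M => //; apply: (transference M0 cM) => t a Aa; first exact: pl1_gen.
have Aa' s : A (ffin [:: t] (fun=> a) s) by rewrite /ffin; case: ifP => // _; exact: (A_zero cA).
have f1 : l1_space A (ffin [:: t] (fun=> a)) by exact: (ffin_l1 cA).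
have <- : pi_tilde alpha (ffin [:: t] (fun=> a)) = gen t a.
  by rewrite (pi_tilde_ffin cA dyn) // pps1.
rewrite SE //; split; first by apply: (pi_tilde_crossed cA dyn); exact: multf_l1.
rewrite (fc_pi_tilde cA dyn _ (multf_l1 f1)).
by rewrite /multf /ffin inE eqxx.
Qed.

Lemma bd_herz_schur (M : R) : 0 <= M -> schur_bd A (N_ alpha F) M -> herz_schur A alpha F.
Proof.
move=> M0 bN; split=> //; exists (smap (N_ alpha F)).
have [h1 h2 h3] := smap_CB M0 bN.
split; last by move=> f f1; exact: smap_pi_tilde bN f1.
split.
- move=> _ [f f1 <-]; rewrite (smap_pi_tilde M0 bN f1); exists (multf F f) => //.
  exact: multf_l1.
- by move=> c x y /pl1_crossed Xx /pl1_crossed Xy; exact: h2.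
apply: (@le_lt_trans _ _ M%:E); last by rewrite ltry.
apply: cbnorm_le => //.
- by move=> x /pl1_crossed; exact: crossed_bop.
- by move=> x /pl1_crossed/h1; exact: crossed_lin.
- by move=> I x N Xx; apply: h3 => i j; exact: pl1_crossed (Xx i j).
Qed.

Lemma mnorm_lt (M e : R) : 0 <= M -> M < e -> schur_bd A (N_ alpha F) M ->
  (mnorm A alpha F < e%:E)%E.
Proof.
move=> M0 Me bN; apply: (@le_lt_trans _ _ M%:E); last by rewrite lte_fin.
have [h1 h2 h3] := smap_CB M0 bN.
apply: (cbnorm_le (@crossed_bop R G H A alpha) _ M0).
  by move=> x Xx; rewrite (S_smap M0 bN Xx); apply/crossed_lin/h1.
move=> I x N Xx N0 xN; apply: eq_mxle (h3 I x N Xx N0 xN) => i j v.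
by rewrite (S_smap M0 bN (Xx i j)).
Qed.

Lemma mnorm_bd (e : R) : herz_schur A alpha F -> (mnorm A alpha F < e%:E)%E ->
  schur_bd A (N_ alpha F) e.
Proof.
move=> /herz_schur_bd[M M0 bN] me.
have [CBS _] := S_P M0 bN; have [SX lS _] := CBS.
have sX := crossed_lsub cA dyn.
have lin y : X y -> linear (S_ A alpha F y) by move=> /SX; exact: crossed_lin.
have cS := cbnorm_lt_cble sX (@crossed_bop R G H A alpha) lS lin me.
have e0 : 0 <= e.
  rewrite -lee_fin; apply: (le_trans _ (ltW me)); apply: cbnorm_ge0; first by case: sX.
  by apply: lin; case: sX.
apply: (transference e0 cS) => t a Aa; first exact: (crossed_gen cA dyn).
have Xg := crossed_gen cA dyn t Aa.
split; first exact: SX.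
by rewrite (S_smap M0 bN Xg) (smap_crossed M0 bN Xg) fc_gen // eqxx.
Qed.

End NF.

End Schur.

(** * Hilbert space tensor products with l^2(J) *)

Section ScalarMatrices.
Variables (R : realType) (V : hilbertType R) (I J : finType) (b : I -> J -> R[i]) (B : R).
Hypothesis B0 : 0 <= B.
Hypothesis bB : mxle (fun i j (z : scal R) => (b i j : R[i]) *: z) B.

Lemma pythagoras (e w : V) (c : R[i]) : nrm e = 1 -> inner w e = 0 ->
  nrm (c *: e + w) ^+ 2 = complex.Re `|c| ^+ 2 + nrm w ^+ 2.
Proof.
move=> e1 we; rewrite nrm_sqrD nrmZ e1 mulr1 rinC.
have -> : rin w (c *: e) = 0 by rewrite /rin innerZr we mulr0.
by rewrite mulr0 addr0.
Qed.

(* Splitting off the direction of one nonzero vector reduces to fewer nonzero vectors. *)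
Lemma scalar_mxle : mxle (fun i j (v : V) => b i j *: v) B.
Proof.
apply/mxleP => // v.
have [n] := ubnP #|[pred j | v j != 0]|.
elim: n v => // n IH v vn.
have [v0|/forallPn /= [j0 vj0]] := boolP [forall j, v j == 0].
  rewrite big1 ?mulr_ge0 ?sqr_ge0 ?sumr_ge0 // => [j _|i _]; first exact: sqr_ge0.
  rewrite big1 ?nrm0 ?expr0n // => j _.
  by have /forallP/(_ j)/eqP -> := v0; rewrite scaler0.
have nj : 0 < nrm (v j0).
  by rewrite lt_def nrm_ge0 andbT; apply: contra vj0 => /eqP/nrm_eq0 ->.
pose e := (nrm (v j0))^-1%:C *: v j0.
have e1 : nrm e = 1 by rewrite nrmZ Re_norm_real ?invr_ge0 ?nrm_ge0 // mulVf // gt_eqF.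
have ee : inner e e = 1 by rewrite innerxx_nrm e1 expr1n.
pose c j : scal R := inner (v j) e.
pose w j := v j - (c j : R[i]) *: e.
have we j : inner (w j) e = 0 by rewrite innerB innerZ ee mulr1 subrr.
have vE j : v j = (c j : R[i]) *: e + w j by rewrite addrC subrK.
have w0 j : v j = 0 -> w j = 0 by rewrite /w /c => ->; rewrite inner0 scale0r subrr.
have wj0 : w j0 = 0.
  have h : v j0 = (nrm (v j0))%:C *: e.
    by rewrite scalerA -rmorphM mulfV ?gt_eqF // scale1r.
  by rewrite /w /c {1}h [in inner _ _]h innerZ ee mulr1 subrr.
have wn : (#|[pred j | w j != 0%R]| < n)%N.
  rewrite -ltnS; apply: leq_trans vn; rewrite ltnS; apply: proper_card.
  apply/properP; split.
    by apply/fintype.subsetP => j; rewrite !inE; apply: contra => /eqP h; apply/eqP; exact: w0.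
  by exists j0; rewrite !inE ?wj0 ?eqxx.
have /(mxleP _ B0)/(_ c) h1 := bB.
have h2 := IH w wn.
have -> : \sum_j nrm (v j) ^+ 2 = \sum_j nrm (c j) ^+ 2 + \sum_j nrm (w j) ^+ 2.
  by rewrite -big_split; apply: eq_bigr => j _; rewrite {1}vE pythagoras.
have -> : \sum_i nrm (\sum_j b i j *: v j) ^+ 2 =
    \sum_i nrm (\sum_j b i j *: c j) ^+ 2 + \sum_i nrm (\sum_j b i j *: w j) ^+ 2.
  rewrite -big_split; apply: eq_bigr => i _.
  have -> : \sum_j b i j *: v j = (\sum_j b i j * (c j : R[i])) *: e + \sum_j b i j *: w j.
    rewrite scaler_suml -big_split; apply: eq_bigr => j _.
    by rewrite {1}vE scalerDr scalerA.
  rewrite pythagoras // inner_suml big1 // => j _.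
  by rewrite innerZ we mulr0.
by rewrite mulrDr lerD.
Qed.

Lemma scalar_op_mxle (x : V -> V) (N : R) : 0 <= N -> ople x N ->
  mxle (fun i j (v : V) => b i j *: x v) (B * N).
Proof.
move=> N0 xN; apply/mxleP; first by rewrite mulr_ge0.
move=> v; have /(mxleP _ B0)/(_ (fun j => x (v j))) h := scalar_mxle.
apply: (le_trans h); rewrite exprMn -(mulrA (B ^+ 2)) ler_wpM2l ?sqr_ge0 // mulr_sumr.
by apply: ler_sum => j _; rewrite -exprMn lerXn2r ?nnegrE ?nrm_ge0 ?mulr_ge0 ?nrm_ge0.
Qed.

End ScalarMatrices.

Section Tensor.
Variables (R : realType) (J : choiceType) (L : hilbertType R).
Local Notation K := (l2 J (scal R)).
Local Notation T := (l2 J L).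

(** The map [l2tensor] over an arbitrary index set. A very large one is used later, since SOAP
    quantifies over all Hilbert spaces. *)
Definition tn (k : K) (v : L) : T := to_l2 (fun s => (k s : R[i]) *: v).

Lemma tnE k v s : tn k v s = (k s : R[i]) *: v.
Proof.
rewrite /tn to_l2E //; apply: (@to_l2_bounded _ _ _ _ (nrm k * nrm v)) => r ur.
rewrite exprMn; apply: (@le_trans _ _ ((\sum_(i <- r) nrm (k i) ^+ 2) * nrm v ^+ 2)).
  by rewrite mulr_suml; apply: ler_sum => i _; rewrite nrmZ exprMn.
by rewrite ler_wpM2r ?sqr_ge0 // l2_bessel.
Qed.

Lemma tn_ople k v : nrm (tn k v) <= nrm k * nrm v.
Proof.
apply: l2_nrm_le; first by rewrite mulr_ge0 ?nrm_ge0.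
move=> r ur; under eq_bigr do rewrite tnE nrmZ exprMn.
by rewrite -mulr_suml exprMn ler_wpM2r ?sqr_ge0 // (l2_bessel k ur).
Qed.

Lemma tn_linearl v : linear (tn^~ v).
Proof.
move=> c k k'; apply: l2_ext => s; rewrite tnE.
rewrite -[RHS]/(c *: tn k v s + tn k' v s) !tnE scalerA -scalerDl.
by rewrite -[l2val (c *: k + k') s]/(c * (k s : R[i]) + (k' s : R[i]) : R[i]).
Qed.

Lemma tn_linearr k : linear (tn k).
Proof.
move=> c v w; apply: l2_ext => s; rewrite tnE.
by rewrite -[RHS]/(c *: tn k v s + tn k w s) !tnE scalerDr !scalerA mulrC.
Qed.

Lemma tn_dl q (c : scal R) v : tn (dl q c) v = dl q ((c : R[i]) *: v).
Proof.
by apply: l2_ext => s; rewrite tnE !dlE; case: eqP => // _; rewrite scale0r.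
Qed.

Definition sone : scal R := (1 : R[i]).

Lemma dl_sone q (c : scal R) : dl q c = (c : R[i]) *: dl q sone :> K.
Proof.
apply: l2_ext => s; rewrite -[RHS]/((c : R[i]) *: dl q sone s) !dlE.
case: eqP => _; last by rewrite scaler0.
by rewrite -[RHS]/((c : R[i]) * 1) mulr1.
Qed.

Lemma tn_dl1 q v : tn (dl q sone) v = dl q v.
Proof. by rewrite tn_dl -[RHS]/(dl q v) (scale1r v). Qed.

Lemma tn_hilbert : hilbert_tensor tn.
Proof.
split; [exact: tn_linearl|exact: tn_linearr| |].
  move=> k l k' l'.
  pose f k : scal R := inner (tn k l) (tn k' l') - inner k k' * inner l l'.
  suff h : f k = 0 by apply/eqP; rewrite -subr_eq0; apply/eqP.
  apply: (@dl_dense0 _ _ _ (scal R) f ((nrm k' * nrm l * nrm l') + (nrm k' * nrm l * nrm l'))).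
  - by rewrite addr_ge0 // !mulr_ge0 ?nrm_ge0.
  - move=> c a b; rewrite /f tn_linearl !innerD !innerZ.
    by rewrite -[RHS]/(c * (_ - _) + (_ - _) : R[i]); ring.
  - move=> a; apply: (le_trans (nrmB _ _)); rewrite mulrDl; apply: lerD.
      apply: le_trans (cauchy_schwarz _ _) _.
      apply: (@le_trans _ _ ((nrm a * nrm l) * (nrm k' * nrm l'))).
        by apply: ler_pM; rewrite ?nrm_ge0 ?tn_ople.
      by rewrite le_eqVlt; apply/orP; left; apply/eqP; ring.
    have -> : nrm (inner a k' * inner l l' : scal R) =
        complex.Re `|inner a k'| * complex.Re `|inner l l'|.
      by rewrite -[_ * _]/(inner a k' *: (inner l l' : scal R)) nrmZ.
    apply: (@le_trans _ _ ((nrm a * nrm k') * (nrm l * nrm l'))).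
      by apply: ler_pM; rewrite ?cauchy_schwarz // -ler0c complex_normE.
    by rewrite le_eqVlt; apply/orP; left; apply/eqP; ring.
  move=> q c; rewrite /f tn_dl !inner_dl innerZ tnE innerZr.
  have -> : inner c (k' q) = (c : R[i]) * (k' q : R[i])^* by [].
  by rewrite mulrA subrr.
move=> v e e0; have e2 : 0 < e / 2 by lra.
have [s [us sP]] := cut_dense v e2.
exists (size s), (fun j => dl (tnth (in_tuple s) j) sone), (fun j => v (tnth (in_tuple s) j)).
have hs : \sum_(j < size s) tn (dl (tnth (in_tuple s) j) sone) (v (tnth (in_tuple s) j)) = cut s v.
  by rewrite /cut [RHS]big_tnth; apply: eq_bigr => j _; exact: tn_dl1.
apply: (@le_lt_trans _ _ (e / 2)); last by lra.
by have := sP s us (fun j js => js); rewrite -hs.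
Qed.

Definition coef (b : K -> K) (p q : J) : R[i] := b (dl q sone) p.

(** b ⊗ x is the matrix (b_pq x), whose sections are bounded by [scalar_op_mxle]. Existence shows
    that the [xget] in [tensop] does not return its default. *)
Lemma tn_op_exists (b : K -> K) (x : L -> L) : bop K b -> bop L x ->
  exists y, [/\ bop T y, forall k l, y (tn k l) = tn (b k) (x l) &
    forall p q, ent y p q = coef b p q *: x].
Proof.
move=> /bopP[lb [B B0 bB]] /bopP[lx [N N0 xN]].
have BN : 0 <= B * N by rewrite mulr_ge0.
pose z p q : L -> L := coef b p q *: x.
have lz p q : linear (z p q) by exact: linear_scale.
have [y [ly yM yE]] : exists y : T -> T,
    [/\ linear y, ople y (B * N) & forall p q v, ent y p q v = z p q v].
  apply: matrix_op => //; apply: secle_mxle_fin => // n p ip.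
  apply: (scalar_op_mxle (b := fun a c : unit * 'I_n => coef b (p a.2) (p c.2))) => //.
  have h := @mxle_compress R (scal R) unit J (unit * 'I_n)%type (fun _ _ => b) B
    (fun _ => tt) (fun a => p a.2) B0 (fun _ _ => lb) ((ople_mxle1 b B0).1 bB).
  apply: eq_mxle (h _); last by move=> [[] k] [[] l] _ /= /ip ->.
  move=> i j v /=; rewrite /ent /coef.
  rewrite (dl_sone (p j.2) v) (linearZ' _ _ lb).
  exact: (mulrC (v : R[i]) (b (dl (p j.2) sone) (p i.2) : R[i])).
exists y; split; first by apply/bopP; split=> //; exists (B * N).
  move=> k l.
  pose f k := y (tn k l) - tn (b k) (x l).
  suff h : f k = 0 by apply/eqP; rewrite -subr_eq0; apply/eqP.
  apply: (@dl_dense0 _ _ _ _ f (B * N * nrm l + B * nrm (x l))).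
  - by rewrite addr_ge0 // !mulr_ge0 ?nrm_ge0.
  - move=> c a a'; rewrite /f tn_linearl ly lb tn_linearl scalerBr.
    by rewrite opprD addrACA.
  - move=> a; apply: (le_trans (nrmB _ _)); rewrite mulrDl; apply: lerD.
      apply: le_trans (yM _) _; apply: (@le_trans _ _ (B * N * (nrm a * nrm l))).
        by rewrite ler_wpM2l // tn_ople.
      by rewrite (mulrC (nrm a)) mulrA.
    apply: le_trans (tn_ople _ _) _.
    by rewrite mulrAC ler_wpM2r ?nrm_ge0.
  move=> q c; rewrite /f; apply/eqP; rewrite subr_eq0; apply/eqP.
  apply: l2_ext => p; rewrite tn_dl tnE -[LHS]/(ent y p q ((c : R[i]) *: l)) yE.
  rewrite /z -[LHS]/(coef b p q *: x ((c : R[i]) *: l)) linearZ' // scalerA.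
  congr (_ *: _); rewrite /coef.
  rewrite (dl_sone q c) (linearZ' _ _ lb).
  exact: (mulrC (b (dl q sone) p : R[i]) (c : R[i])).
by move=> p q; apply/funext => v; exact: yE.
Qed.

Lemma tensopP (b : K -> K) (x : L -> L) : bop K b -> bop L x ->
  [/\ bop T (tensop tn b x), forall k l, tensop tn b x (tn k l) = tn (b k) (x l) &
    forall p q, ent (tensop tn b x) p q = coef b p q *: x].
Proof.
move=> bb bx; have [y [by_ yt yE]] := tn_op_exists bb bx.
have : exists y, bop T y /\ forall k l, y (tn k l) = tn (b k) (x l) by exists y.
move=> /(xgetPex 0)[bz zt]; split=> // p q; rewrite -yE; apply/funext => v.
have zt' k l : tensop tn b x (tn k l) = tn (b k) (x l) by exact: zt.
by rewrite /ent -tn_dl1 zt' yt.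
Qed.

Section MinTensor.
Variable Y : set (L -> L).
Hypotheses (Yb : Y `<=` bop L) (sY : lsub Y).
Hypothesis Ycl : forall y, bop L y ->
  (forall e : R, 0 < e -> exists2 x, Y x & ople (y - x) e) -> Y y.

Definition algtensor : set (T -> T) :=
  [set y | exists n (b : 'I_n -> K -> K) (x : 'I_n -> L -> L),
    (forall j, bop K (b j) /\ Y (x j)) /\ y = \sum_j tensop tn (b j) (x j)].

Lemma algtensor_bop y : algtensor y -> bop T y.
Proof.
move=> [n [b [x [bx ->]]]]; elim/big_rec: _ => [|j z _ bz]; first exact: bop0.
by have [bb /Yb bxj] := bx j; have [h _ _] := tensopP bb bxj; exact: bop_add.
Qed.

Lemma algtensor_lsub : lsub algtensor.
Proof.
split; first by exists 0%N, (fun _ => 0), (fun _ => 0); split; [case|rewrite big_ord0].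
move=> c _ _ [n [b [x [bx ->]]]] [m [b' [x' [bx' ->]]]].
pose f (u : 'I_n + 'I_m) := match u with inl j => b j | inr j => b' j end.
pose g (u : 'I_n + 'I_m) : L -> L := match u with inl j => c *: x j | inr j => x' j end.
exists (n + m)%N, (fun j => f (fintype.split j)), (fun j => g (fintype.split j)); split.
  move=> j; case: (fintype.split j) => k; last exact: bx'.
  by have [bb Yx] := bx k; split=> //; exact: (lsubZ sY).
rewrite big_split_ord /= scaler_sumr; congr (_ + _); apply: eq_bigr => j _.
  rewrite (unsplitK (inl j)) /=; have [bb Yx] := bx j.
  have [h1 h2 h3] := tensopP bb (Yb Yx); have [h4 h5 h6] := tensopP bb (Yb (lsubZ sY c Yx)).
  have h0 : bop T (c *: tensop tn (b j) (x j)).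
    by have := bop_scaleD c h1 (bop0 T); rewrite addr0.
  apply: (ent_ext h0 h4) => p q v.
  rewrite -[LHS]/(c *: ent (tensop tn (b j) (x j)) p q v) h3 h6.
  rewrite -[LHS]/(c *: (coef (b j) p q *: x j v)) -[RHS]/(coef (b j) p q *: (c *: x j v)).
  by rewrite !scalerA mulrC.
by rewrite (unsplitK (inr j)).
Qed.

Lemma mintensorP y : mintensor tn Y y <-> bop T y /\
  forall e : R, 0 < e -> exists2 x, algtensor x & ople (y - x) e.
Proof.
split=> -[by_ yc]; split=> // e e0.
  have [x xa yx] := yc e e0; exists x => //; apply: opnorm_lt_ople yx.
  by apply: linear_sub; apply: bop_lin; [|exact: algtensor_bop].
have e2 : 0 < e / 2 by lra.
have [x xa yx] := yc _ e2; exists x => //.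
apply: (ople_opnorm_lt _ _ _ yx); [|by lra|by lra].
by apply: linear_sub; apply: bop_lin => //; exact: algtensor_bop.
Qed.

Lemma mintensor_bop : mintensor tn Y `<=` bop T. Proof. by move=> x []. Qed.

Lemma mintensor_lsub : lsub (mintensor tn Y).
Proof.
split.
  apply/mintensorP; split; first exact: bop0.
  move=> e e0; exists 0; first by case: algtensor_lsub.
  by rewrite subrr; apply: (ople_mon (ltW e0)); exact: ople_zero.
move=> c x y /mintensorP[bx xc] /mintensorP[by_ yc]; apply/mintensorP.
split; first exact: bop_scaleD.
move=> e e0; have c0 : 0 <= complex.Re `|c| by rewrite -ler0c complex_normE.
have d0 : 0 < e / (complex.Re `|c| + 1) by rewrite divr_gt0 //; lra.
have [x' xa xx] := xc _ d0; have [y' ya yy] := yc _ d0.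
exists (c *: x' + y'); first by case: algtensor_lsub => _; apply.
rewrite opprD addrACA -scalerBr.
apply: (ople_mon _ (ople_add (ople_scale c xx) yy)).
by rewrite le_eqVlt; apply/orP; left; apply/eqP; field; rewrite gt_eqF //; lra.
Qed.

Lemma mintensor_tensop b x : bop K b -> Y x -> mintensor tn Y (tensop tn b x).
Proof.
move=> bb Yx; apply/mintensorP; split; first by have [] := tensopP bb (Yb Yx).
move=> e e0; exists (tensop tn b x).
  by exists 1%N, (fun=> b), (fun=> x); split=> //; rewrite big_ord1.
by rewrite subrr; apply: (ople_mon (ltW e0)); exact: ople_zero.
Qed.

Lemma algtensor_ent y p q : algtensor y -> Y (ent y p q).
Proof.
move=> [n [b [x [bx ->]]]].
have -> : ent (\sum_j tensop tn (b j) (x j)) p q = \sum_j ent (tensop tn (b j) (x j)) p q.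
  by apply/funext => v; rewrite /ent !sumfE (l2sumE R J).
apply: (lsub_sum sY) => j _; have [bb Yx] := bx j.
by have [_ _ ->] := tensopP bb (Yb Yx); exact: (lsubZ sY).
Qed.

Lemma mintensor_ent y p q : mintensor tn Y y -> Y (ent y p q).
Proof.
move=> /mintensorP[by_ yc]; apply: Ycl; first exact: bop_ent.
move=> e e0; have [x xa yx] := yc e e0; exists (ent x p q); first exact: algtensor_ent.
exact: (@ent_ople _ _ _ (y - x) p q e (ltW e0) yx).
Qed.

End MinTensor.

End Tensor.

(** * Schur multipliers on B(ℓ²(G)) ⊗_min A *)

Section SchurDomain.
Variables (R : realType) (G : groupType) (H : hilbertType R) (A : set (H -> H)).
Hypothesis cA : cstar_algebra A.
Local Notation HH := (l2 G H).
Local Notation D := (schur_domain G A).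
Implicit Types (phi : G -> G -> (H -> H) -> (H -> H)).

Let Ab : A `<=` bop H. Proof. by move=> a; exact: (A_bop cA). Qed.
Let sA : lsub A. Proof. exact: (A_lsub cA). Qed.

Let Acl y : bop H y ->
  (forall e : R, 0 < e -> exists2 x, A x & ople (y - x) e) -> A y.
Proof. by move=> /bop_lin ly; exact: (A_closed cA). Qed.

Lemma schur_domainE : D = mintensor (@tn R G H) A.
Proof. by []. Qed.

Lemma l2basisE_dl q : l2basis R q = dl q (sone R) :> l2 G (scal R).
Proof.
by apply: l2_ext => s; rewrite l2basisE dlE; case: eqP.
Qed.

Lemma entryE (x : HH -> HH) p q : entry x p q = ent x p q.
Proof. by apply/funext => v; rewrite /entry l2basisE_dl -[l2tensor _ v]/(tn (dl q (sone R)) v) tn_dl1. Qed.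

Lemma schur_domain_matA x : D x -> matA A x.
Proof.
rewrite schur_domainE => Dx; split; first exact: mintensor_bop Dx.
by move=> p q; exact: (mintensor_ent Ab sA Acl p q Dx).
Qed.

Lemma schur_domain_bop : D `<=` bop HH. Proof. exact: mintensor_bop. Qed.

Lemma schur_domain_lsub : lsub D.
Proof. rewrite schur_domainE; exact: (@mintensor_lsub R G H A Ab sA). Qed.

(** The operator e_pq ⊗ a. Matrices of such operators test a Schur multiplier at prescribed
    entries. *)
Definition munit (p q : G) (a : H -> H) : HH -> HH := fun xi => dl p (a (xi q)).

Lemma munit_linear p q a : linear a -> linear (munit p q a).
Proof.
move=> la c u v; rewrite /munit -[l2val (c *: u + v) q]/(c *: u q + v q) la.
exact: (dl_linear p c (a (u q)) (a (v q))).
Qed.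

Lemma munit_ople p q a (M : R) : 0 <= M -> ople a M -> ople (munit p q a) M.
Proof.
move=> M0 aM v; rewrite nrm_dl (le_trans (aM _)) // ler_wpM2l //.
exact: (@l2_coord _ _ _ v q).
Qed.

Lemma ent_munit p q a r s v : linear a ->
  ent (munit p q a) r s v = if (r == p) && (q == s) then a v else 0.
Proof.
move=> la; rewrite /ent /munit !dlE; case: (r == p) => //=.
by case: (q == s) => //; rewrite linear0'.
Qed.

Lemma munit_domain p q a : A a -> D (munit p q a).
Proof.
move=> Aa; have la := A_lin cA Aa.
have [_ [M M0 aM]] := (bopP a).1 (A_bop cA Aa).
pose E : l2 G (scal R) -> l2 G (scal R) := fun k => dl p (k q).
have bE : bop _ E.
  apply/bopP; split.
    by move=> c u v; exact: (dl_linear p c (u q) (v q)).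
  by exists 1 => // v; rewrite nrm_dl mul1r; exact: (@l2_coord _ _ _ v q).
rewrite schur_domainE; have := mintensor_tensop Ab bE Aa.
have [b1 _ e1] := tensopP bE (A_bop cA Aa).
suff -> : tensop (@tn R G H) E a = munit p q a by [].
have b2 : bop HH (munit p q a).
  by apply/bopP; split; [exact: munit_linear|exists M => //; exact: munit_ople].
apply: (ent_ext b1 b2) => r s v.
rewrite e1 (ent_munit p q r s v la) -[LHS]/(coef E r s *: a v) /coef /E !dlE.
case: (r == p) => /=; last by rewrite scale0r.
case: (q == s); last by rewrite scale0r.
by rewrite scale1r.
Qed.

Lemma munit_mxle (I : finType) (p : I -> G) (a : I -> I -> H -> H) (N : R) : 0 <= N ->
  mxle a N -> mxle (fun i j => munit (p i) (p j) (a i j)) N.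
Proof.
move=> N0 /(mxleP _ N0) aN; apply/mxleP => // v.
have := aN (fun j => v j (p j)) => h.
apply: (@le_trans _ _ (\sum_i nrm (\sum_j a i j (v j (p j))) ^+ 2)).
  rewrite le_eqVlt; apply/orP; left; apply/eqP; apply: eq_bigr => i _.
  by rewrite /munit -(linear_sum' _ _ _ (dl_linear (p i))) nrm_dl.
apply: (le_trans h); rewrite ler_wpM2l ?sqr_ge0 //; apply: ler_sum => j _.
by rewrite lerXn2r ?nnegrE ?nrm_ge0 //; exact: (@l2_coord _ _ _ (v j) (p j)).
Qed.

Section Maps.
Variable phi : G -> G -> (H -> H) -> (H -> H).
Hypothesis CBphi : forall s t, CB A (bop H) (phi s t).

Lemma phi_lin q p : linear_on A (phi q p). Proof. by case: (CBphi q p). Qed.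
Lemma phi_linear q p a : A a -> linear (phi q p a).
Proof. by case: (CBphi q p) => h _ _ /h/bop_lin. Qed.

(** Feeding the matrix (e_{p_i p_j} ⊗ a_ij) to [S] and reading the entry at (p_i, p_j) recovers
    φ(p_j, p_i)(a_ij). *)
Lemma schur_map_bd S (M : R) : 0 <= M ->
  (forall x p q, D x -> entry (S x) p q = phi q p (entry x p q)) ->
  (forall x, D x -> linear (S x)) -> cble D S M -> schur_bd A phi M.
Proof.
move=> M0 SE lS cS I p a N Aa N0 aN.
have MN : 0 <= M * N by rewrite mulr_ge0 // ltW.
have Du i j := munit_domain (p i) (p j) (Aa i j).
have h1 := cS _ _ N Du N0 (munit_mxle p (ltW N0) aN).
have h2 := @mxle_compress R H I G I _ (M * N) id p MN (fun i j => lS _ (Du i j)) h1.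
apply: eq_mxle (h2 _) => // i j v.
rewrite -entryE SE // entryE; congr (phi _ _ _ v).
by apply/funext => w; rewrite ent_munit ?eqxx //; exact: (A_lin cA).
Qed.

Lemma smap_schur (M : R) : 0 <= M -> schur_bd A phi M ->
  [/\ schur_map A phi (smap phi),
    forall x p q, D x -> entry (smap phi x) p q = phi q p (entry x p q)
   & cble D (smap phi) M].
Proof.
move=> M0 bphi.
have h0 x p q : D x -> entry (smap phi x) p q = phi q p (entry x p q).
  move=> /schur_domain_matA Ax; rewrite !entryE.
  by have [_ ->] := smapP M0 bphi phi_linear Ax.
have h1 x : D x -> bop HH (smap phi x).
  by move=> /schur_domain_matA Ax; have [] := smapP M0 bphi phi_linear Ax.
have h2 : cble D (smap phi) M.
  move=> I x N Dx N0 xN; apply: (smap_mxle M0 bphi phi_linear) => // i j.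
  exact: schur_domain_matA.
split=> //; split=> //; split=> //.
  move=> c x y Dx Dy; apply: (smapZD sA M0 bphi phi_lin phi_linear).
    exact: schur_domain_matA.
  exact: schur_domain_matA.
apply: (@le_lt_trans _ _ M%:E); last by rewrite ltry.
apply: (cbnorm_le schur_domain_bop _ M0 h2) => x Dx; exact: bop_lin (h1 x Dx).
Qed.

Lemma S_schurP : schur_multiplier A phi -> schur_map A phi (S_schur A phi).
Proof. by case=> _ _ /(xgetPex 0). Qed.

End Maps.

Lemma S_schur_sub_bd phi phi' (e : R) : schur_multiplier A phi -> schur_multiplier A phi' ->
  (cbnorm D (S_schur A phi - S_schur A phi')%R < e%:E)%E ->
  schur_bd A (fun q p a => phi q p a - phi' q p a) e.
Proof.
move=> sp sp' ce; have [CBS SE] := S_schurP sp; have [CBS' SE'] := S_schurP sp'.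
have [Sb lS _] := CBS; have [Sb' lS' _] := CBS'.
pose S := S_schur A phi - S_schur A phi'.
have SSE x : S x = S_schur A phi x - S_schur A phi' x by [].
have lin x : D x -> linear (S x).
  by move=> Dx; rewrite SSE; apply: linear_sub; apply: bop_lin; [exact: Sb|exact: Sb'].
have lSS : linear_on D S.
  by move=> c x y Dx Dy; rewrite !SSE lS // lS' // scalerBr opprD addrACA.
have cS := cbnorm_lt_cble schur_domain_lsub schur_domain_bop lSS lin ce.
have D0 : D 0 by case: schur_domain_lsub.
have e0 : 0 <= e.
  by rewrite -lee_fin; apply: (le_trans _ (ltW ce)); apply: cbnorm_ge0 => //; exact: lin.
apply: (schur_map_bd e0 _ lin cS) => x p q Dx.
by rewrite entryE SSE -[LHS]/(ent (S_schur A phi x) p q - ent (S_schur A phi' x) p q)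
  -!entryE SE // SE'.
Qed.

Lemma bd_schur_multiplier phi (M : R) : (forall s t, CB A (bop H) (phi s t)) -> 0 <= M ->
  (exists c : R, forall s t, (cbnorm A (phi s t) <= c%:E)%E) ->
  schur_bd A phi M -> schur_multiplier A phi.
Proof.
move=> CBp M0 cb bphi; split=> //; exists (smap phi).
by have [] := smap_schur CBp M0 bphi.
Qed.

Lemma bd_S_schur_sub phi phi' (M e : R) :
  schur_multiplier A phi -> schur_multiplier A phi' -> 0 <= M -> M < e ->
  schur_bd A (fun q p a => phi q p a - phi' q p a) M ->
  (cbnorm D (S_schur A phi - S_schur A phi')%R < e%:E)%E.
Proof.
move=> sp sp' M0 Me bd; have [CBS SE] := S_schurP sp; have [CBS' SE'] := S_schurP sp'.
have [Sb lS _] := CBS; have [Sb' lS' _] := CBS'.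
have [CBp _ _] := sp; have [CBp' _ _] := sp'.
pose psi q p a := phi q p a - phi' q p a.
have lpsi q p a : A a -> linear (psi q p a).
  by move=> Aa; apply: linear_sub; [exact: (phi_linear CBp)|exact: (phi_linear CBp')].
have SSE x : D x -> (S_schur A phi - S_schur A phi') x = smap psi x.
  move=> Dx; have Ax := schur_domain_matA Dx.
  have [b1 e1] := smapP M0 bd lpsi Ax.
  have b2 : bop HH (S_schur A phi x - S_schur A phi' x) by apply: bop_sub; [exact: Sb|exact: Sb'].
  apply: (ent_ext b2 b1) => p q v; rewrite e1.
  rewrite -[LHS]/(ent (S_schur A phi x) p q v - ent (S_schur A phi' x) p q v).
  by rewrite -!entryE SE // SE'.
apply: (@le_lt_trans _ _ M%:E); last by rewrite lte_fin.
apply: (cbnorm_le schur_domain_bop _ M0).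
  by move=> x Dx; rewrite SSE //; have [] := smapP M0 bd lpsi (schur_domain_matA Dx); move=> /bop_lin.
move=> I x N Dx N0 xN.
have h := smap_mxle M0 bd lpsi N0 (fun i j => schur_domain_matA (Dx i j)) xN.
by apply: eq_mxle h => i j v; rewrite SSE.
Qed.

End SchurDomain.

(** * Coordinates on finite dimensional subspaces, and block diagonal operators *)

Section Functionals.
Variables (R : realType) (L : hilbertType R).
Implicit Types (x y : L -> L) (f g : (L -> L) -> R[i]).

(** The bound on scalar matrices keeps coordinates bounded independently of the matrix size.
    Linearity and bound are asked beyond any given subspace, so that functionals found on a smaller
    space can be corrected on a larger one. *)
Definition cbfun f : Prop :=
  (forall (c : R[i]) x y, f (c *: x + y) = c * f x + f y) /\
  exists2 M : R, 0 <= M & forall (I : finType) (x : I -> I -> L -> L) (N : R),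
    0 <= N -> (forall i j, linear (x i j)) -> mxle x N ->
    mxle (fun i j (z : scal R) => f (x i j) *: z) (M * N).

Lemma cbfun_comb f g (c : R[i]) : cbfun f -> cbfun g -> cbfun (fun x => c * f x + g x).
Proof.
move=> [lf [M M0 fM]] [lg [M' M0' gM]]; split.
  by move=> a x y; rewrite lf lg; ring.
exists (complex.Re `|c| * M + M').
  by rewrite addr_ge0 // mulr_ge0 // -ler0c complex_normE.
move=> I x N N0 lx xN; rewrite mulrDl -mulrA.
apply: eq_mxle (mxle_add (mxle_scale c (fM I x N N0 lx xN)) (gM I x N N0 lx xN)) => i j v.
by rewrite scalerDl scalerA.
Qed.

Lemma cbfun_zero : cbfun (fun=> 0).
Proof.
split; first by move=> c x y; rewrite mulr0 addr0.
exists 0 => // I x N N0 lx xN; rewrite mul0r.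
by apply: eq_mxle (@mxle_zero R (scal R) (scal R) I I) => i j v; rewrite scale0r.
Qed.

Lemma cbfun_sum n (a : nat -> R[i]) (f : nat -> (L -> L) -> R[i]) :
  (forall k, (k < n)%N -> cbfun (f k)) -> cbfun (fun x => \sum_(k < n) a k * f k x).
Proof.
elim: n => [|n IH] cf.
  have -> : (fun x => \sum_(k < 0) a k * f k x) = fun=> 0.
    by apply/funext => x; rewrite big_ord0.
  exact: cbfun_zero.
have -> : (fun x => \sum_(k < n.+1) a k * f k x) =
    fun x => a n * f n x + \sum_(k < n) a k * f k x.
  by apply/funext => x; rewrite big_ord_recr addrC.
apply: cbfun_comb; first exact: cf.
by apply: IH => k kn; apply: cf; rewrite ltnS ltnW.
Qed.

Lemma cbfun_vector (u v : L) : cbfun (fun x => inner (x u) v).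
Proof.
split; first by move=> c x y; rewrite -[(c *: x + y) u]/(c *: x u + y u) innerD innerZ.
exists (nrm u * nrm v); first by rewrite mulr_ge0 ?nrm_ge0.
move=> I x N N0 lx /(mxleP _ N0) xN.
have uv0 : 0 <= nrm u * nrm v by rewrite mulr_ge0 ?nrm_ge0.
apply/mxleP; first by rewrite mulr_ge0.
move=> z; have := xN (fun j => (z j : R[i]) *: u) => h.
apply: (@le_trans _ _ (\sum_i (nrm (\sum_j x i j ((z j : R[i]) *: u)) * nrm v) ^+ 2)).
  apply: ler_sum => i _; rewrite lerXn2r ?nnegrE ?mulr_ge0 ?nrm_ge0 //.
  apply: le_trans (cauchy_schwarz _ _); rewrite inner_suml.
  have -> : \sum_j inner (x i j ((z j : R[i]) *: u)) v = \sum_j inner (x i j u) v *: z j.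
    by apply: eq_bigr => j _; rewrite linearZ' // innerZ mulrC.
  by [].
under eq_bigr do rewrite exprMn.
rewrite -mulr_suml; apply: (le_trans (ler_wpM2r (sqr_ge0 _) h)).
under eq_bigr do rewrite nrmZ exprMn.
rewrite -mulr_suml le_eqVlt; apply/orP; left; apply/eqP.
have -> : \sum_j nrm (z j) ^+ 2 = \sum_j complex.Re `|z j : R[i]| ^+ 2 by [].
ring.
Qed.

Definition spanned (n : nat) (e : nat -> L -> L) y : Prop :=
  exists c : nat -> R[i], y = \sum_(k < n) c k *: e k.

(** Induction on the number of spanning elements, with vector functionals x ↦ ⟨x u, v⟩ in place of
    Hahn-Banach: the coordinates come out completely bounded, and the new basis lies in [V]
    itself. *)
Lemma coordinates n (e : nat -> L -> L) (V : set (L -> L)) : lsub V ->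
  (forall y, V y -> spanned n e y) ->
  exists m (e' : nat -> L -> L) (f : nat -> (L -> L) -> R[i]),
    [/\ forall k, (k < m)%N -> V (e' k), forall k, (k < m)%N -> cbfun (f k)
      & forall y, V y -> y = \sum_(k < m) f k y *: e' k].
Proof.
elim: n V => [|n IH] V sV Vn.
  exists 0%N, (fun=> 0), (fun=> fun=> 0); split=> // y /Vn[c ->].
  by rewrite !big_ord0.
have [h|/existsNP[r /not_implyP[Vr nr]]] := pselect (forall y, V y -> spanned n e y).
  exact: IH.
pose V' y := V y /\ spanned n e y.
have sV' : lsub V'.
  split; first by split; [case: sV|exists (fun=> 0); rewrite big1 // => k _; rewrite scale0r].
  move=> c a b [Va [ca ae]] [Vb [cb be]]; split; first by case: sV => _; apply.
  exists (fun k => c * ca k + cb k); rewrite ae be scaler_sumr -big_split /=.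
  by apply: eq_bigr => k _; rewrite scalerDl scalerA.
have [m [e' [f [Ve' cf fE]]]] := IH V' sV' (fun y h => h.2).
have [cr rE] := Vn r Vr; rewrite big_ord_recr /= in rE.
have gr : cr n != 0.
  by apply: contra_notN nr => /eqP c0; exists cr; rewrite {1}rE c0 scale0r addr0.
pose P y := \sum_(k < m) f k y *: e' k.
have PD c x y : P (c *: x + y) = c *: P x + P y.
  rewrite /P scaler_sumr -big_split; apply: eq_bigr => k _.
  by have [-> _] := cf k (ltn_ord k); rewrite scalerDl scalerA.
have VP y : V' (P y).
  by apply: (lsub_sum sV') => k _; apply: (lsubZ sV'); exact: Ve'.
have dec y : V y -> exists c, V' (y - c *: r).
  move=> Vy; have [cy yE] := Vn y Vy; rewrite big_ord_recr /= in yE.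
  exists (cy n / cr n); split; first by apply: (lsubB sV) => //; exact: (lsubZ sV).
  exists (fun k => cy k - (cy n / cr n) * cr k).
  rewrite {1}yE {1}rE scalerDr scalerA divfK // opprD addrACA subrr addr0 scaler_sumr.
  rewrite -sumrB; apply: eq_bigr => k _.
  by rewrite scalerBl scalerA.
(* The part of [r] that the coordinates found so far miss. A vector functional that does not vanish
   on it, corrected by these coordinates, becomes the coordinate [g] of [r]. *)
pose rho := r - P r.
have rho0 : exists u, rho u != 0.
  apply: contrapT => /forallNP h; apply: nr.
  have -> : r = P r.
    apply/funext => u; apply/eqP; rewrite -subr_eq0.
    by have /negP := h u; rewrite negbK.
  by case: (VP r).
have [u ru] := rho0; pose v := rho u.
have vn : inner (rho u) v != 0.
  rewrite innerxx_nrm; apply: contra ru => /eqP/complexI/eqP.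
  by rewrite sqrf_eq0 => /eqP/nrm_eq0 ->.
pose a := (inner (rho u) v)^-1.
pose g y := a * inner (y u) v + \sum_(k < m) (- a * inner (e' k u) v) * f k y.
have cg : cbfun g.
  apply: cbfun_comb; first exact: cbfun_vector.
  exact: (@cbfun_sum m (fun k => - a * inner (e' k u) v)).
have gE y : g y = a * inner ((y - P y) u) v.
  rewrite -[(y - P y) u]/(y u - P y u) innerB mulrBr /g; congr (_ + _).
  rewrite /P sumfE inner_suml mulr_sumr -sumrN; apply: eq_bigr => k _.
  rewrite -[(f k y *: e' k) u]/(f k y *: e' k u) innerZ.
  by ring.
have gD c x y : g (c *: x + y) = c * g x + g y by case: cg.
have gr1 : g r = 1 by rewrite gE mulVf.
have gV y : V' y -> g y = 0.
  by move=> /fE e1; rewrite gE /P -e1 subrr inner0 mulr0.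
(* The old coordinates reproduce elements of [V'] only; the correction removes what they see of
   [r]. *)
pose f2 k y := if (k < m)%N then (- f k r) * g y + f k y else g y.
exists m.+1, (fun k => if (k < m)%N then e' k else r), f2; split.
- by move=> k _; case: ifP => // km; case: (Ve' k km).
- move=> k _; rewrite /f2; case E: (k < m)%N; last exact: cg.
  exact: (cbfun_comb (- f k r) cg (cf k E)).
move=> y Vy; have [c Vc] := dec y Vy.
have yE : y = c *: r + (y - c *: r) by rewrite addrC subrK.
have gy : g y = c by rewrite yE (gD c r (y - c *: r)) gr1 (gV (y - c *: r) Vc) mulr1 addr0.
rewrite big_ord_recr /= /f2 ltnn gy.
have -> : \sum_(i < m) (if (i < m)%N then - f i r * c + f i y else c) *:
    (if (i < m)%N then e' i else r) = P (y - c *: r).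
  apply: eq_bigr => k _; rewrite ltn_ord; congr (_ *: _).
  have -> : y - c *: r = (- c) *: r + y by rewrite scaleNr addrC.
  by have [-> _] := cf k (ltn_ord k); ring.
have e1 := fE _ Vc; rewrite -/(P _) in e1.
by rewrite -e1 subrK.
Qed.

Lemma findim_spanned (Y : set (L -> L)) : findim Y -> exists n e, forall y, Y y -> spanned n e y.
Proof.
move=> [n [e ->]].
exists n, (fun k => if insub k is Some j then e j else 0) => _ [c _ <-].
exists (fun k => if insub k is Some j then c j else 0); apply: eq_bigr => k _.
by rewrite valK.
Qed.

Lemma findim_lsub (Y : set (L -> L)) : findim Y -> lsub Y.
Proof.
move=> [n [e ->]]; split.
  by exists (fun=> 0) => //; rewrite big1 // => k _; rewrite scale0r.
move=> c _ _ [a _ <-] [b _ <-]; exists (fun k => c * a k + b k) => //.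
rewrite scaler_sumr -big_split; apply: eq_bigr => k _.
by rewrite scalerDl scalerA.
Qed.

End Functionals.

Section BlockDiagonal.
Variables (R : realType) (Q : choiceType) (m : Q -> nat) (V : hilbertType R).
Local Notation J := (Q * nat)%type.

(** Only the leading m(t) by m(t) corner of block t is kept, so that blocks of all sizes share one
    index set. *)
Definition bdiag (y : Q -> nat -> nat -> V -> V) (p q : J) : V -> V :=
  if [&& p.1 == q.1, (p.2 < m p.1)%N & (q.2 < m q.1)%N] then y p.1 p.2 q.2 else 0.

Lemma slice (T : nmodType) (s : seq J) (t : Q) (F : J -> T) : uniq s ->
  \sum_(p <- s | (p.1 == t) && (p.2 < m t)%N) F p =
  \sum_(i < m t) (if (t, i : nat) \in s then F (t, i : nat) else 0).
Proof.
move=> us; rewrite -big_mkcond /= -big_filter.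
rewrite -(big_mkord (fun i => (t, i) \in s) (fun i => F (t, i))) -[RHS]big_filter.
transitivity (\sum_(p <- [seq (t, i) | i <- [seq i <- index_iota 0 (m t) | (t, i) \in s]]) F p);
  last by rewrite big_map.
apply: perm_big; apply: uniq_perm.
- exact: filter_uniq.
- rewrite map_inj_uniq ?filter_uniq ?iota_uniq // => i j [] //.
move=> [t' i]; rewrite mem_filter /=; apply/idP/mapP => [/andP[/andP[/eqP -> im] ts]|[j]].
  by exists i => //; rewrite mem_filter ts mem_index_iota.
by rewrite mem_filter mem_index_iota /= => /andP[tj jm] [-> ->]; rewrite eqxx jm.
Qed.

Lemma fiber_sum (T : nmodType) (s : seq J) (F : J -> T) :
  \sum_(t <- undup [seq p.1 | p <- s]) \sum_(p <- s | p.1 == t) F p = \sum_(p <- s) F p.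
Proof.
rewrite (exchange_big_dep xpredT) //= big_seq [RHS]big_seq; apply: eq_bigr => p ps.
rewrite -big_filter (_ : [seq _ <- _ | _] = [:: p.1]) ?big_seq1 //.
apply: perm_small_eq => //; apply: uniq_perm => //; first by rewrite filter_uniq ?undup_uniq.
move=> t; have pm : p.1 \in [seq p.1 | p <- s] by exact: (map_f (fun p : J => p.1) ps).
rewrite mem_filter inE mem_undup; apply/andP/eqP => [[/eqP]//|->].
by split; [exact: eqxx|exact: pm].
Qed.

Lemma bdiag_linear (y : Q -> nat -> nat -> V -> V) p q : (forall t i j, linear (y t i j)) -> linear (bdiag y p q).
Proof. by move=> ly; rewrite /bdiag; case: ifP => // _; exact: linear_zero. Qed.

(** Orthogonality of blocks: a section splits over the finitely many blocks that it meets, and each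
    is bounded separately. *)
Lemma bdiag_secle (y : Q -> nat -> nat -> V -> V) (M : R) : 0 <= M -> (forall t i j, linear (y t i j)) ->
  (forall t, mxle (fun i j : 'I_(m t) => y t i j) M) ->
  secle (fun _ _ : unit => bdiag y) M.
Proof.
move=> M0 ly yM s us xi0; rewrite !big_unit; under eq_bigr do rewrite big_unit.
move: (xi0 tt) => xi {xi0}.
pose v (t : Q) (j : nat) : V := if (t, j) \in s then xi (t, j) else 0.
have inner_sum p : \sum_(q <- s) bdiag y p q (xi q) =
    if (p.2 < m p.1)%N then \sum_(j < m p.1) y p.1 p.2 j (v p.1 j) else 0.
  case: ifPn => pm; last first.
    by rewrite big1 // => q _; rewrite /bdiag (negPf pm) andbF.
  rewrite (bigID (fun q => (q.1 == p.1) && (q.2 < m p.1)%N)) /= [X in _ + X]big1 ?addr0.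
    rewrite (eq_bigr (fun q => y p.1 p.2 q.2 (xi q))).
      rewrite slice //; apply: eq_bigr => j _; rewrite /v.
      by case: ifP => //; rewrite linear0'.
    move=> q /andP[/eqP e qm].
    by rewrite /bdiag e eqxx pm qm.
  move=> q; rewrite /bdiag eq_sym; case: eqP => //= <-.
  by rewrite pm /= => /negPf ->.
under eq_bigr do rewrite inner_sum.
rewrite -(fiber_sum s (fun p => nrm (xi p) ^+ 2)) -fiber_sum mulr_sumr.
apply: ler_sum => t _.
have h (F : J -> R) : \sum_(p <- s | p.1 == t) (if (p.2 < m p.1)%N then F p else 0) =
    \sum_(i < m t) (if (t, i : nat) \in s then F (t, i : nat) else 0).
  rewrite -slice // big_mkcondr; apply: eq_bigr => p /eqP ->.
  by case: ifP.
apply: (@le_trans _ _ (\sum_(i < m t) nrm (\sum_(j < m t) y t i j (v t j)) ^+ 2)).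
  rewrite (eq_bigr (fun p : J => if (p.2 < m p.1)%N then
     nrm (\sum_(j < m p.1) y p.1 p.2 j (v p.1 j)) ^+ 2 else 0)); last first.
    by move=> p _; case: ifP => // _; rewrite nrm0 expr0n.
  rewrite (h (fun p => nrm (\sum_(j < m p.1) y p.1 p.2 j (v p.1 j)) ^+ 2)).
  by apply: ler_sum => i _; case: ifP => // _; rewrite sqr_ge0.
have /(mxleP _ M0)/(_ (fun j => v t j)) h2 := yM t; apply: (le_trans h2).
rewrite ler_wpM2l ?sqr_ge0 //.
apply: (@le_trans _ _ (\sum_(p <- s | p.1 == t) (if (p.2 < m p.1)%N then nrm (xi p) ^+ 2 else 0))).
  rewrite (h (fun p => nrm (xi p) ^+ 2)); apply: ler_sum => i _; rewrite /v.
  by case: ifP => // _; rewrite nrm0 expr0n.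
by apply: ler_sum => p _; case: ifP => // _; rewrite sqr_ge0.
Qed.

End BlockDiagonal.

(** * The strong operator approximation property and complete compactness *)

Section IdTensor.
Variables (R : realType) (L : hilbertType R) (X : set (L -> L)).
Hypotheses (Xb : X `<=` bop L) (sX : lsub X).
Hypothesis Xcl : forall y, bop L y ->
  (forall e : R, 0 < e -> exists2 x, X x & ople (y - x) e) -> X y.

Section OneMap.
Variables (J : choiceType) (Phi : (L -> L) -> (L -> L)).
Hypothesis CBPhi : CB X X Phi.
Local Notation K := (l2 J (scal R)).
Local Notation T := (l2 J L).
Local Notation MT := (mintensor (@tn R J L) X).

Let PhiX x : X x -> X (Phi x). Proof. by case: CBPhi => h _ _; exact: h. Qed.
Let PhiL : linear_on X Phi. Proof. by case: CBPhi. Qed.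
Let lPhi x : X x -> linear (Phi x). Proof. by move=> /PhiX/Xb/bop_lin. Qed.

Let sMT : lsub MT. Proof. exact: (@mintensor_lsub R J L X Xb sX). Qed.

Let mtA x : MT x -> matA X x.
Proof.
move=> Mx; split; first exact: mintensor_bop Mx.
by move=> p q; exact: (mintensor_ent Xb sX Xcl p q Mx).
Qed.

Let phi : J -> J -> (L -> L) -> (L -> L) := fun _ _ => Phi.

Lemma smap_tensop (C : R) b x : 0 <= C -> schur_bd X phi C -> bop K b -> X x ->
  smap phi (tensop (@tn R J L) b x) = tensop (@tn R J L) b (Phi x).
Proof.
move=> C0 bd bb Xx.
have [h1 h2] := smapP C0 bd (fun _ _ => lPhi) (mtA (mintensor_tensop Xb bb Xx)).
have [_ _ e1] := tensopP bb (Xb Xx).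
have [h3 _ e3] := tensopP bb (Xb (PhiX Xx)).
apply: (ent_ext h1 h3) => p q v; rewrite h2 e1 e3 /phi.
by rewrite (linear_onZ sX PhiL _ Xx).
Qed.

Lemma smap_sub (C : R) x y : 0 <= C -> schur_bd X phi C -> MT x -> MT y ->
  smap phi (x - y) = smap phi x - smap phi y.
Proof.
move=> C0 bd Mx My; have := smapZD sX C0 bd (fun _ _ => PhiL) (fun _ _ => lPhi) (-1) (mtA My) (mtA Mx).
by rewrite !scaleN1r addrC => ->; rewrite addrC.
Qed.

Lemma algtensor_MT w : algtensor X w -> MT w.
Proof.
move=> aw; apply/(mintensorP Xb); split; first exact: (algtensor_bop Xb).
move=> e e0; exists w => //; rewrite subrr; apply: (ople_mon (ltW e0)); exact: ople_zero.
Qed.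

Lemma linear_algtensor (Th : (T -> T) -> (T -> T)) w : linear_on MT Th ->
  (forall b x, bop K b -> X x -> Th (tensop (@tn R J L) b x) = tensop (@tn R J L) b (Phi x)) ->
  algtensor X w -> algtensor X (Th w) /\ forall p q, ent (Th w) p q = Phi (ent w p q).
Proof.
move=> lT TE [n [b [x [bx ->]]]].
have Mt j : MT (tensop (@tn R J L) (b j) (x j)).
  by have [bb Xx] := bx j; exact: (mintensor_tensop Xb).
rewrite (linear_on_sum sMT lT) => [|j _]; last exact: Mt.
have e j : Th (tensop (@tn R J L) (b j) (x j)) = tensop (@tn R J L) (b j) (Phi (x j)).
  by have [bb Xx] := bx j; exact: TE.
rewrite (eq_bigr _ (fun j _ => e j)); split.
  exists n, b, (fun j => Phi (x j)); split=> // j.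
  by have [bb Xx] := bx j; split=> //; exact: PhiX.
move=> p q.
have es (z : 'I_n -> L -> L) : ent (\sum_j tensop (@tn R J L) (b j) (z j)) p q =
    \sum_j ent (tensop (@tn R J L) (b j) (z j)) p q.
  by apply/funext => v; rewrite /ent !sumfE (l2sumE R J).
rewrite !es.
have e1 j : ent (tensop (@tn R J L) (b j) (x j)) p q = coef (b j) p q *: x j.
  by have [bb Xx] := bx j; have [_ _ ->] := tensopP bb (Xb Xx).
have e2 j : ent (tensop (@tn R J L) (b j) (Phi (x j))) p q = coef (b j) p q *: Phi (x j).
  by have [bb Xx] := bx j; have [_ _ ->] := tensopP bb (Xb (PhiX Xx)).
rewrite (eq_bigr _ (fun j _ => e1 j)) (eq_bigr _ (fun j _ => e2 j)).
rewrite (linear_on_sum sX PhiL) => [|j _]; last by apply: (lsubZ sX); have [] := bx j.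
by apply: eq_bigr => j _; rewrite (linear_onZ sX PhiL) //; have [] := bx j.
Qed.

(** The specification behind [xget] is met by applying [Phi] to every entry; complete boundedness of
    [Phi] is what bounds this map. *)
Lemma id_tensorP : [/\ forall x, MT x -> MT (id_tensor (@tn R J L) X Phi x),
  linear_on MT (id_tensor (@tn R J L) X Phi),
  exists c : R, forall x, MT x ->
    (opnorm (id_tensor (@tn R J L) X Phi x) <= c%:E * opnorm x)%E
  & forall b x, bop K b -> X x ->
    id_tensor (@tn R J L) X Phi (tensop (@tn R J L) b x) = tensop (@tn R J L) b (Phi x)].
Proof.
have [_ _ [C C0 cC]] := (CB_cble Phi sX Xb Xb).1 CBPhi.
have bd : schur_bd X phi C by move=> I p a N; exact: cC.
have lin : linear_on MT (smap phi).
  move=> c x y Mx My.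
  exact: (smapZD sX C0 bd (fun _ _ => PhiL) (fun _ _ => lPhi) c (mtA Mx) (mtA My)).
have spec b x := @smap_tensop C b x C0 bd.
have bnd x (N : R) : MT x -> 0 < N -> ople x N -> ople (smap phi x) (C * N).
  move=> Mx N0 xN; have CN : 0 <= C * N by rewrite mulr_ge0 // ltW.
  apply: (ople_mxle1 (smap phi x) CN).2.
  exact: (smap_mxle C0 bd (fun _ _ => lPhi) N0 (fun _ _ => mtA Mx) ((ople_mxle1 x (ltW N0)).1 xN)).
have inMT x : MT x -> MT (smap phi x).
  move=> Mx; have [b1 _] := smapP C0 bd (fun _ _ => lPhi) (mtA Mx).
  apply/(mintensorP Xb); split=> // e e0.
  have [bx xc] := (mintensorP Xb x).1 Mx.
  have d0 : 0 < e / (C + 1) by rewrite divr_gt0 //; lra.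
  have [w aw xw] := xc _ d0; exists (smap phi w).
    by have [] := linear_algtensor lin spec aw.
  have Mw := algtensor_MT aw; rewrite -(smap_sub C0 bd Mx Mw).
  have h := bnd _ _ (lsubB sMT Mx Mw) d0 xw.
  by apply: (ople_mon _ h); exact: frac_le (ltW e0).
suff : exists Th, [/\ forall x, MT x -> MT (Th x), linear_on MT Th,
    exists c : R, forall x, MT x -> (opnorm (Th x) <= c%:E * opnorm x)%E
    & forall b x, bop K b -> X x -> Th (tensop (@tn R J L) b x) = tensop (@tn R J L) b (Phi x)].
  by move=> /(xgetPex 0).
exists (smap phi); split=> //; exists C => x Mx.
have bx := mintensor_bop Mx; have lx := bop_lin bx.
have [b1 _] := smapP C0 bd (fun _ _ => lPhi) (mtA Mx).
have x0 := opnorm_ge0 lx.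
have xf : (fine (opnorm x))%:E = opnorm x.
  by rewrite fineK // ge0_fin_numE //; case: bx.
have n0 : 0 <= fine (opnorm x) by rewrite fine_ge0.
rewrite -xf -EFinM; apply/opnormP; [exact: bop_lin|by rewrite mulr_ge0|].
apply: ople_eps => e e0; have d0 : 0 < e / (C + 1) by rewrite divr_gt0 //; lra.
have d1 : 0 < fine (opnorm x) + e / (C + 1) by lra.
have xN : ople x (fine (opnorm x) + e / (C + 1)).
  by apply: (@ople_mon _ _ _ _ (fine (opnorm x))); [lra|apply/opnormP => //; rewrite xf].
apply: (ople_mon _ (bnd _ _ Mx d1 xN)).
by rewrite mulrDr lerD2l; exact: frac_le (ltW e0).
Qed.

(** The specification determines the map on elementary tensors, hence everywhere by continuity;
    whichever map [xget] picked acts entrywise. *)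
Lemma id_tensor_ent x p q : MT x -> ent (id_tensor (@tn R J L) X Phi x) p q = Phi (ent x p q).
Proof.
move=> Mx; have [h1 h2 [c hc] h4] := id_tensorP.
have [_ _ [C C0 cC]] := (CB_cble Phi sX Xb Xb).1 CBPhi.
set Th := id_tensor _ _ _ in h1 h2 hc h4 *.
apply: ople_inj; apply: ople_eps => e e0; rewrite add0r.
have K0 : 0 < `|c| + C + 1 by have := normr_ge0 c; lra.
have d0 : 0 < e / (`|c| + C + 1) by rewrite divr_gt0.
have [bx xc] := (mintensorP Xb x).1 Mx.
have [w aw xw] := xc _ d0; have Mw := algtensor_MT aw.
have [_ ew] := linear_algtensor h2 h4 aw.
have Mxw := lsubB sMT Mx Mw.
have Xx : X (ent x p q) by case: (mtA Mx).
have Xw : X (ent w p q) by case: (mtA Mw).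
have -> : ent (Th x) p q - Phi (ent x p q) = ent (Th (x - w)) p q - Phi (ent (x - w) p q).
  rewrite (linear_onB sMT h2 Mx Mw).
  have -> : ent (x - w) p q = ent x p q - ent w p q by [].
  rewrite (linear_onB sX PhiL Xx Xw) -ew.
  have -> : ent (Th x - Th w) p q = ent (Th x) p q - ent (Th w) p q by [].
  by rewrite opprB [RHS]addrA subrK.
have t1 : ople (Th (x - w)) (`|c| * (e / (`|c| + C + 1))).
  apply/opnormP; [exact/bop_lin/mintensor_bop/h1|by rewrite mulr_ge0 // ltW|].
  apply: (le_trans (hc _ Mxw)).
  have lxw : linear (x - w) by exact/bop_lin/mintensor_bop/Mxw.
  have xo : (opnorm (x - w)%R <= (e / (`|c| + C + 1))%:E)%E by apply/opnormP => //; exact: ltW.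
  rewrite EFinM; apply: (@le_trans _ _ ((`|c|%:E) * opnorm (x - w)%R)%E).
    by apply: lee_wpmul2r; [exact: opnorm_ge0|rewrite lee_fin ler_norm].
  by apply: lee_wpmul2l => //; rewrite lee_fin.
have t2 : ople (Phi (ent (x - w) p q)) (C * (e / (`|c| + C + 1))).
  apply: (cble_ople Xb lPhi C0 d0 cC); first by case: (mtA Mxw).
  exact: (@ent_ople _ _ _ (x - w) p q _ (ltW d0) xw).
have n0 : 0 <= `|c| * (e / (`|c| + C + 1)) by rewrite mulr_ge0 // ltW.
apply: (ople_mon _ (ople_sub (ent_ople p q n0 t1) t2)).
by rewrite -mulrDl; apply: frac_le (ltW e0); rewrite addr_ge0.
Qed.

End OneMap.

(* All matrices in the unit balls are placed in a single block diagonal operator over the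
   index set J, to which the strong approximation is applied once. *)
Lemma soap_approx (Psi : (L -> L) -> (L -> L)) (e : R) : 0 < e ->
  completely_compact X X Psi -> SOAP X ->
  exists Phi, [/\ CB X X Phi, finite_rank X Phi & cble X (fun x => Phi (Psi x) - Psi x) e].
Proof.
move=> e0 [CBPsi cc] [D [le [Phi [[_ lerefl _ _] PhiP soap]]]].
have [PsiX PsiL [C C0 cC]] := (CB_cble Psi sX Xb Xb).1 CBPsi.
have lPsi x : X x -> linear (Psi x) by move=> /PsiX/Xb/bop_lin.
(* A block is indexed by the matrix itself together with its size; its rows and columns range over
   [nat] so that all sizes fit into one type. *)
pose Q : choiceType := {classic ((nat -> nat -> L -> L) * nat)}.
pose m (t : Q) : nat := (t : (nat -> nat -> L -> L) * nat).2.
pose xt (t : Q) : nat -> nat -> L -> L := (t : (nat -> nat -> L -> L) * nat).1.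
pose J : choiceType := (Q * nat)%type.
pose good t := (forall i j, X (xt t i j)) /\ mxle (fun i j : 'I_(m t) => xt t i j) 1.
(* Blocks whose index is not a contractive matrix over [X] are set to zero, so that the whole family
   is bounded. *)
pose y (t : Q) (i j : nat) : L -> L := if `[< good t >] then Psi (xt t i j) else 0.
have Xy t i j : X (y t i j).
  by rewrite /y; case: asboolP => [[h _]|_]; [exact: PsiX|case: sX].
have ly t i j : linear (y t i j) by apply/bop_lin/Xb/Xy.
have yC t : mxle (fun i j : 'I_(m t) => y t i j) (C + 1).
  rewrite /y; case: asboolP => [[h1 h2]|_].
    have h := cC _ (fun i j : 'I_(m t) => xt t i j) 1 (fun i j => h1 i j) ltr01 h2.
    by apply: (mxle_mon _ h); lra.
  by apply: (mxle_mon _ (@mxle_zero R L L _ _)); lra.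
have C1 : 0 <= C + 1 by lra.
have [z [lz zC zE]] := matrix_op C1 (fun p q : J => @bdiag_linear R Q m L y p q ly)
  (@bdiag_secle R Q m L y _ C1 ly yC).
have bz : bop (l2 J L) z by apply/bopP; split=> //; exists (C + 1).
(* Complete compactness enters here: all blocks are within d/2 of matrices over one space [Y], and
   expanding those in completely bounded coordinates of [Y] turns the approximant into a finite sum
   of tensors b_k ⊗ e_k. *)
have Mz : mintensor (@tn R J L) X z.
  apply/(mintensorP Xb); split=> // d d0.
  have d2 : 0 < d / 2 by lra.
  have [Y [fY YX Yd]] := cc _ d2.
  have sY := findim_lsub fY; have [n0 [e00 Ysp]] := findim_spanned fY.
  have [n [ek [f [Vek cf fE]]]] := coordinates sY Ysp.
  have wex t : exists w : nat -> nat -> L -> L, (forall i j, Y (w i j)) /\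
      mxle (fun i j : 'I_(m t) => y t i j - w i j : L -> L) (d / 2).
    have [gt|ngt] := pselect (good t); last first.
      exists (fun _ _ => 0); split; first by move=> _ _; case: sY.
      apply: (mxle_mon (ltW d2)); apply: eq_mxle (@mxle_zero R L L _ _) => i j v.
      by rewrite /y; case: asboolP => // _; rewrite subr0.
    have [Xx x1] := gt.
    pose xm : 'M[L -> L]_(m t) := \matrix_(i, j) xt t i j.
    have Xxm : mxset X xm by move=> i j; rewrite mxE.
    have xm1 : (mxnorm xm <= 1)%E.
      have lxm i j : linear (xm i j) by rewrite mxE; exact/bop_lin/Xb.
      by apply: (mxnormP lxm ler01).2; apply: eq_mxle x1 => i j v; rewrite mxE.
    have /ereal_inf_lt[_ [w Yw <-] wd] := Yd _ xm Xxm xm1.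
    exists (fun i j => if (insub i, insub j) is (Some i', Some j') then w i' j' else 0); split.
      move=> i j; case: (insub i) => [i'|]; last by case: sY.
      by case: (insub j) => [j'|]; [exact: Yw|case: sY].
    have lw i j : linear ((map_mx Psi xm - w) i j).
      rewrite !mxE; apply: linear_sub; first exact: lPsi.
      by apply/bop_lin/Xb/YX/Yw.
    have := (mxnormP lw (ltW d2)).1 (ltW wd); apply: eq_mxle => i j v.
    by rewrite !valK !mxE /y; case: asboolP.
  pose w t := projT1 (cid (wex t)).
  have Yw t i j : Y (w t i j) by rewrite /w; case: cid => ? [].
  have wd t : mxle (fun i j : 'I_(m t) => y t i j - w t i j : L -> L) (d / 2).
    by rewrite /w; case: cid => ? [].
  have lw t i j : linear (w t i j) by apply/bop_lin/Xb/YX/Yw.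
  have CD0 : 0 <= C + 1 + d / 2 by lra.
  have wC t : mxle (fun i j : 'I_(m t) => w t i j) (C + 1 + d / 2).
    apply: eq_mxle (mxle_sub (yC t) (wd t)) => i j v.
    by rewrite -[(y t i j - w t i j) v]/(y t i j v - w t i j v) opprB addrC subrK.
  have bex k : (k < n)%N -> exists b : l2 J (scal R) -> l2 J (scal R), bop _ b /\
      forall p q, coef b p q = if [&& p.1 == q.1, (p.2 < m p.1)%N & (q.2 < m q.1)%N]
        then f k (w p.1 p.2 q.2) else 0.
    move=> kn; have [lf [M M0 fM]] := cf k kn.
    pose g (t : Q) (i j : nat) : scal R -> scal R := fun c => f k (w t i j) *: c.
    have lg t i j : linear (g t i j).
      by move=> c a b; rewrite /g scalerDr !scalerA mulrC.
    have N0 : 0 <= M * (C + 1 + d / 2) by rewrite mulr_ge0.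
    have gM t : mxle (fun i j : 'I_(m t) => g t i j) (M * (C + 1 + d / 2)).
      by apply: fM.
    have [b [lb bM bE]] := matrix_op N0 (fun p q : J => @bdiag_linear R Q m (scal R) g p q lg)
      (@bdiag_secle R Q m (scal R) g _ N0 lg gM).
    exists b; split; first by apply/bopP; split=> //; exists (M * (C + 1 + d / 2)).
    move=> p q; rewrite /coef -[LHS]/(ent b p q (sone R)) bE /bdiag.
    by case: ifP => // _; rewrite /g -[LHS]/(f k (w p.1 p.2 q.2) * 1) mulr1.
  pose b (k : 'I_n) := projT1 (cid (bex k (ltn_ord k))).
  have bb k : bop _ (b k) by rewrite /b; case: cid => ? [].
  have bE k p q : coef (b k) p q = if [&& p.1 == q.1, (p.2 < m p.1)%N & (q.2 < m q.1)%N]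
        then f k (w p.1 p.2 q.2) else 0 by rewrite /b; case: cid => ? [].
  pose s := \sum_(k < n) tensop (@tn R J L) (b k) (ek k).
  have as_ : algtensor X s.
    by exists n, b, (fun k : 'I_n => ek k); split=> // k; split=> //; exact/YX/Vek.
  exists s => //.
  have bs : bop _ (z - s) by apply: bop_sub => //; exact: (algtensor_bop Xb).
  apply: (ople_mon (M := d / 2)); first by lra.
  apply: (ople_secle (ltW d2) bs).
  have lyw t i j : linear (y t i j - w t i j) by exact: linear_sub.
  have := @bdiag_secle R Q m L (fun t i j => y t i j - w t i j) _ (ltW d2) lyw wd; congr (secle _ _).
  apply/funext => _; apply/funext => _; apply/funext => p; apply/funext => q; apply/funext => v.
  rewrite -[RHS]/(ent z p q v - ent s p q v) zE.
  have -> : ent s p q v = \sum_(k < n) ent (tensop (@tn R J L) (b k) (ek k)) p q v.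
    by rewrite /ent /s sumfE (l2sumE R J).
  have ets k : ent (tensop (@tn R J L) (b k) (ek k)) p q v = coef (b k) p q *: ek k v.
    by have [_ _ ->] := tensopP (bb k) (Xb (YX _ (Vek _ (ltn_ord k)))).
  rewrite (eq_bigr _ (fun k _ => ets k)) /bdiag.
  under eq_bigr do rewrite bE.
  case: ifP => _; last first.
    by rewrite big1 ?subr0 // => k _; rewrite scale0r.
  rewrite -[LHS]/(y p.1 p.2 q.2 v - w p.1 p.2 q.2 v); congr (_ - _).
  by rewrite {1}(fE _ (Yw p.1 p.2 q.2)) sumfE.
(* One index of the net is enough, since [z] already contains the image of every contractive
   matrix. *)
have [i0 i0P] := soap _ _ _ (@tn_hilbert R J L) z Mz e e0.
have {}i0P := i0P i0 (lerefl i0); have [CBP frP] := PhiP i0.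
exists (Phi i0); split=> // I x N Xx N0 xN.
have [PhiX PhiL _] := CBP.
have [MTh _ _ _] := id_tensorP J CBP.
set Th := id_tensor _ _ _ in MTh i0P.
have bTz : bop _ (Th z - z) by apply: bop_sub => //; exact/mintensor_bop/MTh.
have he := opnorm_lt_ople (bop_lin bTz) i0P.
(* The given matrix, scaled to norm at most 1 and padded by zeros, is one of the indices;
   compressing to its block reads off the estimate. *)
pose xn (i j : nat) : L -> L := if (insub i : option 'I_#|I|, insub j : option 'I_#|I|) is (Some i', Some j')
  then N^-1%:C *: x (enum_val i') (enum_val j') else 0.
pose t : Q := (xn, #|I|).
have gt : good t.
  split.
    move=> i j; rewrite /xt /= /xn; case: (insub i) => [i'|]; last by case: sX.
    by case: (insub j) => [j'|]; [exact: (lsubZ sX)|case: sX].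
  have lx i j : linear (x i j) by exact/bop_lin/Xb.
  have := mxle_scale (N^-1)%:C (mxle_reindex (ltW N0) (@enum_val_inj _ (mem I))
      (@enum_val_inj _ (mem I)) lx xN).
  have -> : complex.Re `|(N^-1)%:C| * N = 1.
    by rewrite Re_norm_real ?invr_ge0 ?(ltW N0) // mulVf // gt_eqF.
  by apply: eq_mxle => i j v; rewrite /xt /= /xn !valK.
have h := @mxle_compress R L unit J 'I_#|I| (fun _ _ => Th z - z) e (fun=> tt)
  (fun i => (t, val i)) (ltW e0) (fun _ _ => bop_lin bTz) ((ople_mxle1 _ (ltW e0)).1 he).
have {}h := h (fun k l _ e1 => val_inj (congr1 snd e1)).
have Xz p q : X (ent z p q) by exact: (mintensor_ent Xb sX Xcl p q Mz).
have he2 : mxle (fun i j : 'I_#|I| => N^-1%:C *: (Phi i0 (Psi (x (enum_val i) (enum_val j))) -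
    Psi (x (enum_val i) (enum_val j)))) e.
  apply: eq_mxle h => i j v.
  rewrite -[LHS]/(ent (Th z) (t, val i) (t, val j) v - ent z (t, val i) (t, val j) v).
  rewrite (id_tensor_ent CBP _ _ Mz).
  have -> : ent z (t, val i) (t, val j) = N^-1%:C *: Psi (x (enum_val i) (enum_val j)).
    apply/funext => u; rewrite zE /bdiag /= eqxx !ltn_ord /= /y.
    case: asboolP => // _; rewrite /xt /= /xn !valK.
    by rewrite (linear_onZ sX PsiL).
  rewrite (linear_onZ sX PhiL); last exact: PsiX.
  by rewrite -scalerBr.
have lin i j : linear (Phi i0 (Psi (x i j)) - Psi (x i j)).
  by apply: linear_sub; [exact/bop_lin/Xb/PhiX/PsiX|exact: lPsi].
have := mxle_scale N%:C (mxle_reindex (ltW e0) (@enum_rank_inj I) (@enum_rank_inj I) _ he2).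
rewrite Re_norm_real ?(ltW N0) // mulrC => h'; apply: eq_mxle (h' _).
  move=> i j v; rewrite !enum_rankK.
  rewrite -[X in _ *: X = _]/(_ *: (Phi i0 (Psi (x i j)) - Psi (x i j)) v) scalerA -rmorphM.
  by rewrite mulfV ?gt_eqF // scale1r.
by move=> i j; exact: linear_scale.
Qed.

End IdTensor.

(** * Approximation by finitely supported multipliers *)

Section Approximation.
Variables (R : realType) (G : groupType) (H : hilbertType R).
Variables (A : set (H -> H)) (alpha : G -> (H -> H) -> (H -> H)).
Hypotheses (cA : cstar_algebra A) (dyn : dyn_action A alpha).
Local Notation HH := (l2 G H).
Local Notation X := (crossed A alpha).
Local Notation gen := (gen alpha).

Let Xb : X `<=` bop HH. Proof. exact: crossed_bop. Qed.
Let sX : lsub X. Proof. exact: (crossed_lsub cA dyn). Qed.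
Let sA : lsub A. Proof. exact: (A_lsub cA). Qed.
Let Xcl y : bop HH y ->
  (forall e : R, 0 < e -> exists2 x, X x & ople (y - x) e) -> X y.
Proof. by move=> /bop_lin ly; exact: (crossed_closed cA dyn). Qed.

Lemma mxle_ent (I : finType) (x : I -> I -> HH -> HH) (M : R) p q : 0 <= M ->
  mxle x M -> mxle (fun i j => ent (x i j) p q) M.
Proof.
move=> M0 /(mxleP _ M0) xM; apply/mxleP => // v.
have := xM (fun j => dl q (v j)); under [X in _ <= _ * X -> _]eq_bigr do rewrite nrm_dl.
apply: le_trans; apply: ler_sum => i _.
set w := \sum_j x i j _; have -> : \sum_j ent (x i j) p q (v j) = w p.
  by rewrite /w (l2sumE R G).
by rewrite lerXn2r ?nnegrE ?nrm_ge0 //; exact: (@l2_coord _ _ _ w p).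
Qed.

Lemma gen_mxle1 (I : finType) t (x : I -> I -> H -> H) (M : R) : 0 <= M ->
  (forall i j, A (x i j)) -> mxle x M -> mxle (fun i j => gen t (x i j)) M.
Proof.
move=> M0 Ax xM; apply/mxleP => // v.
have /(mxleP _ M0)/(_ (fun j => lambda_ t (v j))) h := pi_mxle cA dyn M0 Ax xM.
apply: (le_trans h); rewrite ler_wpM2l ?sqr_ge0 //; apply: ler_sum => j _.
by rewrite lerXn2r ?nnegrE ?nrm_ge0 //; exact: lambda_le.
Qed.

(* The multiplier t ↦ E_t(Ψ(π(·)λ_t)) of a completely bounded map Ψ of the crossed product. *)
Definition mult_of (Psi : (HH -> HH) -> (HH -> HH)) (t : G) (a : H -> H) : H -> H :=
  fc (Psi (gen t a)) t.

Lemma mult_of_bounded (Psi : (HH -> HH) -> (HH -> HH)) : CB X X Psi -> bounded_CB A (mult_of Psi).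
Proof.
move=> CBP; have [PX lP [C C0 cC]] := (CB_cble Psi sX Xb Xb).1 CBP.
have Xg t a : A a -> X (gen t a) by exact: (crossed_gen cA dyn).
have mA t a : A a -> A (mult_of Psi t a).
  by move=> Aa; apply: (crossed_fc cA dyn); apply: PX; exact: Xg.
have ml t : linear_on A (mult_of Psi t).
  by move=> c a b Aa Ab; rewrite /mult_of (genZD cA dyn t c Aa Ab) lP //; exact: Xg.
have mC t : cble A (mult_of Psi t) C.
  move=> I x N Ax N0 xN; have CN : 0 <= C * N by rewrite mulr_ge0 // ltW.
  have h := cC I _ N (fun i j => Xg t _ (Ax i j)) N0 (gen_mxle1 t (ltW N0) Ax xN).
  exact: (mxle_ent 1%g t^-1%g CN h).
have lm t a : A a -> linear (mult_of Psi t a) by move=> /(mA t)/(A_lin cA).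
have Ab : A `<=` bop H by move=> a; exact: (A_bop cA).
split=> [t|].
  by apply/(CB_cble _ sA Ab Ab); split; [exact: mA|exact: ml|exists C].
by exists C => t; apply: (cbnorm_le Ab (lm t) C0).
Qed.

Lemma mult_of_bd (Psi : (HH -> HH) -> (HH -> HH)) (M : R) : 0 <= M -> CB X X Psi -> cble X Psi M ->
  schur_bd A (N_ alpha (mult_of Psi)) M.
Proof.
move=> M0 [PX _ _] cM; apply: (transference cA dyn M0 cM) => t a Aa.
  exact: (crossed_gen cA dyn).
by split=> //; apply: PX; exact: (crossed_gen cA dyn).
Qed.

Lemma bounded_CB_sub (F F' : G -> (H -> H) -> (H -> H)) : bounded_CB A F -> bounded_CB A F' -> bounded_CB A (F - F').
Proof.
move=> bF bF'; have [c c0 cP] := F_bound cA bF; have [c' c0' cP'] := F_bound cA bF'.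
have Ab : A `<=` bop H by move=> a; exact: (A_bop cA).
have FE t a : (F - F') t a = F t a - F' t a by [].
have mA t a : A a -> A ((F - F') t a).
  by move=> Aa; rewrite FE; apply: (lsubB sA); [exact: (F_A bF)|exact: (F_A bF')].
have ml t : linear_on A ((F - F') t).
  by move=> d a b Aa Ab'; rewrite !FE (F_lin bF) // (F_lin bF') // scalerBr opprD addrACA.
have mC t : cble A ((F - F') t) (c + c').
  move=> I x N Ax N0 xN; rewrite mulrDl.
  exact: eq_mxle (mxle_sub (cP t I x N Ax N0 xN) (cP' t I x N Ax N0 xN)).
have cc : 0 <= c + c' by rewrite addr_ge0.
have lm t a : A a -> linear ((F - F') t a) by move=> /(mA t)/(A_lin cA).
split=> [t|].
  by apply/(CB_cble _ sA Ab Ab); split; [exact: mA|exact: ml|exists (c + c')].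
by exists (c + c') => t; apply: (cbnorm_le Ab (lm t) cc).
Qed.

Variable F : G -> (H -> H) -> (H -> H).
Hypothesis hsF : herz_schur A alpha F.

Let bF : bounded_CB A F. Proof. by case: hsF. Qed.

Lemma S_spec : [/\ CB X X (S_ A alpha F), forall x, X x -> forall t, fc (S_ A alpha F x) t = F t (fc x t)
  & forall t a, A a -> S_ A alpha F (gen t a) = gen t (F t a)].
Proof.
have [M M0 bN] := herz_schur_bd cA dyn bF hsF.
have [CBS _] := S_P cA dyn bF M0 bN.
have h x : X x -> forall t, fc (S_ A alpha F x) t = F t (fc x t).
  move=> Xx t; rewrite (S_smap cA dyn bF M0 bN Xx).
  exact: (smap_crossed cA dyn bF M0 bN Xx).
split=> // t a Aa; have Xg := crossed_gen cA dyn t Aa.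
have AF : A (F t a) by exact: (F_A bF).
apply: (crossed_ext cA dyn); [by case: CBS => PX _ _; exact: PX|exact: (crossed_gen cA dyn)|].
move=> s; rewrite h // !(fc_gen cA dyn) //; case: eqP => [->//|_].
by rewrite (linear_on0 sA (F_lin bF s)).
Qed.

(** A basis of the range is moved into the finite sums. Its coordinates are completely bounded, so a
    small change of the basis is a small change in cb-norm. *)
Lemma finite_rank_perturb (Psi : (HH -> HH) -> (HH -> HH)) (e : R) : 0 < e ->
  CB X X Psi -> finite_rank X Psi ->
  exists n (g : nat -> (HH -> HH) -> R[i]) (E : nat -> seq G) (h : nat -> G -> H -> H),
    [/\ forall k, uniq (E k), forall k t, A (h k t),
      CB X X (fun x => \sum_(k < n) g k x *: pps alpha (E k) (h k)),
      cble X (fun x => \sum_(k < n) g k x *: pps alpha (E k) (h k) - Psi x) e &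
      forall k, (k < n)%N -> forall c x y, X x -> X y -> g k (c *: x + y) = c * g k x + g k y].
Proof.
move=> e0 CBP [Y fY YP]; have [PX lP [C C0 cC]] := (CB_cble Psi sX Xb Xb).1 CBP.
pose V := Psi @` X.
have sV : lsub V.
  split; first by exists 0; [case: sX|exact: (linear_on0 sX lP)].
  move=> c _ _ [x Xx <-] [y Xy <-]; exists (c *: x + y); first by case: sX => _; apply.
  exact: lP.
have [n0 [e00 Ysp]] := findim_spanned fY.
have VY y : V y -> spanned n0 e00 y by move=> [x Xx <-]; apply: Ysp; exact: YP.
have [n [ek [f [Vek cf fE]]]] := coordinates sV VY.
have Xek k : (k < n)%N -> X (ek k) by move=> /Vek[x Xx <-]; exact: PX.
have lPx x : X x -> linear (Psi x) by move=> /PX/Xb/bop_lin.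
have cM k : exists2 M : R, 0 <= M & (k < n)%N -> forall (I : finType) (x : I -> I -> HH -> HH) (N : R),
    0 <= N -> (forall i j, linear (x i j)) -> mxle x N ->
    mxle (fun i j (z : scal R) => f k (x i j) *: z) (M * N).
  have [kn|kn] := boolP (k < n)%N; last by exists 0.
  by have [_ [M M0 h]] := cf k kn; exists M => // _; exact: h.
pose M k := projT1 (cid2 (cM k)).
have M0 k : 0 <= M k by rewrite /M; case: cid2.
have MP k : (k < n)%N -> forall (I : finType) (x : I -> I -> HH -> HH) (N : R),
    0 <= N -> (forall i j, linear (x i j)) -> mxle x N ->
    mxle (fun i j (z : scal R) => f k (x i j) *: z) (M k * N).
  by rewrite /M; case: cid2.
(* Chosen so that each of the n terms costs M k * C * d k <= e / (n + 1) per unit of norm. *)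
pose d k := e / ((n%:R + 1) * (M k * C + 1)).
have d0 k : 0 < d k.
  rewrite divr_gt0 // mulr_gt0 // ?ltr_wpDl ?mulr_ge0 //.
have pert k : exists Eh : seq G * (G -> H -> H), (k < n)%N ->
    [/\ uniq Eh.1, forall t, A (Eh.2 t) & ople (ek k - pps alpha Eh.1 Eh.2) (d k)].
  have [kn|kn] := boolP (k < n)%N; last by exists ([::], fun=> 0).
  have [_ h] := (crossedP cA dyn (ek k)).1 (Xek k kn).
  by have [E [h' [p1 p2 p3]]] := h _ (d0 k); exists (E, h').
have [W WP] := choice pert.
pose E k := if (k < n)%N then (W k).1 else [::].
pose h k := if (k < n)%N then (W k).2 else fun=> 0.
have uE k : uniq (E k) by rewrite /E; case: ifP => // kn; case: (WP k kn).
have Ah k t : A (h k t).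
  by rewrite /h; case: ifP => [kn|_]; [case: (WP k kn)|exact: (A_zero cA)].
have dE k : (k < n)%N -> ople (ek k - pps alpha (E k) (h k)) (d k).
  by move=> kn; rewrite /E /h kn; case: (WP k kn).
pose g k x := f k (Psi x).
have gD k : (k < n)%N -> forall c x y, X x -> X y -> g k (c *: x + y) = c * g k x + g k y.
  by move=> kn c x y Xx Xy; rewrite /g lP //; have [-> _] := cf k kn.
exists n, g, E, h.
pose P2 x := \sum_(k < n) g k x *: pps alpha (E k) (h k).
have XP2 x : X x -> X (P2 x).
  move=> Xx; apply: (lsub_sum sX) => k _; apply: (lsubZ sX).
  exact: (crossed_pps cA dyn).
have lP2 : linear_on X P2.
  move=> c x y Xx Xy; rewrite /P2 scaler_sumr -big_split; apply: eq_bigr => k _.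
  by rewrite gD // scalerDl scalerA.
have diff x : X x -> P2 x - Psi x = \sum_(k < n) g k x *: (pps alpha (E k) (h k) - ek k).
  move=> Xx; rewrite {1}(fE (Psi x)); last by exists x.
  by rewrite -sumrB; apply: eq_bigr => k _; rewrite scalerBr.
have c2 : cble X (fun x => P2 x - Psi x) e.
  move=> I x N Xx N0 xN.
  have CN : 0 <= C * N by rewrite mulr_ge0 // ltW.
  have h1 := cC I x N Xx N0 xN.
  have h2 (k : 'I_n) : mxle (fun i j => g k (x i j) *: (pps alpha (E k) (h k) - ek k)) (M k * (C * N) * d k).
    have := @scalar_op_mxle R HH I I (fun i j => g k (x i j)) (M k * (C * N)) _ _ (pps alpha (E k) (h k) - ek k) (d k).
    apply; [by rewrite mulr_ge0| |exact: ltW|].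
      by apply: (MP k) => // i j; exact: lPx.
    by rewrite -opprB; apply: ople_opp; exact: dE.
  apply: (mxle_mon (M := \sum_(k < n) M k * (C * N) * d k)); last first.
    apply: eq_mxle (mxle_sum (index_enum 'I_n) h2) => i j v.
    by rewrite (diff _ (Xx i j)).
  apply: (@le_trans _ _ (\sum_(k < n) (e * N / (n%:R + 1)))).
    apply: ler_sum => k _; rewrite /d.
    have a1 : 0 < M k * C + 1 by rewrite ltr_wpDl ?mulr_ge0.
    have a2 : (0 : R) < n%:R + 1 by rewrite ltr_wpDl.
    have -> : M k * (C * N) * (e / ((n%:R + 1) * (M k * C + 1))) =
        (M k * C) * ((e * N / (n%:R + 1)) / (M k * C + 1)).
      by field; rewrite !gt_eqF.
    apply: frac_le; first by rewrite mulr_ge0.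
    by rewrite divr_ge0 ?(ltW a2) // mulr_ge0 ?(ltW e0) ?(ltW N0).
  rewrite sumr_const card_ord -[leLHS]mulr_natl.
  by apply: frac_le => //; rewrite mulr_ge0 ?(ltW e0) ?(ltW N0).
have cc2 : CB X X P2.
  apply/(CB_cble _ sX Xb Xb); split; [exact: XP2|exact: lP2|exists (e + C)].
    by rewrite addr_ge0 // ltW.
  move=> I x N Xx N0 xN; rewrite mulrDl.
  apply: eq_mxle (mxle_add (c2 I x N Xx N0 xN) (cC I x N Xx N0 xN)) => i j v.
  by rewrite -[(P2 (x i j) - Psi (x i j)) v]/(P2 (x i j) v - Psi (x i j) v) subrK.
by split.
Qed.

Lemma approx_multiplier (e : R) : 0 < e ->
  completely_compact X X (S_ A alpha F) -> SOAP X ->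
  exists F' (U : set (H -> H)),
    [/\ herz_schur A alpha F' /\ finitely_supported A F',
      findim U /\ U `<=` A, forall s a, A a -> U (F' s a)
    & (mnorm A alpha (F' - F)%R < e%:E)%E].
Proof.
(* One third for SOAP, one third for moving the range into the finite sums, and the last one for
   strictness. *)
move=> e0 cc soap; have e3 : 0 < e / 3 by lra.
have [CBS Sfc Sgen] := S_spec.
have [SX lS [C C0 cS]] := (CB_cble _ sX Xb Xb).1 CBS.
have [Phi [CBP frP cP]] := soap_approx Xb sX Xcl e3 cc soap.
have [PX lP [C' C0' cP']] := (CB_cble _ sX Xb Xb).1 CBP.
pose Psi x := Phi (S_ A alpha F x).
have CBPsi : CB X X Psi.
  apply/(CB_cble _ sX Xb Xb); split.
  - by move=> x /SX/PX.
  - move=> c x y Xx Xy; rewrite /Psi (lS c x y Xx Xy).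
    exact: (lP c _ _ (SX x Xx) (SX y Xy)).
  exists (C' * (C + 1)); first by rewrite mulr_ge0 //; lra.
  move=> I x N Xx N0 xN; rewrite -mulrA.
  have N1 : 0 < (C + 1) * N by rewrite mulr_gt0 //; lra.
  have CC : C * N <= (C + 1) * N by rewrite ler_wpM2r ?(ltW N0) //; lra.
  exact: (cP' I _ _ (fun i j => SX _ (Xx i j)) N1 (mxle_mon CC (cS I x N Xx N0 xN))).
have frPsi : finite_rank X Psi.
  by have [Y fY YP] := frP; exists Y => // x /SX; exact: YP.
have [n [g [E [h [uE Ah CBP2 cP2 gD]]]]] := finite_rank_perturb e3 CBPsi frPsi.
set P2 := fun x => _ in CBP2 cP2.
pose F' := mult_of P2.
have [P2X lP2 [C2 C20 c2]] := (CB_cble _ sX Xb Xb).1 CBP2.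
have F'E t a : F' t a = \sum_(k < n) g k (gen t a) *: ffin (E k) (h k) t.
  apply/funext => v; rewrite /F' /mult_of /fc /ent /P2 !sumfE (l2sumE R G).
  apply: eq_bigr => k _.
  rewrite -[LHS]/(g k (gen t a) *: fc (pps alpha (E k) (h k)) t v).
  by rewrite (fc_pps cA dyn).
(* The coefficients of all the finite sums together span one space that serves every degree. *)
pose s := [seq (k, t) | k <- index_iota 0 n, t <- E k].
pose U := [set \sum_(i < size s) c i *: h (tnth (in_tuple s) i).1 (tnth (in_tuple s) i).2
  | c in [set: 'I_(size s) -> R[i]]].
have UF t a : U (F' t a).
  exists (fun i => if (tnth (in_tuple s) i).2 == t then g (tnth (in_tuple s) i).1 (gen t a) else 0) => //.
  rewrite -(big_tnth _ _ s xpredT (fun kt => (if kt.2 == t then g kt.1 (gen t a) else 0) *: h kt.1 kt.2)).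
  rewrite big_allpairs_dep /= big_mkord F'E.
  apply: eq_bigr => k _; rewrite /ffin; case: ifPn => tE.
    rewrite (bigD1_seq t) //= eqxx big1 ?addr0 // => r /negPf ->.
    by rewrite scale0r.
  rewrite scaler0 big_seq big1 // => r rE; case: eqP => [rt|_]; last by rewrite scale0r.
  by rewrite -rt rE in tE.
have bF' : bounded_CB A F' by exact: mult_of_bounded.
exists F', U; split.
- split; first exact: (bd_herz_schur cA dyn bF' C20 (mult_of_bd C20 CBP2 c2)).
  exists [fset t | t in flatten [seq E k | k <- iota 0 n]]%fset => t tE a Aa.
  rewrite F'E big1 // => k _; rewrite /ffin; case: ifPn => [tk|_]; last by rewrite scaler0.
  case/negP: tE; rewrite in_fset /=; apply/flattenP; exists (E k) => //.
  by apply: map_f; rewrite mem_iota /= add0n.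
- split; first by exists (size s), (fun i => h (tnth (in_tuple s) i).1 (tnth (in_tuple s) i).2).
  move=> _ [c _ <-]; apply: (lsub_sum sA) => i _; exact: (lsubZ sA).
- by move=> t a _.
have e23 : e / 3 + e / 3 < e by lra.
have e23' : 0 <= e / 3 + e / 3 by lra.
apply: (mnorm_lt cA dyn (bounded_CB_sub bF' bF) e23' e23).
apply: (transference cA dyn (X0 := X) (Psi := fun x => P2 x - S_ A alpha F x) e23').
- move=> I x N Xx N0 xN; rewrite mulrDl.
  apply: eq_mxle (mxle_add (cP2 I x N Xx N0 xN) (cP I (fun i j => x i j) N Xx N0 xN)) => i j v.
  rewrite -[(P2 (x i j) - _) v]/(P2 (x i j) v - Psi (x i j) v).
  by rewrite -[(Phi _ - _) v]/(Psi (x i j) v - S_ A alpha F (x i j) v) addrA subrK.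
- by move=> t a Aa; exact: (crossed_gen cA dyn).
move=> t a Aa; have Xg := crossed_gen cA dyn t Aa.
split; first by apply: (lsubB sX); [exact: P2X|exact: SX].
rewrite -[LHS]/(F' t a - fc (S_ A alpha F (gen t a)) t) Sfc //.
by rewrite (fc_gen cA dyn) // eqxx.
Qed.

End Approximation.

(** * Uniform approximation by truncations in a graded Hilbert space *)

Section LogConvex.
Variable R : realType.

(** Take the leftmost index where the maximum is attained: if it were interior, log-convexity would
    make its left neighbour as large. The lemma interpolates ‖h^i w‖ between i = 0 and i = 2D. *)
Lemma logconvex_max (a : nat -> R) n (M : R) : (forall i, 0 <= a i) ->
  (forall i, (0 < i)%N -> (i < n)%N -> a i ^+ 2 <= a i.-1 * a i.+1) ->
  a 0%N <= M -> a n <= M -> forall i, (i <= n)%N -> a i <= M.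
Proof.
move=> a0 lc aM0 aMn i0 i0n; rewrite leNgt; apply/negP => Mi0.
have M0 : 0 <= M by exact: le_trans aM0.
pose mx := [arg max_(i > (Ordinal (i0n : (i0 < n.+1)%N)) | predT i) a (i : 'I_n.+1)]%O.
have mxP (j : 'I_n.+1) : a j <= a mx by rewrite /mx; case: arg_maxP => // k _ /(_ j isT).
have ex : exists i, (i <= n)%N && (a i == a mx).
  by exists mx; rewrite eqxx andbT -ltnS ltn_ord.
case: (ex_minnP ex) => i /andP[iln /eqP aimx] imin.
have big : M < a i by rewrite aimx; apply: (lt_le_trans Mi0); exact: (mxP (Ordinal (i0n : (i0 < n.+1)%N))).
have i_pos : (0 < i)%N by rewrite lt0n; apply/eqP => e; move: big; rewrite e ltNge aM0.
have i_lt : (i < n)%N.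
  by rewrite ltn_neqAle iln andbT; apply/eqP => e; move: big; rewrite e ltNge aMn.
have ap : 0 < a i by exact: le_lt_trans big.
have h1 := lc i i_pos i_lt.
have h2 : a i.+1 <= a i by rewrite aimx; exact: (mxP (Ordinal (i_lt : (i.+1 < n.+1)%N))).
have h3 : a i.-1 <= a i.
  have lt : (i.-1 < n.+1)%N by rewrite ltnS (leq_trans (leq_pred i)).
  by rewrite aimx; exact: (mxP (Ordinal lt)).
have h4 : a i <= a i.-1.
  rewrite -(ler_pM2r ap) -expr2; apply: (le_trans h1).
  by rewrite ler_wpM2l.
have : (i <= i.-1)%N.
  apply: imin; rewrite (leq_trans (leq_pred i)) //=; apply/eqP/le_anti.
  by rewrite -aimx h3 h4.
by rewrite leqNgt prednK // leqnn.
Qed.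

End LogConvex.

(** * Truncated resolvents of a bounded selfadjoint operator *)

Section Resolvent.
Variables (R : realType) (V : hilbertType R) (h : V -> V) (N : R) (D : nat).
Hypotheses (lh : linear h) (hh : adjoint h h) (N0 : 0 <= N) (hN : ople h N).
Local Notation hp i := (iter i h).

Lemma iter_linear (f : V -> V) i : linear f -> linear (iter i f).
Proof. by move=> lf; elim: i => [//|i IH] c u v; rewrite !iterS IH lf. Qed.

Lemma iter_ople (f : V -> V) (M : R) i : 0 <= M -> ople f M -> ople (iter i f) (M ^+ i).
Proof.
move=> M0 fM; elim: i => [|i IH] v; first by rewrite expr0 mul1r.
by rewrite iterS exprS -mulrA (le_trans (fM _)) // ler_wpM2l.
Qed.

Lemma iter_adjoint i : adjoint (hp i) (hp i).
Proof.
elim: i => [|i IH] u v //.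
by rewrite iterS hh IH -iterSr.
Qed.

Let Lam2 : R := (N ^+ D) ^+ 2.
Let rs : R[i] := ((1 + Lam2)^-1)%:C.
Let Lam20 : 0 <= Lam2. Proof. exact: sqr_ge0. Qed.
Let Lp : 0 < 1 + Lam2. Proof. by rewrite ltr_wpDr. Qed.

(** With Λ = N^D this is the B for which 1 + h^{2D} = (1 + Λ²)(1 - B). It is a strict contraction
    because 0 <= h^{2D} <= Λ². *)
Definition Bop (v : V) : V := rs *: (Lam2%:C *: v - hp (2 * D) v).

(** The Neumann series of (1 + h^{2D})⁻¹, cut after m terms. The cut makes it a polynomial in h, so
    that finiteness of the support of h passes to it. *)
Definition Rop m (v : V) : V := rs *: \sum_(j < m) iter j Bop v.

Lemma Bop_linear : linear Bop.
Proof.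
move=> c u v; rewrite /Bop (iter_linear _ lh).
have -> : Lam2%:C *: (c *: u + v) - (c *: hp (2 * D) u + hp (2 * D) v) =
    c *: (Lam2%:C *: u - hp (2 * D) u) + (Lam2%:C *: v - hp (2 * D) v).
  by rewrite [_ *: (_ + v)]scalerDr scalerA mulrC -scalerA opprD addrACA -scalerBr.
by rewrite [LHS]scalerDr scalerA [rs * c]mulrC -scalerA.
Qed.

Lemma Bop_comm i v : hp i (Bop v) = Bop (hp i v).
Proof.
have li := iter_linear i lh.
rewrite /Bop (linearZ' _ _ li) (linearB' _ _ li) (linearZ' _ _ li).
by rewrite -!iterD addnC.
Qed.

(** ‖(Λ² - h^{2D})v‖² = Λ⁴‖v‖² - 2Λ²‖h^D v‖² + ‖h^{2D} v‖², and the last term is at most Λ²‖h^D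
    v‖². *)
Lemma Bop_ople : ople Bop (Lam2 / (1 + Lam2)).
Proof.
move=> v; rewrite /Bop nrmZ Re_norm_real ?invr_ge0 ?(ltW Lp) //.
rewrite mulrAC [leRHS]mulrC ler_wpM2l ?invr_ge0 ?(ltW Lp) //.
rewrite -ler_sqr ?nnegrE ?nrm_ge0 ?(mulr_ge0 Lam20 (nrm_ge0 v)) // nrm_sqrB rinZ nrmZ Re_norm_real //.
have -> : rin v (hp (2 * D) v) = nrm (hp D v) ^+ 2.
  by rewrite mul2n -addnn iterD /rin -(iter_adjoint D v) -/(rin _ _) rin_xx.
have : nrm (hp (2 * D) v) ^+ 2 <= Lam2 * nrm (hp D v) ^+ 2.
  rewrite mul2n -addnn iterD /Lam2 -exprMn lerXn2r ?nnegrE ?mulr_ge0 ?nrm_ge0 ?exprn_ge0 //.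
  exact: (iter_ople D N0 hN (hp D v)).
have : 0 <= Lam2 * nrm (hp D v) ^+ 2 by rewrite mulr_ge0 ?sqr_ge0.
by move: (nrm (hp D v) ^+ 2) (nrm (hp (2 * D) v) ^+ 2) => a b; lra.
Qed.

Let beta : R := Lam2 / (1 + Lam2).
Let beta0 : 0 <= beta. Proof. by rewrite divr_ge0 // ltW. Qed.
Let beta1 : beta < 1. Proof. by rewrite ltr_pdivrMr // mul1r ltrDr. Qed.

Lemma Rop_linear m : linear (Rop m).
Proof.
move=> c u v; rewrite /Rop.
under eq_bigr do rewrite (iter_linear _ Bop_linear).
by rewrite big_split /= -scaler_sumr scalerDr scalerA [rs * c]mulrC -scalerA.
Qed.

Lemma Rop_comm m i v : hp i (Rop m v) = Rop m (hp i v).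
Proof.
have li := iter_linear i lh.
rewrite /Rop (linearZ' _ _ li) linear_sum' //; congr (_ *: _); apply: eq_bigr => j _.
elim: (j : nat) => [//|k IH].
by rewrite !iterS Bop_comm IH.
Qed.

Lemma Rop_eq m v : Rop m v + hp (2 * D) (Rop m v) = v - iter m Bop v.
Proof.
have e w : w - Bop w = rs *: (w + hp (2 * D) w).
  have {1}-> : w = rs *: ((1 + Lam2)%:C *: w).
    by rewrite scalerA -rmorphM mulVf ?gt_eqF // scale1r.
  rewrite /Bop -scalerBr; congr (_ *: _).
  by rewrite rmorphD scalerDl /= scale1r opprB addrA [X in X - _]addrAC addrK.
have l2 := iter_linear (2 * D) lh.
rewrite /Rop (linearZ' _ _ l2) -scalerDr linear_sum' // -big_split /= scaler_sumr.
elim: m => [|m IH]; first by rewrite big_ord0 subrr.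
by rewrite big_ord_recr /= IH -e addrA subrK.
Qed.

(** In the square of ‖R v + h^{2D} R v‖ the cross term is 2‖h^D R v‖² >= 0, so both summands are
    bounded by the norm of the sum, which is v - B^m v. The constant 2 does not see [N], that is,
    the size of h. *)
Lemma Rop_bounds m v : nrm (Rop m v) <= 2 * nrm v /\ nrm (hp (2 * D) (Rop m v)) <= 2 * nrm v.
Proof.
have h1 : nrm (Rop m v + hp (2 * D) (Rop m v)) <= 2 * nrm v.
  rewrite Rop_eq (le_trans (nrmB _ _)) // mulrDl mul1r lerD2l.
  apply: (le_trans (iter_ople m beta0 Bop_ople v)).
  by rewrite ler_piMl ?nrm_ge0 // exprn_ile1 // ltW.
have h2 : rin (Rop m v) (hp (2 * D) (Rop m v)) = nrm (hp D (Rop m v)) ^+ 2.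
  by rewrite mul2n -addnn iterD /rin -(iter_adjoint D (Rop m v)) -/(rin _ _) rin_xx.
have h3 : nrm (Rop m v + hp (2 * D) (Rop m v)) ^+ 2 <= (2 * nrm v) ^+ 2.
  by rewrite lerXn2r ?nnegrE ?nrm_ge0 ?mulr_ge0 ?nrm_ge0.
move: h3; rewrite nrm_sqrD h2 => h3.
have p1 := sqr_ge0 (nrm (Rop m v)); have p2 := sqr_ge0 (nrm (hp D (Rop m v))).
have p3 := sqr_ge0 (nrm (hp (2 * D) (Rop m v))).
by split; rewrite -ler_sqr ?nnegrE ?nrm_ge0 ?mulr_ge0 ?nrm_ge0 //; lra.
Qed.

(** ‖h^i w‖² <= ‖h^{i-1} w‖ ‖h^{i+1} w‖ by selfadjointness and Cauchy-Schwarz, so the bounds at both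
    ends give all intermediate powers. *)
Lemma hp_Rop m i v : (i <= 2 * D)%N -> nrm (hp i (Rop m v)) <= 2 * nrm v.
Proof.
have [h1 h2] := Rop_bounds m v.
apply: (logconvex_max (a := fun i => nrm (hp i (Rop m v)))) => // {}i; first exact: nrm_ge0.
case: i => // i _ _; rewrite -rin_xx /=.
have -> : rin (h (hp i (Rop m v))) (h (hp i (Rop m v))) =
    rin (hp i (Rop m v)) (h (h (hp i (Rop m v)))) by rewrite /rin hh.
exact: rin_le.
Qed.

(** Up to the Neumann remainder 1 - R = h^{2D} R, so the error of hR as a substitute for h is R
    h^{2D+1}, which is small on vectors where h behaves like an operator of norm 1/2. *)
Lemma hRop_eq m v : h v - h (Rop m v) = Rop m (hp (2 * D).+1 v) + h (iter m Bop v).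
Proof.
have -> : h v = h (Rop m v) + hp (2 * D).+1 (Rop m v) + h (iter m Bop v).
  by rewrite iterS -!(linearD _ _ lh) Rop_eq subrK.
by rewrite Rop_comm -[X in X - _]addrA [LHS]addrC addKr.
Qed.

End Resolvent.

(** * Graded spaces, windows of degrees and averages over scales *)

Section Graded.
Variables (R : realType) (G : groupType).

Definition hs (V : hilbertType R) (T : G -> V -> V) (E : seq G) : V -> V := \sum_(t <- E) T t.

Definition pw (V : hilbertType R) (P : G -> V -> V) (s : seq G) (v : V) : V :=
  \sum_(q <- s) P q v.

Definition prodset (E F : seq G) : seq G := [seq (t * q)%g | t <- E, q <- F].

(* V is graded by G through the projections P q; T t is the part of degree t of a selfadjoint
   operator of norm at most 1/2 with finitely many nonzero parts.  Alg E is a class of operators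
   thought of as supported in degrees E. *)
Record graded := Graded {
  gV : hilbertType R;
  gP : G -> gV -> gV;
  gT : G -> gV -> gV;
  gS : seq G;
  gAlg : seq G -> (gV -> gV) -> Prop;
  g_uS : uniq gS;
  g_lP : forall q, linear (gP q);
  g_bessel : forall s v, uniq s -> \sum_(q <- s) nrm (gP q v) ^+ 2 <= nrm v ^+ 2;
  g_pw : forall s v, uniq s -> nrm (pw gP s v) ^+ 2 = \sum_(q <- s) nrm (gP q v) ^+ 2;
  g_PP : forall p q v, gP p (gP q v) = if p == q then gP q v else 0;
  g_lT : forall t, linear (gT t);
  g_T1 : forall t, ople (gT t) 1;
  g_PT : forall t q v, gP (t * q)%g (gT t v) = gT t (gP q v);
  g_adj : forall t, adjoint (gT t) (gT t^-1%g);
  g_TS : forall t, t \notin gS -> forall v, gT t v = 0;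
  g_half : ople (hs gT gS) (1 / 2);
  g_algL : forall E x, gAlg E x -> linear x;
  g_alg0 : gAlg [::] 0;
  g_algT : forall E, uniq E -> gAlg E (hs gT E);
  g_algM : forall E F x y, gAlg E x -> gAlg F y -> gAlg (prodset E F) (x \o y);
  g_algD : forall E F c x y, gAlg E x -> gAlg F y -> gAlg (E ++ F) (c *: x + y) }.

Section OneGraded.
Variable X : graded.
Local Notation V := (gV X).
Local Notation P := (@gP X).
Local Notation T := (@gT X).
Local Notation Tt := (hs (@gT X) (gS X)).

Lemma hs_linear E : linear (hs (@gT X) E).
Proof. by apply: linear_fsum => t _; exact: g_lT. Qed.

Lemma pw_linear s : linear (pw (@gP X) s).
Proof.
move=> c u v; rewrite /pw scaler_sumr -big_split; apply: eq_bigr => q _.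
exact: g_lP.
Qed.

Lemma hs_ople E : ople (hs (@gT X) E) (size E)%:R.
Proof.
apply: (ople_mon _ (@ople_fsum R V V G E predT (@gT X) (fun=> 1) (fun t _ => @g_T1 X t))).
by rewrite big_const_seq count_predT iter_addr_0.
Qed.

Lemma hs_adjoint E : uniq E -> (forall t, t \in E -> t^-1%g \in E) ->
  adjoint (hs (@gT X) E) (hs (@gT X) E).
Proof.
move=> uE sE u v; rewrite /hs !sumfE inner_suml inner_sumr.
under eq_bigr do rewrite g_adj.
rewrite -(big_map (fun t : G => t^-1%g) predT (fun t => inner u (T t v))).
apply: perm_big; apply: uniq_perm => //.
  by rewrite map_inj_uniq //; exact: invg_inj.
move=> t; apply/mapP/idP => [[r rE ->]|tE]; first exact: sE.
by exists t^-1%g; rewrite ?invgK // sE.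
Qed.

Lemma pw_le s v : uniq s -> nrm (pw (@gP X) s v) <= nrm v.
Proof. by move=> us; rewrite -ler_sqr ?nnegrE ?nrm_ge0 // g_pw // g_bessel. Qed.

Lemma P_le q v : nrm (P q v) <= nrm v.
Proof.
have := @pw_le [:: q] v isT; by rewrite /pw big_seq1.
Qed.

Lemma P_pw s q v : uniq s -> P q (pw (@gP X) s v) = if q \in s then P q v else 0.
Proof.
move=> us; rewrite /pw linear_sum'; last exact: g_lP.
case: ifPn => qs.
  rewrite (bigD1_seq q) //= g_PP eqxx big1 ?addr0 // => r /negPf rq.
  by rewrite g_PP eq_sym rq.
rewrite big_seq big1 // => r rs; rewrite g_PP; case: eqP => // qr.
by rewrite qr rs in qs.
Qed.

Lemma P_hs E p q v : uniq E ->
  P p (hs (@gT X) E (P q v)) = if (p * q^-1)%g \in E then T (p * q^-1)%g (P q v) else 0.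
Proof.
move=> uE; rewrite /hs sumfE linear_sum'; last exact: g_lP.
have h t : P p (T t (P q v)) = if t == (p * q^-1)%g then T t (P q v) else 0.
  rewrite -g_PT g_PP g_PT; have -> : (p == t * q)%g = (t == p * q^-1)%g.
    by apply/eqP/eqP => ->; rewrite ?mulgK ?mulgVK ?mulgKV.
  by case: eqP => // ->; rewrite mulgVK.
under eq_bigr do rewrite h.
case: ifPn => pE.
  by rewrite (bigD1_seq _ pE) //= eqxx big1 ?addr0 // => t /negPf ->.
rewrite big_seq big1 // => t tE; case: eqP => // te.
by rewrite -te tE in pE.
Qed.

Lemma P_Tt p q v : P p (Tt (P q v)) = T (p * q^-1)%g (P q v).
Proof.
rewrite P_hs ?g_uS //; case: ifPn => // h.
by rewrite g_TS.
Qed.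

(* Only entries outside a window differ between a truncated operator and the full one. *)
Lemma trunc_error (E Wa Wb W' : seq G) z : uniq E -> uniq Wa -> uniq Wb -> uniq W' ->
  pw (@gP X) Wa z = z ->
  (forall p q, p \in Wb -> q \in Wa -> (p * q^-1)%g \in E) ->
  (forall t q, t \in E -> q \in Wa -> (t * q)%g \in W') -> {subset Wb <= W'} ->
  nrm (hs (@gT X) E z - pw (@gP X) Wb (Tt z)) <=
  \sum_(q <- Wa) Num.sqrt (\sum_(p <- W' | p \notin Wb) nrm (P p (Tt (P q z))) ^+ 2).
Proof.
move=> uE ua ub u' za hE hW sub.
pose eq_ q := hs (@gT X) E (P q z) - pw (@gP X) Wb (Tt (P q z)).
have -> : hs (@gT X) E z - pw (@gP X) Wb (Tt z) = \sum_(q <- Wa) eq_ q.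
  rewrite sumrB -(linear_sum' _ _ _ (hs_linear E)).
  rewrite -(linear_sum' _ _ (fun q => Tt (P q z)) (pw_linear Wb)).
  by rewrite -(linear_sum' _ _ _ (hs_linear (gS X))) -/(pw (@gP X) Wa z) za.
have tri (r : seq G) (f : G -> V) : nrm (\sum_(q <- r) f q) <= \sum_(q <- r) nrm (f q).
  elim: r => [|q r IH]; first by rewrite !big_nil nrm0.
  by rewrite !big_cons (le_trans (nrmD _ _)) // lerD2l.
apply: (le_trans (tri _ _)); rewrite !big_seq; apply: ler_sum => q qa.
have Pe p : P p (eq_ q) = if p \in Wb then 0 else
    if (p * q^-1)%g \in E then T (p * q^-1)%g (P q z) else 0.
  rewrite /eq_ linearB'; last exact: g_lP.
  rewrite P_hs // P_pw //; case: (boolP (p \in Wb)) => pb; last by rewrite subr0.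
  by rewrite P_Tt hE // subrr.
have sup : pw (@gP X) W' (eq_ q) = eq_ q.
  rewrite /eq_ (linearB' _ _ (pw_linear W')); congr (_ - _).
    rewrite {2}/hs sumfE /hs sumfE (linear_sum' _ _ _ (pw_linear W')).
    rewrite !big_seq; apply: eq_bigr => t tE.
    rewrite -(g_PT t q z) /pw (bigD1_seq (t * q)%g) ?hW //= g_PP eqxx big1 ?addr0 // => r /negPf rn.
    by rewrite g_PP rn.
  rewrite {2}/pw (linear_sum' _ _ _ (pw_linear W')) {2}/pw !big_seq.
  apply: eq_bigr => p pb; rewrite /pw (bigD1_seq p) ?sub //= g_PP eqxx big1 ?addr0 // => r /negPf rn.
  by rewrite g_PP rn.
rewrite -sup -ler_sqr ?nnegrE ?nrm_ge0 ?sqrtr_ge0 // g_pw // sqr_sqrtr; last first.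
  by apply: sumr_ge0 => p _; rewrite sqr_ge0.
rewrite (bigID (fun p => p \in Wb)) /= big1 ?add0r => [|p pb]; last first.
  by rewrite Pe pb nrm0 expr0n.
apply: ler_sum => p pb; rewrite Pe (negPf pb) P_Tt.
by case: ifP => // _; rewrite nrm0 expr0n sqr_ge0.
Qed.

End OneGraded.
Arguments hs_linear : clear implicits.

Section Scales.
Variable E0 : seq G.

(** [EE k] collects the degrees connecting two points of the window [W k], and [W k.+1] contains the
    products of [EE k] with [W k]. So the operator and its truncation to [EE k] agree inside the
    window, and the truncation maps it into the next one. [EE k] is closed under inverses, which
    keeps the truncation selfadjoint. *)
Fixpoint W (k : nat) : seq G :=
  if k is k'.+1 then undup (prodset (undup (prodset (W k') [seq q^-1%g | q <- W k'])) (W k'))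
  else undup (1%g :: E0).

Definition EE k : seq G := undup (prodset (W k) [seq q^-1%g | q <- W k]).

Lemma prodsetP E F x : reflect (exists t q, [/\ t \in E, q \in F & x = (t * q)%g]) (x \in prodset E F).
Proof.
apply: (iffP allpairsP) => [[[t q] /= [tE qF ->]]|[t [q [tE qF ->]]]].
  by exists t, q.
by exists (t, q).
Qed.

Lemma EEP k p q : p \in W k -> q \in W k -> (p * q^-1)%g \in EE k.
Proof.
move=> pW qW; rewrite mem_undup; apply/prodsetP; exists p, q^-1%g; split=> //.
exact: map_f.
Qed.

Lemma EE_inv k t : t \in EE k -> t^-1%g \in EE k.
Proof.
rewrite mem_undup => /prodsetP[p [_ [pW /mapP[q qW ->] ->]]].
by rewrite invgM invgK; exact: EEP.
Qed.

Lemma WS k t q : t \in EE k -> q \in W k -> (t * q)%g \in W k.+1.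
Proof. by move=> tE qW; rewrite /= mem_undup; apply/prodsetP; exists t, q. Qed.

Lemma uW k : uniq (W k). Proof. by case: k => [|k]; exact: undup_uniq. Qed.
Lemma uEE k : uniq (EE k). Proof. exact: undup_uniq. Qed.

Lemma W_sub1 k : {subset W k <= W k.+1}.
Proof.
by move=> q qW; have := WS (EEP qW qW) qW; rewrite mulgV mul1g.
Qed.

Lemma W_sub k l : (k <= l)%N -> {subset W k <= W l}.
Proof.
move=> /subnK <-; elim: (l - k)%N => [//|m IH] q qW.
by rewrite addSn; apply: W_sub1; exact: IH.
Qed.

Lemma W0_1 k : 1%g \in W k.
Proof. by apply: (W_sub (leq0n k)); rewrite mem_undup inE eqxx. Qed.

Lemma W0_E0 k t : t \in E0 -> t \in W k.
Proof. by move=> tE; apply: (W_sub (leq0n k)); rewrite mem_undup inE tE orbT. Qed.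

Local Notation hk X k := (hs (@gT X) (EE k)).

Definition wsum (l : seq (R * nat)) (f : nat -> R) : R := \sum_(x <- l) x.1 * f x.2.

(** Linearises the square roots, so that the masses under them can be summed over the ranges of
    scales before Bessel is applied. *)
Lemma sqrt_amgm (x t : R) : 0 <= x -> 0 < t -> Num.sqrt x <= x / (2 * t) + t / 2.
Proof.
move=> x0 t0; have s0 := sqrtr_ge0 x; have e := sqr_sqrtr x0.
rewrite -{2}e; move: (Num.sqrt x) s0 => s s0.
have -> : s ^+ 2 / (2 * t) + t / 2 = s + (s - t) ^+ 2 / (2 * t).
  by field; rewrite gt_eqF.
by rewrite lerDl divr_ge0 ?sqr_ge0 // mulr_ge0 // ltW.
Qed.

(* Averaging over many disjoint ranges of scales makes the truncation error small on average:
   by orthogonality the mass of a vector in most ranges is small. *)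
Lemma averaged_truncation (L a : nat) (d : R) : 0 < d ->
  exists l : seq (R * nat),
    [/\ forall x, x \in l -> 0 <= x.1 /\ (a <= x.2)%N, wsum l (fun=> 1) = 1 &
    forall (X : graded) (z : gV X) (C : R) (Q : nat -> gV X -> gV X),
      0 <= C -> pw (@gP X) (W a) z = z -> (forall k, linear (Q k)) ->
      (forall k i, (i <= L.-1)%N -> ople (fun v => Q k (iter i (hk X k) v)) C) ->
      wsum l (fun k => nrm (Q k (iter L (hk X k) z))) <= C * (2^-1 ^+ L + d) * nrm z].
Proof.
elim: L a d => [|L IH] a d d0.
  exists [:: (1, a)]; split.
  - by move=> x; rewrite inE => /eqP ->.
  - by rewrite /wsum big_seq1 mulr1.
  move=> X z C Q C0 _ _ QC; rewrite /wsum big_seq1 mul1r.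
  apply: (le_trans (QC a 0%N (leqnn _) z)); rewrite expr0 ler_wpM2r ?nrm_ge0 //.
  by rewrite ler_peMr // lerDl ltW.
(* The average that the induction hypothesis provides for vectors supported in window [b]. *)
pose cl b := projT1 (cid (IH b d d0)).
have clP b := projT2 (cid (IH b d d0)).
rewrite -/(cl _) in clP.
(* Starting scales of successive ranges: each lies beyond every scale occurring in the average of
   the previous range. *)
pose s := fix s (j : nat) : nat := if j is j'.+1 then
  (maxn (s j') (\max_(x <- cl (s j')) x.2)).+1 else a.
have s_cl j x : x \in cl (s j) -> (s j <= x.2)%N /\ (x.2 < s j.+1)%N.
  move=> xl; have [h _ _] := clP (s j); have [_ sx] := h x xl; split=> //.
  by rewrite ltnS leq_max; apply/orP; right; exact: leq_bigmax_seq.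
have s_mon j : (s j < s j.+1)%N by rewrite /= ltnS leq_maxl.
have s_le j k : (j <= k)%N -> (s j <= s k)%N.
  move=> /subnK <-; elim: (k - j)%N => [//|m IHm].
  by rewrite addSn; apply: (leq_trans IHm); exact: ltnW.
pose n := size (W a).
have n0 : (0 < n)%N by rewrite /n; have := W0_1 a; case: (W a).
have nr0 : (0 : R) < n%:R by rewrite ltr0n.
(* The error allowed for each degree of [W a], per unit of norm; the number [K] of ranges is then
   taken so large that 4 t² K >= 1. *)
pose t : R := d / (2 * n%:R).
have t0 : 0 < t by rewrite divr_gt0 // mulr_gt0.
have [K KP] : exists K : nat, (0 < K)%N /\ (4 * t ^+ 2)^-1 <= K%:R.
  exists (Num.bound (4 * t ^+ 2)^-1).+1; split=> //.
  have p0 : 0 <= (4 * t ^+ 2)^-1 by rewrite invr_ge0 mulr_ge0 ?sqr_ge0.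
  apply: (le_trans (ltW (archi_boundP p0))); by rewrite ler_nat.
case: KP => K0 KP; have Kr0 : (0 : R) < K%:R by rewrite ltr0n.
pose l := flatten [seq [seq (x.1 / K%:R, x.2) | x <- cl (s j)] | j <- index_iota 0 K].
have wl f : wsum l f = \sum_(j < K) K%:R^-1 * wsum (cl (s j)) f.
  rewrite /wsum /l big_flatten big_map big_mkord; apply: eq_bigr => j _.
  rewrite big_map mulr_sumr; apply: eq_bigr => x _ /=.
  by rewrite mulrAC mulrC mulrA.
exists l; split.
- move=> x /flattenP[_ /mapP[j _ ->] /mapP[y ycl ->]] /=.
  have [h _ _] := clP (s j); have [y0 sy] := h y ycl.
  by split; [rewrite divr_ge0 // ltW|exact: leq_trans (s_le 0%N j (leq0n j)) sy].
- rewrite wl; under eq_bigr => j _ do have [_ -> _] := clP (s j).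
  by rewrite sumr_const card_ord mulr1 -[LHS]mulr_natl mulfV // gt_eqF.
move=> X z C Q C0 za lQ QC.
set Tt := hs (@gT X) (gS X).
have TtH v : nrm (Tt v) <= 1 / 2 * nrm v by exact: g_half.
(* For every scale of range j, h z is close to this vector, the part of T z in window s j. It has
   norm at most ‖z‖/2 and is common to the whole range, so the induction hypothesis applies to
   it. *)
pose v j := pw (@gP X) (W (s j)) (Tt z).
have vn j : nrm (v j) <= 1 / 2 * nrm z.
  by apply: (le_trans (pw_le _ (uW _))); exact: TtH.
have vW j : pw (@gP X) (W (s j)) (v j) = v j.
  rewrite /v /pw; apply: eq_big_seq => q qs.
  by rewrite -/(pw (@gP X) (W (s j)) (Tt z)) P_pw ?uW // qs.
pose u q := Tt (gP q z).
(* The mass of T P_q z in the shell between windows s j and s (j + 1). The shells are disjoint, so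
   by Bessel the masses add up to at most ‖T P_q z‖². *)
pose Aq q j := \sum_(p <- W (s j.+1) | p \notin W (s j)) nrm (gP p (u q)) ^+ 2.
have Aq0 q j : 0 <= Aq q j by apply: sumr_ge0 => p _; rewrite sqr_ge0.
have Asum q : \sum_(j < K) Aq q j <= nrm (u q) ^+ 2.
  suff : \sum_(j < K) Aq q j <= \sum_(p <- W (s K)) nrm (gP p (u q)) ^+ 2.
    by move/le_trans; apply; exact: (g_bessel _ (uW _)).
  elim: K {l wl K0 KP Kr0} => [|K IHK].
    by rewrite big_ord0; apply: sumr_ge0 => p _; rewrite sqr_ge0.
  rewrite big_ord_recr [leRHS](bigID (fun p => p \in W (s K))).
  apply: lerD; last exact: lexx.
  apply: (le_trans IHK); rewrite le_eqVlt; apply/orP; left; apply/eqP.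
  rewrite -[RHS]big_filter; apply: perm_big; apply: uniq_perm; rewrite ?filter_uniq ?uW // => p.
  rewrite mem_filter andb_idr // => pW; apply: (W_sub (ltnW (s_mon K))); exact: pW.
have err j x : x \in cl (s j) ->
    nrm (hk X x.2 z - v j) <= \sum_(q <- W a) Num.sqrt (Aq q j).
  move=> xl; have [sx xs] := s_cl j x xl.
  have ax : (a <= x.2)%N by exact: leq_trans (s_le 0%N j (leq0n j)) sx.
  apply: (le_trans (trunc_error (uEE _) (uW a) (uW (s j)) (uW x.2.+1) za _ _ _)).
  - by move=> p q pW qW; apply: EEP; [exact: (W_sub sx)|exact: (W_sub ax)].
  - by move=> r q rE qW; apply: WS => //; exact: (W_sub ax).
  - by apply: W_sub; exact: leqW.
  apply: ler_sum => q _; rewrite ler_sqrt //.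
  rewrite /Aq -big_filter -[leRHS]big_filter.
  pose f1 := [seq p <- W x.2.+1 | p \notin W (s j)].
  pose f2 := [seq p <- W (s j.+1) | p \notin W (s j)].
  rewrite -[leLHS]/(\sum_(p <- f1) nrm (gP p (u q)) ^+ 2).
  rewrite -[leRHS]/(\sum_(p <- f2) nrm (gP p (u q)) ^+ 2).
  have sub : {subset f1 <= f2}.
    by move=> p; rewrite !mem_filter => /andP[-> pW]; exact: (W_sub xs).
  rewrite [leRHS](bigID (mem f1)) /= -[X in _ <= X + _]big_filter.
  rewrite [X in _ <= X + _](perm_big f1) /=; last first.
    apply: uniq_perm; rewrite ?filter_uniq ?uW // => p.
    by rewrite mem_filter /= andb_idr // => /sub.
  by rewrite lerDl sumr_ge0 // => p _; rewrite sqr_ge0.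
have main j : wsum (cl (s j)) (fun k => nrm (Q k (iter L.+1 (hk X k) z))) <=
    C * (2^-1 ^+ L + d) * (1 / 2 * nrm z) + C * \sum_(q <- W a) Num.sqrt (Aq q j).
  have [h1 h2 h3] := clP (s j).
  have h4 : wsum (cl (s j)) (fun k => nrm (Q k (iter L (hk X k) (v j)))) <=
      C * (2^-1 ^+ L + d) * (1 / 2 * nrm z).
    apply: (le_trans (h3 X (v j) C Q C0 (vW j) lQ _)).
      by move=> k i iL; apply: QC; rewrite (leq_trans iL) // leq_pred.
    by rewrite ler_wpM2l // mulr_ge0 // addr_ge0 ?(ltW d0) // exprn_ge0 // invr_ge0.
  apply: (@le_trans _ _ (wsum (cl (s j)) (fun k => nrm (Q k (iter L (hk X k) (v j)))) +
      wsum (cl (s j)) (fun=> 1) * (C * \sum_(q <- W a) Num.sqrt (Aq q j)))); last first.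
    by rewrite h2 mul1r lerD2r.
  rewrite /wsum mulr_suml -big_split /= !big_seq; apply: ler_sum => x xl.
  have [x0 _] := h1 x xl; rewrite mulr1 -mulrDr ler_wpM2l //.
  have lit := iter_linear L (hs_linear X (EE x.2)).
  have it : iter L.+1 (hk X x.2) z = iter L (hk X x.2) (v j) +
      iter L (hk X x.2) (hk X x.2 z - v j).
    by rewrite -(linearD _ _ lit) addrC subrK iterSr.
  rewrite -/(iter L.+1 (hk X x.2) z) it (linearD _ _ (lQ x.2)); apply: (le_trans (nrmD _ _)); rewrite lerD2l.
  apply: (le_trans (QC x.2 L (leqnn _) _)); rewrite ler_wpM2l // -big_seq.
  exact: err.
rewrite wl; apply: (@le_trans _ _ (\sum_(j < K) K%:R^-1 *
    (C * (2^-1 ^+ L + d) * (1 / 2 * nrm z) + C * \sum_(q <- W a) Num.sqrt (Aq q j)))).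
  by apply: ler_sum => j _; rewrite ler_wpM2l ?invr_ge0 ?(ltW Kr0).
rewrite -mulr_sumr big_split /= sumr_const card_ord -[X in X + _]mulr_natl.
rewrite mulrDr mulKf ?gt_eqF //.
(* Half of the error 2^-L + d of the induction hypothesis and d/2 from the truncations add up to
   2^-(L+1) + d. *)
suff key : K%:R^-1 * (\sum_(j < K) C * (\sum_(q <- W a) Num.sqrt (Aq q j))) <= C * (d / 2 * nrm z).
  apply: (le_trans (lerD (lexx _) key)).
  by rewrite exprS le_eqVlt; apply/orP; left; apply/eqP; field.
rewrite -mulr_sumr mulrCA ler_wpM2l // exchange_big /=.
have [z0|zn] := eqVneq (nrm z) 0.
  have zz := nrm_eq0 z0; rewrite z0 mulr0 big1 ?mulr0 // => q _; rewrite big1 // => j _.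
  have -> : Aq q j = 0; last by rewrite sqrtr0.
  rewrite /Aq big1 // => p _; rewrite /u /Tt zz (linear0' (g_lP q)) (linear0' (hs_linear X _)).
  by rewrite (linear0' (g_lP p)) nrm0 expr0n.
have zp : 0 < nrm z by rewrite lt_def zn nrm_ge0.
(* With τ = t‖z‖, the arithmetic-geometric inequality bounds the average by Σ_j A_qj / (2τK) + τ/2,
   and the choice of [K] makes the first part at most τ/2. *)
have each q : K%:R^-1 * \sum_(j < K) Num.sqrt (Aq q j) <= t * nrm z.
  pose tau := t * nrm z; have tau0 : 0 < tau by rewrite mulr_gt0.
  apply: (@le_trans _ _ (K%:R^-1 * \sum_(j < K) (Aq q j / (2 * tau) + tau / 2))).
    rewrite ler_wpM2l ?invr_ge0 ?(ltW Kr0) //; apply: ler_sum => j _; exact: sqrt_amgm.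
  rewrite big_split /= -mulr_suml sumr_const card_ord -[X in _ + X]mulr_natl.
  have u1 : nrm (u q) ^+ 2 <= (1 / 2 * nrm z) ^+ 2.
    rewrite lerXn2r ?nnegrE ?nrm_ge0 ?mulr_ge0 ?nrm_ge0 //.
    by apply: (le_trans (TtH _)); rewrite ler_wpM2l // P_le.
  have u2 := le_trans (Asum q) u1.
  have -> : t * nrm z = tau / 2 + tau / 2 by rewrite /tau; field.
  rewrite mulrDr mulKf ?gt_eqF // lerD2r.
  have tt0 : 0 < 2 * tau by rewrite mulr_gt0.
  rewrite mulrA ler_pdivrMr // [leLHS]mulrC ler_pdivrMr //.
  apply: (le_trans u2).
  have k1 : 1 <= K%:R * (4 * t ^+ 2).
    have t4 : 0 < 4 * t ^+ 2 by rewrite mulr_gt0 // exprn_gt0.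
    by rewrite -ler_pdivrMr // div1r.
  have -> : tau / 2 * (2 * tau) * K%:R = nrm z ^+ 2 / 4 * (K%:R * (4 * t ^+ 2)).
    by rewrite /tau; field.
  have -> : (1 / 2 * nrm z) ^+ 2 = nrm z ^+ 2 / 4 by field.
  by rewrite ler_peMr // divr_ge0 // sqr_ge0.
rewrite mulr_sumr; apply: (@le_trans _ _ (\sum_(q <- W a) t * nrm z)).
  by apply: ler_sum => q _; exact: each.
rewrite big_const_seq count_predT iter_addr_0 -/n -[leLHS]mulr_natl.
by rewrite le_eqVlt; apply/orP; left; apply/eqP; rewrite /t; field; rewrite gt_eqF.
Qed.

(** * Families given uniformly over all graded spaces *)

Definition family := forall X : graded, gV X -> gV X.

(** The support [E] is common to all graded spaces; this carries the uniformity in the operator and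
    in the matrix size. *)
Definition uf (c : family) : Prop := exists E, forall X : graded, gAlg E (c X).

(* A need not be unital, so the identity has to be adjoined. *)
Definition uf1 (c : family) : Prop :=
  exists a c0, uf c0 /\ forall X, c X = a *: idfun + c0 X.

Definition lin_closed (U : family -> Prop) : Prop :=
  U (fun X => 0) /\ forall a c c', U c -> U c' -> U (fun X => a *: c X + c' X).

Lemma uf_eq (U : family -> Prop) c c' : (forall X, c X = c' X) -> U c -> U c'.
Proof. by move=> e Uc; rewrite (_ : c' = c) //; apply: functional_extensionality_dep => X. Qed.

Lemma uf_scale U a c : lin_closed U -> U c -> U (fun X => a *: c X).
Proof. by move=> [U0 Ul] h; apply: uf_eq (Ul a _ _ h U0) => X; rewrite addr0. Qed.

Lemma uf_sum U (I : Type) (r : seq I) (c : I -> family) : lin_closed U ->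
  (forall i, U (c i)) -> U (fun X => \sum_(i <- r) c i X).
Proof.
move=> [U0 Ul] h; elim: r => [|i r IH].
  by apply: uf_eq U0 => X; rewrite big_nil.
by apply: uf_eq (Ul 1 _ _ (h i) IH) => X; rewrite big_cons scale1r.
Qed.

Lemma uf_lin : lin_closed uf.
Proof.
split; first by exists [::] => X; exact: g_alg0.
by move=> a c c' [E h] [E' h']; exists (E ++ E') => X; exact: g_algD.
Qed.

Lemma uf_linear c X : uf c -> linear (c X).
Proof. by move=> [E h]; exact: (g_algL (h X)). Qed.

Lemma uf_hk k : uf (fun X => hk X k). Proof. by exists (EE k) => X; apply: g_algT; exact: uEE. Qed.

Lemma uf_comp c c' : uf c -> uf c' -> uf (fun X => c X \o c' X).
Proof. by move=> [E h] [E' h']; exists (prodset E E') => X; exact: g_algM. Qed.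

(** A left factor without identity part removes the identity from the product, so h p(h) is
    admissible for every polynomial p, constant term included. *)
Lemma uf_comp1 c c' : uf c -> uf1 c' -> uf (fun X => c X \o c' X).
Proof.
move=> h [b [d [h' e]]].
apply: uf_eq (uf_lin.2 b _ _ h (uf_comp h h')) => X; apply/funext => v /=.
have lc : linear (c X) by exact: uf_linear.
by rewrite e -[RHS]/(c X (b *: v + d X v)) (linearD _ _ lc) (linearZ' _ _ lc).
Qed.

Lemma uf1_lin : lin_closed uf1.
Proof.
split.
  exists 0, (fun X => 0); split; first exact: uf_lin.1.
  by move=> X; rewrite scale0r addr0.
move=> a c c' [b [d [h e]]] [b' [d' [h' e']]].
exists (a * b + b'), (fun X => a *: d X + d' X); split; first exact: uf_lin.2.
move=> X; apply/funext => v; rewrite e e'.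
rewrite -[LHS]/(a *: (b *: v + d X v) + (b' *: v + d' X v)).
rewrite -[RHS]/((a * b + b') *: v + (a *: d X v + d' X v)).
by rewrite scalerDr scalerDl scalerA addrACA.
Qed.

Lemma uf1_hk k : uf1 (fun X => hk X k).
Proof.
by exists 0, (fun X => hk X k); split; [exact: uf_hk|move=> X; rewrite scale0r add0r].
Qed.

Lemma uf1_id : uf1 (fun X => idfun).
Proof.
exists 1, (fun X => 0); split; first exact: uf_lin.1.
by move=> X; rewrite scale1r addr0.
Qed.

Lemma uf1_comp c c' : uf1 c -> uf1 c' -> uf1 (fun X => c X \o c' X).
Proof.
move=> [b [d [h e]]] h'; have [b' [d' [hd' e']]] := h'.
exists (b * b'), (fun X => b *: d' X + (d X \o c' X)); split.
  by apply: uf_lin.2 => //; exact: uf_comp1.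
move=> X; apply/funext => v; rewrite e -[LHS]/(b *: c' X v + d X (c' X v)).
rewrite -[RHS]/((b * b') *: v + (b *: d' X v + d X (c' X v))) addrA; congr (_ + _).
by rewrite e' -[LHS]/(b *: (b' *: v + d' X v)) scalerDr scalerA.
Qed.

Lemma uf1_iter c i : uf1 c -> uf1 (fun X => iter i (c X)).
Proof.
move=> h; elim: i => [|i IH]; first exact: uf1_id.
by apply: uf_eq (uf1_comp h IH) => X; apply/funext.
Qed.

(** The family is an average over scales of h_k (1 + h_k^{2D})⁻¹, with the inverse replaced by
    [Rop]. Each term is bounded by 2 whatever the size of h_k; the averaging serves the error
    alone. *)
Lemma uniform_approximation (e : R) : 0 < e ->
  exists2 c : family, uf c &
    forall X : graded, [/\ linear (c X), ople (c X) 2 &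
      forall t z, t \in E0 -> gP 1%g z = z ->
        nrm (gP t (hs (@gT X) (gS X) z - c X z)) <= e * nrm z].
Proof.
(* The budget: 2 (e/8 + e/8) from the averaged truncation, where 2 is the bound on [Rop], and e/8
   from the Neumann remainder. *)
move=> e0; have e8 : 0 < e / 8 by lra.
have h12 : (2^-1 : R) < 1 by lra.
have h02 : (0 : R) <= 2^-1 by lra.
have [D0 DP] := geometric_small 1 h02 h12 e8; rewrite mul1r in DP.
(* The successor ensures 1 <= 2D, so that the interpolated bound covers h R itself. *)
pose D := D0.+1.
have D1 : 2^-1 ^+ (2 * D).+1 <= e / 8.
  apply: le_trans (ltW DP); apply: ler_wiXn2l => //; first exact: ltW.
  by rewrite leqW // (leq_trans (leqnSn D0)) // leq_pmull.
have [l [l1 l2 l3]] := averaged_truncation (2 * D).+1 0 e8.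
(* The trivial bound of a truncation, one for each homogeneous part. It may be huge, and only
   decides how many Neumann terms [m k] are taken. *)
pose N k : R := (size (EE k))%:R.
have N0 k : 0 <= N k by [].
pose be k : R := (N k ^+ D) ^+ 2 / (1 + (N k ^+ D) ^+ 2).
have be0 k : 0 <= be k by rewrite divr_ge0 ?sqr_ge0 // addr_ge0 ?sqr_ge0.
have be1 k : be k < 1.
  by rewrite ltr_pdivrMr ?mul1r ?ltrDr // ltr_wpDr // sqr_ge0.
have mex k : exists m, N k * be k ^+ m < e / 8 by exact: geometric_small.
pose m k := projT1 (cid (mex k)).
have mP k : N k * be k ^+ m k < e / 8 by rewrite /m; case: cid.
pose Rk X k := Rop (hk X k) (N k) D (m k).
pose ck X k := hk X k \o Rk X k.
pose c X := \sum_(x <- l) x.1%:C *: ck X x.2.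
have lh X k := hs_linear X (EE k).
have ah X k : adjoint (hk X k) (hk X k) by apply: hs_adjoint; [exact: uEE|exact: EE_inv].
have hN X k : ople (hk X k) (N k) by exact: hs_ople.
have lR X k : linear (Rk X k) by exact: Rop_linear.
have lck X k : linear (ck X k) by exact: (linear_comp (lh X k) (lR X k)).
have ck2 X k : ople (ck X k) 2.
  move=> v; apply: (@hp_Rop R (gV X) (hk X k) (N k) D (lh X k) (ah X k) (N0 k) (hN X k) (m k) 1 v).
  by rewrite muln_gt0.
exists c.
  apply: (uf_sum _ uf_lin) => x; apply: (uf_scale _ uf_lin); apply: uf_comp1.
    exact: uf_hk.
  have uB : uf1 (fun X => Bop (hk X x.2) (N x.2) D).
    pose a := ((1 + (N x.2 ^+ D) ^+ 2)^-1)%:C; pose b := ((N x.2 ^+ D) ^+ 2)%:C.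
    apply: uf_eq (uf_scale a uf1_lin (uf1_lin.2 (-1) _ _ (uf1_iter (2 * D) (uf1_hk x.2))
      (uf_scale b uf1_lin uf1_id))) => X.
    apply/funext => v; rewrite /Bop -/a -/b.
    rewrite -[LHS]/(a *: (-1 *: iter (2 * D) (hk X x.2) v + b *: v)).
    by rewrite scaleN1r addrC.
  apply: uf_eq (uf_scale ((1 + (N x.2 ^+ D) ^+ 2)^-1)%:C uf1_lin
    (uf_sum (index_enum 'I_(m x.2)) uf1_lin (fun j => uf1_iter j uB))) => X.
  by apply/funext => v; rewrite /Rk /Rop -[LHS]/(_ *: _ v) sumfE.
move=> X; split.
- by apply: linear_fsum => x _; exact: (linear_scale _ (lck X x.2)).
- have h (x : R * nat) : ople (x.1%:C *: ck X x.2) (complex.Re `|x.1%:C| * 2).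
    by apply: ople_scale; exact: ck2.
  apply: (ople_mon _ (@ople_fsum R _ _ _ l predT _ _ (fun x _ => h x))).
  rewrite -mulr_suml -[leRHS]mul1r ler_wpM2r // -l2 /wsum !big_seq.
  by apply: ler_sum => x xl; have [x0 _] := l1 x xl; rewrite Re_norm_real // mulr1.
move=> t z tE z1.
have zW : pw (@gP X) (W 0) z = z.
  rewrite /pw (bigD1_seq 1%g) ?uW ?W0_1 //= z1 big1 ?addr0 // => q /negPf q1.
  by rewrite -z1 g_PP q1.
(* On a vector of degree 1 the components in degrees of [E0] are untouched by the truncation,
   because [E0] and 1 lie in every window. *)
have Pt k : gP t (hs (@gT X) (gS X) z) = gP t (hk X k z).
  rewrite -z1 P_Tt P_hs ?uEE // EEP ?W0_1 //.
  exact: W0_E0.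
have w1 : \sum_(x <- l) x.1 = 1.
  by rewrite -l2 /wsum; apply: eq_bigr => x _; rewrite mulr1.
have lPt := g_lP (g := X) t.
have -> : gP t (hs (@gT X) (gS X) z - c X z) =
    \sum_(x <- l) x.1%:C *: gP t (hk X x.2 z - ck X x.2 z).
  rewrite (linearB' _ _ lPt) /c sumfE (linear_sum' _ _ _ lPt).
  have -> : gP t (hs (@gT X) (gS X) z) = \sum_(x <- l) x.1%:C *: gP t (hk X x.2 z).
    under eq_bigr do rewrite -Pt.
    by rewrite -scaler_suml -rmorph_sum w1 scale1r.
  rewrite -sumrB; apply: eq_bigr => x _.
  by rewrite -[(x.1%:C *: ck X x.2) z]/(x.1%:C *: ck X x.2 z) (linearZ' _ _ lPt) -scalerBr
    (linearB' _ _ lPt).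
have tri (f : R * nat -> gV X) : nrm (\sum_(x <- l) f x) <= \sum_(x <- l) nrm (f x).
  elim: l {l1 l2 l3 c w1} => [|x r IH]; first by rewrite !big_nil nrm0.
  by rewrite !big_cons (le_trans (nrmD _ _)) // lerD2l.
apply: (le_trans (tri _)).
(* Commuting h^i past [Rop] turns the interpolated bound into the hypothesis on [Q] in the averaging
   lemma. *)
have QC k i : (i <= (2 * D).+1.-1)%N -> ople (fun v => Rk X k (iter i (hk X k) v)) 2.
  move=> iD v; rewrite /Rk -(Rop_comm (N k) D (lh X k)).
  exact: (hp_Rop (lh X k) (ah X k) (N0 k) (hN X k) (m k) v iD).
have := l3 X z 2 (Rk X) (ler0n _ _) zW (lR X) QC.
rewrite /wsum => h3.
apply: (@le_trans _ _ (\sum_(x <- l) (x.1 * nrm (Rk X x.2 (iter (2 * D).+1 (hk X x.2) z)) +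
    x.1 * (e / 8 * nrm z)))).
  rewrite !big_seq; apply: ler_sum => x xl; have [x0 _] := l1 x xl.
  rewrite nrmZ Re_norm_real // -mulrDr ler_wpM2l //.
  apply: (le_trans (P_le t _)).
  rewrite /ck /= /Rk (hRop_eq (N x.2) D (lh X x.2)) (le_trans (nrmD _ _)) // lerD2l.
  apply: (le_trans (hN X x.2 _)).
  apply: (@le_trans _ _ (N x.2 * (be x.2 ^+ m x.2 * nrm z))).
    rewrite ler_wpM2l //.
    have hB : ople (Bop (hk X x.2) (N x.2) D) (be x.2).
      exact: (Bop_ople D (ah X x.2) (N0 x.2) (hN X x.2)).
    exact: (iter_ople (m x.2) (be0 x.2) hB z).
  by rewrite mulrA ler_wpM2r ?nrm_ge0 // ltW.
rewrite big_split /= -mulr_suml w1 mul1r.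
apply: (le_trans (lerD h3 (lexx _))); rewrite -mulrDl ler_wpM2r ?nrm_ge0 //.
by move: D1; move: (2^-1 ^+ _) => q; lra.
Qed.

End Scales.

End Graded.

(** * Uniform approximation of matrices over the crossed product *)

Lemma mxle_corner (R : realType) (V W : normedModType R[i]) (I : finType)
    (x : I -> I -> V -> W) (M : R) : 0 <= M -> mxle x M ->
  mxle (fun k l : bool * I => if ~~ k.1 && l.1 then x k.2 l.2 else 0) M.
Proof.
move=> M0 /(mxleP _ M0) xM; apply/(mxleP _ M0) => v.
have sp (f : bool * I -> R) : \sum_k f k = \sum_i f (true, i) + \sum_i f (false, i).
  rewrite (eq_bigr (fun k => f (k.1, k.2))) => [|[] //].
  by rewrite -(pair_bigA _ (fun c i => f (c, i))) /= big_bool.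
have sv (f : bool * I -> W) : \sum_k f k = \sum_i f (true, i) + \sum_i f (false, i).
  rewrite (eq_bigr (fun k => f (k.1, k.2))) => [|[] //].
  by rewrite -(pair_bigA _ (fun c i => f (c, i))) /= big_bool.
rewrite !sp /= big1 ?add0r => [|i _]; last first.
  by rewrite big1 ?nrm0 ?expr0n.
apply: (@le_trans _ _ (M ^+ 2 * \sum_i nrm (v (true, i)) ^+ 2)).
  apply: le_trans (xM (fun j => v (true, j))); apply: ler_sum => i _.
  by rewrite sv /= [X in _ + X]big1 ?addr0.
by rewrite ler_wpM2l ?sqr_ge0 // lerDl sumr_ge0 // => i _; rewrite sqr_ge0.
Qed.

Section UniformCrossed.
Variables (R : realType) (G : groupType) (H : hilbertType R).
Variables (A : set (H -> H)) (alpha : G -> (H -> H) -> (H -> H)).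
Hypotheses (cA : cstar_algebra A) (dyn : dyn_action A alpha).
Local Notation HH := (l2 G H).
Local Notation X := (crossed A alpha).
Local Notation gen := (gen alpha).
Local Notation pps := (pps alpha).

Let sA : lsub A. Proof. exact: (A_lsub cA). Qed.

Local Opaque to_l2.

Lemma gen_linear_on t : linear_on A (gen t).
Proof. by move=> c a b; exact: (genZD cA dyn). Qed.

Lemma genM t s a b : A a -> A b -> gen t a \o gen s b = gen (t * s) (a \o alpha t b).
Proof.
move=> Aa Ab; have Atb := al_A dyn t Ab; have Ac := A_comp cA Aa Atb.
apply/funext => xi; apply: l2_ext => r /=.
have e1 := genE cA dyn (t * s)%g xi r Ac.
have e2 := genE cA dyn s xi (t^-1 * r)%g Ab.
have e3 := genE cA dyn t (gen s b xi) r Aa.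
rewrite e1 e3 e2.
have [_ _ hM _] := al_star dyn r^-1%g.
by rewrite hM //= -(alM dyn r^-1%g t) // !invgM !invgK mulgA.
Qed.

(** The adjoint of π(a)λ_t is π(c)λ_{t⁻¹} where α_t(c) is the adjoint of a; on entries, both sides
    live at pq⁻¹ = t and are related by α_{p⁻¹}. *)
Lemma gen_adjoint t a c : A a -> A c -> adjoint a (alpha t c) -> adjoint (gen t a) (gen t^-1 c).
Proof.
move=> Aa Ac ac; have Atc := al_A dyn t Ac.
apply: adjoint_ent; [exact: (gen_bop cA dyn t Aa)|exact: (gen_bop cA dyn t^-1 Ac)|].
move=> p q u v; rewrite (ent_gen cA dyn t p q u Aa) (ent_gen cA dyn t^-1 q p v Ac).
have -> : (t^-1 == q * p^-1)%g = (t == p * q^-1)%g.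
  by rewrite -(inj_eq (@invg_inj G)) invgK invgM invgK.
case: eqP => [tE|_]; last by rewrite inner0 inner0r.
have [_ _ _ hA] := al_star dyn p^-1%g.
have -> : alpha q^-1%g c = alpha p^-1%g (alpha t c).
  by rewrite -(alM dyn p^-1%g t Ac) tE mulgA mulVg mul1g.
exact: (hA _ _ Aa Atc ac).
Qed.

(** Degrees may repeat, so closure under sums and products is a plain induction; with the
    coefficient functions of [pps], equal degrees would have to be merged each time. *)
Inductive fsum (E : seq G) : (HH -> HH) -> Prop :=
| fsum0 : fsum E 0
| fsumS t a y : t \in E -> A a -> fsum E y -> fsum E (gen t a + y).

Lemma fsum_sub E F y : {subset E <= F} -> fsum E y -> fsum F y.
Proof.
move=> EF; elim=> [|t a {}y tE Aa _ IH]; first exact: fsum0.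
by apply: fsumS => //; exact: EF.
Qed.

Lemma fsumD E x y : fsum E x -> fsum E y -> fsum E (x + y).
Proof.
move=> hx hy; elim: hx => [|t a {}x tE Aa _ IH]; first by rewrite add0r.
by rewrite -addrA; exact: fsumS.
Qed.

Lemma fsumZ E (c : R[i]) y : fsum E y -> fsum E (c *: y).
Proof.
elim=> [|t a {}y tE Aa _ IH]; first by rewrite scaler0; exact: fsum0.
rewrite scalerDr -(linear_onZ sA (gen_linear_on t)) //; apply: fsumS => //.
exact: lsubZ.
Qed.

Lemma fsum_sum E (I : Type) (r : seq I) (F : I -> HH -> HH) :
  (forall i, fsum E (F i)) -> fsum E (\sum_(i <- r) F i).
Proof.
move=> hF; elim/big_rec: _ => [|i y _]; first exact: fsum0.
exact: fsumD.
Qed.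


Lemma fsum_pps E F f : (forall t, A (f t)) -> {subset E <= F} -> fsum F (pps E f).
Proof.
move=> Af; elim: E => [|t E IH] EF; first by rewrite [X in fsum F X]big_nil; exact: fsum0.
rewrite [X in fsum F X]big_cons; apply: fsumS => //; first by apply: EF; rewrite mem_head.
by apply: IH => s sE; apply: EF; rewrite in_cons sE orbT.
Qed.

Lemma fsumM E F x y : fsum E x -> fsum F y -> fsum (prodset E F) (x \o y).
Proof.
move=> hx hy; elim: hx => [|t a {}x tE Aa _ IH]; first exact: fsum0.
apply: (fsumD (x := gen t a \o y)) => //.
elim: hy {IH} => [|s b {}y sF Ab _ IH].
  rewrite (_ : _ \o _ = 0); first exact: fsum0.
  by apply/funext => v; exact: (linear0' (gen_linear cA dyn t Aa)).
have -> : gen t a \o (gen s b + y) = gen t a \o gen s b + (gen t a \o y).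
  by apply/funext => v; exact: (linearD _ _ (gen_linear cA dyn t Aa)).
rewrite genM //; apply: fsumS => //.
  by apply/prodsetP; exists t, s.
by apply: (A_comp cA) => //; exact: (al_A dyn).
Qed.

Lemma fsum_crossed E y : fsum E y -> X y.
Proof.
have sX := crossed_lsub cA dyn.
elim=> [|t a {}y _ Aa _ IH]; first by case: sX.
exact: (lsubD sX (crossed_gen cA dyn t Aa) IH).
Qed.

Lemma fsum_linear E y : fsum E y -> linear y.
Proof. by move/fsum_crossed/crossed_lin. Qed.

Lemma fsum_fc E y t : fsum E y -> t \notin E -> fc y t = 0.
Proof.
move=> hy tE; elim: hy => [|s a {}y sE Aa _ IH]; first exact: funext.
have -> : fc (gen s a + y) t = fc (gen s a) t + fc y t by apply/funext.
rewrite IH addr0 (fc_gen cA dyn) //; case: eqP => // ts.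
by rewrite ts sE in tE.
Qed.

(** * The graded space of a selfadjoint matrix of finite sums *)

Section Instance.
Variables (K : finType) (E : seq G) (b : G -> K -> K -> H -> H).
Hypotheses (uE : uniq E) (Ab : forall t k l, A (b t k l)).
Hypothesis b_adj : forall t k l, adjoint (b t k l) (alpha t (b t^-1%g l k)).
Hypothesis bE : forall t k l, t \notin E -> b t k l = 0.
Hypothesis b_half : mxle (fun k l => pps E (fun t => b t k l)) (1 / 2).
Local Notation V := (l2 K HH).

Definition gproj (q : G) (v : V) : V := to_l2 (fun k => dl q (v k q)).

Lemma gprojE q v k : gproj q v k = dl q (v k q).
Proof. exact: to_l2_fin. Qed.

Lemma gproj_linear q : linear (gproj q).
Proof.
move=> c u v; apply: l2_ext => k.
have hu := gprojE q u k; have hv := gprojE q v k.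
have h := gprojE q (c *: u + v) k.
apply: (etrans h).
move: (gproj q u) (gproj q v) hu hv => gu gv hu hv.
apply: (@etrans _ _ (c *: gu k + gv k)); last by [].
have e : (c *: u + v) k q = c *: u k q + v k q by [].
by rewrite hu hv e (dl_linear q).
Qed.

Lemma gproj_bessel s v : uniq s -> \sum_(q <- s) nrm (gproj q v) ^+ 2 <= nrm v ^+ 2.
Proof.
move=> us; rewrite l2norm_fin.
under eq_bigr do rewrite l2norm_fin.
rewrite exchange_big /=; apply: ler_sum => k _.
under eq_bigr do rewrite gprojE nrm_dl.
exact: l2_bessel.
Qed.

Lemma gproj_pw s v : uniq s -> nrm (pw gproj s v) ^+ 2 = \sum_(q <- s) nrm (gproj q v) ^+ 2.
Proof.
move=> us; rewrite l2norm_fin.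
under [RHS]eq_bigr do rewrite l2norm_fin.
rewrite exchange_big /=; apply: eq_bigr => k _.
under [RHS]eq_bigr do rewrite gprojE nrm_dl.
rewrite -nrm_cut //; congr (nrm _ ^+ 2).
by rewrite /pw (l2sumE R K); apply: eq_bigr => q _; rewrite gprojE.
Qed.

Lemma gprojPP p q v : gproj p (gproj q v) = if p == q then gproj q v else 0.
Proof.
apply: l2_ext => k; rewrite !gprojE dlE; case: eqP => [->|_]; first by rewrite gprojE.
exact: (linear0' (dl_linear p)).
Qed.

Definition hpart (t : G) : V -> V := mxop (fun k l => gen t (b t k l)).

Lemma hpart_linear t : linear (hpart t).
Proof. by apply: mxop_linear => k l; exact: (gen_linear cA dyn). Qed.

(** A homogeneous part is bounded by the whole through its coefficients: reading the entries at (1,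
    t⁻¹) and spreading them out again by π and λ_t are both completely contractive. *)
Lemma hpart1 t : ople (hpart t) 1.
Proof.
have h0 : (0 : R) <= 1 / 2 by rewrite divr_ge0.
apply: (@ople_mon _ _ _ _ (1 / 2)); first lra.
have h := mxle_ent 1%g t^-1%g h0 b_half.
apply: (gen_mxle1 cA dyn t h0 (Ab t)).
apply: eq_mxle h => k l v; rewrite (ent_pps cA dyn) // invgK mul1g invg1.
by case: ifPn => tE; [rewrite (al1 dyn)|rewrite bE].
Qed.

(** λ_t moves coordinate q to tq, while π acts coordinate by coordinate. *)
Lemma hpart_gproj t q v : gproj (t * q)%g (hpart t v) = hpart t (gproj q v).
Proof.
have e w k r : hpart t w k r = \sum_l alpha r^-1%g (b t k l) (w l (t^-1 * r)%g).
  rewrite [hpart t w k]mxopE (l2sumE R G); apply: eq_bigr => l _.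
  exact: (genE cA dyn).
apply: l2_ext => k; apply: (etrans (gprojE (t * q)%g (hpart t v) k)); apply: l2_ext => r.
apply: (etrans (dlE (t * q)%g (hpart t v k (t * q)%g) r)).
apply: (etrans (congr1 (fun x => if r == (t * q)%g then x else 0) (e v k (t * q)%g))).
apply: (etrans _ (esym (e (gproj q v) k r))).
have f l : gproj q v l (t^-1 * r)%g = if r == (t * q)%g then v l q else 0.
  rewrite gprojE dlE -(inj_eq (mulgI t)) mulgA mulgV mul1g.
  by [].
under [RHS]eq_bigr do rewrite f.
case: eqP => [->|rn].
  by apply: eq_bigr => l _; rewrite mulgA mulVg mul1g.
rewrite big1 // => l _.
exact: (linear0' (al_linear cA dyn _ (Ab _ _ _))).
Qed.

Lemma hpart_adj t : adjoint (hpart t) (hpart t^-1%g).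
Proof. by apply: mxop_adjoint => k l; apply: gen_adjoint. Qed.

Lemma hpart0 t : t \notin E -> forall v, hpart t v = 0.
Proof.
move=> tE v; apply: l2_ext => k; rewrite mxopE big1 // => l _.
by rewrite bE // (linear_on0 sA (gen_linear_on t)).
Qed.

Lemma hs_hpart F : hs hpart F = mxop (fun k l => pps F (fun t => b t k l)).
Proof.
apply/funext => v; apply: l2_ext => k.
apply: (etrans _ (esym (mxopE (fun k l => pps F (fun t => b t k l)) v k))).
have -> : hs hpart F v k = \sum_(t <- F) hpart t v k by rewrite /hs sumfE (l2sumE R K).
have f t : hpart t v k = \sum_l gen t (b t k l) (v l) := mxopE _ v k.
rewrite (eq_bigr _ (fun t _ => f t)) exchange_big /=; apply: eq_bigr => l _.
exact: (esym (sumfE F predT (fun t => gen t (b t k l)) (v l))).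
Qed.

Definition band_mx (F : seq G) (y : V -> V) : Prop :=
  exists2 Y : K -> K -> HH -> HH, forall k l, fsum F (Y k l) & y = mxop Y.

Lemma band_mx_linear F y : band_mx F y -> linear y.
Proof. by move=> [Y fY ->]; apply: mxop_linear => k l; exact: (fsum_linear (fY k l)). Qed.

Lemma band_mx0 : band_mx [::] 0.
Proof.
exists (fun _ _ => 0) => [k l|]; first exact: fsum0.
by apply/funext => v; apply: l2_ext => k; rewrite mxopE big1.
Qed.

Lemma band_mx_hs F : uniq F -> band_mx F (hs hpart F).
Proof. by move=> uF; rewrite hs_hpart; exists (fun k l => pps F (fun t => b t k l)) => // k l; exact: fsum_pps. Qed.

Lemma band_mxM F F' x y : band_mx F x -> band_mx F' y -> band_mx (prodset F F') (x \o y).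
Proof.
move=> [Y fY ->] [Z fZ ->]; exists (fun k l => \sum_m (Y k m \o Z m l)) => [k l|].
  by apply: fsum_sum => m; exact: fsumM.
apply/funext => v; apply: l2_ext => k; apply: (etrans (mxopE Y (mxop Z v) k)).
apply: (etrans _ (esym (mxopE (fun k l => \sum_m (Y k m \o Z m l)) v k))).
under eq_bigr => m _ do rewrite (mxopE Z v m) (linear_sum' _ _ _ (fsum_linear (fY k m))).
by rewrite exchange_big /=; apply: eq_bigr => l _; rewrite sumfE.
Qed.

Lemma band_mxD F F' c x y : band_mx F x -> band_mx F' y -> band_mx (F ++ F') (c *: x + y).
Proof.
move=> [Y fY ->] [Z fZ ->]; exists (fun k l => c *: Y k l + Z k l) => [k l|].
  apply: fsumD; first apply: fsumZ.
    by apply: fsum_sub (fY k l) => t tF; rewrite mem_cat tF.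
  by apply: fsum_sub (fZ k l) => t tF; rewrite mem_cat tF orbT.
apply/funext => v; apply: l2_ext => k.
have eY := mxopE Y v k; have eZ := mxopE Z v k.
apply: (@etrans _ _ (c *: mxop Y v k + mxop Z v k)); first by [].
apply: (etrans _ (esym (mxopE (fun k l => c *: Y k l + Z k l) v k))).
apply: (etrans (congr2 (fun x y => c *: x + y) eY eZ)).
rewrite (scaler_sumr c (index_enum K) predT (fun l => Y k l (v l))) -big_split.
by apply: eq_bigr.
Qed.

Lemma hs_half : ople (hs hpart E) (1 / 2).
Proof. by rewrite hs_hpart; exact: b_half. Qed.

Definition mx_graded : graded R G :=
  @Graded R G V gproj hpart E band_mx uE gproj_linear gproj_bessel gproj_pw gprojPP
    hpart_linear hpart1 hpart_gproj hpart_adj hpart0 hs_half band_mx_linear band_mx0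
    band_mx_hs band_mxM band_mxD.

End Instance.

(* The coefficients of the selfadjoint matrix with corners x and x^*. *)
Definition sa_coef (I : finType) (E : seq G) (f : I -> I -> G -> H -> H)
    (st : (H -> H) -> H -> H) (t : G) (k l : bool * I) : H -> H :=
  if ~~ k.1 && l.1 then if t \in E then f k.2 l.2 t else 0
  else if k.1 && ~~ l.1 then if t^-1%g \in E then alpha t (st (f l.2 k.2 t^-1%g)) else 0
  else 0.

Section Selfadjoint.
Variables (I : finType) (E : seq G) (f : I -> I -> G -> H -> H) (st : (H -> H) -> H -> H).
Hypotheses (uE : uniq E) (Af : forall i j t, A (f i j t)).
Hypothesis stP : forall a, A a -> A (st a) /\ adjoint a (st a).
Local Notation K := (bool * I)%type.

Let E2 : seq G := undup (E ++ [seq t^-1%g | t <- E]).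

Let b := sa_coef E f st.

Let Y (k l : K) : HH -> HH := pps E2 (fun t => b t k l).

Lemma sa_A t k l : A (b t k l).
Proof.
have A0 := A_zero cA; rewrite /b /sa_coef; case: ifP => _; first by case: ifP.
case: ifP => // _; case: ifP => // _; apply: (al_A dyn).
exact: (stP (Af _ _ _)).1.
Qed.

Lemma sa_adj t k l : adjoint (b t k l) (alpha t (b t^-1%g l k)).
Proof.
have z : adjoint (0 : H -> H) (alpha t 0).
  by rewrite (al0 cA dyn) => u v; rewrite inner0 inner0r.
rewrite /b /sa_coef; case: k l => -[] i [[] j] //=; rewrite ?invgK; case: ifP => // _.
- have [_ _ _ hA] := al_star dyn t; have [As sa] := stP (Af j i t^-1%g).
  exact: (hA _ _ As (Af j i t^-1%g) (adjointC sa)).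
- have [As sa] := stP (Af i j t); rewrite (alKV dyn t As); exact: sa.
Qed.

Lemma sa_supp t k l : t \notin E2 -> b t k l = 0.
Proof.
rewrite mem_undup mem_cat negb_or => /andP[/negPf tE tE'].
have /negPf tV : t^-1%g \notin E.
  by apply: contra tE' => h; rewrite -(invgK t) map_f.
by rewrite /b /sa_coef tE tV !if_same.
Qed.

Lemma sa_corner i j : Y (false, i) (true, j) = pps E (f i j).
Proof.
rewrite /Y (_ : pps E (f i j) = \sum_(t <- E) gen t (b t (false, i) (true, j))).
  apply: big_uniq_sub => // [|t tE|t _ tE]; first exact: undup_uniq.
    by rewrite mem_undup mem_cat tE.
  by rewrite /b /sa_coef /= (negPf tE) (linear_on0 sA (gen_linear_on t)).
by apply: eq_big_seq => t tE; rewrite /b /sa_coef /= tE.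
Qed.

Lemma sa_adjoint k l : adjoint (Y k l) (Y l k).
Proof.
move=> u v.
have e w (m n : K) : Y m n w = \sum_(t <- E2) gen t (b t m n) w by exact: sumfE.
rewrite (e u k l) (e v l k) inner_suml inner_sumr.
have g t := gen_adjoint (sa_A t k l) (sa_A t^-1%g l k) (sa_adj t k l) u v.
pose F t := inner u (gen t (b t l k) v).
apply: (@etrans _ _ (\sum_(t <- E2) F t^-1%g)).
  by apply: eq_bigr => t _; exact: g.
apply: (etrans (esym (big_map (fun t : G => t^-1%g) predT F))).
apply: perm_big; apply: uniq_perm; rewrite ?undup_uniq //.
  by rewrite map_inj_uniq ?undup_uniq //; exact: invg_inj.
have s t : t \in E2 -> t^-1%g \in E2.
  rewrite !mem_undup !mem_cat => /orP[tE|/mapP[r rE ->]]; apply/orP.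
    by right; exact: map_f.
  by left; rewrite invgK.
move=> t; apply/mapP/idP => [[r rE ->]|tE]; first exact: s.
by exists t^-1%g; rewrite ?invgK // s.
Qed.

Hypothesis quarter : mxle (fun i j => pps E (f i j)) (1 / 4).

(** Each off-diagonal corner has norm at most 1/4. Adding the two bounds, instead of using that the
    corners act between orthogonal parts, loses a factor 2 that the hypothesis 1/4 pays for. *)
Lemma sa_half : mxle Y (1 / 2).
Proof.
have q0 : (0 : R) <= 1 / 4 by rewrite divr_ge0.
pose Yu (k l : K) : HH -> HH := if ~~ k.1 && l.1 then pps E (f k.2 l.2) else 0.
pose Yd (k l : K) : HH -> HH := if k.1 && ~~ l.1 then Y k l else 0.
have hu : mxle Yu (1 / 4) by exact: (mxle_corner q0 quarter).
have hd : mxle Yd (1 / 4).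
  apply: (adjoint_ople q0 _ hu); apply: mxop_adjoint => k l; rewrite /Yu /Yd andbC.
  case: ifP => [|_ u v]; last by rewrite inner0 inner0r.
  case: k l => -[] i [[] j] //= _; rewrite -sa_corner; exact: sa_adjoint.
apply: (mxle_mon _ (eq_mxle _ (mxle_add hu hd))); first lra.
have diag k l : k.1 = l.1 -> Y k l = 0.
  move=> kl; rewrite [Y k l]big1 // => t _.
  by rewrite /b /sa_coef kl andbN andNb (linear_on0 sA (gen_linear_on t)).
move=> k l v; rewrite /Yu /Yd.
case: k l => -[] i [[] j] /=.
- by rewrite diag // addr0.
- by rewrite add0r.
- by rewrite addr0 -sa_corner.
- by rewrite diag // addr0.
Qed.

End Selfadjoint.

(** The matrix becomes a corner of a selfadjoint one, whose graded space is fed to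
    [uniform_approximation]. [F] is chosen before the matrix, its size and its support [E]; this
    order makes the later choice of the second φ possible. *)
Lemma uniform_crossed (E0 : seq G) (e : R) : 0 < e -> exists F : seq G,
  forall (I : finType) (E : seq G) (f : I -> I -> G -> H -> H), uniq E ->
    (forall i j t, A (f i j t)) -> mxle (fun i j => pps E (f i j)) (1 / 4) ->
  exists c : I -> I -> HH -> HH, [/\ forall i j, fsum F (c i j), mxle c 2 &
    forall t, t \in E0 -> mxle (fun i j => fc (pps E (f i j) - c i j) t) e].
Proof.
move=> e0; have [uc [F hF] ucP] := uniform_approximation E0 e0.
exists F => I E f uE Af xq.
have [st stP] : exists st : (H -> H) -> H -> H, forall a, A a -> A (st a) /\ adjoint a (st a).
  have h a : exists b, A a -> A b /\ adjoint a b.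
    have [Aa|nA] := pselect (A a); last by exists 0.
    by have [_ _ _ h _] := cA; have [b Ab ab] := h a Aa; exists b.
  by have [st stP] := choice h; exists st.
pose E2 := undup (E ++ [seq t^-1%g | t <- E]).
pose K := (bool * I)%type.
pose b := sa_coef E f st.
pose Y (k l : K) : HH -> HH := pps E2 (fun t => b t k l).
pose XX := mx_graded (undup_uniq _ : uniq E2) (sa_A E Af stP) (sa_adj E Af stP)
  (sa_supp f st (E := E)) (sa_half uE Af stP xq).
have [Z fZ cZ] : band_mx F (uc XX) := hF XX.
have [_ c2 cP] := ucP XX.
have f_inj (c : bool) : injective (fun i : I => (c, i)) by move=> i j [].
have lZ k l : linear (Z k l) := fsum_linear (fZ k l).
exists (fun i j => Z (false, i) (true, j)); split=> // [|t tE].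
  rewrite cZ in c2; exact: (mxle_reindex (ler0n R 2) (f_inj false) (f_inj true) lZ c2).
have XY k l : X (Y k l) by apply: (crossed_pps cA dyn); [exact: undup_uniq|move=> s; exact: (sa_A E Af stP)].
have XD k l : X (Y k l - Z k l).
  exact: (lsubB (crossed_lsub cA dyn) (XY k l) (fsum_crossed (fZ k l))).
have h1 : mxle (fun k l => ent (Y k l - Z k l) t 1%g) e.
  apply/(mxleP _ (ltW e0)) => w.
  (* Testing on δ_1 ⊗ w, a vector of degree 1, turns the graded estimate into one on the column at
     1, whose entries are the coefficients up to an automorphism. *)
  have [z zE] : exists z : l2 K HH, forall k, z k = dl 1%g (w k).
    by exists (to_l2 (fun k => dl 1%g (w k))) => k; exact: to_l2_fin.
  have z1 : gproj 1%g z = z.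
    apply: l2_ext => k; apply: (etrans (gprojE 1%g z k)); rewrite (zE k).
    by apply: (congr1 (dl 1%g)); rewrite dlE eqxx.
  have nz : nrm z ^+ 2 = \sum_k nrm (w k) ^+ 2.
    by rewrite l2norm_fin; apply: eq_bigr => k _; rewrite zE nrm_dl.
  have h := cP t z tE z1.
  have [u uD] : exists u, u = hs (hpart b) E2 z - mxop Z z by eexists.
  have {}h : nrm (gproj t u) <= e * nrm z by rewrite uD -cZ.
  have uE' k : u k t = \sum_l ent (Y k l - Z k l) t 1%g (w l).
    have -> : u k = \sum_l (Y k l - Z k l) (dl 1%g (w l)).
      rewrite uD hs_hpart -[LHS]/(mxop Y z k - mxop Z z k).
      apply: (etrans (congr2 (fun x y => x - y) (mxopE Y z k) (mxopE Z z k))).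
      rewrite -sumrB.
      by apply: eq_bigr => l _; rewrite zE.
    by rewrite (l2sumE R G).
  rewrite -nz -exprMn.
  apply: (@le_trans _ _ (nrm (gproj t u) ^+ 2)); last first.
    by rewrite lerXn2r ?nnegrE ?nrm_ge0 // mulr_ge0 ?nrm_ge0 ?(ltW e0).
  rewrite l2norm_fin; apply: ler_sum => k _.
  have -> : gproj t u k = dl t (u k t) := gprojE t u k.
  by rewrite nrm_dl uE'.
have lD k l : linear (ent (Y k l - Z k l) t 1%g) by apply: ent_linear; exact: (crossed_lin (XD k l)).
have h2 := mxle_reindex (ltW e0) (f_inj false) (f_inj true) lD h1.
pose y i j := pps E (f i j) - Z (false, i) (true, j).
have yY i j : Y (false, i) (true, j) - Z (false, i) (true, j) = y i j.
  apply: (congr1 (fun x => x - Z (false, i) (true, j))); exact: sa_corner.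
have Xy i j : X (y i j) by rewrite -yY.
have h3 : mxle (fun i j => alpha t^-1%g (fc (y i j) t)) e.
  apply: eq_mxle h2 => i j v; rewrite yY (crossed_ent cA dyn t 1%g (Xy i j)).
  by rewrite invg1 mulg1.
have Afc i j : A (fc (y i j) t) := crossed_fc cA dyn t (Xy i j).
have := al_mxle cA dyn t (ltW e0) (fun i j => al_A dyn t^-1%g (Afc i j)) h3.
by apply: eq_mxle => i j v; rewrite (alKV dyn t (Afc i j)).
Qed.

End UniformCrossed.


(** * The three conditions *)

Section SchurBounds.
Variables (R : realType) (J : choiceType) (H : hilbertType R) (A : set (H -> H)).
Hypothesis sA : lsub A.
Implicit Types (phi psi : J -> J -> (H -> H) -> (H -> H)).

Lemma eq_schur_bd phi psi (M : R) : (forall q p a, A a -> phi q p a = psi q p a) ->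
  schur_bd A phi M -> schur_bd A psi M.
Proof.
move=> e bphi I p a N Aa N0 aN.
by apply: eq_mxle (bphi I p a N Aa N0 aN) => i j v; rewrite e.
Qed.

Lemma schur_bd_sub phi psi (M N : R) : schur_bd A phi M -> schur_bd A psi N ->
  schur_bd A (fun q p a => phi q p a - psi q p a) (M + N).
Proof.
move=> b1 b2 I p a K Aa K0 aK; rewrite mulrDl.
exact: (eq_mxle _ (mxle_sub (b1 I p a K Aa K0 aK) (b2 I p a K Aa K0 aK))).
Qed.

Lemma schur_bd_subC phi psi (M : R) : schur_bd A (fun q p a => phi q p a - psi q p a) M ->
  schur_bd A (fun q p a => psi q p a - phi q p a) M.
Proof.
move=> b1 I p a K Aa K0 aK.
have := mxle_scale (-1) (b1 I p a K Aa K0 aK).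
rewrite normrN1 mul1r; apply: eq_mxle => i j v.
by rewrite scaleN1r -[X in - X]/(phi (p j) (p i) (a i j) v - psi (p j) (p i) (a i j) v) opprB.
Qed.

(* Placing the matrix in an off-diagonal corner makes all its entries sit over the pair (q, p). *)
Lemma schur_bd_cble phi (M : R) q p : 0 <= M ->
  (forall q p a, A a -> linear (phi q p a)) -> schur_bd A phi M -> cble A (phi q p) M.
Proof.
move=> M0 lphi bphi I x N Ax N0 xN.
pose a (k l : bool * I) : H -> H := if ~~ k.1 && l.1 then x k.2 l.2 else 0.
pose pp (k : bool * I) := if k.1 then q else p.
have Aa k l : A (a k l) by rewrite /a; case: ifP => // _; case: sA.
have aN : mxle a N by exact: (mxle_corner (ltW N0) xN).
have h := bphi _ pp a N Aa N0 aN.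
have inj (c : bool) : injective (fun i : I => (c, i)) by move=> i j [].
have ll k l : linear (phi (pp l) (pp k) (a k l)) by exact: lphi.
exact: (mxle_reindex (mulr_ge0 M0 (ltW N0)) (inj false) (inj true) ll h).
Qed.

End SchurBounds.

Section Conditions.
Variables (R : realType) (G : groupType) (H : hilbertType R).
Variables (A : set (H -> H)) (alpha : G -> (H -> H) -> (H -> H)).
Hypotheses (cA : cstar_algebra A) (dyn : dyn_action A alpha).
Local Notation HH := (l2 G H).
Local Notation X := (crossed A alpha).
Local Notation gen := (gen alpha).
Local Notation pps := (pps alpha).
Implicit Types (F : G -> (H -> H) -> (H -> H)).

Let sA : lsub A. Proof. exact: (A_lsub cA). Qed.
Let Ab : A `<=` bop H. Proof. by move=> a; exact: (A_bop cA). Qed.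

Lemma N_sub F F' q p a : bounded_CB A F -> bounded_CB A F' -> A a ->
  N_ alpha (F - F') q p a = N_ alpha F q p a - N_ alpha F' q p a.
Proof.
move=> bF bF' Aa; have Apa := al_A dyn p Aa; rewrite /N_ -(linear_onB sA (al_lin dyn p^-1%g)) //.
  exact: (F_A bF).
exact: (F_A bF').
Qed.

Lemma herz_schur_N F : herz_schur A alpha F -> schur_multiplier A (N_ alpha F).
Proof.
move=> hsF; have bF : bounded_CB A F by case: hsF.
have [M M0 bN] := herz_schur_bd cA dyn bF hsF.
have [c c0 cF] := F_bound cA bF.
have cN q p : cble A (N_ alpha F q p) c.
  move=> I x N Ax N0 xN.
  have Apx i j : A (alpha p (x i j)) by exact: (al_A dyn).
  have h1 := al_mxle cA dyn p (ltW N0) Ax xN.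
  have h2 := cF (p * q^-1)%g I _ N Apx N0 h1.
  exact: (al_mxle cA dyn p^-1%g (mulr_ge0 c0 (ltW N0)) (fun i j => F_A bF _ (Apx i j)) h2).
apply: (bd_schur_multiplier cA _ M0 _ bN) => [q p|].
  apply/(CB_cble _ sA Ab (@subset_refl _ _)); split.
  - by move=> a Aa; apply: Ab; exact: (N_A dyn bF q p Aa).
  - exact: (N_lin dyn bF).
  - by exists c.
exists c => q p; exact: (cbnorm_le Ab (fun a Aa => N_linear cA dyn bF q p Aa) c0 (cN q p)).
Qed.

Lemma herz_schur_sub F F' : herz_schur A alpha F -> herz_schur A alpha F' ->
  herz_schur A alpha (F - F').
Proof.
move=> hsF hsF'; have bF : bounded_CB A F by case: hsF.
have bF' : bounded_CB A F' by case: hsF'.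
have [M M0 bN] := herz_schur_bd cA dyn bF hsF.
have [M' M0' bN'] := herz_schur_bd cA dyn bF' hsF'.
apply: (bd_herz_schur cA dyn (bounded_CB_sub cA bF bF') (addr_ge0 M0 M0')).
apply: eq_schur_bd (schur_bd_sub bN bN') => q p a Aa.
by rewrite N_sub.
Qed.

Lemma mnorm_schur_lt F F' (e : R) : herz_schur A alpha F -> herz_schur A alpha F' -> 0 < e ->
  (mnorm A alpha (F' - F)%R < (e / 2)%:E)%E ->
  (cbnorm (schur_domain G A) (S_schur A (N_ alpha F) - S_schur A (N_ alpha F'))%R < e%:E)%E.
Proof.
move=> hsF hsF' e0 h; have bF : bounded_CB A F by case: hsF.
have bF' : bounded_CB A F' by case: hsF'.
have b := mnorm_bd cA dyn (bounded_CB_sub cA bF' bF) (herz_schur_sub hsF' hsF) h.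
have e2 : 0 <= e / 2 by rewrite divr_ge0 // ltW.
have e2e : e / 2 < e by rewrite ltr_pdivrMr // ltr_pMr // ltr1n.
apply: (bd_S_schur_sub cA (herz_schur_N hsF) (herz_schur_N hsF') e2 e2e).
by apply: schur_bd_subC; apply: eq_schur_bd b => q p a Aa; rewrite N_sub.
Qed.

Lemma findim_span (L : hilbertType R) (T : finType) (e : T -> L -> L) :
  findim [set \sum_t c t *: e t | c in [set: T -> R[i]]].
Proof.
exists #|T|, (fun i => e (enum_val i)); apply/seteqP; split=> _ [c _ <-].
  exists (fun i => c (enum_val i)) => //.
  by rewrite [RHS](reindex_onto enum_val enum_rank) /= => [|i _];
    [apply: eq_bigl => i; rewrite enum_valK eqxx|rewrite enum_rankK].
exists (fun t => c (enum_rank t)) => //.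
rewrite (reindex_onto enum_val enum_rank) /= => [|i _]; last by rewrite enum_rankK.
by apply: eq_big => [i|i _]; rewrite ?enum_valK ?eqxx.
Qed.

(** A double family, because both uses have one generator for each degree in [E] and each basis
    element; the second clause is what places the span inside [A] or the crossed product. *)
Lemma span_family (L : hilbertType R) (T : eqType) (E : seq T) n (v : T -> 'I_n -> L -> L) :
  exists Y : set (L -> L), [/\ findim Y,
    forall W : set (L -> L), lsub W -> (forall t k, t \in E -> W (v t k)) -> Y `<=` W &
    forall t c, t \in E -> Y (\sum_k c k *: v t k)].
Proof.
pose K := ('I_(size E) * 'I_n)%type.
pose w (t : K) := v (tnth (in_tuple E) t.1) t.2.
exists [set \sum_t c t *: w t | c in [set: K -> R[i]]]; split.
- exact: findim_span.
- move=> W sW Wv _ [c _ <-]; apply: (lsub_sum sW) => t _; apply: (lsubZ sW); apply: Wv.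
  exact: (mem_tnth t.1 (in_tuple E)).
move=> t c tE.
have [i it] : exists i, tnth (in_tuple E) i = t.
  by have /tnthP[i ->] : t \in in_tuple E by []; exists i.
exists (fun jk => if jk.1 == i then c jk.2 else 0) => //.
rewrite -(pair_bigA _ (fun j k => (if j == i then c k else 0) *: w (j, k))) /=.
rewrite (bigD1 i) //= [X in _ + X]big1 ?addr0 => [|j /negPf ji]; last first.
  by rewrite big1 // => k _; rewrite ji scale0r.
by apply: eq_bigr => k _; rewrite eqxx /w /= it.
Qed.

Lemma findim_basis (L : hilbertType R) n (e : 'I_n -> L -> L) k :
  [set \sum_i c i *: e i | c in [set: 'I_n -> R[i]]] (e k).
Proof.
exists (fun j => (j == k)%:R) => //.
by rewrite (bigD1 k) //= eqxx scale1r big1 ?addr0 // => j /negPf ->; rewrite scale0r.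
Qed.

(** In (iii) the range of α_s φ(s, e) is the image under α_s of the range of F_i(s⁻¹), so the space
    of (ii) is spread by the finitely many automorphisms that meet the support. *)
Lemma spread_findim (E : seq G) (U : set (H -> H)) : findim U -> U `<=` A ->
  exists U' : set (H -> H), [/\ findim U', U' `<=` A &
    forall t u, t \in E -> U u -> U' (alpha t u)].
Proof.
move=> [n [e ->]] UA; have Ae k : A (e k) := UA _ (findim_basis e k).
have [Y [fY YW YE]] := span_family E (fun t k => alpha t (e k)).
exists Y; split=> //; first by apply: YW => // t k _; exact: (al_A dyn).
move=> t _ tE [c _ <-].
rewrite (linear_on_sum sA (al_lin dyn t)); last by move=> k _; exact: (lsubZ sA).
under eq_bigr => k _ do rewrite (linear_onZ sA (al_lin dyn t)) //.
exact: YE.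
Qed.

Lemma N_band F (E : {fset G}) s t a : (forall s, s \notin E -> forall a, A a -> F s a = 0) ->
  (t * s^-1)%g \notin E -> A a -> N_ alpha F s t a = 0.
Proof.
move=> FE tE Aa; rewrite /N_ FE ?(al0 cA dyn) //.
exact: (al_A dyn).
Qed.

Lemma N_at1 F s a : A (F s^-1%g a) -> A a -> N_ alpha F s 1%g a = F s^-1%g a.
Proof. by move=> AF Aa; rewrite /N_ (al1 dyn Aa) mul1g invg1 (al1 dyn AF). Qed.

Definition multiplier_net F : Prop :=
  exists (D : Type) (le : D -> D -> Prop)
     (Fi : D -> G -> (H -> H) -> (H -> H)) (U : D -> set (H -> H)),
     [/\ directed le,
         forall i, herz_schur A alpha (Fi i) /\ finitely_supported A (Fi i),
         forall i, findim (U i) /\ U i `<=` A,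
         forall i s a, A a -> U i (Fi i s a)
       & net_to0 le (fun i => mnorm A alpha (Fi i - F))].

Definition schur_net F : Prop :=
  exists (D : Type) (le : D -> D -> Prop)
     (phi : D -> G -> G -> (H -> H) -> (H -> H)) (U : D -> set (H -> H)),
     [/\ directed le,
         forall i, schur_multiplier A (phi i) /\ band_finite A (phi i),
         forall i, findim (U i) /\ U i `<=` A,
         forall i s a, A a ->
           A (phi i s 1%g a) /\ U i (alpha s (phi i s 1%g a))
       & net_to0 le (fun i => cbnorm (schur_domain G A)
           (S_schur A (N_ alpha F) - S_schur A (phi i)))].

Lemma completely_compact_net F : herz_schur A alpha F -> SOAP X ->
  completely_compact X X (S_ A alpha F) -> multiplier_net F.
Proof.
move=> hsF soap cc.
have h n : exists FU : (G -> (H -> H) -> (H -> H)) * set (H -> H),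
    [/\ herz_schur A alpha FU.1 /\ finitely_supported A FU.1,
      findim FU.2 /\ FU.2 `<=` A, forall s a, A a -> FU.2 (FU.1 s a)
    & (mnorm A alpha (FU.1 - F)%R < (n.+1%:R^-1)%:E)%E].
  have n0 : (0 : R) < n.+1%:R^-1 by rewrite invr_gt0 ltr0n.
  by have [F' [U h]] := approx_multiplier cA dyn hsF n0 cc soap; exists (F', U).
have [FU FUP] := choice h.
exists nat, (fun m n => (m <= n)%N), (fun n => (FU n).1), (fun n => (FU n).2); split.
- split=> [|i|i j k|i j]; [exact: (inhabits 0%N)|exact: leqnn|exact: leq_trans|].
  by exists (maxn i j); rewrite leq_maxl leq_maxr.
- by move=> n; have [] := FUP n.
- by move=> n; have [] := FUP n.
- by move=> n; have [] := FUP n.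
move=> e e0; exists (Num.bound e^-1) => n ln; have [_ _ _ hn] := FUP n.
apply: (lt_le_trans hn); rewrite lee_fin invf_ple ?posrE ?ltr0n //.
apply: (le_trans (ltW (archi_boundP _))); first by rewrite invr_ge0 ltW.
by rewrite ler_nat leqW.
Qed.

Lemma multiplier_net_schur F : herz_schur A alpha F -> multiplier_net F -> schur_net F.
Proof.
move=> hsF [D [le [Fi [U [dir hFi hU ran net]]]]].
have h i : exists U' : set (H -> H), [/\ findim U', U' `<=` A &
    forall s a, A a -> U' (alpha s (Fi i s^-1%g a))].
  have [_ [E FE]] := hFi i; have [fU UA] := hU i.
  have [U' [fU' UA' tU]] := spread_findim [seq t^-1%g | t <- E] fU UA.
  exists U'; split=> // s a Aa.
  have [sE|sE] := boolP (s^-1%g \in E); last first.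
    by rewrite FE // (al0 cA dyn); case: (findim_lsub fU').
  apply: tU; last exact: ran.
  by rewrite -[s]invgK map_f.
have [U' U'P] := choice h.
exists D, le, (fun i => N_ alpha (Fi i)), U'; split.
- exact: dir.
- move=> i; have [hs [E FE]] := hFi i; split; first exact: herz_schur_N.
  by exists E => s t tE a Aa; exact: (N_band FE tE Aa).
- by move=> i; have [] := U'P i.
- move=> i s a Aa; have [hs _] := hFi i; have bF : bounded_CB A (Fi i) by case: hs.
  have AF : A (Fi i s^-1%g a) by exact: (F_A bF).
  rewrite N_at1 //; split=> //.
  by have [_ _] := U'P i; apply.
move=> e e0; have e2 : 0 < e / 2 by rewrite divr_gt0.
have [i0 i0P] := net _ e2; exists i0 => i lei; have [hs _] := hFi i.
exact: (mnorm_schur_lt hsF hs e0 (i0P i lei)).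
Qed.

(** The support [E] may depend on the matrix and its size, since [uniform_crossed] is uniform in it;
    hence the crude [mxle_entries] is good enough. *)
Lemma approx_pps (I : finType) (x : I -> I -> HH -> HH) (d : R) : 0 < d ->
  (forall i j, X (x i j)) -> exists E (f : I -> I -> G -> H -> H),
  [/\ uniq E, forall i j t, A (f i j t) & mxle (fun i j => x i j - pps E (f i j)) d].
Proof.
move=> d0 Xx.
pose N : R := \sum_(i : I) \sum_(j : I) 1.
have N0 : 0 <= N by apply: sumr_ge0 => i _; apply: sumr_ge0.
have d1 : 0 < d / (N + 1) by rewrite divr_gt0 // ltr_wpDl.
have h (ij : I * I) : exists Ef : seq G * (G -> H -> H),
    [/\ uniq Ef.1, forall t, A (Ef.2 t) & ople (x ij.1 ij.2 - pps Ef.1 Ef.2) (d / (N + 1))].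
  have [_ h] := (crossedP cA dyn _).1 (Xx ij.1 ij.2).
  by have [E [f ef]] := h _ d1; exists (E, f).
have [Ef EfP] := choice h.
pose E := undup (flatten [seq (Ef ij).1 | ij <- enum {: I * I}]).
pose f i j t := if t \in (Ef (i, j)).1 then (Ef (i, j)).2 t else 0.
have Af i j t : A (f i j t).
  by rewrite /f; case: ifP => _; [have [_ + _] := EfP (i, j); apply|exact: (A_zero cA)].
have e i j : pps E (f i j) = pps (Ef (i, j)).1 (Ef (i, j)).2.
  have [u _ _] := EfP (i, j).
  apply: (@etrans _ _ (\sum_(t <- (Ef (i, j)).1) gen t (f i j t))); last first.
    by apply: eq_big_seq => t tE; rewrite /f tE.
  apply: big_uniq_sub => // [|t tE|t _ tE]; first exact: undup_uniq.
    rewrite mem_undup; apply/flattenP; exists (Ef (i, j)).1 => //.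
    by apply: (map_f (fun ij => (Ef ij).1)); rewrite mem_enum.
  by rewrite /f (negPf tE) (linear_on0 sA (gen_linear_on cA dyn t)).
exists E, f; split=> //; first exact: undup_uniq.
have o i j : ople (x i j - pps E (f i j)) (d / (N + 1)).
  by rewrite e; have [_ _] := EfP (i, j).
apply: (mxle_mon _ (mxle_entries (ltW d1) o)).
have -> : \sum_(i : I) \sum_(j : I) d / (N + 1) = N * (d / (N + 1)).
  rewrite mulr_suml; apply: eq_bigr => i _; rewrite mulr_suml; apply: eq_bigr => j _.
  by rewrite mul1r.
exact: frac_le N0 (ltW d0).
Qed.

End Conditions.

(** * From approximating Schur multipliers to complete compactness *)

Section CompletelyCompact.
Variables (R : realType) (G : groupType) (H : hilbertType R).
Variables (A : set (H -> H)) (alpha : G -> (H -> H) -> (H -> H)).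
Hypotheses (cA : cstar_algebra A) (dyn : dyn_action A alpha).
Local Notation HH := (l2 G H).
Local Notation X := (crossed A alpha).
Local Notation gen := (gen alpha).
Local Notation pps := (pps alpha).

Let sA : lsub A. Proof. exact: (A_lsub cA). Qed.
Let sX : lsub X. Proof. exact: (crossed_lsub cA dyn). Qed.

(** Triangle inequality over degrees. The factor [size E] is the loss that forces the second φ to be
    chosen after [E]. *)
Lemma gen_mxle_sum (I : finType) (E : seq G) (a : G -> I -> I -> H -> H) (M : R) : 0 <= M ->
  (forall t i j, A (a t i j)) -> (forall t, t \in E -> mxle (a t) M) ->
  mxle (fun i j => pps E (fun t => a t i j)) ((size E)%:R * M).
Proof.
move=> M0 Aa aM.
pose a' t i j := if t \in E then a t i j else 0.
have Aa' t i j : A (a' t i j) by rewrite /a'; case: ifP => _ //; exact: (A_zero cA).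
have aM' t : mxle (a' t) M.
  rewrite /a'; case: (boolP (t \in E)) => tE; first exact: aM.
  by apply: (mxle_mon M0); exact: mxle_zero.
have := mxle_sum E (fun t => gen_mxle1 cA dyn t M0 (Aa' t) (aM' t)).
rewrite big_const_seq count_predT iter_addr_0 -[X in mxle _ X -> _]mulr_natl.
apply: eq_mxle => i j v; congr (_ v).
by apply: eq_big_seq => t tE; rewrite /a' tE.
Qed.

(* On the complement of the band the multiplier N(F) agrees with N(F) - φ, which is small. *)
Lemma off_band (F : G -> (H -> H) -> (H -> H)) phi (E : {fset G}) (I : finType)
    (z : I -> I -> HH -> HH) (e N : R) :
  herz_schur A alpha F -> schur_multiplier A phi ->
  (forall s t, (t * s^-1)%g \notin E -> forall a, A a -> phi s t a = 0) ->
  0 <= e -> schur_bd A (fun q p a => N_ alpha F q p a - phi q p a) e ->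
  0 < N -> (forall i j, X (z i j)) -> mxle z N ->
  (forall i j t, t \in E -> fc (z i j) t = 0) ->
  mxle (fun i j => S_ A alpha F (z i j)) (e * N).
Proof.
move=> hsF [CBp _ _] band e0 be N0 Xz zN z0.
have bF : bounded_CB A F by case: hsF.
have [M M0 bN] := herz_schur_bd cA dyn bF hsF.
pose psi q p a := N_ alpha F q p a - phi q p a.
have lpsi q p a : A a -> linear (psi q p a).
  move=> Aa; apply: linear_sub; first exact: (N_linear cA dyn bF q p Aa).
  exact: (phi_linear CBp).
have h := smap_mxle e0 be lpsi N0 (fun i j => crossed_matA cA dyn (Xz i j)) zN.
have eq i j : S_ A alpha F (z i j) = smap psi (z i j).
  rewrite (S_smap cA dyn bF M0 bN (Xz i j)).
  have mz := crossed_matA cA dyn (Xz i j).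
  have [b1 e1] := smapP M0 bN (fun q p a Aa => N_linear cA dyn bF q p Aa) mz.
  have [b2 e2] := smapP e0 be lpsi mz.
  apply: (ent_ext b1 b2) => p q v; rewrite e1 e2 /psi.
  have -> : phi q p (ent (z i j) p q) = 0; last by rewrite subr0.
  have [pE|pE] := boolP ((p * q^-1)%g \in E); last first.
    by apply: band => //; have [_] := mz; apply.
  rewrite (crossed_ent cA dyn p q (Xz i j)) z0 // (al0 cA dyn).
  exact: (linear_on0 sA (phi_lin CBp q p)).
by apply: eq_mxle h => i j v; rewrite eq.
Qed.

(** N(F)(t⁻¹, e) is F(t) itself, so each coefficient of S_F(c) is close to φ(t⁻¹, e) applied to the
    coefficient of c, whose range condition (iii) controls. *)
Lemma band_span (F : G -> (H -> H) -> (H -> H)) phi (E : seq G) (I : finType)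
    (c : I -> I -> HH -> HH) (e N : R) :
  herz_schur A alpha F -> schur_multiplier A phi -> uniq E ->
  (forall s a, A a -> A (phi s 1%g a)) ->
  0 <= e -> schur_bd A (fun q p a => N_ alpha F q p a - phi q p a) e ->
  0 < N -> (forall i j, fsum A alpha E (c i j)) -> mxle c N ->
  mxle (fun i j => S_ A alpha F (c i j) - pps E (fun t => phi t^-1%g 1%g (fc (c i j) t)))
    ((size E)%:R * (e * N)).
Proof.
move=> hsF [CBp _ _] uE Ap e0 be N0 fcE cN.
have bF : bounded_CB A F by case: hsF.
have [[SX _ _] Sfc _] := S_spec cA dyn hsF.
have Xc i j : X (c i j) := fsum_crossed cA dyn (fcE i j).
have Afc i j t : A (fc (c i j) t) := crossed_fc cA dyn t (Xc i j).
pose psi q p a := N_ alpha F q p a - phi q p a.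
have lpsi q p a : A a -> linear (psi q p a).
  move=> Aa; apply: linear_sub; first exact: (N_linear cA dyn bF q p Aa).
  exact: (phi_linear CBp).
have N1 t a : A a -> N_ alpha F t^-1%g 1%g a = F t a.
  move=> Aa; have AF : A (F t^-1^-1%g a) by exact: (F_A bF).
  by rewrite (N_at1 dyn AF Aa) invgK.
pose a t i j := psi t^-1%g 1%g (fc (c i j) t).
have Aa t i j : A (a t i j).
  by rewrite /a /psi N1 //; apply: (lsubB sA); [exact: (F_A bF)|exact: Ap].
have aM t : t \in E -> mxle (a t) (e * N).
  move=> _; apply: (schur_bd_cble sA t^-1%g 1%g e0 lpsi be) => //.
  exact: (mxle_ent 1%g t^-1%g (ltW N0) cN).
apply: eq_mxle (gen_mxle_sum (mulr_ge0 e0 (ltW N0)) Aa aM) => i j v; congr (_ v).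
have AF t : A (F t (fc (c i j) t)) by exact: (F_A bF).
have -> : S_ A alpha F (c i j) = pps E (fun t => F t (fc (c i j) t)).
  apply: (crossed_ext cA dyn); [exact: SX|exact: crossed_pps|] => t.
  rewrite Sfc // (fc_pps cA dyn) //; case: ifPn => // tE.
  by rewrite (fsum_fc cA dyn (fcE i j) tE) (linear_on0 sA (F_lin bF t)).
rewrite -sumrB; apply: eq_bigr => t _.
rewrite -(linear_onB sA (gen_linear_on cA dyn t)) //; last exact: Ap.
by rewrite /a /psi N1.
Qed.

Lemma ppsZ (E : seq G) (k : R[i]) (f : G -> H -> H) : (forall t, A (f t)) ->
  pps E (fun t => k *: f t) = k *: pps E f.
Proof.
move=> Af; rewrite [RHS]scaler_sumr; apply: eq_bigr => t _.
exact: (linear_onZ sA (gen_linear_on cA dyn t)).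
Qed.

(** Let x' be a finite sum near x and c its uniform approximant. Then r = x - x', y collects the
    small coefficients of x' - c on [E0], and z is the rest of x' - c. *)
Lemma band_decomposition (E0 : {fset G}) (d : R) : 0 < d -> d <= 1 -> exists2 E : seq G, uniq E &
  forall (I : finType) (x : I -> I -> HH -> HH), (forall i j, X (x i j)) -> mxle x 1 ->
  exists c y z r : I -> I -> HH -> HH,
    [/\ forall i j, x i j = r i j + (z i j + (y i j + c i j)),
      forall i j, [/\ fsum A alpha E (c i j), X (y i j), X (z i j) & X (r i j)],
      forall i j t, t \in E0 -> fc (z i j) t = 0
    & [/\ mxle c 16, mxle y d, mxle z 19 & mxle r d]].
Proof.
(* After scaling back by 8 each coefficient on [E0] is bounded by h, and together they cost at most
   d. *)
move=> d0 d1; pose h := d / ((size E0)%:R + 1).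
have h0 : 0 < h by rewrite divr_gt0 // ltr_wpDl.
have h8 : 0 < h / 8 by rewrite divr_gt0.
have [E1 hE1] := uniform_crossed cA dyn E0 h8.
exists (undup E1); first exact: undup_uniq.
move=> I x Xx x1; have [E2 [f [uE2 Af xf]]] := approx_pps cA dyn d0 Xx.
pose x' i j := pps E2 (f i j).
have Xx' i j : X (x' i j) by exact: crossed_pps.
have x'2 : mxle x' 2.
  have d2 : 1 + d <= 2 by rewrite -[2]/(1 + 1) lerD2l.
  apply: (mxle_mon d2 (eq_mxle _ (mxle_sub x1 xf))) => i j v.
  by rewrite -[(x i j - _) v]/(x i j v - x' i j v) opprB addrC subrK.
(* x' has norm at most 2, so x'/8 meets the bound 1/4 of [uniform_crossed]. Scaling its approximant
   back gives 2 * 8 = 16 for c, and then 2 + 16 + 1 = 19 for z. *)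
pose k8 : R[i] := (8^-1 : R)%:C; pose e8 : R[i] := (8 : R)%:C.
have ke : e8 * k8 = 1 by rewrite /e8 /k8 -rmorphM mulfV.
have n8 : complex.Re `|e8| = 8 by rewrite Re_norm_real.
have q : mxle (fun i j => pps E2 (fun t => k8 *: f i j t)) (1 / 4).
  have -> : 1 / 4 = complex.Re `|k8| * 2 :> R by rewrite Re_norm_real ?invr_ge0 //; field.
  by apply: eq_mxle (mxle_scale k8 x'2) => i j v; rewrite ppsZ.
have Af' i j t : A (k8 *: f i j t) by exact: (lsubZ sA).
have [c0 [fc0 c02 hc0]] := hE1 I E2 (fun i j t => k8 *: f i j t) uE2 Af' q.
pose c i j := e8 *: c0 i j.
have fcc i j : fsum A alpha (undup E1) (c i j).
  apply: (fsumZ cA dyn); apply: fsum_sub (fc0 i j) => t; by rewrite mem_undup.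
have Xc i j : X (c i j) := fsum_crossed cA dyn (fcc i j).
have c16 : mxle c 16.
  have -> : 16 = complex.Re `|e8| * 2 :> R by rewrite n8 -natrM.
  exact: (mxle_scale e8 c02).
pose y i j := x' i j - c i j.
have Xy i j : X (y i j) := lsubB sX (Xx' i j) (Xc i j).
have Afy i j t : A (fc (y i j) t) := crossed_fc cA dyn t (Xy i j).
have yE i j : y i j = e8 *: (pps E2 (fun t => k8 *: f i j t) - c0 i j).
  by rewrite ppsZ // scalerBr scalerA ke scale1r.
have fcy t : t \in (E0 : seq G) -> mxle (fun i j => fc (y i j) t) h.
  move=> tE; have -> : h = complex.Re `|e8| * (h / 8) by rewrite n8 mulrCA mulfV ?mulr1.
  by apply: eq_mxle (mxle_scale e8 (hc0 t tE)) => i j v; rewrite yE.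
pose y0 i j := pps E0 (fun t => fc (y i j) t).
have Xy0 i j : X (y0 i j) by apply: crossed_pps => //; exact: fset_uniq.
have y0d : mxle y0 d.
  apply: (mxle_mon _ (gen_mxle_sum (a := fun t i j => fc (y i j) t) (ltW h0) _ fcy)) => //.
  by apply: frac_le => //; exact: ltW.
pose z i j := y i j - y0 i j.
exists c, y0, z, (fun i j => x i j - x' i j); split.
- move=> i j; have -> : z i j + (y0 i j + c i j) = x' i j; last by rewrite subrK.
  by rewrite /z addrA subrK /y subrK.
- move=> i j; split=> //; first exact: (lsubB sX (Xy i j) (Xy0 i j)).
  exact: (lsubB sX (Xx i j) (Xx' i j)).
- move=> i j t tE; have -> : fc (z i j) t = fc (y i j) t - fc (y0 i j) t by [].
  by rewrite (fc_pps cA dyn) ?fset_uniq // tE subrr.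
split; [exact: c16|exact: y0d| |exact: xf].
have z3 : 2 + 16 + d <= 19 by rewrite -natrD -[19]/((18 + 1)%:R) [leRHS]natrD lerD2l.
exact: (mxle_mon z3 (eq_mxle _ (mxle_sub (mxle_sub x'2 c16) y0d))).
Qed.

Lemma S_cble (F : G -> (H -> H) -> (H -> H)) : herz_schur A alpha F ->
  exists2 M : R, 0 <= M & cble X (S_ A alpha F) M.
Proof.
move=> hsF; have [CBS _ _] := S_spec cA dyn hsF.
have Xb : X `<=` bop HH by exact: crossed_bop.
by have [_ _ h] := (CB_cble _ sX Xb Xb).1 CBS.
Qed.

Lemma schur_net_completely_compact (F : G -> (H -> H) -> (H -> H)) : herz_schur A alpha F ->
  schur_net A alpha F -> completely_compact X X (S_ A alpha F).
Proof.
move=> hsF [D [le [phi [U [dir hphi hU ran net]]]]].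
have [CBS _ _] := S_spec cA dyn hsF; split; first exact: CBS.
have [SX lS _] := CBS.
have [M M0 cS] := S_cble hsF.
move=> e e0.
have net' (d : R) : 0 < d -> exists i, schur_bd A (fun q p a => N_ alpha F q p a - phi i q p a) d.
  move=> d0; have [i0 h] := net d d0; have [_ refl _ _] := dir; exists i0.
  exact: (S_schur_sub_bd cA (herz_schur_N cA dyn hsF) (hphi i0).1 (h i0 (refl i0))).
(* There are four error terms, from r, z, y and c; the fifth share leaves the inequality strict. *)
pose e5 := e / 5; have e50 : 0 < e5 by rewrite divr_gt0.
pose e1 := e5 / 19; have e10 : 0 < e1 by rewrite divr_gt0.
have [i1 b1] := net' e1 e10; have [m1 [E0 band]] := hphi i1.
(* The cap 1 is the hypothesis of [band_decomposition]; the other term makes S_F, of cb-norm at most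
   M, small on r and y. *)
pose d := Num.min 1 (e5 / (M + 1)).
have d0 : 0 < d by rewrite lt_min ltr01 divr_gt0 // ltr_wpDl.
have d1 : d <= 1 by rewrite ge_min lexx.
have Md : M * d <= e5.
  by apply: le_trans (frac_le M0 (ltW e50)); rewrite ler_wpM2l // ge_min lexx orbT.
have [E uE dec] := band_decomposition E0 d0 d1.
pose n := (size E)%:R * 16 : R; have n0 : 0 <= n by rewrite mulr_ge0.
pose e2 := e5 / (n + 1); have e20 : 0 < e2 by rewrite divr_gt0 // ltr_wpDl.
(* Only now, with [size E] known, is the second φ chosen. *)
have [i2 b2] := net' e2 e20; have [m2 _] := hphi i2.
have [[n2 [ev UE]] UA] := hU i2.
have Ae k : A (ev k) by apply: UA; rewrite UE; exact: findim_basis.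
(* Condition (iii) at s = t⁻¹ places α_{t⁻¹}(φ(t⁻¹, e)(a)) in U, so the coefficient of degree t lies
   in α_t(U). *)
have [Y [fY YW YE]] := span_family E (fun t k => gen t (alpha t (ev k))).
have YX : Y `<=` X.
  apply: YW => // t k _; apply: (crossed_gen cA dyn); exact: (al_A dyn).
exists Y; split=> // m x Xx x1.
have Xb : X `<=` bop HH by exact: crossed_bop.
have {}x1 : mxle (fun i j => x i j) 1.
  by apply/(mxnormP _ ler01) => // i j; exact: (crossed_lin (Xx i j)).
have [c [y [z [r [xE XX z0 [c16 yd z19 rd]]]]]] := dec _ _ Xx x1.
pose w i j := pps E (fun t => phi i2 t^-1%g 1%g (fc (c i j) t)).
have Aphi s a : A a -> A (phi i2 s 1%g a) by move=> Aa; have [] := ran i2 s a Aa.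
have fcE i j : fsum A alpha E (c i j) by have [] := XX i j.
have Xc i j : X (c i j) := fsum_crossed cA dyn (fcE i j).
have Xy i j : X (y i j) by have [] := XX i j.
have Xz i j : X (z i j) by have [] := XX i j.
have Xr i j : X (r i j) by have [] := XX i j.
have wY i j : Y (w i j).
  rewrite /w [X in Y X]big_seq; apply: (lsub_sum (findim_lsub fY)) => t tE.
  have Afc : A (fc (c i j) t) := crossed_fc cA dyn t (Xc i j).
  have [Ap Up] := ran i2 t^-1%g _ Afc.
  rewrite UE in Up; have [k _ kE] := Up.
  have -> : phi i2 t^-1%g 1%g (fc (c i j) t) = \sum_i k i *: alpha t (ev i).
    rewrite -[LHS](alKV dyn t Ap) -kE (linear_on_sum sA (al_lin dyn t)).
      by apply: eq_bigr => l _; rewrite (linear_onZ sA (al_lin dyn t)).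
    by move=> l _; exact: (lsubZ sA).
  rewrite (linear_on_sum sA (gen_linear_on cA dyn t)); last first.
    by move=> l _; apply: (lsubZ sA); exact: (al_A dyn).
  rewrite (eq_bigr (fun l => k l *: gen t (alpha t (ev l)))); first exact: YE.
  move=> l _; rewrite (linear_onZ sA (gen_linear_on cA dyn t)) //; exact: (al_A dyn).
have hr := cS _ r d Xr d0 rd.
have hy := cS _ y d Xy d0 yd.
have n19 : (0 : R) < 19 by [].
have hz := off_band hsF m1 band (ltW e10) b1 n19 Xz z19 z0.
have n16 : (0 : R) < 16 by [].
have hc := band_span hsF m2 uE Aphi (ltW e20) b2 n16 fcE c16.
have SE i j v : S_ A alpha F (r i j) v + (S_ A alpha F (z i j) v + (S_ A alpha F (y i j) v +
    (S_ A alpha F (c i j) - w i j) v)) = (S_ A alpha F (x i j) - w i j) v.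
  have Xyc := lsubD sX (Xy i j) (Xc i j).
  rewrite xE (linear_onD lS (Xr i j) (lsubD sX (Xz i j) Xyc)).
  rewrite (linear_onD lS (Xz i j) Xyc) (linear_onD lS (Xy i j) (Xc i j)).
  rewrite -[RHS]/(S_ A alpha F (r i j) v + (S_ A alpha F (z i j) v + (S_ A alpha F (y i j) v +
    S_ A alpha F (c i j) v)) - w i j v).
  by rewrite -[X in _ + (_ + (_ + X))]/(S_ A alpha F (c i j) v - w i j v) !addrA.
have hall := mxle_add hr (mxle_add hz (mxle_add hy hc)).
pose B := M * d + (e1 * 19 + (M * d + (size E)%:R * (e2 * 16))).
have Be : B < e.
  have a1 : e1 * 19 = e5 by rewrite /e1 mulrVK // unitfE.
  have a2 : (size E)%:R * (e2 * 16) <= e5.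
    by rewrite mulrCA [leLHS]mulrC; exact: (frac_le n0 (ltW e50)).
  have a3 : e5 * 5 = e by rewrite /e5 mulrVK // unitfE.
  by rewrite /B a1; move: (M * d) (_ * _) Md a2 a3 e50 => s t; clear; lra.
have B0 : 0 <= B.
  have p0 : 0 <= M * d := mulr_ge0 M0 (ltW d0).
  have p1 : 0 <= e1 * 19 := mulr_ge0 (ltW e10) (ltW n19).
  have p2 : 0 <= e2 * 16 := mulr_ge0 (ltW e20) (ltW n16).
  exact: (addr_ge0 p0 (addr_ge0 p1 (addr_ge0 p0 (mulr_ge0 (ler0n R (size E)) p2)))).
apply: (@le_lt_trans _ _ B%:E); last by rewrite lte_fin.
apply: (@le_trans _ _ (mxnorm (map_mx (S_ A alpha F) x - \matrix_(i, j) w i j)%R)).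
  by apply: ereal_inf_lbound; exists (\matrix_(i, j) w i j) => // i j; rewrite mxE.
have lin i j : linear (S_ A alpha F (x i j) - w i j).
  apply: linear_sub; first exact: (crossed_lin (SX _ (Xx i j))).
  exact: (crossed_lin (YX _ (wY i j))).
apply/(mxnormP _ B0) => [i j|]; first by rewrite !mxE; exact: lin.
by apply: eq_mxle hall => i j v; rewrite SE !mxE.
Qed.

End CompletelyCompact.

Theorem theorem3p7 (R : realType) (G : groupType) (H : hilbertType R)
    (A : set (H -> H)) (alpha : G -> (H -> H) -> (H -> H))
    (F : G -> (H -> H) -> (H -> H))
    (cstarA : cstar_algebra A) (ndA : nondegenerate_alg A)
    (dynA : dyn_action A alpha) (HSF : herz_schur A alpha F)
    (soapX : SOAP (crossed A alpha)) :
  (completely_compact (crossed A alpha) (crossed A alpha) (S_ A alpha F) <->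
   exists (D : Type) (le : D -> D -> Prop)
     (Fi : D -> G -> (H -> H) -> (H -> H)) (U : D -> set (H -> H)),
     [/\ directed le,
         forall i, herz_schur A alpha (Fi i) /\ finitely_supported A (Fi i),
         forall i, findim (U i) /\ U i `<=` A,
         forall i s a, A a -> U i (Fi i s a)
       & net_to0 le (fun i => mnorm A alpha (Fi i - F))])
  /\
  (completely_compact (crossed A alpha) (crossed A alpha) (S_ A alpha F) <->
   exists (D : Type) (le : D -> D -> Prop)
     (phi : D -> G -> G -> (H -> H) -> (H -> H)) (U : D -> set (H -> H)),
     [/\ directed le,
         forall i, schur_multiplier A (phi i) /\ band_finite A (phi i),
         forall i, findim (U i) /\ U i `<=` A,
         forall i s a, A a ->
           A (phi i s 1%g a) /\ U i (alpha s (phi i s 1%g a))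
       & net_to0 le (fun i => cbnorm (schur_domain G A)
           (S_schur A (N_ alpha F) - S_schur A (phi i)))]).
Proof.
have i_ii := completely_compact_net cstarA dynA HSF soapX.
have ii_iii := multiplier_net_schur cstarA dynA HSF.
have iii_i := schur_net_completely_compact cstarA dynA HSF.
by split; split=> h; [exact: i_ii|exact/iii_i/ii_iii|exact/ii_iii/i_ii|exact: iii_i].
Qed.
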